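(* Let $\nu\ge 0$ and let $m\ge 1$ be an integer. Assume that $\tilde u(z,0)$ and $\tilde v(z,0)$ are in $C^m[0,1]$ and periodic in $z$ with period $1$, with $\int_0^1\tilde v(z,0)\,dz=0$. Then the solution $(\tilde u,\tilde v)$ of the 1D model $$\tilde u_t+2\tilde\psi\,\tilde u_z=\nu\tilde u_{zz}-2\tilde v\tilde u,$$ $$\tilde v_t+2\tilde\psi\,\tilde v_z=\nu\tilde v_{zz}+\tilde u^2-\tilde v^2+c(t),$$ with $\tilde v=-\tilde\psi_z$ and $$c(t)=3\int_0^1\tilde v^2\,dz-\int_0^1\tilde u^2\,dz,$$ exists and is in $C^m[0,1]$ (as a function of $z$) for all times $t\ge 0$.
   Context: All functions $\tilde u,\tilde v,\tilde\psi$ are real-valued functions of $(z,t)$, periodic in $z$ with period $1$. The constant $\nu$ is the viscosity; the model is considered with viscosity ($\nu>0$) or without it ($\nu=0$). ''In $C^m[0,1]$ and periodic with period $1$'' means that the 1-periodic function is of class $C^m$ in $z$. The function $\tilde\psi$ is a 1-periodic function of $z$ with $\tilde\psi_z=-\tilde v$. This determines $\tilde\psi$ up to an additive function of $t$: $\tilde\psi(z,t)=a(t)-\int_0^z\tilde v(z',t)\,dz'$, where $a$ is an arbitrary prescribed continuous function of $t$ (for instance $a\equiv 0$). The term $c(t)$ is the constant of integration that enforces $\int_0^1\tilde v(z,t)\,dz=0$ for all $t$. *)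

(* Defs.v *)
From Stdlib Require Import Reals.
From Coquelicot Require Import Coquelicot.

Open Scope R_scope.

Definition periodic1 (f : R -> R) : Prop := forall z, f (z + 1) = f z.

(** [ex_derive_n f k z] is [ex_derive (Derive_n f k.-1) z]; it is informative
    only because all lower orders are required at every point as well. *)
Definition Cm (m : nat) (f : R -> R) : Prop :=
  forall k : nat, (k <= m)%nat ->
    forall z : R, ex_derive_n f k z /\ continuous (Derive_n f k) z.

(** Functions of [(z, t)] are curried, space variable first. *)
Definition d_t (f : R -> R -> R) (z t : R) : R := Derive (fun s => f z s) t.
Definition d_z (f : R -> R -> R) (z t : R) : R := Derive (fun y => f y t) z.
Definition d_zz (f : R -> R -> R) (z t : R) : R := d_z (d_z f) z t.

Definition jointly_continuous_on (T : R -> Prop) (f : R -> R -> R) : Prop :=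
  continuous_on (fun p : R * R => T (snd p)) (fun p : R * R => f (fst p) (snd p)).

(** Classical regularity: continuity up to [t = 0], and, for [t > 0], continuous
    derivatives of the orders occurring in the equations.  Second derivatives
    in [z] occur only if [nu > 0]; for [C^1] data they need not exist at
    [t = 0], and for [nu = 0] they need not exist at all. *)
Record classical_regularity (nu : R) (f : R -> R -> R) : Prop := {
  cr_continuous : jointly_continuous_on (fun t => 0 <= t) f;
  cr_ex_d_t : forall z t, 0 < t -> ex_derive (fun s => f z s) t;
  cr_ex_d_z : forall z t, 0 < t -> ex_derive (fun y => f y t) z;
  cr_d_t : jointly_continuous_on (fun t => 0 < t) (d_t f);
  cr_d_z : jointly_continuous_on (fun t => 0 < t) (d_z f);
  cr_ex_d_zz : 0 < nu ->
    forall z t, 0 < t -> ex_derive (fun y => d_z f y t) z;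
  cr_d_zz : 0 < nu -> jointly_continuous_on (fun t => 0 < t) (d_zz f)
}.

Definition c_of (u v : R -> R -> R) (t : R) : R :=
  3 * RInt (fun z => v z t ^ 2) 0 1 - RInt (fun z => u z t ^ 2) 0 1.

(** Global classical solutions.  The function [a] fixes the additive function
    of time left free in [psi] by [psi_z = - v].  Periodicity of [psi] contains
    the condition that [v] has zero mean at every time.  For [nu = 0] the terms
    [nu * d_zz _ z t] vanish, whatever the value of [d_zz]. *)
Record model_solution (nu : R) (a u0 v0 : R -> R) (u v psi : R -> R -> R) : Prop := {
  ms_periodic_u : forall t, 0 <= t -> periodic1 (fun z => u z t);
  ms_periodic_v : forall t, 0 <= t -> periodic1 (fun z => v z t);
  ms_periodic_psi : forall t, 0 <= t -> periodic1 (fun z => psi z t);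
  ms_regular_u : classical_regularity nu u;
  ms_regular_v : classical_regularity nu v;
  ms_psi_z : forall z t, 0 <= t -> is_derive (fun y => psi y t) z (- v z t);
  ms_psi_0 : forall t, 0 <= t -> psi 0 t = a t;
  ms_init_u : forall z, u z 0 = u0 z;
  ms_init_v : forall z, v z 0 = v0 z;
  ms_eq_u : forall z t, 0 < t ->
    d_t u z t + 2 * psi z t * d_z u z t
    = nu * d_zz u z t - 2 * v z t * u z t;
  ms_eq_v : forall z t, 0 < t ->
    d_t v z t + 2 * psi z t * d_z v z t
    = nu * d_zz v z t + u z t ^ 2 - v z t ^ 2 + c_of u v t
}.

(* Main.v *)
Require Import Defs.
From Stdlib Require Import Reals Lra Lia Psatz ZArith.
From Stdlib Require Import Classical ClassicalDescription FunctionalExtensionality.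
From Coquelicot Require Import Coquelicot.
From mathcomp.classical Require filter.

Open Scope R_scope.

(** Put [w = v + i u].  The two equations become
    [w_t + 2 psi w_z = nu w_zz - w^2 + c] with a real [c], and differentiating in [z] gives
    [(w_z)_t + 2 psi (w_z)_z = nu (w_z)_zz - 2 i u w_z]: the zeroth order term only rotates [w_z],
    so [|w_z|] obeys a maximum principle.  As [v] has mean zero, [v] is bounded by the initial
    bound of [w_z] for all times, and [u] grows at most exponentially.  Replacing [z] by [z + xi t]
    with [xi' = 2 (psi (xi) - a)] turns the normalisation [psi 0 t = 0] into [psi 0 t = a t].

    For [nu > 0] an explicit difference scheme on the periodic lattice of mesh [1 / N] with time
    step [1 / (4 nu N^2)] satisfies the same maximum principle, and Bernstein estimates bound all
    its differences after any positive time.  Limits along an ultrafilter then exist at every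
    point, and the uniform bounds make them a solution, smooth for [t > 0].

    For [nu = 0] the Riccati equation is linearised along the characteristics [X (x, t)]:
    [w = y_t / y] with [y = p + w0 q], where [p] and [q] solve [y'' = c y], [X_x = 1 / |y|^2] and
    [u = u0 / |y|^2].  In polar coordinates [(p, q) = r (cos th, sin th)] the Wronskian gives
    [r^2 th' = 1] and the period of [X] gives [r^2 = I (th)], where [I (th)] is the integral of
    [1 / |cos th + w0 sin th|^2] over a period.  So everything is explicit in the solution of the
    autonomous equation [th' = 1 / I (th)]; extended by [0] to the angles at which [I] diverges,
    its right-hand side is Lipschitz, so these angles are never reached. *)

(** * Limits along an ultrafilter *)

(** The nonlocal constant is never estimated in the form [c_of]. Each construction yields some
    function of time in its place, the viscous one to keep a discrete mean at zero, the inviscid one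
    from explicit formulas; integrating the equation over a period then forces its value, because
    [v] has zero mean at all times.

    The ultrafilter replaces compactness: it gives limits at uncountably many points at once,
    compatible with sums and products, so that lattice identities pass to the limit term by term and
    derivatives are read off from Taylor inequalities with uniform constants.

    The time step turns explicit diffusion into an average with weights 1/2, 1/4, 1/4. Their
    positivity leaves room for the transport term, and the strict convexity of the square supplies
    the dissipation for Bernstein's method.

    For [nu > 0] the delicate time is [t = 0]: the bounds on second differences blow up there, and
    continuity rests on spatial averaging instead. Existence uses only [C^1] data; the order [m]
    enters at [t = 0] if [nu > 0], and through the label map if [nu = 0]. *)

Lemma ultrafilter_nat_exists :
  exists U : (nat -> Prop) -> Prop,
    ProperFilter U /\ (forall A, U A \/ U (fun n => ~ A n)) /\
    (forall A, eventually A -> U A).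
Proof.
destruct (@filter.ultraFilterLemma nat (eventually : classical_sets.set_system nat))
  as [U [hU hsub]].
{ constructor.
  - intros [N h]; exact (h N (le_n N)).
  - constructor.
    + exists O; intros; exact I.
    + intros P Q [N hN] [N' hN']; exists (max N N'); intros n hn; split;
        [apply hN | apply hN']; lia.
    + intros P Q h [N hN]; exists N; intros n hn; apply h, hN, hn. }
exists U.
destruct (@filter.ultra_proper nat U hU) as [h0 [hT hI hS]].
split; [|split].
- constructor.
  + intros P hP; apply NNPP; intros hn; apply h0.
    apply (hS P); [|exact hP].
    intros n hPn; apply hn; exists n; exact hPn.
  + constructor; [exact hT | intros P Q hP hQ; exact (hI P Q hP hQ) | exact hS].
- intros A; exact (@filter.in_ultra_setVsetC nat U A hU).
- exact hsub.
Qed.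

(* The limit is the supremum of the levels [y] with [y <= x n] for [U]-almost all [n]. *)
Lemma ultrafilter_bounded_cv (U : (nat -> Prop) -> Prop) (FU : ProperFilter U)
  (hU : forall A, U A \/ U (fun n => ~ A n)) (x : nat -> R) (M : R)
  (hx : U (fun n => Rabs (x n) <= M)) :
  exists l : R, filterlim x U (locally l).
Proof.
destruct (completeness (fun y => U (fun n => y <= x n))) as [l [ub lub]].
{ exists M; intros y hy.
  destruct (filter_ex _ (filter_and _ _ hx hy)) as [n [h1 h2]].
  generalize (Rle_abs (x n)); lra. }
{ exists (- M); revert hx; apply filter_imp; intros n h.
  generalize (Rle_abs (- x n)); rewrite Rabs_Ropp; lra. }
exists l.
apply filterlim_locally; intros eps.
assert (h1 : U (fun n => l - eps < x n)).
{ destruct (hU (fun n => l - eps / 2 <= x n)) as [h|h].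
  - revert h; apply filter_imp; intros n; generalize (cond_pos eps); lra.
  - exfalso.
    assert (l <= l - eps / 2); [|generalize (cond_pos eps); lra].
    apply lub; intros y hy.
    destruct (filter_ex _ (filter_and _ _ h hy)) as [n [h1 h2]]; lra. }
assert (h2 : U (fun n => x n < l + eps)).
{ destruct (hU (fun n => l + eps / 2 <= x n)) as [h|h].
  - exfalso; specialize (ub _ h); generalize (cond_pos eps); lra.
  - revert h; apply filter_imp; intros n; generalize (cond_pos eps); lra. }
generalize (filter_and _ _ h1 h2); apply filter_imp; intros n [a b].
apply Rabs_lt_between'; lra.
Qed.

(** * Bernstein estimate on the lattice *)

Definition N2 (z : C) : R := fst z ^ 2 + snd z ^ 2.

Lemma N2_pos (z : C) : 0 <= N2 z.
Proof. unfold N2; nra. Qed.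

Lemma Cmod_sqr (z : C) : Cmod z ^ 2 = N2 z.
Proof. unfold Cmod; apply pow2_sqrt, N2_pos. Qed.

Definition shiftZ (f : Z -> C) (i : Z) : C := f (i + 1)%Z.
Definition diffZ (q : R) (f : Z -> C) (i : Z) : C :=
  (RtoC q * (f (i + 1)%Z - f i))%C.
Definition averZ (f : Z -> C) (i : Z) : C :=
  (RtoC (1/2) * f i + RtoC (1/4) * f (i + 1)%Z + RtoC (1/4) * f (i - 1)%Z)%C.

(** Jensen's inequality for the weights 1/2, 1/4, 1/4, with its defect. The defect is 1/8 of the
    squared distances from [f i] to both neighbours, kept here as dissipation, plus 1/16 of the
    squared distance between the neighbours, which is dropped. *)
Lemma N2_averZ (q : R) (hq : 0 < q) (f : Z -> C) (i : Z) :
  N2 (averZ f i) <= 1/2 * N2 (f i) + 1/4 * N2 (f (i+1)%Z) + 1/4 * N2 (f (i-1)%Z)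
    - / (8 * q ^ 2) * (N2 (diffZ q f i) + N2 (diffZ q f (i - 1))).
Proof.
unfold diffZ; replace (i - 1 + 1)%Z with i by lia.
unfold averZ; destruct (f i) as [a a'], (f (i+1)%Z) as [b b'], (f (i-1)%Z) as [c c'].
match goal with |- ?l <= ?r =>
  assert (e : r - l = 1/16 * ((b - c) ^ 2 + (b' - c') ^ 2)) by (unfold N2; simpl; field; lra); generalize dependent l; generalize dependent r end.
intros r l e; generalize (pow2_ge_0 (b - c)) (pow2_ge_0 (b' - c')); lra.
Qed.

Lemma Cmod_averZ (f : Z -> C) (M : R) (hM : forall i, Cmod (f i) <= M) (i : Z) :
  Cmod (averZ f i) <= M.
Proof.
unfold averZ.
eapply Rle_trans; [apply Cmod_triangle|].
eapply Rle_trans; [apply Rplus_le_compat_r, Cmod_triangle|].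
rewrite !Cmod_mult, !Cmod_R, !Rabs_pos_eq by lra.
generalize (hM i) (hM (i+1)%Z) (hM (i-1)%Z); lra.
Qed.

Lemma N2_perturb (y r : C) (t Y : R) (ht : 0 <= t) (hY : Cmod y <= Y) :
  N2 (y + RtoC t * r)%C <= N2 y + t * (2 * Y * Cmod r + t * Cmod r ^ 2).
Proof.
assert (h : Cmod (y + RtoC t * r)%C <= Cmod y + t * Cmod r).
{ eapply Rle_trans; [apply Cmod_triangle|].
  rewrite Cmod_mult, Cmod_R, Rabs_pos_eq; lra. }
rewrite <- !Cmod_sqr.
generalize (Cmod_ge_0 (y + RtoC t * r)%C) (Cmod_ge_0 y) (Cmod_ge_0 r); intros h1 h2 h3.
assert (t * Cmod r * Cmod y <= t * Cmod r * Y) by (apply Rmult_le_compat_l; nra).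
assert (Cmod (y + RtoC t * r)%C ^ 2 <= (Cmod y + t * Cmod r) ^ 2) by (apply pow_incr; lra).
nra.
Qed.

Lemma diffZ_averZ (q : R) (f : Z -> C) (i : Z) :
  diffZ q (averZ f) i = averZ (diffZ q f) i.
Proof.
unfold diffZ, averZ.
replace (i + 1 - 1)%Z with i by lia; replace (i - 1 + 1)%Z with i by lia.
ring.
Qed.

Lemma sqr_sum3 (x y z : R) : (x + y + z) ^ 2 <= 3 * (x ^ 2 + y ^ 2 + z ^ 2).
Proof.
generalize (pow2_ge_0 (x - y)) (pow2_ge_0 (x - z)) (pow2_ge_0 (y - z)); simpl; lra.
Qed.

Lemma sqr_sum4 (x y z w : R) :
  (x + y + z + w) ^ 2 <= 4 * (x ^ 2 + y ^ 2 + z ^ 2 + w ^ 2).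
Proof.
generalize (pow2_ge_0 (x - y)) (pow2_ge_0 (x - z)) (pow2_ge_0 (y - z))
  (pow2_ge_0 (x - w)) (pow2_ge_0 (y - w)) (pow2_ge_0 (z - w)); simpl; lra.
Qed.

(* The weight [B (|f|^2 + |f_+|^2)] uses two neighbouring points so that its
   dissipation covers all the values of [D f] that enter the average of [|D f|^2]. *)
Lemma lattice_smoothing (nu M A T : R) (hnu : 0 < nu) (hM : 0 <= M) (hA : 1 <= A) (hT : 0 <= T) :
  exists Cb : R, 0 <= Cb /\ forall (q : R) (f r : nat -> Z -> C) (K : nat),
    0 < q -> let t := / (4 * nu * q ^ 2) in
    t * A ^ 2 <= nu / 24 -> INR K * t <= T ->
    (forall k i, (k < K)%nat -> f (S k) i = (averZ (f k) i + RtoC t * r k i)%C) ->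
    (forall k i, (k <= K)%nat -> Cmod (f k i) <= M) ->
    (forall k i, (k < K)%nat -> Cmod (r k i) <=
       A * (1 + Cmod (diffZ q (f k) i) + Cmod (diffZ q (f k) (i - 1)))) ->
    (forall k X, (k < K)%nat -> (forall i, Cmod (diffZ q (f k) i) <= X) ->
       forall i, Cmod (diffZ q (r k) i) <=
       A * (1 + X + Cmod (diffZ q (diffZ q (f k)) i)
                  + Cmod (diffZ q (diffZ q (f k)) (i - 1)))) ->
    forall k i, (k <= K)%nat -> INR k * t * Cmod (diffZ q (f k) i) ^ 2 <= Cb.
Proof.
(* [C1] and [C2] bound the sources in the inequalities for [|f|^2] and [|D f|^2] once the
   dissipation has absorbed the residual. [B = 4 / nu] makes [B * (nu * t / 4) = t], so that the
   dissipation of the weight pays for the growth of the factor [INR k * t]. [T'] bounds the time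
   after one more step, and [C3] collects the remaining constant terms. *)
set (C1 := 2 * M * A + 16 * M ^ 2 * A ^ 2 / nu + nu / 8).
set (C2 := 3 * A + 16 * A ^ 2 / nu + nu).
set (B := 4 / nu).
set (T' := T + nu).
set (C3 := C2 * T' + C2 * (M ^ 2 / nu) + 2 * B * C1).
assert (hC1 : 0 <= C1).
{ unfold C1; assert (0 <= 16 * M ^ 2 * A ^ 2 / nu); [|nra].
  apply Rdiv_le_0_compat; [nra|lra]. }
assert (hC2 : 0 < C2).
{ unfold C2; assert (0 <= 16 * A ^ 2 / nu); [|nra].
  apply Rdiv_le_0_compat; [nra|lra]. }
assert (hB : 0 < B) by (unfold B; apply Rdiv_lt_0_compat; lra).
assert (hMn : 0 <= M ^ 2 / nu) by (apply Rdiv_le_0_compat; [nra|lra]).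
assert (hC3 : 0 <= C3).
{ unfold C3, T'. assert (0 <= C2 * (T + nu)) by nra. assert (0 <= C2 * (M ^ 2 / nu)) by nra.
  assert (0 <= B * C1) by nra. nra. }
(* The solution of [Q' = C2 * Q + C3] with [Q 0 = 2 * B * M ^ 2]. By convexity of the exponential it
   dominates the recursion proved below. *)
set (Q := fun x => (2 * B * M ^ 2 + C3 / C2) * exp (C2 * x) - C3 / C2).
assert (hc32 : 0 <= C3 / C2) by (apply Rdiv_le_0_compat; lra).
assert (hQ0 : 0 <= 2 * B * M ^ 2 + C3 / C2) by nra.
exists ((2 * B * M ^ 2 + C3 / C2) * exp (C2 * T)).
split; [generalize (exp_pos (C2 * T)); nra|].
intros q f r K hq t ht hKT hstep hf hr hdr.
assert (hq2 : 0 < q ^ 2) by nra.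
assert (htp : 0 < t) by (apply Rinv_0_lt_compat; nra).
assert (hqt : / (8 * q ^ 2) = nu * t / 2) by (unfold t; field; split; lra).
assert (hqt4 : 4 * nu * q ^ 2 * t = 1) by (unfold t; field; split; lra).
assert (hinv : forall k, (k <= K)%nat -> forall i,
  INR k * t * N2 (diffZ q (f k) i) + B * (N2 (f k i) + N2 (f k (i + 1)%Z)) <= Q (INR k * t)).
{ induction k as [|k IH]; intros hk i.
  - simpl; rewrite !Rmult_0_l, Rplus_0_l; unfold Q; rewrite Rmult_0_r, exp_0.
    generalize (hf O i hk) (hf O (i+1)%Z hk) (Cmod_ge_0 (f O i)) (Cmod_ge_0 (f O (i+1)%Z)).
    rewrite <- !Cmod_sqr; intros.
    assert (Cmod (f O i) ^ 2 <= M ^ 2) by (apply pow_incr; lra).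
    assert (Cmod (f O (i+1)%Z) ^ 2 <= M ^ 2) by (apply pow_incr; lra).
    nra.
  - assert (hk' : (k < K)%nat) by lia.
    specialize (IH (Nat.lt_le_incl _ _ hk')).
    set (s := INR k * t) in *.
    assert (hs : 0 <= s) by (apply Rmult_le_pos; [apply pos_INR|lra]).
    assert (hsT : s <= T).
    { eapply Rle_trans; [|exact hKT]; apply Rmult_le_compat_r; [lra|].
      apply le_INR; lia. }
    assert (hS : INR (S k) * t = s + t) by (rewrite S_INR; unfold s; ring).
    rewrite hS.
    set (F := diffZ q (f k)) in *.
    set (Qs := Q s) in *.
    assert (hQs : 0 <= Qs).
    { specialize (IH 0%Z). generalize (N2_pos (F 0%Z)) (N2_pos (f k 0%Z)) (N2_pos (f k 1%Z)).
      simpl in IH. intros. assert (0 <= s * N2 (F 0%Z)) by nra. nra. }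
    (* One bound [X] of [|D f|] with two sizes: the trivial [2 * M * q] gives
       [t * X ^ 2 <= M ^ 2 / nu], the induction hypothesis gives [s * X ^ 2 <= Qs]. Their minimum
       controls [(s + t) * X ^ 2], although [X] itself is not bounded uniformly in [q]. *)
    assert (hX : exists X, 0 <= X /\ (forall i, Cmod (F i) <= X) /\
                 s * X ^ 2 <= Qs /\ t * X ^ 2 <= M ^ 2 / nu).
    { assert (hX1 : forall i, Cmod (F i) <= 2 * M * q).
      { intros j; unfold F, diffZ; rewrite Cmod_mult, Cmod_R, Rabs_pos_eq by lra.
        generalize (Cmod_triangle (f k (j+1)%Z) (- f k j)%C); rewrite Cmod_opp.
        unfold Cminus; generalize (hf k (j+1)%Z) (hf k j); intros a b c.
        specialize (a ltac:(lia)); specialize (b ltac:(lia)). nra. }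
      assert (hX2 : t * (2 * M * q) ^ 2 <= M ^ 2 / nu).
      { replace (t * (2 * M * q) ^ 2) with (4 * nu * q ^ 2 * t * (M ^ 2 / nu)) by (field; lra).
        rewrite hqt4; lra. }
      destruct (Rle_lt_or_eq_dec 0 s hs) as [hs0|hs0].
      - assert (hX3 : forall i, Cmod (F i) <= sqrt (Qs / s)).
        { intros j; rewrite <- (sqrt_pow2 (Cmod (F j))) by apply Cmod_ge_0.
          apply sqrt_le_1_alt; rewrite Cmod_sqr.
          apply Rmult_le_reg_l with s; [exact hs0|].
          replace (s * (Qs / s)) with Qs by (field; lra).
          specialize (IH j). generalize (N2_pos (f k j)) (N2_pos (f k (j+1)%Z)); intros; nra. }
        assert (hqs : 0 <= Qs / s) by (apply Rdiv_le_0_compat; lra).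
        exists (Rmin (2 * M * q) (sqrt (Qs / s))).
        assert (hmp : 0 <= Rmin (2 * M * q) (sqrt (Qs / s))).
        { apply Rmin_glb; [nra|apply sqrt_pos]. }
        split; [exact hmp|split; [|split]].
        + intros j; apply Rmin_glb; auto.
        + assert (Rmin (2 * M * q) (sqrt (Qs / s)) ^ 2 <= Qs / s).
          { rewrite <- (pow2_sqrt (Qs / s)) at 2 by exact hqs.
            apply pow_incr; split; [exact hmp|apply Rmin_r]. }
          replace Qs with (s * (Qs / s)) at 2 by (field; lra).
          apply Rmult_le_compat_l; lra.
        + eapply Rle_trans; [|exact hX2]. apply Rmult_le_compat_l; [lra|].
          apply pow_incr; split; [exact hmp|apply Rmin_l].
      - exists (2 * M * q); split; [nra|split; [exact hX1|split; [|exact hX2]]].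
        rewrite <- hs0; lra. }
    destruct hX as [X [hX0 [hXF [hXs hXt]]]].
    (* The average dissipates with coefficient [nu * t / 2]. One half absorbs the gradients in the
       residual by Young's inequality; the other half is left for the weight. *)
    assert (hff : forall j, N2 (f (S k) j) <=
      1/2 * N2 (f k j) + 1/4 * N2 (f k (j+1)%Z) + 1/4 * N2 (f k (j-1)%Z)
      - nu * t / 4 * (N2 (F j) + N2 (F (j - 1)%Z)) + t * C1).
    { intros j; rewrite hstep by exact hk'.
      eapply Rle_trans; [apply (N2_perturb _ _ t M); [lra|apply Cmod_averZ; intros; apply hf; lia]|].
      generalize (N2_averZ q hq (f k) j); fold F; rewrite hqt; intros hav.
      generalize (hr k j hk') (Cmod_ge_0 (r k j)); fold F.
      rewrite <- (Cmod_sqr (F j)), <- (Cmod_sqr (F (j - 1)%Z)) in *.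
      generalize (Cmod_ge_0 (F j)) (Cmod_ge_0 (F (j-1)%Z)).
      generalize dependent (Cmod (F j)); generalize dependent (Cmod (F (j-1)%Z)).
      intros y x hav hx hy hrr hr0.
      set (rr := Cmod (r k j)) in *.
      assert (h2 : t * rr ^ 2 <= nu / 8 * (1 + x ^ 2 + y ^ 2)).
      { apply Rle_trans with (t * (A * (1 + x + y)) ^ 2).
        - apply Rmult_le_compat_l; [lra|]; apply pow_incr; lra.
        - replace (t * (A * (1 + x + y)) ^ 2) with (t * A ^ 2 * (1 + x + y) ^ 2) by ring.
          apply Rle_trans with (nu / 24 * (1 + x + y) ^ 2).
          + apply Rmult_le_compat_r; [nra|lra].
          + apply Rle_trans with (nu / 24 * (3 * (1 ^ 2 + x ^ 2 + y ^ 2))); [|lra].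
            apply Rmult_le_compat_l; [lra|apply sqr_sum3]. }
      assert (h3 : 2 * M * rr <= 2 * M * A + 16 * M ^ 2 * A ^ 2 / nu + nu / 8 * (x ^ 2 + y ^ 2)).
      { apply Rle_trans with (2 * M * (A * (1 + x + y))); [nra|].
        assert (hz : forall z, 2 * M * A * z <= 8 * M ^ 2 * A ^ 2 / nu + nu / 8 * z ^ 2).
        { intros z. replace (8 * M ^ 2 * A ^ 2 / nu + nu / 8 * z ^ 2) with
            (2 * M * A * z + nu / 8 * (z - 8 * M * A / nu) ^ 2) by (field; lra).
          generalize (Rmult_le_pos (nu / 8) _ ltac:(lra) (pow2_ge_0 (z - 8 * M * A / nu))); lra. }
        generalize (hz x) (hz y).
        replace (16 * M ^ 2 * A ^ 2 / nu) with (2 * (8 * M ^ 2 * A ^ 2 / nu)) by (field; lra).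
        lra. }
      assert (h4 : t * (2 * M * rr + t * rr ^ 2) <= t * (C1 + nu / 4 * (x ^ 2 + y ^ 2))).
      { apply Rmult_le_compat_l; [lra|]. unfold C1; lra. }
      lra. }
    (* At the level of [D f] the whole dissipation is spent on the second differences in the
       residual. *)
    assert (hFF : forall j, N2 (diffZ q (f (S k)) j) <=
      1/2 * N2 (F j) + 1/4 * N2 (F (j+1)%Z) + 1/4 * N2 (F (j-1)%Z)
      + t * (C2 * (1 + X ^ 2))).
    { intros j.
      replace (diffZ q (f (S k)) j) with (averZ F j + RtoC t * diffZ q (r k) j)%C.
      2:{ unfold F; rewrite <- diffZ_averZ; unfold diffZ at 1 2 3; rewrite !hstep by exact hk'; ring. }
      eapply Rle_trans; [apply (N2_perturb _ _ t X); [lra|apply Cmod_averZ; exact hXF]|].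
      generalize (N2_averZ q hq F j); rewrite hqt; intros hav.
      generalize (hdr k X hk' hXF j) (Cmod_ge_0 (diffZ q (r k) j)); fold F.
      rewrite <- (Cmod_sqr (diffZ q F j)), <- (Cmod_sqr (diffZ q F (j - 1)%Z)) in *.
      generalize (Cmod_ge_0 (diffZ q F j)) (Cmod_ge_0 (diffZ q F (j-1)%Z)).
      generalize dependent (Cmod (diffZ q F j)); generalize dependent (Cmod (diffZ q F (j-1)%Z)).
      intros y x hav hx hy hrr hr0.
      set (rr := Cmod (diffZ q (r k) j)) in *.
      assert (h2 : t * rr ^ 2 <= nu / 6 * (1 + X ^ 2 + x ^ 2 + y ^ 2)).
      { apply Rle_trans with (t * (A * (1 + X + x + y)) ^ 2).
        - apply Rmult_le_compat_l; [lra|]; apply pow_incr; lra.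
        - replace (t * (A * (1 + X + x + y)) ^ 2) with (t * A ^ 2 * (1 + X + x + y) ^ 2) by ring.
          apply Rle_trans with (nu / 24 * (1 + X + x + y) ^ 2).
          + apply Rmult_le_compat_r; [nra|lra].
          + apply Rle_trans with (nu / 24 * (4 * (1 ^ 2 + X ^ 2 + x ^ 2 + y ^ 2))); [|lra].
            apply Rmult_le_compat_l; [lra|apply sqr_sum4]. }
      assert (h3 : 2 * X * rr <= (3 * A + 16 * A ^ 2 / nu) * (1 + X ^ 2) + nu / 8 * (x ^ 2 + y ^ 2)).
      { apply Rle_trans with (2 * X * (A * (1 + X + x + y))); [nra|].
        assert (hz : forall z, 2 * X * A * z <= 8 * A ^ 2 / nu * X ^ 2 + nu / 8 * z ^ 2).
        { intros z. replace (8 * A ^ 2 / nu * X ^ 2 + nu / 8 * z ^ 2) with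
            (2 * X * A * z + nu / 8 * (z - 8 * X * A / nu) ^ 2) by (field; lra).
          generalize (Rmult_le_pos (nu / 8) _ ltac:(lra) (pow2_ge_0 (z - 8 * X * A / nu))); lra. }
        generalize (hz x) (hz y).
        assert (0 <= 8 * A ^ 2 / nu) by (apply Rdiv_le_0_compat; nra).
        replace (16 * A ^ 2 / nu) with (2 * (8 * A ^ 2 / nu)) by (field; lra).
        generalize dependent (8 * A ^ 2 / nu); intros w' _ hw'.
        assert (2 * X * A + 2 * X * X * A <= 3 * A * (1 + X ^ 2)).
        { generalize (pow2_ge_0 (X - 1)); intros hsq.
          replace (2 * X * A + 2 * X * X * A) with (A * (2 * X + 2 * X * X)) by ring.
          replace (3 * A * (1 + X ^ 2)) with (A * (3 * (1 + X ^ 2))) by ring.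
          apply Rmult_le_compat_l; [lra|]. simpl in *; lra. }
        intros; lra. }
      assert (h4 : t * (2 * X * rr + t * rr ^ 2) <=
                   t * (C2 * (1 + X ^ 2) + nu / 2 * (x ^ 2 + y ^ 2))).
      { apply Rmult_le_compat_l; [lra|]. unfold C2.
        assert (0 <= nu * (x ^ 2 + y ^ 2)) by nra. assert (0 <= nu * (1 + X ^ 2)) by nra.
        replace ((3 * A + 16 * A ^ 2 / nu + nu) * (1 + X ^ 2)) with
           ((3 * A + 16 * A ^ 2 / nu) * (1 + X ^ 2) + nu * (1 + X ^ 2)) by ring.
        lra. }
      lra. }
    assert (hQstep : Qs + t * (C3 + C2 * Qs) <= Q (s + t)).
    { unfold Qs, Q; replace (C2 * (s + t)) with (C2 * s + C2 * t) by ring; rewrite exp_plus.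
      generalize (exp_ineq1_le (C2 * t)) (exp_pos (C2 * s)); intros e1 e2.
      set (E := 2 * B * M ^ 2 + C3 / C2) in *.
      assert (hh : C2 * (C3 / C2) = C3) by (field; lra).
      assert (E * exp (C2 * s) * (1 + C2 * t) <= E * exp (C2 * s) * exp (C2 * t)).
      { apply Rmult_le_compat_l; [nra|lra]. }
      replace (t * (C3 + C2 * (E * exp (C2 * s) - C3 / C2))) with
        (C2 * t * (E * exp (C2 * s))) by (rewrite <- hh at 1; ring).
      lra. }
    eapply Rle_trans; [|exact hQstep].
    generalize (hFF i) (hff i) (hff (i+1)%Z).
    replace (i + 1 - 1)%Z with i by lia.
    generalize (IH i) (IH (i+1)%Z) (IH (i-1)%Z); clear IH hFF hff.
    replace (i - 1 + 1)%Z with i by lia.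
    generalize (N2_pos (F i)) (N2_pos (F (i+1)%Z)) (N2_pos (F (i-1)%Z)).
    generalize (N2 (diffZ q (f (S k)) i)) (N2 (f (S k) i)) (N2 (f (S k) (i + 1)%Z)).
    generalize (N2 (F i)) (N2 (F (i+1)%Z)) (N2 (F (i-1)%Z)).
    generalize (N2 (f k i)) (N2 (f k (i+1)%Z)) (N2 (f k (i+1+1)%Z)) (N2 (f k (i-1)%Z)).
    intros g0 g1 g2 gm F0 F1 Fm F' f' f1' pF0 pF1 pFm I0 I1 Im hF' hf0 hf1.
    assert (hBn : B * (nu * t / 4) = t) by (unfold B; field; lra).
    assert (hst : s + t <= T').
    { unfold T'. assert (hA2 : 1 <= A ^ 2) by nra.
      generalize (Rmult_le_compat_l t _ _ (Rlt_le _ _ htp) hA2); lra. }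
    assert (a1 : (s + t) * F' <= (s + t) * (1/2 * F0 + 1/4 * F1 + 1/4 * Fm + t * (C2 * (1 + X ^ 2))))
      by (apply Rmult_le_compat_l; lra).
    assert (a2 : B * f' <= B * (1/2 * g0 + 1/4 * g1 + 1/4 * gm - nu * t / 4 * (F0 + Fm) + t * C1))
      by (apply Rmult_le_compat_l; lra).
    assert (a3 : B * f1' <= B * (1/2 * g1 + 1/4 * g2 + 1/4 * g0 - nu * t / 4 * (F1 + F0) + t * C1))
      by (apply Rmult_le_compat_l; lra).
    assert (a4 : (s + t) * (t * (C2 * (1 + X ^ 2))) <= t * (C2 * T' + C2 * Qs + C2 * (M ^ 2 / nu))).
    { replace ((s + t) * (t * (C2 * (1 + X ^ 2)))) with
        (t * (C2 * (s + t) + C2 * (s * X ^ 2) + C2 * (t * X ^ 2))) by ring.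
      apply Rmult_le_compat_l; [lra|].
      apply Rplus_le_compat; [apply Rplus_le_compat|]; apply Rmult_le_compat_l; lra. }
    assert (a5 : B * (nu * t / 4 * (F0 + Fm)) + B * (nu * t / 4 * (F1 + F0)) = t * (F0 + Fm + F1 + F0)).
    { transitivity (B * (nu * t / 4) * (F0 + Fm + F1 + F0)); [ring|rewrite hBn; ring]. }
    unfold C3.
    assert (0 <= t * (F0 + Fm + F1)) by nra.
    assert (0 <= t * F0) by nra. assert (0 <= t * F1) by nra. assert (0 <= t * Fm) by nra.
    lra. }
intros k i hk.
specialize (hinv k hk i).
rewrite Cmod_sqr.
generalize (N2_pos (f k i)) (N2_pos (f k (i+1)%Z)); intros.
assert (Q (INR k * t) <= (2 * B * M ^ 2 + C3 / C2) * exp (C2 * T)).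
{ unfold Q. assert (exp (C2 * (INR k * t)) <= exp (C2 * T)).
  { assert (hle : C2 * (INR k * t) <= C2 * T).
    { apply Rmult_le_compat_l; [lra|]. eapply Rle_trans; [|exact hKT].
      apply Rmult_le_compat_r; [lra|apply le_INR; lia]. }
    destruct (Rle_lt_or_eq_dec _ _ hle) as [l|e]; [left; apply exp_increasing, l|rewrite e; lra]. }
  nra. }
assert (0 <= B * (N2 (f k i) + N2 (f k (i+1)%Z))) by nra.
lra.
Qed.

(** * Leibniz rules for iterated differences and the residual of the scheme *)

Fixpoint diffn (q : R) (j : nat) (f : Z -> C) : Z -> C :=
  match j with O => f | S j => diffZ q (diffn q j f) end.

Definition reZ (f : Z -> C) (i : Z) : C := RtoC (fst (f i)).

Lemma diffn_diffZ (q : R) (j : nat) (f : Z -> C) :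
  diffn q j (diffZ q f) = diffZ q (diffn q j f).
Proof. induction j as [|j IH]; simpl; [reflexivity|now rewrite IH]. Qed.

Lemma diffn_shiftZ (q : R) (j : nat) (f : Z -> C) :
  diffn q j (shiftZ f) = shiftZ (diffn q j f).
Proof. induction j as [|j IH]; simpl; [reflexivity|now rewrite IH]. Qed.

Lemma diffn_lin (q : R) (j : nat) (x y : C) (f g : Z -> C) :
  diffn q j (fun i => x * f i + y * g i)%C =
  (fun i => x * diffn q j f i + y * diffn q j g i)%C.
Proof.
induction j as [|j IH]; simpl; [reflexivity|rewrite IH].
apply functional_extensionality; intros i; unfold diffZ; ring.
Qed.

Lemma diffn_pred (q : R) (j : nat) (f : Z -> C) :
  diffn q j (fun i => f (i - 1)%Z) = (fun i => diffn q j f (i - 1)%Z).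
Proof.
induction j as [|j IH]; simpl; [reflexivity|rewrite IH].
apply functional_extensionality; intros i; unfold diffZ.
replace (i + 1 - 1)%Z with (i - 1 + 1)%Z by lia; reflexivity.
Qed.

Lemma diffn_const (q : R) (j : nat) (c : C) (i : Z) :
  diffn q (S j) (fun _ => c) i = RtoC 0.
Proof.
simpl; rewrite <- (diffn_diffZ q j (fun _ => c)).
replace (diffZ q (fun _ => c)) with (fun _ : Z => RtoC 0).
- induction j as [|j IH] in i |- *; simpl; [reflexivity|].
  unfold diffZ; rewrite !IH; ring.
- apply functional_extensionality; intros k; unfold diffZ; ring.
Qed.

Lemma diffn_reZ (q : R) (j : nat) (f : Z -> C) :
  diffn q j (reZ f) = reZ (diffn q j f).
Proof.
induction j as [|j IH]; simpl; [reflexivity|rewrite IH].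
apply functional_extensionality; intros i; unfold diffZ, reZ.
unfold RtoC, Cmult, Cminus, Cplus, Copp; simpl; f_equal; ring.
Qed.

Lemma diffn_averZ (q : R) (j : nat) (f : Z -> C) :
  diffn q j (averZ f) = averZ (diffn q j f).
Proof.
induction j as [|j IH]; simpl; [reflexivity|rewrite IH].
apply functional_extensionality; intros i; apply diffZ_averZ.
Qed.

Lemma Cmod_reZ (f : Z -> C) (i : Z) : Cmod (reZ f i) <= Cmod (f i).
Proof.
unfold reZ; rewrite Cmod_R.
eapply Rle_trans; [|apply Rmax_Cmod]; apply Rmax_l.
Qed.

(** The factors [RtoC 1] give the two terms of the discrete Leibniz rule the shape that [diffn_lin]
    rewrites. *)
Lemma diffZ_mult (q : R) (f g : Z -> C) :
  diffZ q (fun i => f i * g i)%C =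
  (fun i => RtoC 1 * (shiftZ f i * diffZ q g i) + RtoC 1 * (diffZ q f i * g i))%C.
Proof. apply functional_extensionality; intros i; unfold diffZ, shiftZ; ring. Qed.

Lemma diffn_mult_le (q : R) (j : nat) (f g : Z -> C) (A B : R) :
  (forall l i, (l <= j)%nat -> Cmod (diffn q l f i) <= A) ->
  (forall l i, (l <= j)%nat -> Cmod (diffn q l g i) <= B) ->
  forall i, Cmod (diffn q j (fun i => f i * g i)%C i) <= 2 ^ j * A * B.
Proof.
revert f g; induction j as [|j IH]; intros f g hf hg i.
- simpl; rewrite Cmod_mult, Rmult_1_l.
  apply Rmult_le_compat; try apply Cmod_ge_0; [apply (hf O)|apply (hg O)]; lia.
- change (diffn q (S j) (fun i => f i * g i)%C) with
    (diffZ q (diffn q j (fun i => f i * g i)%C)).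
  rewrite <- diffn_diffZ, diffZ_mult, diffn_lin, !Cmult_1_l.
  eapply Rle_trans; [apply Cmod_triangle|].
  replace (2 ^ S j * A * B) with (2 ^ j * A * B + 2 ^ j * A * B) by (simpl; ring).
  apply Rplus_le_compat; apply IH; intros l k hl.
  + rewrite diffn_shiftZ; apply hf; lia.
  + rewrite diffn_diffZ; apply (hg (S l)); lia.
  + rewrite diffn_diffZ; apply (hf (S l)); lia.
  + apply hg; lia.
Qed.

(** The term in which all differences fall on [g] is kept apart. In the applications [g] is the
    discrete gradient, whose top difference is one order beyond those already bounded and has to be
    absorbed by dissipation. *)
Lemma diffn_mult_comm_le (q : R) (j : nat) (f g : Z -> C) (A B : R) :
  0 <= A -> 0 <= B ->
  (forall l i, (l <= j)%nat -> Cmod (diffn q l f i) <= A) ->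
  (forall l i, (l < j)%nat -> Cmod (diffn q l g i) <= B) ->
  forall i, Cmod (diffn q j (fun i => f i * g i)%C i) <=
    A * Cmod (diffn q j g i) + 2 ^ j * A * B.
Proof.
revert f g; induction j as [|j IH]; intros f g hA hB hf hg i.
- simpl; rewrite Cmod_mult.
  generalize (hf O i (le_n _)) (Cmod_ge_0 (g i)); simpl; intros.
  assert (0 <= A * B) by nra. nra.
- change (diffn q (S j) (fun i => f i * g i)%C) with
    (diffZ q (diffn q j (fun i => f i * g i)%C)).
  rewrite <- diffn_diffZ, diffZ_mult, diffn_lin, !Cmult_1_l.
  eapply Rle_trans; [apply Cmod_triangle|].
  replace (A * Cmod (diffn q (S j) g i) + 2 ^ S j * A * B) with
    (A * Cmod (diffn q j (diffZ q g) i) + 2 ^ j * A * B + 2 ^ j * A * B)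
    by (rewrite diffn_diffZ; simpl; ring).
  apply Rplus_le_compat.
  + apply IH; auto; intros l k hl.
    * rewrite diffn_shiftZ; apply hf; lia.
    * rewrite diffn_diffZ; apply (hg (S l)); lia.
  + apply diffn_mult_le; intros l k hl.
    * rewrite diffn_diffZ; apply (hf (S l)); lia.
    * apply hg; lia.
Qed.

(** The centred difference quotient, as the mean of the forward and the backward one. *)
Definition cdiffZ (q : R) (f : Z -> C) (i : Z) : C :=
  (RtoC (1/2) * diffZ q f i + RtoC (1/2) * diffZ q f (i - 1))%C.

Lemma diffn_cdiffZ (q : R) (j : nat) (f : Z -> C) (i : Z) :
  diffn q j (cdiffZ q f) i =
  (RtoC (1/2) * diffn q (S j) f i + RtoC (1/2) * diffn q (S j) f (i - 1))%C.
Proof.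
unfold cdiffZ; rewrite diffn_lin, diffn_pred, diffn_diffZ; reflexivity.
Qed.

Lemma Cmod_diffn_cdiffZ (q : R) (j : nat) (f : Z -> C) (i : Z) :
  Cmod (diffn q j (cdiffZ q f) i) <=
  1/2 * (Cmod (diffn q (S j) f i) + Cmod (diffn q (S j) f (i - 1))).
Proof.
rewrite diffn_cdiffZ; eapply Rle_trans; [apply Cmod_triangle|].
rewrite !Cmod_mult, !Cmod_R, !Rabs_pos_eq by lra; lra.
Qed.

(** The terms [c - 2 psi w_z - w^2] of the equation, with [b] in the place of [2 psi]. *)
Definition resZ (q : R) (b : Z -> C) (c : C) (w : Z -> C) (i : Z) : C :=
  (c - b i * cdiffZ q w i - w i * w i)%C.

(** From order one on, the spatially constant [c] has zero differences; this frees the higher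
    estimates from the nonlocal constant. *)
Lemma diffn_resZ_le (q : R) (j : nat) (b : Z -> C) (c : C) (w : Z -> C) (i : Z) :
  Cmod (diffn q (S j) (resZ q b c w) i) <=
  Cmod (diffn q (S j) (fun i => b i * cdiffZ q w i)%C i) +
  Cmod (diffn q (S j) (fun i => w i * w i)%C i).
Proof.
replace (resZ q b c w) with (fun i => RtoC 1 * (fun _ => c) i + RtoC (-1) *
   (fun i => RtoC 1 * (fun i => b i * cdiffZ q w i) i + RtoC 1 * (fun i => w i * w i) i) i)%C.
- rewrite !diffn_lin, diffn_const.
  eapply Rle_trans; [apply Cmod_triangle|].
  rewrite !Cmult_1_l, Cmod_0, Cmod_mult, Cmod_R, Rplus_0_l.
  replace (Rabs (-1)) with 1 by (rewrite Rabs_left; lra); rewrite Rmult_1_l.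
  apply Cmod_triangle.
- apply functional_extensionality; intros k; unfold resZ.
  replace (RtoC (-1)) with (- RtoC 1)%C by (unfold RtoC, Copp; simpl; f_equal; ring).
  ring.
Qed.

Section Residual.
Variables (q : R) (b w : Z -> C) (c : C) (M : R) (j : nat).
Hypothesis hM : 0 <= M.
Hypothesis hb : forall i, diffZ q b i = (- (reZ w i + shiftZ (reZ w) i))%C.
Hypothesis hb0 : forall i, Cmod (b i) <= 2 * M.
Hypothesis hw : forall l i, (l <= j)%nat -> Cmod (diffn q l w i) <= M.

(** The velocity is one order smoother than [w]: by [hb] its differences of order [l + 1] are sums
    of two differences of [v] of order [l]. *)
Lemma diffn_velocity_le (l : nat) (i : Z) :
  (l <= S j)%nat -> Cmod (diffn q l b i) <= 2 * M.
Proof.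
intros hl; destruct l as [|l]; [apply hb0|].
simpl; rewrite <- diffn_diffZ.
replace (diffZ q b) with (fun i => RtoC (-1) * reZ w i + RtoC (-1) * shiftZ (reZ w) i)%C.
- rewrite diffn_lin, diffn_shiftZ, diffn_reZ.
  eapply Rle_trans; [apply Cmod_triangle|].
  rewrite !Cmod_mult, !Cmod_R; replace (Rabs (-1)) with 1 by (rewrite Rabs_left; lra).
  unfold shiftZ.
  generalize (Cmod_reZ (diffn q l w) i) (Cmod_reZ (diffn q l w) (i + 1)%Z)
    (hw l i ltac:(lia)) (hw l (i + 1)%Z ltac:(lia)); lra.
- apply functional_extensionality; intros k; rewrite hb.
  replace (RtoC (-1)) with (- RtoC 1)%C by (unfold RtoC, Copp; simpl; f_equal; ring).
  ring.
Qed.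

Lemma diffn_residual_le (i : Z) : (0 < j)%nat ->
  Cmod (diffn q j (resZ q b c w) i) <=
  (1 + 2 * M + 6 * 2 ^ j * M * (M + 1)) *
  (1 + Cmod (diffn q (S j) w i) + Cmod (diffn q (S j) w (i - 1))).
Proof.
intros hj.
assert (hr : Cmod (diffn q j (resZ q b c w) i) <=
  Cmod (diffn q j (fun i => b i * cdiffZ q w i)%C i) +
  Cmod (diffn q j (fun i => w i * w i)%C i)).
{ replace j with (S (pred j)) by lia; apply diffn_resZ_le. }
eapply Rle_trans; [exact hr|clear hr].
assert (h1 : Cmod (diffn q j (fun i => b i * cdiffZ q w i)%C i) <=
  2 * M * Cmod (diffn q j (cdiffZ q w) i) + 2 ^ j * (2 * M) * M).
{ apply diffn_mult_comm_le; try lra.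
  - intros l m hl; apply diffn_velocity_le; lia.
  - intros l m hl; eapply Rle_trans; [apply Cmod_diffn_cdiffZ|].
    generalize (hw (S l) m ltac:(lia)) (hw (S l) (m - 1)%Z ltac:(lia)); lra. }
assert (h2 : Cmod (diffn q j (fun i => w i * w i)%C i) <= 2 ^ j * M * M).
{ apply diffn_mult_le; intros; apply hw; lia. }
generalize (Cmod_diffn_cdiffZ q j w i).
generalize (Cmod_ge_0 (diffn q (S j) w i)) (Cmod_ge_0 (diffn q (S j) w (i - 1)%Z)).
revert h1 h2; generalize (Cmod (diffn q (S j) w i)) (Cmod (diffn q (S j) w (i - 1)%Z)).
assert (h0 : 0 < 2 ^ j) by (apply pow_lt; lra).
revert h0; generalize (2 ^ j); intros p h0 x y h1 h2 hx hy h3.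
assert (2 * M * Cmod (diffn q j (cdiffZ q w) i) <= 2 * M * (1/2 * (x + y)))
  by (apply Rmult_le_compat_l; lra).
assert (0 <= p * M) by nra.
assert (0 <= p * M * M) by nra.
assert (0 <= p * M * (M + 1) * (x + y)) by (apply Rmult_le_pos; nra).
nra.
Qed.

(** Together with [diffn_residual_le] this supplies the residual hypotheses of [lattice_smoothing]
    for the [j]-th differences. The bound has to be linear in [X]; therefore the difference of the
    square is factored as [(w + shiftZ w) * diffZ q w] before further differences are taken. *)
Lemma diffn_S_residual_le (X : R) (hX : forall i, Cmod (diffn q (S j) w i) <= X) (i : Z) :
  Cmod (diffn q (S j) (resZ q b c w) i) <=
  (1 + 2 * M + 6 * 2 ^ j * M * (M + 1)) *
  (1 + X + Cmod (diffn q (S (S j)) w i) + Cmod (diffn q (S (S j)) w (i - 1))).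
Proof.
assert (hX0 : 0 <= X) by (eapply Rle_trans; [apply Cmod_ge_0|apply (hX 0%Z)]).
assert (hw' : forall l m, (l <= S j)%nat -> Cmod (diffn q l w m) <= M + X).
{ intros l m hl; destruct (le_lt_dec l j) as [h|h].
  - generalize (hw l m h); lra.
  - replace l with (S j) by lia; generalize (hX m); lra. }
eapply Rle_trans; [apply diffn_resZ_le|].
assert (h1 : Cmod (diffn q (S j) (fun i => b i * cdiffZ q w i)%C i) <=
  2 * M * Cmod (diffn q (S j) (cdiffZ q w) i) + 2 ^ S j * (2 * M) * (M + X)).
{ apply diffn_mult_comm_le; try lra.
  - intros l m hl; apply diffn_velocity_le; lia.
  - intros l m hl; eapply Rle_trans; [apply Cmod_diffn_cdiffZ|].
    generalize (hw' (S l) m ltac:(lia)) (hw' (S l) (m - 1)%Z ltac:(lia)); lra. }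
assert (h2 : Cmod (diffn q (S j) (fun i => w i * w i)%C i) <= 2 ^ j * (2 * M) * (M + X)).
{ simpl; rewrite <- diffn_diffZ.
  replace (diffZ q (fun i => w i * w i)%C) with
    (fun i => (RtoC 1 * w i + RtoC 1 * shiftZ w i) * diffZ q w i)%C
    by (apply functional_extensionality; intros m; unfold diffZ, shiftZ; ring).
  apply diffn_mult_le; intros l m hl.
  - rewrite diffn_lin, diffn_shiftZ, !Cmult_1_l.
    eapply Rle_trans; [apply Cmod_triangle|]; unfold shiftZ.
    generalize (hw l m hl) (hw l (m + 1)%Z hl); lra.
  - rewrite diffn_diffZ; apply (hw' (S l)); lia. }
generalize (Cmod_diffn_cdiffZ q (S j) w i).
generalize (Cmod_ge_0 (diffn q (S (S j)) w i)) (Cmod_ge_0 (diffn q (S (S j)) w (i - 1)%Z)).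
revert h1 h2; generalize (Cmod (diffn q (S (S j)) w i)) (Cmod (diffn q (S (S j)) w (i - 1)%Z)).
change (2 ^ S j) with (2 * 2 ^ j).
assert (h0 : 0 < 2 ^ j) by (apply pow_lt; lra).
revert h0; generalize (2 ^ j); intros p h0 x y h1 h2 hx hy h3.
assert (2 * M * Cmod (diffn q (S j) (cdiffZ q w) i) <= 2 * M * (1/2 * (x + y)))
  by (apply Rmult_le_compat_l; lra).
assert (0 <= p * M) by nra.
assert (0 <= p * M * M) by nra.
assert (0 <= p * M * X) by nra.
assert (0 <= p * M * M * X) by nra.
assert (0 <= p * M * (M + 1) * (x + y)) by (apply Rmult_le_pos; nra).
nra.
Qed.

End Residual.

(** * The explicit scheme *)

Fixpoint rsum (f : nat -> R) (n : nat) : R :=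
  match n with O => 0 | S n => rsum f n + f n end.

Lemma rsum_ext (f g : nat -> R) (n : nat) :
  (forall k, (k < n)%nat -> f k = g k) -> rsum f n = rsum g n.
Proof.
induction n as [|n IH]; simpl; intros h; [reflexivity|].
rewrite IH, h; auto; intros; apply h; lia.
Qed.

Lemma rsum_lin (a b : R) (f g : nat -> R) (n : nat) :
  rsum (fun k => a * f k + b * g k) n = a * rsum f n + b * rsum g n.
Proof. induction n as [|n IH]; simpl; [ring|rewrite IH; ring]. Qed.

Lemma rsum_const (a : R) (n : nat) : rsum (fun _ => a) n = INR n * a.
Proof. induction n as [|n IH]; [simpl; ring|rewrite S_INR; simpl; rewrite IH; ring]. Qed.

Lemma rsum_abs_le (f : nat -> R) (M : R) (n : nat) :
  (forall k, (k < n)%nat -> Rabs (f k) <= M) -> Rabs (rsum f n) <= INR n * M.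
Proof.
intros h; rewrite <- rsum_const; induction n as [|n IH]; simpl; [rewrite Rabs_R0; lra|].
eapply Rle_trans; [apply Rabs_triang|].
apply Rplus_le_compat; [apply IH; intros; apply h; lia|apply h; lia].
Qed.

Lemma rsum_telescope (f : nat -> R) (n : nat) :
  rsum (fun k => f (S k) - f k) n = f n - f O.
Proof. induction n as [|n IH]; simpl; [ring|rewrite IH; ring]. Qed.

Definition periodicZ (N : nat) (f : Z -> C) : Prop := forall i, f (i + Z.of_nat N)%Z = f i.

Definition rsumZ (N : nat) (f : Z -> R) : R := rsum (fun n => f (Z.of_nat n)) N.

Lemma rsumZ_shift (N : nat) (f : Z -> R) (hf : forall i, f (i + Z.of_nat N)%Z = f i) :
  rsumZ N (fun i => f (i + 1)%Z) = rsumZ N f.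
Proof.
unfold rsumZ.
assert (h := rsum_telescope (fun n => f (Z.of_nat n)) N).
assert (h0 : f (Z.of_nat N) = f (Z.of_nat 0)) by exact (hf 0%Z).
rewrite (rsum_ext _ (fun k => 1 * f (Z.of_nat k + 1)%Z + (-1) * f (Z.of_nat k))) in h.
- rewrite (rsum_lin 1 (-1) (fun k => f (Z.of_nat k + 1)%Z) (fun k => f (Z.of_nat k))) in h; lra.
- intros k _; rewrite Nat2Z.inj_succ; unfold Z.succ; ring.
Qed.

Lemma rsumZ_pred (N : nat) (f : Z -> R) (hf : forall i, f (i + Z.of_nat N)%Z = f i) :
  rsumZ N (fun i => f (i - 1)%Z) = rsumZ N f.
Proof.
rewrite <- (rsumZ_shift N (fun i => f (i - 1)%Z)).
- apply rsum_ext; intros k _; cbv beta; f_equal; lia.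
- intros i; rewrite <- (hf (i - 1)%Z); f_equal; lia.
Qed.

Lemma rsumZ_lin (N : nat) (a b : R) (f g : Z -> R) :
  rsumZ N (fun i => a * f i + b * g i) = a * rsumZ N f + b * rsumZ N g.
Proof. apply rsum_lin. Qed.

(* The discrete [2 psi]: its difference quotient is [- (v_i + v_{i+1})] and it vanishes at [0]. *)
Definition velZ (N : nat) (w : Z -> C) (i : Z) : C :=
  RtoC (- / INR N * rsum (fun n => fst (w (Z.of_nat n)) + fst (w (Z.of_nat n + 1)%Z))
                     (Z.to_nat (i mod Z.of_nat N))).

(** The value that keeps the discrete mean of [v] exactly zero. It is not a sampled version of
    [3 v^2 - u^2]; that formula is recovered only in the limit. *)
Definition cstZ (N : nat) (w : Z -> C) : C :=
  RtoC (/ INR N * rsumZ N (fun i => fst (velZ N w i * cdiffZ (INR N) w i + w i * w i)%C)).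

(* With this time step, explicit diffusion is the average [averZ]. *)
Definition tau (nu : R) (N : nat) : R := / (4 * nu * INR N ^ 2).

Definition stepZ (nu : R) (N : nat) (w : Z -> C) (i : Z) : C :=
  (averZ w i + RtoC (tau nu N) * resZ (INR N) (velZ N w) (cstZ N w) w i)%C.

Section Step.
Variables (nu : R) (N : nat) (w : Z -> C).
Hypothesis hN : (0 < N)%nat.
Hypothesis hper : periodicZ N w.
Hypothesis hmean : rsumZ N (fun i => fst (w i)) = 0.

Let hq : 0 < INR N.
Proof. apply lt_0_INR, hN. Qed.

Lemma velZ_periodic : periodicZ N (velZ N w).
Proof.
intros i; unfold velZ.
replace ((i + Z.of_nat N) mod Z.of_nat N)%Z with (i mod Z.of_nat N)%Z; [reflexivity|].
replace (i + Z.of_nat N)%Z with (i + 1 * Z.of_nat N)%Z by ring; rewrite Z.mod_add by lia; reflexivity.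
Qed.

Lemma velZ_0 : velZ N w 0 = RtoC 0.
Proof. unfold velZ; rewrite Z.mod_0_l by lia; simpl; f_equal; ring. Qed.

Lemma periodicZ_mul (f : Z -> C) (hf : periodicZ N f) (i k : Z) :
  f (i + k * Z.of_nat N)%Z = f i.
Proof.
assert (h : forall (m : nat) j, f (j + Z.of_nat m * Z.of_nat N)%Z = f j).
{ induction m as [|m IH]; intros j; [f_equal; lia|].
  rewrite <- (hf j), <- (IH (j + Z.of_nat N)%Z); f_equal; lia. }
destruct (Z_le_dec 0 k) as [hk|hk].
- rewrite <- (h (Z.to_nat k) i); f_equal; rewrite Z2Nat.id; lia.
- rewrite <- (h (Z.to_nat (- k)) (i + k * Z.of_nat N)%Z); f_equal; rewrite Z2Nat.id; lia.
Qed.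

(** [velZ] is a partial sum up to a residue modulo [N]. The relation survives the wrap from [N - 1]
    to [0] because the sum over a full period vanishes, which is the zero mean of [v]. *)
Lemma velZ_diff (i : Z) :
  diffZ (INR N) (velZ N w) i = (- (reZ w i + shiftZ (reZ w) i))%C.
Proof.
set (r := (i mod Z.of_nat N)%Z).
assert (hr : (0 <= r < Z.of_nat N)%Z) by (apply Z.mod_pos_bound; lia).
assert (hi : i = (r + (i / Z.of_nat N) * Z.of_nat N)%Z).
{ unfold r; rewrite (Z.div_mod i (Z.of_nat N)) at 1 by lia; ring. }
assert (hsum : rsum (fun n => fst (w (Z.of_nat n)) + fst (w (Z.of_nat n + 1)%Z)) N = 0).
{ transitivity (rsumZ N (fun i => 1 * fst (w i) + 1 * fst (w (i + 1)%Z))).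
  - apply rsum_ext; intros; ring.
  - rewrite rsumZ_lin, (rsumZ_shift N (fun i => fst (w i))), hmean; [ring|intros; now rewrite hper]. }
assert (key : rsum (fun n => fst (w (Z.of_nat n)) + fst (w (Z.of_nat n + 1)%Z))
        (Z.to_nat ((i + 1) mod Z.of_nat N)) =
      rsum (fun n => fst (w (Z.of_nat n)) + fst (w (Z.of_nat n + 1)%Z)) (Z.to_nat r)
      + (fst (w i) + fst (w (i + 1)%Z))).
{ assert (hs : rsum (fun n => fst (w (Z.of_nat n)) + fst (w (Z.of_nat n + 1)%Z)) (S (Z.to_nat r))
    = rsum (fun n => fst (w (Z.of_nat n)) + fst (w (Z.of_nat n + 1)%Z)) (Z.to_nat r)
      + (fst (w i) + fst (w (i + 1)%Z))).
  { simpl; rewrite Z2Nat.id by lia; f_equal; f_equal.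
    - rewrite hi, periodicZ_mul by exact hper; reflexivity.
    - rewrite hi; replace (r + i / Z.of_nat N * Z.of_nat N + 1)%Z with
        (r + 1 + i / Z.of_nat N * Z.of_nat N)%Z by ring.
      rewrite periodicZ_mul by exact hper; reflexivity. }
  rewrite <- hs.
  rewrite hi; replace (r + i / Z.of_nat N * Z.of_nat N + 1)%Z with
        (r + 1 + i / Z.of_nat N * Z.of_nat N)%Z by ring.
  rewrite Z.mod_add by lia.
  destruct (Z.eq_dec (r + 1) (Z.of_nat N)) as [e|e].
  - rewrite e, Z.mod_same by lia.
    replace (S (Z.to_nat r)) with N by lia; rewrite hsum; reflexivity.
  - rewrite Z.mod_small by lia; f_equal; lia. }
unfold diffZ, velZ, reZ, shiftZ; rewrite key; fold r.
unfold RtoC, Cmult, Cminus, Cplus, Copp; simpl; f_equal; [|ring].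
field; lra.
Qed.

Lemma velZ_le (V : R) (hV : forall i, Rabs (fst (w i)) <= V) (i : Z) :
  Cmod (velZ N w i) <= 2 * V.
Proof.
assert (hV0 : 0 <= V) by (eapply Rle_trans; [apply Rabs_pos|apply (hV 0%Z)]).
unfold velZ; rewrite Cmod_R, Rabs_mult, Rabs_Ropp, Rabs_pos_eq
  by (left; apply Rinv_0_lt_compat, hq).
apply Rle_trans with (/ INR N * (INR N * (2 * V))).
- apply Rmult_le_compat_l; [left; apply Rinv_0_lt_compat, hq|].
  eapply Rle_trans; [apply rsum_abs_le with (M := 2 * V)|].
  + intros k _; eapply Rle_trans; [apply Rabs_triang|].
    generalize (hV (Z.of_nat k)) (hV (Z.of_nat k + 1)%Z); lra.
  + apply Rmult_le_compat_r; [lra|apply le_INR].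
    generalize (Z.mod_pos_bound i (Z.of_nat N)); lia.
- right; field; lra.
Qed.

Lemma lattice_Lipschitz (f : Z -> C) (G : R) (hG : forall i, Cmod (diffZ (INR N) f i) <= G)
  (i : Z) (n : nat) : Cmod (f (i + Z.of_nat n)%Z - f i) <= INR n * (G / INR N).
Proof.
induction n as [|n IH].
- replace (i + Z.of_nat 0)%Z with i by lia; unfold Cminus; rewrite Cplus_opp_r, Cmod_0; simpl; lra.
- rewrite S_INR.
  replace (f (i + Z.of_nat (S n))%Z - f i)%C with
   ((f (i + Z.of_nat n)%Z - f i) + RtoC (/ INR N) * diffZ (INR N) f (i + Z.of_nat n)%Z)%C.
  + eapply Rle_trans; [apply Cmod_triangle|].
    rewrite Cmod_mult, Cmod_R, Rabs_pos_eq by (left; apply Rinv_0_lt_compat, hq).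
    assert (/ INR N * Cmod (diffZ (INR N) f (i + Z.of_nat n)%Z) <= / INR N * G).
    { apply Rmult_le_compat_l; [left; apply Rinv_0_lt_compat, hq|apply hG]. }
    unfold Rdiv in *; lra.
  + unfold diffZ; replace (i + Z.of_nat n + 1)%Z with (i + Z.of_nat (S n))%Z by lia.
    rewrite RtoC_inv by lra; field; intros e; apply RtoC_inj in e; lra.
Qed.

(** A discrete Poincare inequality: since the mean of [v] is zero, its value at a point is the mean
    of its differences to the values over one period, and each of these is at most [G] because the
    points lie within one period of each other. *)
Lemma re_le_diff (G : R) (hG : forall i, Cmod (diffZ (INR N) w i) <= G) (i : Z) :
  Rabs (fst (w i)) <= G.
Proof.
assert (hG0 : 0 <= G) by (eapply Rle_trans; [apply Cmod_ge_0|apply (hG 0%Z)]).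
assert (h0 : forall a b : Z, (0 <= b - a <= Z.of_nat N)%Z -> Rabs (fst (w b) - fst (w a)) <= G).
{ intros a b hab.
  generalize (lattice_Lipschitz w G hG a (Z.to_nat (b - a))).
  replace (a + Z.of_nat (Z.to_nat (b - a)))%Z with b by lia.
  generalize (Rmax_Cmod (w b - w a)%C); simpl; intros h1 h2.
  apply Rle_trans with (INR (Z.to_nat (b - a)) * (G / INR N)).
  - eapply Rle_trans; [|exact h2]; eapply Rle_trans; [apply Rmax_l|exact h1].
  - apply Rle_trans with (INR N * (G / INR N)); [|right; field; lra].
    apply Rmult_le_compat_r; [apply Rdiv_le_0_compat; [exact hG0|exact hq]|apply le_INR; lia]. }
assert (hloc : forall a, (0 <= a < Z.of_nat N)%Z -> Rabs (fst (w a)) <= G).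
{ intros a ha.
  assert (e : rsumZ N (fun n => fst (w a) - fst (w n)) = INR N * fst (w a)).
  { transitivity (rsumZ N (fun n => 1 * fst (w a) + (-1) * fst (w n))).
    - apply rsum_ext; intros; ring.
    - rewrite (rsumZ_lin N 1 (-1) (fun _ => fst (w a)) (fun n => fst (w n))), hmean; unfold rsumZ; rewrite rsum_const; ring. }
  assert (h1 : Rabs (rsumZ N (fun n => fst (w a) - fst (w n))) <= INR N * G).
  { apply rsum_abs_le; intros k hk.
    destruct (Z_le_dec (Z.of_nat k) a); [|rewrite Rabs_minus_sym]; apply h0; lia. }
  rewrite e, Rabs_mult, (Rabs_pos_eq (INR N)) in h1 by lra.
  apply Rmult_le_reg_l with (INR N); lra. }
rewrite (Z.div_mod i (Z.of_nat N)), Z.add_comm, Z.mul_comm, periodicZ_mul by (exact hper || lia).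
apply hloc, Z.mod_pos_bound; lia.
Qed.

Lemma cdiffZ_periodic : periodicZ N (cdiffZ (INR N) w).
Proof.
intros i; unfold cdiffZ, diffZ.
replace (i + Z.of_nat N + 1)%Z with (i + 1 + Z.of_nat N)%Z by lia.
replace (i + Z.of_nat N - 1 + 1)%Z with (i - 1 + 1 + Z.of_nat N)%Z by lia.
replace (i + Z.of_nat N - 1)%Z with (i - 1 + Z.of_nat N)%Z by lia.
now rewrite !hper.
Qed.

Lemma stepZ_periodic : periodicZ N (stepZ nu N w).
Proof.
intros i; unfold stepZ, averZ, resZ.
rewrite cdiffZ_periodic, velZ_periodic.
replace (i + Z.of_nat N + 1)%Z with (i + 1 + Z.of_nat N)%Z by lia.
replace (i + Z.of_nat N - 1)%Z with (i - 1 + Z.of_nat N)%Z by lia.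
now rewrite !hper.
Qed.

Lemma stepZ_mean : rsumZ N (fun i => fst (stepZ nu N w i)) = 0.
Proof.
transitivity (rsumZ N (fun i => 1 * (1/2 * fst (w i) +
   1/2 * (1/2 * fst (w (i+1)%Z) + 1/2 * fst (w (i-1)%Z)))
   + tau nu N * (1 * (fun _ => fst (cstZ N w)) i +
       (-1) * fst (velZ N w i * cdiffZ (INR N) w i + w i * w i)%C))).
- apply rsum_ext; intros k _; unfold stepZ, averZ, resZ.
  generalize (velZ N w (Z.of_nat k)) (cdiffZ (INR N) w (Z.of_nat k)) (cstZ N w)
    (w (Z.of_nat k)) (w (Z.of_nat k + 1)%Z) (w (Z.of_nat k - 1)%Z) (tau nu N).
  intros [a1 a2] [b1 b2] [c1 c2] [d1 d2] [e1 e2] [f1 f2] t.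
  unfold RtoC, Cmult, Cminus, Cplus, Copp; simpl; field.
- rewrite !rsumZ_lin, (rsumZ_shift N (fun i => fst (w i))), (rsumZ_pred N (fun i => fst (w i))), hmean by (intros; now rewrite hper).
  assert (hc : rsumZ N (fun _ => fst (cstZ N w)) = INR N * fst (cstZ N w)) by (unfold rsumZ; apply rsum_const).
  rewrite hc; change (fst (cstZ N w)) with (/ INR N * rsumZ N (fun i => fst (velZ N w i * cdiffZ (INR N) w i + w i * w i)%C)).
  match goal with |- context [/ INR N * ?x] => generalize x; intros x0 end.
  field; lra.
Qed.

End Step.

Lemma Cmod_le_sum (z : C) : Cmod z <= Rabs (fst z) + Rabs (snd z).
Proof.
unfold Cmod; rewrite <- (sqrt_pow2 (Rabs (fst z) + Rabs (snd z)))
  by (generalize (Rabs_pos (fst z)) (Rabs_pos (snd z)); lra).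
apply sqrt_le_1_alt; rewrite <- (pow2_abs (fst z)), <- (pow2_abs (snd z)).
generalize (Rabs_pos (fst z)) (Rabs_pos (snd z)); nra.
Qed.

(** * The maximum principle for one time step *)

Section StepBounds.
Variables (nu : R) (N : nat) (w : Z -> C) (V U : R).
Hypothesis hN : (0 < N)%nat.
Hypothesis hnu : 0 < nu.
Hypothesis hper : periodicZ N w.
Hypothesis hmean : rsumZ N (fun i => fst (w i)) = 0.
Hypothesis hV : forall i, Rabs (fst (w i)) <= V.
Hypothesis hU : forall i, Rabs (snd (w i)) <= U.
Hypothesis ht1 : tau nu N * V <= 1/8.
Hypothesis ht2 : tau nu N * INR N * V <= 1/8.

Let hq : 0 < INR N.
Proof. apply lt_0_INR, hN. Qed.

Lemma tau_pos : 0 < tau nu N.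
Proof. unfold tau; apply Rinv_0_lt_compat, Rmult_lt_0_compat; [lra|apply pow_lt, hq]. Qed.

Lemma velZ_real (i : Z) : velZ N w i = RtoC (fst (velZ N w i)).
Proof. reflexivity. Qed.

Lemma velZ_re_le (i : Z) : Rabs (fst (velZ N w i)) <= 2 * V.
Proof.
rewrite <- Cmod_R, <- velZ_real; apply velZ_le; auto.
Qed.

(* The terms [-D b D0 w] and [-D (w^2)] combine, up to the rotation by the
   imaginary part, into a difference of neighbouring gradients, which the viscous
   weights absorb; this is the discrete maximum principle for [w_z]. *)
Lemma diffZ_stepZ (i : Z) :
  diffZ (INR N) (stepZ nu N w) i =
  ((1/2 - tau nu N * (fst (w i) + fst (w (i + 1)%Z)) / 2,
    - (tau nu N * (snd (w i) + snd (w (i + 1)%Z))))%R * diffZ (INR N) w i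
   + RtoC (1/4 - tau nu N * INR N * fst (velZ N w (i + 1)) / 2)%R * diffZ (INR N) w (i + 1)
   + RtoC (1/4 + tau nu N * INR N * fst (velZ N w (i + 1)) / 2
           + tau nu N * (fst (w i) + fst (w (i + 1)%Z)) / 2)%R * diffZ (INR N) w (i - 1))%C.
Proof.
(* The velocity at [i] is expressed through that at [i + 1]. A single velocity then remains, and the
   claim becomes an identity of polynomials in independent values. *)
assert (hb : fst (velZ N w i) = fst (velZ N w (i + 1)%Z) +
             / INR N * (fst (w i) + fst (w (i + 1)%Z))).
{ generalize (velZ_diff N w hN hper hmean i); unfold diffZ, reZ, shiftZ.
  rewrite (velZ_real i), (velZ_real (i + 1)); intros h; apply (f_equal fst) in h; revert h.
  unfold RtoC, Cmult, Cminus, Cplus, Copp; simpl; intros h.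
  apply Rmult_eq_reg_l with (INR N); [|lra].
  match goal with |- _ = INR N * (?a + / INR N * ?b) =>
    replace (INR N * (a + / INR N * b)) with (INR N * a + b) by (field; lra) end.
  simpl in h; lra. }
unfold stepZ; unfold diffZ at 1; unfold averZ, resZ, cdiffZ, diffZ.
rewrite (velZ_real i), (velZ_real (i + 1)), hb.
replace (i + 1 - 1)%Z with i by lia; replace (i - 1 + 1)%Z with i by lia.
revert hq; generalize (fst (velZ N w (i + 1))) (INR N) (tau nu N) (cstZ N w)
  (w i) (w (i + 1)%Z) (w (i + 1 + 1)%Z) (w (i - 1)%Z).
intros b q t [c1 c2] [x0 y0] [x1 y1] [x2 y2] [x3 y3] hq'.
unfold RtoC, Cmult, Cminus, Cplus, Copp; simpl; f_equal; field; lra.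
Qed.

(** The real parts of the three weights in [diffZ_stepZ] are positive and add up to 1. Only the
    rotation raises a modulus, and a rotation by an angle of order [tau] does so at second order:
    the excess per step is of order [tau ^ 2], hence of order [tau] over the [T / tau] steps up to
    time [T]. *)
Lemma gradient_step_le (K : R) (hK : forall i, Cmod (diffZ (INR N) w i) <= K) (i : Z) :
  Cmod (diffZ (INR N) (stepZ nu N w) i) <= K * (1 + 8 * U ^ 2 * tau nu N ^ 2).
Proof.
assert (ht := tau_pos).
assert (hb : Rabs (fst (velZ N w (i + 1))) <= 2 * V) by apply velZ_re_le.
assert (hK0 : 0 <= K) by (eapply Rle_trans; [apply Cmod_ge_0|apply (hK 0%Z)]).
rewrite diffZ_stepZ.
eapply Rle_trans; [apply Cmod_triangle|].
eapply Rle_trans; [apply Rplus_le_compat_r, Cmod_triangle|].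
rewrite !Cmod_mult, !Cmod_R.
generalize (hV i) (hV (i+1)%Z) (hU i) (hU (i+1)%Z) (hK i) (hK (i+1)%Z) (hK (i-1)%Z).
generalize (fst (w i)) (fst (w (i+1)%Z)) (snd (w i)) (snd (w (i+1)%Z)).
intros v0 v1 u0 u1 hv0 hv1 hu0 hu1 hK0' hK1 hK2.
set (x := tau nu N * (v0 + v1) / 2).
set (y := tau nu N * INR N * fst (velZ N w (i + 1)) / 2).
set (z := tau nu N * (u0 + u1)).
assert (hx : Rabs x <= 1/8).
{ unfold x; replace (tau nu N * (v0 + v1) / 2) with (tau nu N * ((v0 + v1) / 2)) by field.
  rewrite Rabs_mult, (Rabs_pos_eq (tau nu N)) by lra.
  eapply Rle_trans; [|exact ht1]; apply Rmult_le_compat_l; [lra|].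
  unfold Rdiv; rewrite Rabs_mult, (Rabs_pos_eq (/ 2)) by lra.
  generalize (Rabs_triang v0 v1); lra. }
assert (hy : Rabs y <= 1/8).
{ unfold y; replace (tau nu N * INR N * fst (velZ N w (i + 1)) / 2) with
    (tau nu N * INR N * (fst (velZ N w (i + 1)) / 2)) by field.
  rewrite Rabs_mult, (Rabs_pos_eq (tau nu N * INR N)) by nra.
  eapply Rle_trans; [|exact ht2]; apply Rmult_le_compat_l; [nra|].
  unfold Rdiv; rewrite Rabs_mult, (Rabs_pos_eq (/ 2)) by lra; lra. }
assert (hz : z ^ 2 <= 4 * U ^ 2 * tau nu N ^ 2).
{ unfold z; rewrite Rpow_mult_distr.
  replace (4 * U ^ 2 * tau nu N ^ 2) with (tau nu N ^ 2 * (2 * U) ^ 2) by ring.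
  apply Rmult_le_compat_l; [nra|].
  rewrite <- (pow2_abs (u0 + u1)); apply pow_incr; split; [apply Rabs_pos|].
  generalize (Rabs_triang u0 u1); lra. }
apply Rabs_le_between in hx; apply Rabs_le_between in hy.
rewrite !Rabs_pos_eq by lra.
assert (hc : Cmod (1/2 - x, - z) <= 1/2 - x + 2 * z ^ 2).
{ unfold Cmod; simpl fst; simpl snd.
  rewrite <- (sqrt_pow2 (1/2 - x + 2 * z ^ 2)) by nra.
  apply sqrt_le_1_alt. assert (0 <= z ^ 2) by nra.
  replace ((- z) ^ 2) with (z ^ 2) by ring.
  generalize dependent (z ^ 2); intros z2 _ hz2. nra. }
assert (h1 : Cmod (1/2 - x, - z) * Cmod (diffZ (INR N) w i) <= (1/2 - x + 2 * z ^ 2) * K)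
  by (apply Rmult_le_compat; auto using Cmod_ge_0).
assert (h2 : (1/4 - y) * Cmod (diffZ (INR N) w (i + 1)) <= (1/4 - y) * K)
  by (apply Rmult_le_compat_l; lra).
assert (h3 : (1/4 + y + x) * Cmod (diffZ (INR N) w (i - 1)) <= (1/4 + y + x) * K)
  by (apply Rmult_le_compat_l; lra).
assert (K * (2 * z ^ 2) <= K * (8 * U ^ 2 * tau nu N ^ 2)) by (apply Rmult_le_compat_l; lra).
lra.
Qed.

(** The velocity and the constant are real, so the transport part only averages [u] with positive
    weights, and the source [- 2 v u] contributes the growth rate [2 * V]. *)
Lemma im_step_le (i : Z) :
  Rabs (snd (stepZ nu N w i)) <= U * (1 + 2 * V * tau nu N).
Proof.
assert (ht := tau_pos).
assert (hb : Rabs (fst (velZ N w i)) <= 2 * V) by apply velZ_re_le.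
assert (hU0 : 0 <= U) by (eapply Rle_trans; [apply Rabs_pos|apply (hU 0%Z)]).
assert (e : snd (stepZ nu N w i) =
  (1/2 - 2 * (tau nu N * fst (w i))) * snd (w i)
  + (1/4 - tau nu N * INR N * fst (velZ N w i) / 2) * snd (w (i + 1)%Z)
  + (1/4 + tau nu N * INR N * fst (velZ N w i) / 2) * snd (w (i - 1)%Z)).
{ unfold stepZ, averZ, resZ, cdiffZ, diffZ, cstZ; rewrite (velZ_real i).
  replace (i - 1 + 1)%Z with i by lia.
  generalize (fst (velZ N w i)) (INR N) (tau nu N) (w i) (w (i + 1)%Z) (w (i - 1)%Z)
    (/ INR N * rsumZ N (fun i => fst (velZ N w i * cdiffZ (INR N) w i + w i * w i)%C)).
  intros b q t [x0 y0] [x1 y1] [x3 y3] c.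
  unfold RtoC, Cmult, Cminus, Cplus, Copp; simpl; field. }
rewrite e.
set (y := tau nu N * INR N * fst (velZ N w i) / 2).
assert (hy : Rabs y <= 1/8).
{ unfold y; replace (tau nu N * INR N * fst (velZ N w i) / 2) with
    (tau nu N * INR N * (fst (velZ N w i) / 2)) by field.
  rewrite Rabs_mult, (Rabs_pos_eq (tau nu N * INR N)) by nra.
  eapply Rle_trans; [|exact ht2]; apply Rmult_le_compat_l; [nra|].
  unfold Rdiv; rewrite Rabs_mult, (Rabs_pos_eq (/ 2)) by lra; lra. }
set (x := tau nu N * fst (w i)).
assert (hx : Rabs x <= tau nu N * V).
{ unfold x; rewrite Rabs_mult, (Rabs_pos_eq (tau nu N)) by lra.
  apply Rmult_le_compat_l; [lra|apply hV]. }
eapply Rle_trans; [apply Rabs_triang|].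
eapply Rle_trans; [apply Rplus_le_compat_r, Rabs_triang|].
rewrite !Rabs_mult.
apply Rabs_le_between in hx; apply Rabs_le_between in hy.
rewrite !(Rabs_pos_eq (1/4 - y)), !(Rabs_pos_eq (1/4 + y)), (Rabs_pos_eq (1/2 - 2 * x)) by lra.
assert ((1/2 - 2 * x) * Rabs (snd (w i)) <= (1/2 + 2 * (tau nu N * V)) * U).
{ apply Rmult_le_compat; [lra|apply Rabs_pos|lra|apply hU]. }
assert ((1/4 - y) * Rabs (snd (w (i + 1)%Z)) <= (1/4 - y) * U)
  by (apply Rmult_le_compat_l; [lra|apply hU]).
assert ((1/4 + y) * Rabs (snd (w (i - 1)%Z)) <= (1/4 + y) * U)
  by (apply Rmult_le_compat_l; [lra|apply hU]).
lra.
Qed.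

Lemma cstZ_le (G : R) (hG : forall i, Cmod (diffZ (INR N) w i) <= G) :
  Cmod (cstZ N w) <= 2 * V * G + (V + U) ^ 2.
Proof.
assert (hV0 : 0 <= V) by (eapply Rle_trans; [apply Rabs_pos|apply (hV 0%Z)]).
unfold cstZ; rewrite Cmod_R, Rabs_mult, Rabs_pos_eq by (left; apply Rinv_0_lt_compat, hq).
apply Rle_trans with (/ INR N * (INR N * (2 * V * G + (V + U) ^ 2))).
- apply Rmult_le_compat_l; [left; apply Rinv_0_lt_compat, hq|].
  apply rsum_abs_le; intros k _.
  eapply Rle_trans; [eapply Rle_trans; [apply Rmax_l|apply Rmax_Cmod]|].
  eapply Rle_trans; [apply Cmod_triangle|]; rewrite !Cmod_mult.
  apply Rplus_le_compat.
  + apply Rmult_le_compat; try apply Cmod_ge_0; [apply velZ_le; auto|].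
    eapply Rle_trans; [apply (Cmod_diffn_cdiffZ (INR N) 0 w)|]; simpl.
    generalize (hG (Z.of_nat k)) (hG (Z.of_nat k - 1)%Z); lra.
  + assert (h : Cmod (w (Z.of_nat k)) <= V + U).
    { eapply Rle_trans; [apply Cmod_le_sum|]; apply Rplus_le_compat; auto. }
    generalize (Cmod_ge_0 (w (Z.of_nat k))); nra.
- right; field; lra.
Qed.

End StepBounds.

(** * A priori bounds along the scheme *)

Fixpoint schemeZ (nu : R) (N : nat) (w : Z -> C) (k : nat) : Z -> C :=
  match k with O => w | S k => stepZ nu N (schemeZ nu N w k) end.

Lemma eventually_INR_ge (x : R) : eventually (fun N => x <= INR N).
Proof.
destruct (nfloor_ex (Rmax 0 x) (Rmax_l _ _)) as [n [_ hn]].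
exists (S n); intros N hN; apply Rle_trans with (INR n + 1).
- generalize (Rmax_r 0 x); lra.
- rewrite <- S_INR; apply le_INR; lia.
Qed.

(** [tau * N] equals [1 / (4 nu N)]: a parabolic time step meets any restriction imposed by
    transport once the mesh is fine. *)
Lemma tau_INR_small (nu eps : R) (hnu : 0 < nu) (heps : 0 < eps) :
  eventually (fun N => (0 < N)%nat /\ tau nu N * INR N <= eps /\ tau nu N <= eps).
Proof.
destruct (eventually_INR_ge (Rmax 1 (/ (4 * nu * eps)))) as [N0 h].
exists N0; intros N hN; specialize (h N hN).
assert (h1 : 1 <= INR N) by (eapply Rle_trans; [apply Rmax_l|exact h]).
assert (h2 : / (4 * nu * eps) <= INR N) by (eapply Rle_trans; [apply Rmax_r|exact h]).
assert (hp : 0 < 4 * nu * eps) by nra.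
assert (ht : tau nu N * INR N <= eps).
{ unfold tau; replace (/ (4 * nu * INR N ^ 2) * INR N) with (/ (4 * nu * INR N)) by (field; lra).
  rewrite <- (Rinv_inv eps); apply Rinv_le_contravar; [apply Rinv_0_lt_compat; lra|].
  apply Rmult_le_compat_l with (r := 4 * nu) in h2; [|lra].
  replace (4 * nu * / (4 * nu * eps)) with (/ eps) in h2 by (field; lra); lra. }
split; [apply INR_lt; simpl; lra|split; [exact ht|]].
assert (0 < tau nu N).
{ unfold tau; apply Rinv_0_lt_compat, Rmult_lt_0_compat; [lra|apply pow_lt; lra]. }
nra.
Qed.

Lemma exp_le_mono (x y : R) : x <= y -> exp x <= exp y.
Proof.
intros h; destruct (Rle_lt_or_eq_dec _ _ h) as [l|e];
  [left; apply exp_increasing, l|rewrite e; lra].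
Qed.

(** The step estimates presuppose the bounds that they propagate, so all of them are carried in one
    induction. While the gradient is below [2 * K], its excess per step is at most
    [16 * K * U ^ 2 * tau ^ 2]; up to time [T] this adds up to at most [K], which closes the
    argument. The bound [2 * K] on [v] then gives [u] the growth rate [4 * K]. *)
Lemma scheme_invariants (nu K U0 T : R) (hnu : 0 < nu) (hK : 0 <= K) (hU0 : 0 <= U0)
  (hT : 0 <= T) :
  eventually (fun N => forall w, periodicZ N w -> rsumZ N (fun i => fst (w i)) = 0 ->
    (forall i, Cmod (diffZ (INR N) w i) <= K) -> (forall i, Rabs (snd (w i)) <= U0) ->
    forall k, INR k * tau nu N <= T ->
    periodicZ N (schemeZ nu N w k) /\
    rsumZ N (fun i => fst (schemeZ nu N w k i)) = 0 /\
    (forall i, Cmod (diffZ (INR N) (schemeZ nu N w k) i) <= 2 * K) /\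
    (forall i, Rabs (fst (schemeZ nu N w k i)) <= 2 * K) /\
    (forall i, Rabs (snd (schemeZ nu N w k i)) <= U0 * exp (4 * K * T))).
Proof.
set (U := U0 * exp (4 * K * T)).
assert (hU : 0 <= U) by (unfold U; generalize (exp_pos (4 * K * T)); nra).
(* Chosen to serve the three smallness conditions [c1], [c2] and [c3] at once: the two step
   restrictions with [V = 2 * K], and the total gradient excess. *)
set (eps := / (16 * K + 16 * U ^ 2 * T + 1)).
assert (hden : 0 < 16 * K + 16 * U ^ 2 * T + 1).
{ assert (0 <= U ^ 2 * T) by (apply Rmult_le_pos; [apply pow2_ge_0|lra]). lra. }
assert (heps : 0 < eps) by (apply Rinv_0_lt_compat; exact hden).
assert (e1 : eps * (16 * K + 16 * U ^ 2 * T + 1) = 1) by (unfold eps; field; lra).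
assert (hUT : 0 <= eps * (U ^ 2 * T)).
{ apply Rmult_le_pos; [lra|]; apply Rmult_le_pos; [apply pow2_ge_0|lra]. }
assert (hek : 0 <= eps * K) by nra.
generalize (tau_INR_small nu eps hnu heps); apply filter_imp.
intros N [hN [ht1 ht2]] w hper hmean hD hI.
assert (ht := tau_pos nu N hN hnu).
assert (c1 : tau nu N * (2 * K) <= 1/8).
{ apply Rle_trans with (eps * (2 * K)); [apply Rmult_le_compat_r; lra|lra]. }
assert (c2 : tau nu N * INR N * (2 * K) <= 1/8).
{ apply Rle_trans with (eps * (2 * K)); [apply Rmult_le_compat_r; lra|lra]. }
assert (c3 : tau nu N * (16 * U ^ 2 * T) <= 1).
{ apply Rle_trans with (eps * (16 * U ^ 2 * T)); [apply Rmult_le_compat_r; [|lra]|lra].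
  assert (0 <= U ^ 2 * T) by (apply Rmult_le_pos; [apply pow2_ge_0|lra]); lra. }
assert (main : forall k, INR k * tau nu N <= T ->
    periodicZ N (schemeZ nu N w k) /\
    rsumZ N (fun i => fst (schemeZ nu N w k i)) = 0 /\
    (forall i, Cmod (diffZ (INR N) (schemeZ nu N w k) i)
       <= K + K * (16 * U ^ 2 * tau nu N ^ 2) * INR k) /\
    (forall i, Rabs (snd (schemeZ nu N w k i)) <= U0 * exp (4 * K * (INR k * tau nu N)))).
{ assert (hle : forall k, INR k * tau nu N <= T ->
    K + K * (16 * U ^ 2 * tau nu N ^ 2) * INR k <= 2 * K).
  { intros k hk.
    assert (K * (tau nu N * 16 * U ^ 2 * (INR k * tau nu N)) <= K * (tau nu N * 16 * U ^ 2 * T)).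
    { apply Rmult_le_compat_l; [exact hK|].
      apply Rmult_le_compat_l; [generalize (pow2_ge_0 U); nra|exact hk]. }
    assert (K * (tau nu N * (16 * U ^ 2 * T)) <= K * 1) by (apply Rmult_le_compat_l; lra).
    lra. }
  induction k as [|k IH]; intros hk.
  - simpl schemeZ; split; [exact hper|split; [exact hmean|split]].
    + intros i; simpl INR; rewrite Rmult_0_r, Rplus_0_r; apply hD.
    + intros i; simpl INR; rewrite Rmult_0_l, Rmult_0_r, exp_0, Rmult_1_r; apply hI.
  - assert (hk' : INR k * tau nu N <= T).
    { eapply Rle_trans; [|exact hk]; apply Rmult_le_compat_r; [lra|apply le_INR; lia]. }
    destruct (IH hk') as [p1 [p2 [p3 p4]]]; clear IH.
    set (wk := schemeZ nu N w k) in *.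
    assert (q3 : forall i, Cmod (diffZ (INR N) wk i) <= 2 * K).
    { intros i; eapply Rle_trans; [apply p3|apply hle, hk']. }
    assert (q2 : forall i, Rabs (fst (wk i)) <= 2 * K) by (apply (re_le_diff N); auto).
    assert (q4 : forall i, Rabs (snd (wk i)) <= U).
    { intros i; eapply Rle_trans; [apply p4|]; apply Rmult_le_compat_l; [exact hU0|].
      apply exp_le_mono, Rmult_le_compat_l; [lra|exact hk']. }
    simpl schemeZ; fold wk.
    split; [apply stepZ_periodic; auto|split; [apply stepZ_mean; auto|split]].
    + intros i; eapply Rle_trans; [apply (gradient_step_le nu N wk (2 * K) U) with (K := K + K * (16 * U ^ 2 * tau nu N ^ 2) * INR k); auto|].
      rewrite S_INR.
      assert (hb := hle k hk').
      assert (0 <= 8 * U ^ 2 * tau nu N ^ 2)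
        by (generalize (pow2_ge_0 U) (pow2_ge_0 (tau nu N)); nra).
      assert ((K + K * (16 * U ^ 2 * tau nu N ^ 2) * INR k) * (8 * U ^ 2 * tau nu N ^ 2)
         <= 2 * K * (8 * U ^ 2 * tau nu N ^ 2)) by (apply Rmult_le_compat_r; lra).
      lra.
    + intros i; eapply Rle_trans.
      * apply (im_step_le nu N wk (2 * K) (U0 * exp (4 * K * (INR k * tau nu N)))); auto.
      * rewrite S_INR.
        replace (4 * K * ((INR k + 1) * tau nu N)) with
          (4 * K * (INR k * tau nu N) + 2 * (2 * K) * tau nu N) by ring.
        rewrite exp_plus, <- (Rmult_assoc U0).
        apply Rmult_le_compat_l.
        -- generalize (exp_pos (4 * K * (INR k * tau nu N))); nra.
        -- apply exp_ineq1_le. }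
intros k hk; destruct (main k hk) as [p1 [p2 [p3 p4]]].
assert (q3 : forall i, Cmod (diffZ (INR N) (schemeZ nu N w k) i) <= 2 * K).
{ intros i; eapply Rle_trans; [apply p3|].
  assert (K * (tau nu N * 16 * U ^ 2 * (INR k * tau nu N)) <= K * (tau nu N * 16 * U ^ 2 * T)).
  { apply Rmult_le_compat_l; [exact hK|].
    apply Rmult_le_compat_l; [generalize (pow2_ge_0 U); nra|exact hk]. }
  assert (K * (tau nu N * (16 * U ^ 2 * T)) <= K * 1) by (apply Rmult_le_compat_l; lra).
  lra. }
split; [exact p1|split; [exact p2|split; [exact q3|split]]].
- intros i; apply (re_le_diff N); auto.
- intros i; eapply Rle_trans; [apply p4|]; apply Rmult_le_compat_l; [exact hU0|].
  apply exp_le_mono, Rmult_le_compat_l; [lra|exact hk].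
Qed.

(** All that the limit passage retains of the scheme. The gradient bound [K] is independent of time;
    the bound on [u] and the fineness of the mesh beyond which the bounds hold may depend on [T]. *)
Definition scheme_family (nu : R) (W : nat -> nat -> Z -> C) (K : R) (U : R -> R) : Prop :=
  (forall N k, W N (S k) = stepZ nu N (W N k)) /\
  (forall T, 0 <= T -> eventually (fun N => forall k, INR k * tau nu N <= T ->
    periodicZ N (W N k) /\ rsumZ N (fun i => fst (W N k i)) = 0 /\
    (forall i, Cmod (diffZ (INR N) (W N k) i) <= K) /\
    (forall i, Rabs (fst (W N k i)) <= K) /\
    (forall i, Rabs (snd (W N k i)) <= U T))).

Lemma eventually_and (P Q : nat -> Prop) :
  eventually P -> eventually Q -> eventually (fun n => P n /\ Q n).
Proof. intros; now apply filter_and. Qed.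

(** * Interior bounds of all orders *)

Section Smoothing.
Variables (nu : R) (W : nat -> nat -> Z -> C) (K : R) (U : R -> R).
Hypothesis hnu : 0 < nu.
Hypothesis hW : scheme_family nu W K U.

Lemma scheme_family_K_pos : 0 <= K.
Proof.
destruct hW as [_ h]; destruct (h 0 (Rle_refl _)) as [N hN].
destruct (hN N (le_n _) O) as [_ [_ [h1 _]]]; [simpl; lra|].
eapply Rle_trans; [apply Cmod_ge_0|apply (h1 0%Z)].
Qed.

Lemma scheme_family_Cmod_le (T : R) : 0 <= T ->
  eventually (fun N => forall k i, INR k * tau nu N <= T -> Cmod (W N k i) <= K + U T).
Proof.
intros hT; destruct hW as [_ h]; generalize (h T hT); apply filter_imp.
intros N hN k i hk; destruct (hN k hk) as [_ [_ [_ [h1 h2]]]].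
eapply Rle_trans; [apply Cmod_le_sum|]; apply Rplus_le_compat; auto.
Qed.

Definition bounded_from (s T : R) (j : nat) : Prop :=
  exists M, 0 <= M /\ eventually (fun N => forall k i l, (l <= j)%nat ->
    s <= INR k * tau nu N <= T -> Cmod (diffn (INR N) l (W N k) i) <= M).

Lemma bounded_from_1 (s T : R) (hT : 0 <= T) : bounded_from s T 1.
Proof.
exists (K + Rabs (U T)); split.
{ generalize scheme_family_K_pos (Rabs_pos (U T)); lra. }
generalize (scheme_family_Cmod_le T hT) (proj2 hW T hT); intros h1 h2.
generalize (eventually_and _ _ h1 h2); apply filter_imp.
intros N [g1 g2] k i l hl [_ hk].
destruct l as [|[|l]]; [| |lia].
- simpl; generalize (g1 k i hk) (Rle_abs (U T)); lra.
- simpl; destruct (g2 k hk) as [_ [_ [h _]]]; generalize (h i) (Rabs_pos (U T)); lra.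
Qed.

(** The Bernstein estimate for the [j]-th differences, restarted at time [s / 2], where these are
    already bounded. It yields order [j + 1] from time [s] on. *)
Lemma bounded_from_S (j : nat) (hj : (0 < j)%nat) (T : R) (hT : 0 <= T) :
  (forall s, 0 < s -> bounded_from s T j) -> forall s, 0 < s -> bounded_from s T (S j).
Proof.
intros IH s hs.
destruct (IH (s / 2) ltac:(lra)) as [M1 [hM1 hev]].
set (M := M1 + K).
assert (hK := scheme_family_K_pos).
set (A := 1 + 2 * M + 6 * 2 ^ j * M * (M + 1)).
assert (hM : 0 <= M) by (unfold M; lra).
assert (hA : 1 <= A).
{ unfold A; assert (0 < 2 ^ j) by (apply pow_lt; lra).
  assert (0 <= 2 ^ j * M) by nra. assert (0 <= 2 ^ j * M * (M + 1)) by nra. lra. }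
destruct (lattice_smoothing nu M A T hnu hM hA hT) as [Cb [hCb hsm]].
(* The estimate bounds the square of the top difference by [Cb / (s / 4)]; [x <= 1 + x ^ 2] removes
   the square. *)
exists (M + (1 + Cb / (s / 4))).
assert (hCs : 0 <= Cb / (s / 4)) by (apply Rdiv_le_0_compat; lra).
split; [lra|].
(* The first entry gives the step restriction of [lattice_smoothing]; the second keeps the rounding
   of the starting time below [s / 4]. *)
assert (heps : 0 < Rmin (nu / (24 * A ^ 2)) (s / 4)).
{ apply Rmin_glb_lt; [apply Rdiv_lt_0_compat; nra|lra]. }
generalize (eventually_and _ _ (tau_INR_small nu _ hnu heps)
  (eventually_and _ _ hev (proj2 hW T hT))).
apply filter_imp; intros N [[hN [_ ht]] [g1 g2]] k i l hl [hk1 hk2].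
assert (htp := tau_pos nu N hN hnu).
assert (hq : 0 < INR N) by (apply lt_0_INR, hN).
assert (ht1 : tau nu N * A ^ 2 <= nu / 24).
{ apply Rle_trans with (nu / (24 * A ^ 2) * A ^ 2); [|right; field; lra].
  apply Rmult_le_compat_r; [nra|]. eapply Rle_trans; [exact ht|apply Rmin_l]. }
assert (ht2 : tau nu N <= s / 4) by (eapply Rle_trans; [exact ht|apply Rmin_r]).
destruct (le_lt_dec l j) as [hlj|hlj].
{ specialize (g1 k i l hlj ltac:(lra)); unfold M; lra. }
replace l with (S j) by lia; clear l hl hlj.
assert (hst : 0 <= s / 2 / tau nu N) by (apply Rdiv_le_0_compat; lra).
destruct (nfloor_ex (s / 2 / tau nu N) hst) as [n [hn1 hn2]].
(* A lattice time at most one step after [s / 2]. At times beyond [s] at least [s / 4] has elapsed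
   since then, so the weight in the Bernstein estimate stays away from zero. *)
set (k0 := S n).
assert (hk0 : s / 2 <= INR k0 * tau nu N <= s / 2 + tau nu N).
{ unfold k0; rewrite S_INR.
  assert (e : s / 2 / tau nu N * tau nu N = s / 2) by (field; lra).
  split; [rewrite <- e; apply Rmult_le_compat_r; lra|].
  assert (INR n * tau nu N <= s / 2 / tau nu N * tau nu N) by (apply Rmult_le_compat_r; lra).
  lra. }
assert (hkk : (k0 <= k)%nat).
{ apply INR_le, Rmult_le_reg_r with (tau nu N); lra. }
assert (hrange : forall k', (k' <= k - k0)%nat -> s / 2 <= INR (k0 + k') * tau nu N <= T).
{ intros k' hk'; rewrite plus_INR, Rmult_plus_distr_r.
  assert (0 <= INR k' * tau nu N) by (apply Rmult_le_pos; [apply pos_INR|lra]).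
  split; [lra|].
  eapply Rle_trans; [|exact hk2].
  rewrite <- Rmult_plus_distr_r, <- plus_INR.
  apply Rmult_le_compat_r; [lra|apply le_INR; lia]. }
assert (hbd : forall k' l m, (k' <= k - k0)%nat -> (l <= j)%nat ->
   Cmod (diffn (INR N) l (W N (k0 + k')) m) <= M).
{ intros k' l m hk' hl; unfold M. specialize (g1 (k0 + k')%nat m l hl (hrange k' hk')); lra. }
assert (hb0 : forall k' m, (k' <= k - k0)%nat -> Cmod (velZ N (W N (k0 + k')) m) <= 2 * M).
{ intros k' m hk'; destruct (g2 (k0 + k')%nat (proj2 (hrange k' hk'))) as [_ [_ [_ [h4 _]]]].
  apply Rle_trans with (2 * K); [apply velZ_le; auto|unfold M; lra]. }
assert (hbv : forall k' m, (k' <= k - k0)%nat -> diffZ (INR N) (velZ N (W N (k0 + k'))) m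
   = (- (reZ (W N (k0 + k')) m + shiftZ (reZ (W N (k0 + k'))) m))%C).
{ intros k' m hk'; destruct (g2 (k0 + k')%nat (proj2 (hrange k' hk'))) as [h1 [h2 _]].
  apply velZ_diff; auto. }
generalize (hsm (INR N) (fun k' => diffn (INR N) j (W N (k0 + k')))
  (fun k' => diffn (INR N) j (resZ (INR N) (velZ N (W N (k0 + k'))) (cstZ N (W N (k0 + k')))
     (W N (k0 + k')))) (k - k0)%nat hq ht1).
intros key.
assert (hres : INR (k - k0) * tau nu N * Cmod (diffn (INR N) (S j) (W N k) i) ^ 2 <= Cb).
{ replace (W N k) with (W N (k0 + (k - k0))%nat) by (f_equal; lia).
  apply (key); [| | | | |lia].
  - rewrite minus_INR, Rmult_minus_distr_r by lia; fold (tau nu N); lra.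
  - intros k' m hk'; rewrite Nat.add_succ_r, (proj1 hW).
    fold (tau nu N). rewrite <- diffn_averZ.
    change (stepZ nu N (W N (k0 + k'))) with
      (fun i => averZ (W N (k0 + k')) i + RtoC (tau nu N) *
         resZ (INR N) (velZ N (W N (k0 + k'))) (cstZ N (W N (k0 + k'))) (W N (k0 + k')) i)%C.
    replace (fun i => averZ (W N (k0 + k')) i + RtoC (tau nu N) *
         resZ (INR N) (velZ N (W N (k0 + k'))) (cstZ N (W N (k0 + k'))) (W N (k0 + k')) i)%C
    with (fun i => RtoC 1 * averZ (W N (k0 + k')) i + RtoC (tau nu N) *
         resZ (INR N) (velZ N (W N (k0 + k'))) (cstZ N (W N (k0 + k'))) (W N (k0 + k')) i)%C.
    + rewrite diffn_lin, Cmult_1_l; reflexivity.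
    + apply functional_extensionality; intros; now rewrite Cmult_1_l.
  - intros k' m hk'; apply hbd; lia.
  - intros k' m hk'. apply diffn_residual_le; auto; intros.
    + apply hbv; lia.
    + apply hb0; lia.
    + apply hbd; lia.
  - intros k' X hk' hX m. apply diffn_S_residual_le; auto; intros.
    + apply hbv; lia.
    + apply hb0; lia.
    + apply hbd; lia. }
assert (hlow : s / 4 <= INR (k - k0) * tau nu N).
{ rewrite minus_INR, Rmult_minus_distr_r by lia; lra. }
set (x := Cmod (diffn (INR N) (S j) (W N k) i)) in *.
assert (hx : x ^ 2 <= Cb / (s / 4)).
{ apply Rmult_le_reg_l with (s / 4); [lra|].
  replace (s / 4 * (Cb / (s / 4))) with Cb by (field; lra).
  eapply Rle_trans; [|exact hres]; apply Rmult_le_compat_r; [apply pow2_ge_0|exact hlow]. }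
assert (x <= 1 + x ^ 2) by nra.
lra.
Qed.

Theorem bounded_from_all (j : nat) (s T : R) : 0 < s -> 0 <= T -> bounded_from s T j.
Proof.
intros hs hT.
assert (h : forall s, 0 < s -> bounded_from s T (S j)).
{ induction j as [|n IH]; intros s' hs'; [apply bounded_from_1, hT|].
  apply bounded_from_S; auto; lia. }
destruct (h s hs) as [M [hM hev]]; exists M; split; [exact hM|].
revert hev; apply filter_imp; intros N g k i l hl; apply g; lia.
Qed.

End Smoothing.

(** * Regularity in time, and the modulus of continuity at the initial time *)

Definition rateZ (nu : R) (N : nat) (w : Z -> C) (i : Z) : C :=
  (RtoC nu * diffn (INR N) 2 w (i - 1) + resZ (INR N) (velZ N w) (cstZ N w) w i)%C.

(** [diffn _ 2] is a forward difference, so the second difference centred at [i] is its value at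
    [i - 1]. *)
Lemma stepZ_rateZ (nu : R) (N : nat) (w : Z -> C) (i : Z) : 0 < nu -> (0 < N)%nat ->
  stepZ nu N w i = (w i + RtoC (tau nu N) * rateZ nu N w i)%C.
Proof.
intros hnu hN; assert (hq : 0 < INR N) by (apply lt_0_INR, hN).
unfold stepZ, rateZ, averZ, tau; simpl; unfold diffZ.
replace (i - 1 + 1 + 1)%Z with (i + 1)%Z by lia; replace (i - 1 + 1)%Z with i by lia.
generalize (resZ (INR N) (velZ N w) (cstZ N w) w i) (w i) (w (i + 1)%Z) (w (i - 1)%Z).
intros [a a'] [b b'] [c c'] [d d'].
unfold RtoC, Cmult, Cminus, Cplus, Copp; simpl; f_equal; field; lra.
Qed.

Lemma Cmod_mult_sub (x y x' y' : C) (A B a b : R) :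
  Cmod x' <= A -> Cmod y <= B -> Cmod (x' - x)%C <= a -> Cmod (y' - y)%C <= b ->
  Cmod (x' * y' - x * y)%C <= A * b + a * B.
Proof.
intros hA hB ha hb.
replace (x' * y' - x * y)%C with (x' * (y' - y) + (x' - x) * y)%C by ring.
eapply Rle_trans; [apply Cmod_triangle|]; rewrite !Cmod_mult.
apply Rplus_le_compat; apply Rmult_le_compat; auto using Cmod_ge_0.
Qed.

Lemma velZ_sub_le (N : nat) (w w' : Z -> C) (e : R) (hN : (0 < N)%nat)
  (he : forall i, Cmod (w' i - w i)%C <= e) (i : Z) :
  Cmod (velZ N w' i - velZ N w i)%C <= 2 * e.
Proof.
replace (velZ N w' i - velZ N w i)%C with (velZ N (fun i => w' i - w i)%C i).
- apply velZ_le; [exact hN|]; intros k.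
  eapply Rle_trans; [eapply Rle_trans; [apply Rmax_l|apply Rmax_Cmod]|apply he].
- unfold velZ.
  rewrite (rsum_ext _ (fun n => 1 * (fst (w' (Z.of_nat n)) + fst (w' (Z.of_nat n + 1)%Z)) +
     (-1) * (fst (w (Z.of_nat n)) + fst (w (Z.of_nat n + 1)%Z)))).
  + rewrite rsum_lin; unfold RtoC, Cminus, Cplus, Copp; simpl; f_equal; ring.
  + intros k _; simpl; ring.
Qed.

Lemma cstZ_sub_le (N : nat) (w w' : Z -> C) (e : R) (hN : (0 < N)%nat)
  (he : forall i, Cmod (velZ N w' i * cdiffZ (INR N) w' i + w' i * w' i
            - (velZ N w i * cdiffZ (INR N) w i + w i * w i))%C <= e) :
  Cmod (cstZ N w' - cstZ N w)%C <= e.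
Proof.
assert (hq : 0 < INR N) by (apply lt_0_INR, hN).
unfold cstZ; rewrite <- RtoC_minus, Cmod_R, <- Rmult_minus_distr_l, Rabs_mult.
rewrite Rabs_pos_eq by (left; apply Rinv_0_lt_compat, hq).
apply Rle_trans with (/ INR N * (INR N * e)); [|right; field; lra].
apply Rmult_le_compat_l; [left; apply Rinv_0_lt_compat, hq|].
match goal with |- Rabs (rsumZ N ?f - rsumZ N ?g) <= _ =>
  replace (rsumZ N f - rsumZ N g) with (rsumZ N (fun i => 1 * f i + (-1) * g i))
    by (rewrite (rsumZ_lin N 1 (-1) f g); ring) end.
apply rsum_abs_le; intros k _.
eapply Rle_trans; [|apply (he (Z.of_nat k))].
eapply Rle_trans; [|apply Rmax_Cmod]; eapply Rle_trans; [|apply Rmax_l].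
right; f_equal; simpl; ring.
Qed.

(* Averaging over [r] neighbouring points turns the second difference into a
   boundary term, so only the Lipschitz constant of [f] enters. *)
Lemma window_estimate (f g : nat -> Z -> R) (L e : R) (K : nat)
  (hstep : forall k i, (k < K)%nat -> f (S k) i =
     f k i + 1/4 * (f k (i + 1)%Z - 2 * f k i + f k (i - 1)%Z) + g k i)
  (hL : forall k i, (k <= K)%nat -> Rabs (f k (i + 1)%Z - f k i) <= L)
  (hg : forall k i, (k < K)%nat -> Rabs (g k i) <= e)
  (r : nat) (hr : (0 < r)%nat) (i : Z) :
  Rabs (f K i - f O i) <= 2 * INR r * L + INR K * (L / (2 * INR r) + e).
Proof.
assert (hr0 : 0 < INR r) by (apply lt_0_INR, hr).
set (S_ := fun k => rsum (fun l => f k (i + Z.of_nat l)%Z) r).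
assert (hL0 : 0 <= L) by (eapply Rle_trans; [apply Rabs_pos|apply (hL O 0%Z); lia]).
assert (h1 : forall k, (k <= K)%nat -> Rabs (S_ k - INR r * f k i) <= INR r * (INR r * L)).
{ intros k hk.
  assert (hl : forall l, Rabs (f k (i + Z.of_nat l)%Z - f k i) <= INR l * L).
  { induction l as [|l IH].
    - replace (i + Z.of_nat 0)%Z with i by lia.
      unfold Rminus; rewrite Rplus_opp_r, Rabs_R0; simpl; lra.
    - rewrite S_INR.
      replace (f k (i + Z.of_nat (S l))%Z - f k i) with
        ((f k (i + Z.of_nat l + 1)%Z - f k (i + Z.of_nat l)%Z) + (f k (i + Z.of_nat l)%Z - f k i)).
      + eapply Rle_trans; [apply Rabs_triang|]; generalize (hL k (i + Z.of_nat l)%Z hk); lra.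
      + replace (i + Z.of_nat (S l))%Z with (i + Z.of_nat l + 1)%Z by lia; ring. }
  replace (S_ k - INR r * f k i) with
    (rsum (fun l => 1 * f k (i + Z.of_nat l)%Z + (-1) * f k i) r).
  - apply rsum_abs_le; intros l hlr.
    replace (1 * f k (i + Z.of_nat l)%Z + -1 * f k i) with (f k (i + Z.of_nat l)%Z - f k i) by ring.
    eapply Rle_trans; [apply hl|]; apply Rmult_le_compat_r; [exact hL0|apply le_INR; lia].
  - rewrite (rsum_lin 1 (-1) (fun l => f k (i + Z.of_nat l)%Z) (fun _ => f k i)), rsum_const.
    unfold S_; ring. }
assert (h2 : forall k, (k < K)%nat -> Rabs (S_ (S k) - S_ k) <= L / 2 + INR r * e).
{ intros k hk.
  assert (es : S_ (S k) - S_ k =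
    1/4 * ((f k (i + Z.of_nat r)%Z - f k (i + Z.of_nat r - 1)%Z) - (f k i - f k (i - 1)%Z))
    + rsum (fun l => g k (i + Z.of_nat l)%Z) r).
  { unfold S_; clear -hstep hk; induction r as [|n IH].
    - replace (i + Z.of_nat 0)%Z with i by lia; simpl; ring.
    - simpl rsum; rewrite (hstep k _ hk).
      replace (i + Z.of_nat (S n))%Z with (i + Z.of_nat n + 1)%Z by lia.
      replace (i + Z.of_nat n + 1 - 1)%Z with (i + Z.of_nat n)%Z by lia.
      lra. }
  rewrite es; eapply Rle_trans; [apply Rabs_triang|].
  assert (a1 : Rabs (rsum (fun l => g k (i + Z.of_nat l)%Z) r) <= INR r * e)
    by (apply rsum_abs_le; auto).
  generalize (hL k (i + Z.of_nat r - 1)%Z (Nat.lt_le_incl _ _ hk))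
    (hL k (i - 1)%Z (Nat.lt_le_incl _ _ hk)).
  replace (i + Z.of_nat r - 1 + 1)%Z with (i + Z.of_nat r)%Z by lia.
  replace (i - 1 + 1)%Z with i by lia; intros a2 a3.
  assert (a4 : Rabs (1/4 * ((f k (i + Z.of_nat r)%Z - f k (i + Z.of_nat r - 1)%Z)
      - (f k i - f k (i - 1)%Z))) <= L / 2).
  { rewrite Rabs_mult, (Rabs_pos_eq (1/4)) by lra.
    unfold Rminus at 1; match goal with |- _ * Rabs (?a + - ?b) <= _ =>
      generalize (Rabs_triang a (- b)); rewrite (Rabs_Ropp b) end; lra. }
  lra. }
assert (h3 : Rabs (S_ K - S_ O) <= INR K * (L / 2 + INR r * e)).
{ replace (S_ K - S_ O) with (rsum (fun k => S_ (S k) - S_ k) K) by apply rsum_telescope.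
  apply rsum_abs_le, h2. }
apply Rmult_le_reg_l with (INR r); [exact hr0|].
rewrite <- (Rabs_pos_eq (INR r)) at 1 by lra; rewrite <- Rabs_mult.
replace (INR r * (f K i - f O i)) with
  ((S_ K - S_ O) + ((S_ O - INR r * f O i) + - (S_ K - INR r * f K i))) by ring.
eapply Rle_trans; [apply Rabs_triang|].
generalize (Rabs_triang (S_ O - INR r * f O i) (- (S_ K - INR r * f K i))).
rewrite (Rabs_Ropp (S_ K - INR r * f K i)).
generalize (h1 O (Nat.le_0_l _)) (h1 K (le_n _)).
replace (INR r * (2 * INR r * L + INR K * (L / (2 * INR r) + e))) with
  (2 * (INR r * (INR r * L)) + INR K * (L / 2 + INR r * e)) by (field; lra).
lra.
Qed.

Section Rates.
Variables (nu : R) (W : nat -> nat -> Z -> C) (K : R) (U : R -> R).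
Hypothesis hnu : 0 < nu.
Hypothesis hW : scheme_family nu W K U.

Definition bddF (s T : R) (F : nat -> nat -> Z -> C) : Prop :=
  exists M, 0 <= M /\ eventually (fun N => (0 < N)%nat /\ forall k i,
    s <= INR k * tau nu N <= T -> Cmod (F N k i) <= M).

Lemma bddF_W (j : nat) (s T : R) : 0 < s -> 0 <= T ->
  bddF s T (fun N k => diffn (INR N) j (W N k)).
Proof.
intros hs hT; destruct (bounded_from_all nu W K U hnu hW j s T hs hT) as [M [hM hev]].
exists M; split; [exact hM|].
generalize (eventually_and _ _ (tau_INR_small nu 1 hnu Rlt_0_1) hev); apply filter_imp.
intros N [[hN _] h]; split; [exact hN|]; intros k i hk; apply h; auto.
Qed.

Lemma bddF_W1 (j : nat) (T : R) : (j <= 1)%nat -> 0 <= T ->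
  bddF 0 T (fun N k => diffn (INR N) j (W N k)).
Proof.
intros hj hT; destruct (bounded_from_1 nu W K U hW 0 T hT) as [M [hM hev]].
exists M; split; [exact hM|].
generalize (eventually_and _ _ (tau_INR_small nu 1 hnu Rlt_0_1) hev); apply filter_imp.
intros N [[hN _] h]; split; [exact hN|]; intros k i hk; apply h; auto.
Qed.

Lemma bddF_vel (T : R) : 0 <= T -> bddF 0 T (fun N k => velZ N (W N k)).
Proof.
intros hT; exists (2 * K); split.
{ generalize (scheme_family_K_pos nu W K U hW); lra. }
generalize (eventually_and _ _ (tau_INR_small nu 1 hnu Rlt_0_1) (proj2 hW T hT)); apply filter_imp.
intros N [[hN _] h]; split; [exact hN|]; intros k i [_ hk].
destruct (h k hk) as [_ [_ [_ [h4 _]]]]; apply velZ_le; auto.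
Qed.

Lemma vel_diff (T : R) : 0 <= T -> eventually (fun N => forall k i, INR k * tau nu N <= T ->
  diffZ (INR N) (velZ N (W N k)) i = (- (reZ (W N k) i + shiftZ (reZ (W N k)) i))%C).
Proof.
intros hT.
generalize (eventually_and _ _ (tau_INR_small nu 1 hnu Rlt_0_1) (proj2 hW T hT)); apply filter_imp.
intros N [[hN _] h] k i hk; destruct (h k hk) as [h1 [h2 _]]; apply velZ_diff; auto.
Qed.

Lemma bddF_cst (T : R) : 0 <= T -> bddF 0 T (fun N k _ => cstZ N (W N k)).
Proof.
intros hT; exists (2 * K * K + (K + U T) ^ 2); split.
{ generalize (scheme_family_K_pos nu W K U hW) (pow2_ge_0 (K + U T)); nra. }
generalize (eventually_and _ _ (tau_INR_small nu 1 hnu Rlt_0_1) (proj2 hW T hT)); apply filter_imp.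
intros N [[hN _] h]; split; [exact hN|]; intros k i [_ hk].
destruct (h k hk) as [_ [_ [h3 [h4 h5]]]]; apply cstZ_le; auto.
Qed.

Lemma bddF_res (T : R) : 0 <= T ->
  bddF 0 T (fun N k => resZ (INR N) (velZ N (W N k)) (cstZ N (W N k)) (W N k)).
Proof.
intros hT.
destruct (bddF_cst T hT) as [A [hA h1]], (bddF_vel T hT) as [B [hB h2]].
destruct (bddF_W1 0 T (Nat.le_0_l _) hT) as [D [hD h3]].
destruct (bddF_W1 1 T (le_n _) hT) as [E [hE h4]].
exists (A + B * E + D * D); split; [nra|].
generalize (eventually_and _ _ (eventually_and _ _ h1 h2) (eventually_and _ _ h3 h4)).
apply filter_imp; intros N [[[hN g1] [_ g2]] [[_ g3] [_ g4]]]; split; [exact hN|].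
intros k i hk; specialize (g1 k i hk); specialize (g2 k i hk); specialize (g3 k i hk).
unfold resZ, Cminus.
eapply Rle_trans; [apply Cmod_triangle|]; eapply Rle_trans;
  [apply Rplus_le_compat_r, Cmod_triangle|].
rewrite !Cmod_opp, !Cmod_mult; simpl in g3.
assert (Cmod (cdiffZ (INR N) (W N k) i) <= E).
{ eapply Rle_trans; [apply (Cmod_diffn_cdiffZ (INR N) 0 (W N k))|].
  generalize (g4 k i hk) (g4 k (i - 1)%Z hk); simpl; lra. }
repeat apply Rplus_le_compat; auto; apply Rmult_le_compat; auto using Cmod_ge_0.
Qed.

Lemma bddF_diff_res (j : nat) (s T : R) : 0 < s -> 0 <= T ->
  bddF s T (fun N k => diffn (INR N) j
     (resZ (INR N) (velZ N (W N k)) (cstZ N (W N k)) (W N k))).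
Proof.
intros hs hT.
(* Order zero is the only one at which [cstZ] is seen, and it has been bounded separately, already
   from time zero on. *)
destruct (Nat.eq_dec j 0) as [->|hj].
{ destruct (bddF_res T hT) as [A [hA h]]; exists A; split; [exact hA|].
  revert h; apply filter_imp; intros N [hN h]; split; [exact hN|].
  intros k i hk; apply h; lra. }
destruct (bounded_from_all nu W K U hnu hW (S j) s T hs hT) as [M1 [hM1 h1]].
assert (hK := scheme_family_K_pos nu W K U hW).
set (M := M1 + K).
exists ((1 + 2 * M + 6 * 2 ^ j * M * (M + 1)) * (1 + M + M)).
assert (hM : 0 <= M) by (unfold M; lra).
assert (hA : 0 <= 1 + 2 * M + 6 * 2 ^ j * M * (M + 1)).
{ assert (0 < 2 ^ j) by (apply pow_lt; lra).
  assert (0 <= 2 ^ j * M) by nra. assert (0 <= 2 ^ j * M * (M + 1)) by nra. lra. }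
split; [nra|].
generalize (eventually_and _ _ (eventually_and _ _ (tau_INR_small nu 1 hnu Rlt_0_1) h1)
  (eventually_and _ _ (vel_diff T hT) (proj2 hW T hT))).
apply filter_imp; intros N [[[hN _] g1] [g2 g3]]; split; [exact hN|].
intros k i hk.
assert (hb : forall l m, (l <= S j)%nat -> Cmod (diffn (INR N) l (W N k) m) <= M).
{ intros l m hl; specialize (g1 k m l hl hk); unfold M; lra. }
eapply Rle_trans; [apply (diffn_residual_le (INR N) (velZ N (W N k)) (W N k) (cstZ N (W N k)) M j)|].
- exact hM.
- intros m; apply g2, hk.
- intros m; destruct (g3 k (proj2 hk)) as [_ [_ [_ [h4 _]]]].
  apply Rle_trans with (2 * K); [apply velZ_le; auto|unfold M; lra].
- intros l m hl; apply hb; lia.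
- lia.
- apply Rmult_le_compat_l; [exact hA|].
  generalize (hb (S j) i (le_n _)) (hb (S j) (i - 1)%Z (le_n _)); lra.
Qed.

Lemma bddF_diff_rate (j : nat) (s T : R) : 0 < s -> 0 <= T ->
  bddF s T (fun N k => diffn (INR N) j (rateZ nu N (W N k))).
Proof.
intros hs hT.
destruct (bddF_W (j + 2) s T hs hT) as [A [hA h1]].
destruct (bddF_diff_res j s T hs hT) as [B [hB h2]].
exists (nu * A + B); split; [nra|].
generalize (eventually_and _ _ h1 h2); apply filter_imp.
intros N [[hN g1] [_ g2]]; split; [exact hN|]; intros k i hk.
replace (rateZ nu N (W N k)) with
  (fun i => RtoC nu * (fun i => diffn (INR N) 2 (W N k) (i - 1)%Z) i + RtoC 1 *
    resZ (INR N) (velZ N (W N k)) (cstZ N (W N k)) (W N k) i)%C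
  by (apply functional_extensionality; intros m; unfold rateZ; ring).
rewrite diffn_lin, diffn_pred.
eapply Rle_trans; [apply Cmod_triangle|]; rewrite !Cmod_mult, !Cmod_R, Rabs_R1, Rmult_1_l.
rewrite Rabs_pos_eq by lra.
apply Rplus_le_compat; [apply Rmult_le_compat_l; [lra|]|apply g2, hk].
replace (diffn (INR N) j (diffn (INR N) 2 (W N k))) with (diffn (INR N) (j + 2) (W N k));
  [apply g1, hk|].
rewrite Nat.add_comm; simpl; rewrite !diffn_diffZ; reflexivity.
Qed.

Definition lipF (s T : R) (F : nat -> nat -> Z -> C) : Prop :=
  exists M, 0 <= M /\ eventually (fun N => (0 < N)%nat /\ forall k i,
    s <= INR k * tau nu N -> INR (S k) * tau nu N <= T ->
    Cmod (F N (S k) i - F N k i)%C <= M * tau nu N).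

Lemma INR_tau_le_S (N k : nat) (T : R) : (0 < N)%nat ->
  INR (S k) * tau nu N <= T -> INR k * tau nu N <= T.
Proof.
intros hN h; eapply Rle_trans; [|exact h]; apply Rmult_le_compat_r; [|apply le_INR; lia].
left; apply tau_pos; auto.
Qed.

Lemma lipF_W (j : nat) (s T : R) : 0 < s -> 0 <= T ->
  lipF s T (fun N k => diffn (INR N) j (W N k)).
Proof.
intros hs hT; destruct (bddF_diff_rate j s T hs hT) as [A [hA h]].
exists A; split; [exact hA|]; revert h; apply filter_imp; intros N [hN h]; split; [exact hN|].
intros k i hk1 hk2; rewrite (proj1 hW).
replace (stepZ nu N (W N k)) with
  (fun i => RtoC 1 * W N k i + RtoC (tau nu N) * rateZ nu N (W N k) i)%C
  by (apply functional_extensionality; intros m; rewrite stepZ_rateZ by auto; ring).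
rewrite diffn_lin.
match goal with |- Cmod ?e <= _ => replace e with
  (RtoC (tau nu N) * diffn (INR N) j (rateZ nu N (W N k)) i)%C by ring end.
rewrite Cmod_mult, Cmod_R, Rabs_pos_eq, Rmult_comm by (left; apply tau_pos; auto).
apply Rmult_le_compat_r; [left; apply tau_pos; auto|].
apply h; split; [exact hk1|now apply INR_tau_le_S].
Qed.

(** This gives control of second order in time without a formula for the time derivative of the
    nonlocal terms: [velZ] and [cstZ] are averages, so their increments are bounded by those of [w]
    and of its first difference. *)
Lemma lipF_rate (s T : R) : 0 < s -> 0 <= T ->
  lipF s T (fun N k => rateZ nu N (W N k)).
Proof.
intros hs hT.
destruct (lipF_W 0 s T hs hT) as [a0 [ha0 l0]], (lipF_W 1 s T hs hT) as [a1 [ha1 l1]].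
destruct (lipF_W 2 s T hs hT) as [a2 [ha2 l2]].
destruct (bddF_vel T hT) as [B [hB h2]].
destruct (bddF_W1 0 T (Nat.le_0_l _) hT) as [D [hD h3]].
destruct (bddF_W1 1 T (le_n _) hT) as [E [hE h4]].
(* Per unit of time, [p] bounds the increment of the transport term and [p2] that of the square;
   [cstZ] is an average of both, hence [p + p2]. *)
set (p := B * a1 + 2 * a0 * E). set (p2 := D * a0 + a0 * D).
assert (hp : 0 <= p) by (unfold p; nra).
assert (hp2 : 0 <= p2) by (unfold p2; nra).
exists (nu * a2 + (p + p2) + p + p2); split; [nra|].
generalize (eventually_and _ _ (eventually_and _ _ l0 (eventually_and _ _ l1 l2))
  (eventually_and _ _ h2 (eventually_and _ _ h3 h4))).
apply filter_imp; intros N [[[hN g0] [[_ g1] [_ g2]]] [[_ q2] [[_ q3] [_ q4]]]].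
split; [exact hN|]; intros k i hk1 hk2.
assert (ht := tau_pos nu N hN hnu).
assert (hr1 : 0 <= INR k * tau nu N <= T) by (split; [lra|now apply INR_tau_le_S]).
assert (hr2 : 0 <= INR (S k) * tau nu N <= T).
{ split; [apply Rmult_le_pos; [apply pos_INR|lra]|exact hk2]. }
assert (hcd : forall m, Cmod (cdiffZ (INR N) (W N (S k)) m - cdiffZ (INR N) (W N k) m)%C
   <= a1 * tau nu N).
{ intros m; unfold cdiffZ.
  generalize (g1 k m hk1 hk2) (g1 k (m - 1)%Z hk1 hk2); simpl.
  generalize (diffZ (INR N) (W N (S k)) m) (diffZ (INR N) (W N (S k)) (m - 1))
    (diffZ (INR N) (W N k) m) (diffZ (INR N) (W N k) (m - 1)); intros x y z x' hx hy.
  replace (RtoC (1/2) * x + RtoC (1/2) * y - (RtoC (1/2) * z + RtoC (1/2) * x'))%C with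
    (RtoC (1/2) * (x - z) + RtoC (1/2) * (y - x'))%C by ring.
  eapply Rle_trans; [apply Cmod_triangle|].
  rewrite !Cmod_mult, !Cmod_R, !Rabs_pos_eq by lra; lra. }
assert (hcb : forall m, Cmod (cdiffZ (INR N) (W N k) m) <= E).
{ intros m; eapply Rle_trans; [apply (Cmod_diffn_cdiffZ (INR N) 0 (W N k))|].
  generalize (q4 k m hr1) (q4 k (m - 1)%Z hr1); simpl; lra. }
assert (hbc : forall m, Cmod (velZ N (W N (S k)) m * cdiffZ (INR N) (W N (S k)) m
     - velZ N (W N k) m * cdiffZ (INR N) (W N k) m)%C <= p * tau nu N).
{ intros m; apply Rle_trans with (B * (a1 * tau nu N) + 2 * (a0 * tau nu N) * E);
    [|right; unfold p; ring].
  apply Cmod_mult_sub; [apply q2, hr2|apply hcb| |apply hcd].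
  apply velZ_sub_le; [exact hN|]; intros n; apply (g0 k n hk1 hk2). }
assert (hww : forall m, Cmod (W N (S k) m * W N (S k) m - W N k m * W N k m)%C <= p2 * tau nu N).
{ intros m; apply Rle_trans with (D * (a0 * tau nu N) + a0 * tau nu N * D);
    [|right; unfold p2; ring].
  apply Cmod_mult_sub.
  - apply (q3 (S k) m hr2).
  - apply (q3 k m hr1).
  - apply (g0 k m hk1 hk2).
  - apply (g0 k m hk1 hk2). }
assert (hcc : Cmod (cstZ N (W N (S k)) - cstZ N (W N k))%C <= (p + p2) * tau nu N).
{ apply cstZ_sub_le; [exact hN|]; intros m.
  match goal with |- Cmod (?a + ?b - (?c + ?d))%C <= _ =>
    replace (a + b - (c + d))%C with ((a - c) + (b - d))%C by ring end.
  eapply Rle_trans; [apply Cmod_triangle|]; generalize (hbc m) (hww m); lra. }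
unfold rateZ, resZ.
match goal with |- Cmod (?n * ?d' + (?c' - ?x' - ?y') - (?n * ?d + (?c - ?x - ?y)))%C <= _ =>
  replace (n * d' + (c' - x' - y') - (n * d + (c - x - y)))%C with
  (n * (d' - d) + ((c' - c) + (- (x' - x) + - (y' - y))))%C by ring end.
eapply Rle_trans; [apply Cmod_triangle|].
eapply Rle_trans; [apply Rplus_le_compat_l, Cmod_triangle|].
eapply Rle_trans; [apply Rplus_le_compat_l, Rplus_le_compat_l, Cmod_triangle|].
rewrite Cmod_mult, Cmod_R, (Rabs_pos_eq nu), !Cmod_opp by lra.
generalize (g2 k (i - 1)%Z hk1 hk2) (hbc i) (hww i); intros x1 x2 x3.
assert (nu * Cmod (diffn (INR N) 2 (W N (S k)) (i - 1) - diffn (INR N) 2 (W N k) (i - 1))%C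
   <= nu * (a2 * tau nu N)) by (apply Rmult_le_compat_l; [lra|exact x1]).
lra.
Qed.

(** Near [t = 0] only first differences are bounded, so the equation does not control the increments
    of [w] in time. Averaging over a window of width [r / N] costs [2 K] times the width and
    replaces second differences by [2 nu K] divided by the width; the window remains free and is
    optimised in the limit. *)
Lemma initial_modulus (T : R) : 0 <= T -> exists A, 0 <= A /\
  eventually (fun N => (0 < N)%nat /\ forall k i r, (0 < r)%nat -> INR k * tau nu N <= T ->
    (Rabs (fst (W N k i) - fst (W N O i)) <=
      2 * K * (INR r / INR N) + INR k * tau nu N * (2 * nu * K * / (INR r / INR N) + A)) /\
    (Rabs (snd (W N k i) - snd (W N O i)) <=
      2 * K * (INR r / INR N) + INR k * tau nu N * (2 * nu * K * / (INR r / INR N) + A))).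
Proof.
intros hT; destruct (bddF_res T hT) as [A [hA h1]]; exists A; split; [exact hA|].
generalize (eventually_and _ _ h1 (proj2 hW T hT)); apply filter_imp.
intros N [[hN g1] g2]; split; [exact hN|]; intros k i r hr hk.
assert (hq : 0 < INR N) by (apply lt_0_INR, hN).
assert (hr0 : 0 < INR r) by (apply lt_0_INR, hr).
assert (ht := tau_pos nu N hN hnu).
assert (hk' : forall l, (l <= k)%nat -> INR l * tau nu N <= T).
{ intros l hl; eapply Rle_trans; [|exact hk]; apply Rmult_le_compat_r; [lra|apply le_INR, hl]. }
assert (e0 : 2 * K * (INR r / INR N) + INR k * tau nu N * (2 * nu * K * / (INR r / INR N) + A)
  = 2 * INR r * (K / INR N) + INR k * (K / INR N / (2 * INR r) + tau nu N * A)).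
{ unfold tau; field; lra. }
rewrite e0.
assert (hL : forall l m, (l <= k)%nat ->
  Cmod (W N l (m + 1)%Z - W N l m)%C <= K / INR N).
{ intros l m hl; destruct (g2 l (hk' l hl)) as [_ [_ [h3 _]]].
  generalize (h3 m); unfold diffZ; rewrite Cmod_mult, Cmod_R, Rabs_pos_eq by lra; intros h.
  apply Rmult_le_reg_l with (INR N); [exact hq|].
  replace (INR N * (K / INR N)) with K by (field; lra); exact h. }
set (g := fun l m => (RtoC (tau nu N) *
   resZ (INR N) (velZ N (W N l)) (cstZ N (W N l)) (W N l) m)%C).
assert (hg : forall l m, (l < k)%nat -> Cmod (g l m) <= tau nu N * A).
{ intros l m hl; unfold g; rewrite Cmod_mult, Cmod_R, Rabs_pos_eq by lra.
  apply Rmult_le_compat_l; [lra|]; apply g1; split;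
    [apply Rmult_le_pos; [apply pos_INR|lra]|apply hk'; lia]. }
assert (hst : forall l m, (l < k)%nat -> W N (S l) m = (averZ (W N l) m + g l m)%C).
{ intros l m hl; rewrite (proj1 hW); reflexivity. }
split.
- apply (window_estimate (fun l m => fst (W N l m)) (fun l m => fst (g l m))); [| | |exact hr].
  + intros n m hl; rewrite hst by exact hl; unfold averZ; generalize (g n m); intros [g1' g2']; simpl; lra.
  + intros n m hl; eapply Rle_trans; [|apply (hL n m hl)].
    eapply Rle_trans; [|apply Rmax_Cmod]; eapply Rle_trans; [|apply Rmax_l]; right; reflexivity.
  + intros n m hl; eapply Rle_trans; [|apply (hg n m hl)].
    eapply Rle_trans; [|apply Rmax_Cmod]; apply Rmax_l.
- apply (window_estimate (fun l m => snd (W N l m)) (fun l m => snd (g l m))); [| | |exact hr].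
  + intros n m hl; rewrite hst by exact hl; unfold averZ; generalize (g n m); intros [g1' g2']; simpl; lra.
  + intros n m hl; eapply Rle_trans; [|apply (hL n m hl)].
    eapply Rle_trans; [|apply Rmax_Cmod]; eapply Rle_trans; [|apply Rmax_r]; right; reflexivity.
  + intros n m hl; eapply Rle_trans; [|apply (hg n m hl)].
    eapply Rle_trans; [|apply Rmax_Cmod]; apply Rmax_r.
Qed.

End Rates.

(** * Taylor expansions on the lattice *)

Lemma lattice_lip (f : Z -> R) (q M : R) (hq : 0 < q)
  (hM : forall i, Rabs (q * (f (i + 1)%Z - f i)) <= M) (i m : Z) :
  Rabs (f (i + m)%Z - f i) <= M * Rabs (IZR m / q).
Proof.
assert (hM0 : 0 <= M) by (eapply Rle_trans; [apply Rabs_pos|apply (hM 0%Z)]).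
assert (hs : forall j, Rabs (f (j + 1)%Z - f j) <= M / q).
{ intros j; apply Rmult_le_reg_l with q; [exact hq|].
  rewrite <- (Rabs_pos_eq q) at 1 by lra; rewrite <- Rabs_mult.
  replace (q * (M / q)) with M by (field; lra); apply hM. }
assert (hn : forall (n : nat) j, Rabs (f (j + Z.of_nat n)%Z - f j) <= INR n * (M / q)).
{ induction n as [|n IH]; intros j.
  - replace (j + Z.of_nat 0)%Z with j by lia; unfold Rminus; rewrite Rplus_opp_r, Rabs_R0; simpl; lra.
  - rewrite S_INR; replace (j + Z.of_nat (S n))%Z with (j + Z.of_nat n + 1)%Z by lia.
    replace (f (j + Z.of_nat n + 1)%Z - f j) with
      ((f (j + Z.of_nat n + 1)%Z - f (j + Z.of_nat n)%Z) + (f (j + Z.of_nat n)%Z - f j)) by ring.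
    eapply Rle_trans; [apply Rabs_triang|]; generalize (hs (j + Z.of_nat n)%Z) (IH j); lra. }
unfold Rdiv; rewrite Rabs_mult, (Rabs_pos_eq (/ q)) by (left; apply Rinv_0_lt_compat, hq).
rewrite <- abs_IZR.
destruct (Z_le_dec 0 m) as [h|h].
- generalize (hn (Z.to_nat m) i); rewrite Z2Nat.id by lia.
  rewrite INR_IZR_INZ, Z2Nat.id, Z.abs_eq by lia; unfold Rdiv; lra.
- generalize (hn (Z.to_nat (- m)) (i + m)%Z); rewrite Z2Nat.id by lia.
  rewrite INR_IZR_INZ, Z2Nat.id, Z.abs_neq by lia; rewrite Rabs_minus_sym.
  replace (i + m + - m)%Z with i by lia; unfold Rdiv; lra.
Qed.

(** To the right the constant is [M], by summing first-order errors. To the left the expansion is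
    made from the far end [i + m] and its slope is then moved to [i], at the price of another
    [M]. *)
Lemma lattice_taylor (f : Z -> R) (q M : R) (hq : 0 < q)
  (hM : forall i, Rabs (q * (q * (f (i + 1 + 1)%Z - f (i + 1)%Z) - q * (f (i + 1)%Z - f i))) <= M)
  (i m : Z) :
  Rabs (f (i + m)%Z - f i - IZR m / q * (q * (f (i + 1)%Z - f i))) <= 2 * M * Rabs (IZR m / q) ^ 2.
Proof.
assert (hM0 : 0 <= M) by (eapply Rle_trans; [apply Rabs_pos|apply (hM 0%Z)]).
set (d := fun i => q * (f (i + 1)%Z - f i)).
assert (hd := lattice_lip d q M hq hM).
assert (hn : forall (n : nat) j, Rabs (f (j + Z.of_nat n)%Z - f j - INR n / q * d j)
    <= M * (INR n / q) ^ 2).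
{ induction n as [|n IH]; intros j.
  - replace (j + Z.of_nat 0)%Z with j by lia; simpl.
    replace (f j - f j - 0 / q * d j) with 0 by (field; lra); rewrite Rabs_R0.
    apply Rmult_le_pos; [exact hM0|]. apply Rmult_le_pos; [|rewrite Rmult_1_r];
      apply Rdiv_le_0_compat; lra.
  - rewrite S_INR; replace (j + Z.of_nat (S n))%Z with (j + Z.of_nat n + 1)%Z by lia.
    replace (f (j + Z.of_nat n + 1)%Z - f j - (INR n + 1) / q * d j) with
      ((f (j + Z.of_nat n)%Z - f j - INR n / q * d j) + (d (j + Z.of_nat n)%Z - d j) / q)
      by (unfold d; field; lra).
    eapply Rle_trans; [apply Rabs_triang|].
    generalize (IH j) (hd j (Z.of_nat n)); rewrite <- INR_IZR_INZ.
    assert (hnq : 0 <= INR n / q) by (apply Rdiv_le_0_compat; [apply pos_INR|lra]).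
    rewrite (Rabs_pos_eq (INR n / q)) by exact hnq; intros h1 h2.
    change ((d (j + Z.of_nat n)%Z - d j) / q) with ((d (j + Z.of_nat n)%Z - d j) * / q); rewrite Rabs_mult, (Rabs_pos_eq (/ q)) by (left; apply Rinv_0_lt_compat, hq).
    assert (Rabs (d (j + Z.of_nat n)%Z - d j) * / q <= M * (INR n / q) * / q).
    { apply Rmult_le_compat_r; [left; apply Rinv_0_lt_compat, hq|exact h2]. }
    replace (M * ((INR n + 1) / q) ^ 2) with
      (M * (INR n / q) ^ 2 + M * (INR n / q) * / q + (M * (INR n / q) * / q + M * (/ q) ^ 2))
      by (field; lra).
    assert (0 < / q) by (apply Rinv_0_lt_compat, hq).
    assert (0 <= M * (INR n / q) * / q)
      by (apply Rmult_le_pos; [apply Rmult_le_pos; [exact hM0|exact hnq]|lra]).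
    assert (0 <= M * (/ q) ^ 2) by (apply Rmult_le_pos; [exact hM0|apply pow2_ge_0]).
    lra. }
fold (d i).
destruct (Z_le_dec 0 m) as [h|h].
- generalize (hn (Z.to_nat m) i); rewrite INR_IZR_INZ, Z2Nat.id by lia.
  rewrite pow2_abs. generalize (Rmult_le_pos _ _ hM0 (pow2_ge_0 (IZR m / q))); lra.
- generalize (hn (Z.to_nat (- m)) (i + m)%Z); rewrite INR_IZR_INZ, Z2Nat.id by lia.
  replace (i + m + - m)%Z with i by lia; rewrite opp_IZR; intros h1.
  generalize (hd i m); intros h2.
  replace (f (i + m)%Z - f i - IZR m / q * d i) with
    (- (f i - f (i + m)%Z - - IZR m / q * d (i + m)%Z) + IZR m / q * (d (i + m)%Z - d i))
    by (field; lra).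
  eapply Rle_trans; [apply Rabs_triang|]; rewrite Rabs_Ropp, Rabs_mult.
  assert (Rabs (IZR m / q) * Rabs (d (i + m)%Z - d i) <= Rabs (IZR m / q) * (M * Rabs (IZR m / q)))
    by (apply Rmult_le_compat_l; [apply Rabs_pos|exact h2]).
  replace ((- IZR m / q) ^ 2) with ((IZR m / q) ^ 2) in h1 by (field; lra).
  rewrite <- (pow2_abs (IZR m / q)) in h1. lra.
Qed.

Lemma discrete_time_lip (f : nat -> R) (t M : R) (k n : nat)
  (hM : forall l, (k <= l < k + n)%nat -> Rabs (f (S l) - f l) <= M * t) :
  Rabs (f (k + n)%nat - f k) <= M * (INR n * t).
Proof.
induction n as [|n IH].
- rewrite Nat.add_0_r; unfold Rminus; rewrite Rplus_opp_r, Rabs_R0; simpl; lra.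
- rewrite S_INR, Nat.add_succ_r.
  replace (f (S (k + n)) - f k) with ((f (S (k + n)) - f (k + n)%nat) + (f (k + n)%nat - f k)) by ring.
  eapply Rle_trans; [apply Rabs_triang|].
  generalize (hM (k + n)%nat ltac:(lia)) (IH ltac:(intros; apply hM; lia)); lra.
Qed.

Lemma discrete_time_taylor (f g : nat -> R) (t M : R) (k n : nat) (ht : 0 <= t) (hM0 : 0 <= M)
  (hf : forall l, (k <= l < k + n)%nat -> f (S l) = f l + t * g l)
  (hM : forall l, (k <= l < k + n)%nat -> Rabs (g (S l) - g l) <= M * t) :
  Rabs (f (k + n)%nat - f k - INR n * t * g k) <= M * (INR n * t) ^ 2.
Proof.
induction n as [|n IH].
- rewrite Nat.add_0_r; simpl; replace (f k - f k - 0 * t * g k) with 0 by ring.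
  rewrite Rabs_R0; right; ring.
- rewrite S_INR, Nat.add_succ_r, hf by lia.
  replace (f (k + n)%nat + t * g (k + n)%nat - f k - (INR n + 1) * t * g k) with
    ((f (k + n)%nat - f k - INR n * t * g k) + t * (g (k + n)%nat - g k)) by ring.
  eapply Rle_trans; [apply Rabs_triang|]; rewrite Rabs_mult, (Rabs_pos_eq t) by exact ht.
  assert (h1 := discrete_time_lip g t M k n ltac:(intros; apply hM; lia)).
  specialize (IH ltac:(intros; apply hf; lia) ltac:(intros; apply hM; lia)).
  assert (t * Rabs (g (k + n)%nat - g k) <= t * (M * (INR n * t)))
    by (apply Rmult_le_compat_l; [exact ht|exact h1]).
  replace (M * ((INR n + 1) * t) ^ 2) with
    (M * (INR n * t) ^ 2 + t * (M * (INR n * t)) + (t * (M * (INR n * t)) + M * t ^ 2)) by ring.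
  assert (0 <= t * (M * (INR n * t))) by (repeat apply Rmult_le_pos; auto using pos_INR).
  assert (0 <= M * t ^ 2) by (apply Rmult_le_pos; [exact hM0|apply pow2_ge_0]).
  lra.
Qed.

Lemma discrete_time_taylor_back (f g : nat -> R) (t M : R) (k n : nat) (ht : 0 <= t) (hM0 : 0 <= M)
  (hf : forall l, (k <= l < k + n)%nat -> f (S l) = f l + t * g l)
  (hM : forall l, (k <= l < k + n)%nat -> Rabs (g (S l) - g l) <= M * t) :
  Rabs (f k - f (k + n)%nat + INR n * t * g (k + n)%nat) <= 2 * M * (INR n * t) ^ 2.
Proof.
assert (h1 := discrete_time_taylor f g t M k n ht hM0 hf hM).
assert (h2 := discrete_time_lip g t M k n hM).
replace (f k - f (k + n)%nat + INR n * t * g (k + n)%nat) with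
  (- (f (k + n)%nat - f k - INR n * t * g k) + INR n * t * (g (k + n)%nat - g k)) by ring.
eapply Rle_trans; [apply Rabs_triang|]; rewrite Rabs_Ropp, Rabs_mult.
assert (hnt : 0 <= INR n * t) by (apply Rmult_le_pos; [apply pos_INR|exact ht]).
rewrite (Rabs_pos_eq (INR n * t)) by exact hnt.
assert (INR n * t * Rabs (g (k + n)%nat - g k) <= INR n * t * (M * (INR n * t)))
  by (apply Rmult_le_compat_l; auto).
lra.
Qed.

(** * Rounding points of space and time to the lattice *)

Definition kidx (nu : R) (N : nat) (t : R) : nat := Z.to_nat (Int_part (t / tau nu N)).
Definition zidx (N : nat) (z : R) : Z := Int_part (z * INR N).

Lemma kidx_spec (nu : R) (N : nat) (t : R) : 0 < nu -> (0 < N)%nat -> 0 <= t ->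
  INR (kidx nu N t) * tau nu N <= t < INR (kidx nu N t) * tau nu N + tau nu N.
Proof.
intros hnu hN ht; assert (hp := tau_pos nu N hN hnu).
destruct (base_Int_part (t / tau nu N)) as [h1 h2].
assert (h0 : 0 <= t / tau nu N) by (apply Rdiv_le_0_compat; lra).
assert (h3 : (0 <= Int_part (t / tau nu N))%Z).
{ apply Z.lt_succ_r, lt_IZR; rewrite succ_IZR; lra. }
unfold kidx; rewrite INR_IZR_INZ, Z2Nat.id by exact h3.
assert (e : t / tau nu N * tau nu N = t) by (field; lra).
revert h1 h2 e; generalize (IZR (Int_part (t / tau nu N))); intros x.
generalize (t / tau nu N); intros y h1 h2 e.
split; [rewrite <- e; apply Rmult_le_compat_r; lra|].
apply Rle_lt_trans with (y * tau nu N); [lra|].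
replace (x * tau nu N + tau nu N) with ((x + 1) * tau nu N) by ring.
apply Rmult_lt_compat_r; lra.
Qed.

Lemma kidx_0 (nu : R) (N : nat) : 0 < nu -> (0 < N)%nat -> kidx nu N 0 = O.
Proof.
intros hnu hN; assert (hp := tau_pos nu N hN hnu).
destruct (kidx_spec nu N 0 hnu hN (Rle_refl _)) as [h _].
destruct (kidx nu N 0) as [|n]; [reflexivity|].
exfalso; rewrite S_INR in h; generalize (pos_INR n); nra.
Qed.

Lemma kidx_mono (nu : R) (N : nat) (t t' : R) : 0 < nu -> (0 < N)%nat -> 0 <= t -> t <= t' ->
  (kidx nu N t <= kidx nu N t')%nat.
Proof.
intros hnu hN ht htt; assert (hp := tau_pos nu N hN hnu).
destruct (kidx_spec nu N t hnu hN ht) as [h1 _].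
destruct (kidx_spec nu N t' hnu hN ltac:(lra)) as [_ h2].
apply Nat.lt_succ_r, INR_lt; rewrite S_INR.
apply Rmult_lt_reg_r with (tau nu N); lra.
Qed.

Lemma zidx_spec (N : nat) (z : R) : IZR (zidx N z) <= z * INR N < IZR (zidx N z) + 1.
Proof. unfold zidx; destruct (base_Int_part (z * INR N)) as [h1 h2]; lra. Qed.

Lemma zidx_period (N : nat) (z : R) : zidx N (z + 1) = (zidx N z + Z.of_nat N)%Z.
Proof.
destruct (zidx_spec N z) as [h1 h2], (zidx_spec N (z + 1)) as [h3 h4].
rewrite Rmult_plus_distr_r, Rmult_1_l in h3, h4.
rewrite INR_IZR_INZ in h1, h2, h3, h4.
apply Z.le_antisymm; apply Z.lt_succ_r, lt_IZR; rewrite succ_IZR.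
- rewrite plus_IZR; lra.
- rewrite plus_IZR; lra.
Qed.

Lemma zidx_0 (N : nat) : zidx N 0 = 0%Z.
Proof.
destruct (zidx_spec N 0) as [h1 h2]; rewrite Rmult_0_l in h1, h2.
apply Z.le_antisymm; apply Z.lt_succ_r, lt_IZR; rewrite succ_IZR; lra.
Qed.

Lemma zidx_shift (N : nat) (z z' : R) : (0 < N)%nat ->
  Rabs (IZR (zidx N z' - zidx N z) / INR N - (z' - z)) <= / INR N.
Proof.
intros hN; assert (hq : 0 < INR N) by (apply lt_0_INR, hN).
destruct (zidx_spec N z) as [h1 h2], (zidx_spec N z') as [h3 h4].
rewrite minus_IZR.
replace ((IZR (zidx N z') - IZR (zidx N z)) / INR N - (z' - z)) with
  ((IZR (zidx N z') - z' * INR N - (IZR (zidx N z) - z * INR N)) * / INR N) by (field; lra).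
rewrite Rabs_mult, (Rabs_pos_eq (/ INR N)) by (left; apply Rinv_0_lt_compat, hq).
rewrite <- (Rmult_1_l (/ INR N)) at 2; apply Rmult_le_compat_r; [left; apply Rinv_0_lt_compat, hq|].
apply Rabs_le_between; lra.
Qed.

Lemma inv_INR_small (C d : R) : 0 < d -> eventually (fun N => C * / INR N <= d).
Proof.
intros hd; destruct (eventually_INR_ge (Rmax 1 (C / d))) as [N0 h].
exists N0; intros N hN; specialize (h N hN).
assert (h1 : 1 <= INR N) by (eapply Rle_trans; [apply Rmax_l|exact h]).
assert (h2 : C / d <= INR N) by (eapply Rle_trans; [apply Rmax_r|exact h]).
apply Rmult_le_reg_r with (INR N); [lra|].
rewrite Rmult_assoc, Rinv_l, Rmult_1_r by lra.
apply Rmult_le_compat_l with (r := d) in h2; [|lra].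
replace (d * (C / d)) with C in h2 by (field; lra); exact h2.
Qed.

Lemma tau_small (nu C d : R) : 0 < nu -> 0 < d -> eventually (fun N => C * tau nu N <= d).
Proof.
intros hnu hd.
generalize (tau_INR_small nu (d / (Rabs C + 1)) hnu); intros h.
assert (hc : 0 < Rabs C + 1) by (generalize (Rabs_pos C); lra).
assert (hdc : 0 < d / (Rabs C + 1)) by (apply Rdiv_lt_0_compat; lra).
generalize (h hdc); apply filter_imp; intros N [hN [_ ht]].
assert (hp := tau_pos nu N hN hnu).
apply Rle_trans with ((Rabs C + 1) * tau nu N).
- apply Rmult_le_compat_r; [lra|generalize (Rle_abs C); lra].
- apply Rle_trans with ((Rabs C + 1) * (d / (Rabs C + 1))); [apply Rmult_le_compat_l; lra|].
  right; field; lra.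
Qed.

(** * Limits of lattice functions *)

Definition ulim (U : (nat -> Prop) -> Prop) (x : nat -> R) : R :=
  iota (fun l => filterlim x U (locally l)).

Definition limit_filter (U : (nat -> Prop) -> Prop) : Prop :=
  ProperFilter U /\ (forall A, eventually A -> U A) /\
  (forall x M, U (fun n => Rabs (x n) <= M) -> exists l : R, filterlim x U (locally l)).

Definition bddR (nu s T : R) (F : nat -> nat -> Z -> R) : Prop :=
  exists M, 0 <= M /\ eventually (fun N => (0 < N)%nat /\ forall k i,
    s <= INR k * tau nu N <= T -> Rabs (F N k i) <= M).

Definition lipR (nu s T : R) (F : nat -> nat -> Z -> R) : Prop :=
  exists M, 0 <= M /\ eventually (fun N => (0 < N)%nat /\ forall k i,
    s <= INR k * tau nu N -> INR (S k) * tau nu N <= T ->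
    Rabs (F N (S k) i - F N k i) <= M * tau nu N).

Definition rdiff (F : nat -> nat -> Z -> R) (N k : nat) (i : Z) : R :=
  INR N * (F N k (i + 1)%Z - F N k i).

Definition samp (nu : R) (F : nat -> nat -> Z -> R) (z t : R) (N : nat) : R :=
  F N (kidx nu N t) (zidx N z).

(* [s = 0] is kept apart so that bounds valid from the initial time on reach [t = 0]. *)
Definition in_range (s T t : R) : Prop := (s = 0 \/ s < t) /\ 0 <= t <= T.

Section Limits.
Variables (nu : R) (U : (nat -> Prop) -> Prop).
Hypothesis hnu : 0 < nu.
Hypothesis hU : limit_filter U.

Let FU : ProperFilter U := proj1 hU.
#[local] Existing Instance FU.

Definition L (F : nat -> nat -> Z -> R) (z t : R) : R := ulim U (samp nu F z t).

Lemma ulim_unique (x : nat -> R) (l l' : R) :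
  filterlim x U (locally l) -> filterlim x U (locally l') -> l = l'.
Proof. intros h h'; exact (filterlim_locally_unique x l l' h h'). Qed.

Lemma ulim_correct (x : nat -> R) (l : R) : filterlim x U (locally l) -> ulim U x = l.
Proof.
intros h; apply ulim_unique with x; [|exact h].
unfold ulim; apply (iota_correct (fun l => filterlim x U (locally l))).
exists l; split; [exact h|]; intros l' h'; eapply ulim_unique; eauto.
Qed.

Lemma lim_abs_le (x : nat -> R) (l e : R) : filterlim x U (locally l) ->
  (forall d, 0 < d -> eventually (fun n => Rabs (x n) <= e + d)) -> Rabs l <= e.
Proof.
intros hl h; apply le_epsilon; intros d hd.
specialize (h (d / 2) ltac:(lra)); apply (proj1 (proj2 hU)) in h.
assert (hd2 : 0 < d / 2) by lra.
apply filterlim_locally with (eps := mkposreal _ hd2) in hl.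
destruct (filter_ex _ (filter_and _ _ h hl)) as [n [h1 h2]].
change (Rabs (x n - l) < d / 2) in h2.
replace l with (x n + - (x n - l)) by ring.
eapply Rle_trans; [apply Rabs_triang|]; rewrite Rabs_Ropp; lra.
Qed.

Lemma cv_lin (x y : nat -> R) (a b l l' : R) :
  filterlim x U (locally l) -> filterlim y U (locally l') ->
  filterlim (fun n => a * x n + b * y n) U (locally (a * l + b * l')).
Proof.
intros h h'.
apply (filterlim_comp_2 (G := locally (a * l)) (H := locally (b * l'))
  (fun n => a * x n) (fun n => b * y n) Rplus).
- apply filterlim_comp with (1 := h); apply (continuous_scal_r a (fun x => x) l), continuous_id.
- apply filterlim_comp with (1 := h'); apply (continuous_scal_r b (fun x => x) l'), continuous_id.
- apply (filterlim_plus (a * l) (b * l')).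
Qed.

Lemma cv_mult (x y : nat -> R) (l l' : R) :
  filterlim x U (locally l) -> filterlim y U (locally l') ->
  filterlim (fun n => x n * y n) U (locally (l * l')).
Proof.
intros h h'; apply (filterlim_comp_2 (G := locally l) (H := locally l') x y Rmult h h').
apply (filterlim_mult l l').
Qed.

Lemma cv_const (c : R) : filterlim (fun _ : nat => c) U (locally c).
Proof. apply filterlim_const. Qed.

Lemma cv_close (x y : nat -> R) (l : R) : filterlim x U (locally l) ->
  (forall d, 0 < d -> eventually (fun n => Rabs (y n - x n) <= d)) -> filterlim y U (locally l).
Proof.
intros h hd; apply filterlim_locally; intros eps.
assert (he : 0 < eps / 2) by (generalize (cond_pos eps); lra).
apply filterlim_locally with (eps := mkposreal _ he) in h.
specialize (hd (eps / 4) ltac:(lra)); apply (proj1 (proj2 hU)) in hd.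
generalize (filter_and _ _ h hd); apply filter_imp; intros n [h1 h2].
change (Rabs (x n - l) < eps / 2) in h1; change (Rabs (y n - l) < eps).
replace (y n - l) with ((y n - x n) + (x n - l)) by ring.
eapply Rle_lt_trans; [apply Rabs_triang|]; lra.
Qed.

Lemma range_kidx (s T t : R) : in_range s T t ->
  eventually (fun N => (0 < N)%nat /\ s <= INR (kidx nu N t) * tau nu N <= T).
Proof.
intros [hs ht].
assert (hd : exists d, 0 < d /\ (s = 0 \/ s + d <= t)).
{ destruct hs as [h|h]; [exists 1; split; [lra|now left]|exists (t - s); split; [lra|right; lra]]. }
destruct hd as [d [hd hsd]].
generalize (tau_INR_small nu d hnu hd); apply filter_imp; intros N [hN [_ hτ]].
split; [exact hN|].
assert (hp := tau_pos nu N hN hnu).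
destruct (kidx_spec nu N t hnu hN (proj1 ht)) as [h1 h2]; split; [|lra].
destruct hsd as [->|h]; [|lra].
apply Rmult_le_pos; [apply pos_INR|lra].
Qed.

Lemma L_cv (F : nat -> nat -> Z -> R) (s T z t : R) : bddR nu s T F -> in_range s T t ->
  filterlim (samp nu F z t) U (locally (L F z t)).
Proof.
intros [M [hM hb]] ht.
destruct (proj2 (proj2 hU) (samp nu F z t) M) as [l hl].
- apply (proj1 (proj2 hU)).
  generalize (eventually_and _ _ hb (range_kidx s T t ht)); apply filter_imp.
  intros N [[_ h1] [_ h2]]; apply h1, h2.
- unfold L; rewrite (ulim_correct _ l hl); exact hl.
Qed.

Lemma L_lip_z (F : nat -> nat -> Z -> R) (s T : R) : bddR nu s T F -> bddR nu s T (rdiff F) ->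
  exists M, 0 <= M /\ forall z z' t, in_range s T t ->
    Rabs (L F z' t - L F z t) <= M * Rabs (z' - z).
Proof.
intros hF [M [hM hD]]; exists M; split; [exact hM|]; intros z z' t ht.
replace (L F z' t - L F z t) with (1 * L F z' t + (-1) * L F z t) by ring.
apply lim_abs_le with (1 := cv_lin _ _ 1 (-1) _ _ (L_cv F s T z' t hF ht) (L_cv F s T z t hF ht)).
intros d hd.
generalize (eventually_and _ _ (inv_INR_small M d hd) (eventually_and _ _ hD (range_kidx s T t ht))).
apply filter_imp; intros N [h1 [[hN h2] [_ h3]]].
assert (hq : 0 < INR N) by (apply lt_0_INR, hN).
unfold samp.
generalize (lattice_lip (F N (kidx nu N t)) (INR N) M hq (fun i => h2 _ i h3)
  (zidx N z) (zidx N z' - zidx N z)).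
replace (zidx N z + (zidx N z' - zidx N z))%Z with (zidx N z') by lia.
generalize (zidx_shift N z z' hN); generalize (IZR (zidx N z' - zidx N z) / INR N).
intros y hy hl.
replace (1 * F N (kidx nu N t) (zidx N z') + -1 * F N (kidx nu N t) (zidx N z)) with
  (F N (kidx nu N t) (zidx N z') - F N (kidx nu N t) (zidx N z)) by ring.
eapply Rle_trans; [exact hl|].
assert (Rabs y <= Rabs (z' - z) + / INR N).
{ replace y with ((z' - z) + (y - (z' - z))) by ring.
  eapply Rle_trans; [apply Rabs_triang|lra]. }
assert (M * Rabs y <= M * (Rabs (z' - z) + / INR N)) by (apply Rmult_le_compat_l; lra).
lra.
Qed.

(** The second-order Taylor inequality on the lattice passes to the limit: rounding alters the
    displacement by at most [1 / N]. It yields at once the existence of the derivative of the limit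
    and its value, the limit of the difference quotients, with no exchange of limits. *)
Lemma L_taylor_z (F : nat -> nat -> Z -> R) (s T : R) : bddR nu s T F ->
  bddR nu s T (rdiff F) -> bddR nu s T (rdiff (rdiff F)) ->
  exists M, 0 <= M /\ forall z z' t, in_range s T t ->
    Rabs (L F z' t - L F z t - (z' - z) * L (rdiff F) z t) <= M * (z' - z) ^ 2.
Proof.
intros hF hD [M [hM hDD]].
assert (hD' := hD); destruct hD' as [M1 [hM1 hD1]].
exists (2 * M); split; [lra|]; intros z z' t ht.
set (a := z' - z).
replace (L F z' t - L F z t - a * L (rdiff F) z t) with
  (1 * (1 * L F z' t + (-1) * L F z t) + (- a) * L (rdiff F) z t) by ring.
apply lim_abs_le with (1 := cv_lin _ _ 1 (- a) _ _
  (cv_lin _ _ 1 (-1) _ _ (L_cv F s T z' t hF ht) (L_cv F s T z t hF ht)) (L_cv _ s T z t hD ht)).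
intros d hd.
generalize (eventually_and _ _ (inv_INR_small (2 * M * (2 * Rabs a + 1) + M1) d hd)
  (eventually_and _ _ hDD (eventually_and _ _ hD1 (range_kidx s T t ht)))).
apply filter_imp; intros N [h1 [[hN h2] [[_ h2'] [_ h3]]]].
assert (hq : 0 < INR N) by (apply lt_0_INR, hN).
assert (hq1 : 1 <= INR N) by (apply (le_INR 1); lia).
unfold samp; fold a in h1.
generalize (lattice_taylor (F N (kidx nu N t)) (INR N) M hq (fun i => h2 _ i h3)
  (zidx N z) (zidx N z' - zidx N z)).
replace (zidx N z + (zidx N z' - zidx N z))%Z with (zidx N z') by lia.
generalize (zidx_shift N z z' hN); generalize (IZR (zidx N z' - zidx N z) / INR N).
fold (rdiff F N (kidx nu N t) (zidx N z)).
generalize (h2' _ (zidx N z) h3); generalize (rdiff F N (kidx nu N t) (zidx N z)).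
fold a; intros D hDz y hy hl.
match goal with |- Rabs ?e <= _ =>
  replace e with ((F N (kidx nu N t) (zidx N z') - F N (kidx nu N t) (zidx N z) - y * D)
     + (y - a) * D) by ring end.
eapply Rle_trans; [apply Rabs_triang|]; rewrite (Rabs_mult (y - a)).
assert (hi : 0 < / INR N) by (apply Rinv_0_lt_compat, hq).
assert (hi1 : / INR N <= 1) by (rewrite <- Rinv_1; apply Rinv_le_contravar; lra).
assert (Rabs (y - a) * Rabs D <= / INR N * M1).
{ apply Rmult_le_compat; auto using Rabs_pos. }
assert (hya : Rabs y <= Rabs a + / INR N).
{ replace y with (a + (y - a)) by ring; eapply Rle_trans; [apply Rabs_triang|lra]. }
assert (hya2 : Rabs y ^ 2 <= (Rabs a + / INR N) ^ 2)
  by (apply pow_incr; split; [apply Rabs_pos|exact hya]).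
assert (2 * M * Rabs y ^ 2 <= 2 * M * (Rabs a + / INR N) ^ 2) by (apply Rmult_le_compat_l; lra).
assert (hexp : (Rabs a + / INR N) ^ 2 <= a ^ 2 + (2 * Rabs a + 1) * / INR N).
{ rewrite <- (pow2_abs a). generalize (Rabs_pos a); nra. }
assert (2 * M * (Rabs a + / INR N) ^ 2 <= 2 * M * (a ^ 2 + (2 * Rabs a + 1) * / INR N))
  by (apply Rmult_le_compat_l; lra).
lra.
Qed.

Lemma quadratic_is_derive (f : R -> R) (x l M d : R) (hM : 0 <= M) (hd : 0 < d) :
  (forall y, Rabs (y - x) < d -> Rabs (f y - f x - (y - x) * l) <= M * (y - x) ^ 2) ->
  is_derive f x l.
Proof.
intros h; apply is_derive_Reals; intros eps heps.
assert (hm : 0 < Rmin d (eps / (M + 1))).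
{ apply Rmin_glb_lt; [exact hd|apply Rdiv_lt_0_compat; lra]. }
exists (mkposreal _ hm); intros r hr0 hr; simpl in hr.
assert (hr1 : Rabs r < d) by (eapply Rlt_le_trans; [exact hr|apply Rmin_l]).
assert (hr2 : Rabs r < eps / (M + 1)) by (eapply Rlt_le_trans; [exact hr|apply Rmin_r]).
specialize (h (x + r)); replace (x + r - x) with r in h by ring; specialize (h hr1).
assert (hp : 0 < Rabs r) by (apply Rabs_pos_lt, hr0).
replace ((f (x + r) - f x) / r - l) with ((f (x + r) - f x - r * l) / r) by (field; exact hr0).
unfold Rdiv; rewrite Rabs_mult, Rabs_inv.
apply Rmult_lt_reg_r with (Rabs r); [exact hp|].
rewrite Rmult_assoc, Rinv_l, Rmult_1_r by lra.
eapply Rle_lt_trans; [exact h|]; rewrite <- (pow2_abs r).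
assert (Rabs r * (M + 1) < eps).
{ apply Rmult_lt_compat_r with (r := M + 1) in hr2; [|lra].
  replace (eps / (M + 1) * (M + 1)) with eps in hr2 by (field; lra); exact hr2. }
simpl; nra.
Qed.

Lemma L_is_derive_z (F : nat -> nat -> Z -> R) (s T z t : R) : bddR nu s T F ->
  bddR nu s T (rdiff F) -> bddR nu s T (rdiff (rdiff F)) -> in_range s T t ->
  is_derive (fun y => L F y t) z (L (rdiff F) z t).
Proof.
intros h1 h2 h3 ht; destruct (L_taylor_z F s T h1 h2 h3) as [M [hM h]].
apply quadratic_is_derive with M 1; [exact hM|lra|]; intros y _; apply h, ht.
Qed.

Lemma kidx_shift (N : nat) (t t' : R) : (0 < N)%nat -> 0 <= t -> t <= t' ->
  Rabs (INR (kidx nu N t' - kidx nu N t) * tau nu N - (t' - t)) <= tau nu N.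
Proof.
intros hN ht htt; rewrite minus_INR by (apply kidx_mono; auto).
destruct (kidx_spec nu N t hnu hN ht) as [h1 h2].
destruct (kidx_spec nu N t' hnu hN ltac:(lra)) as [h3 h4].
apply Rabs_le_between; lra.
Qed.

Lemma range_between (s T t t' : R) : 0 < s -> in_range s T t -> in_range s T t' -> t <= t' ->
  eventually (fun N => (0 < N)%nat /\ forall l, (kidx nu N t <= l < kidx nu N t')%nat ->
    s <= INR l * tau nu N /\ INR (S l) * tau nu N <= T).
Proof.
intros hs ht ht' htt.
generalize (eventually_and _ _ (range_kidx s T t ht) (range_kidx s T t' ht')); apply filter_imp.
intros N [[hN h1] [_ h2]]; split; [exact hN|]; intros l hl.
assert (hp := tau_pos nu N hN hnu).
split.
- apply Rle_trans with (INR (kidx nu N t) * tau nu N); [lra|].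
  apply Rmult_le_compat_r; [lra|apply le_INR; lia].
- apply Rle_trans with (INR (kidx nu N t') * tau nu N); [|lra].
  apply Rmult_le_compat_r; [lra|apply le_INR; lia].
Qed.

Lemma L_lip_t (F : nat -> nat -> Z -> R) (s T : R) : 0 < s -> bddR nu s T F -> lipR nu s T F ->
  exists M, 0 <= M /\ forall z t t', in_range s T t -> in_range s T t' ->
    Rabs (L F z t' - L F z t) <= M * Rabs (t' - t).
Proof.
intros hs hF [M [hM hD]]; exists M; split; [exact hM|].
assert (main : forall z t t', in_range s T t -> in_range s T t' -> t <= t' ->
    Rabs (L F z t' - L F z t) <= M * Rabs (t' - t)).
{ intros z t t' ht ht' htt.
  replace (L F z t' - L F z t) with (1 * L F z t' + (-1) * L F z t) by ring.
  apply lim_abs_le with (1 := cv_lin _ _ 1 (-1) _ _ (L_cv F s T z t' hF ht') (L_cv F s T z t hF ht)).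
  intros d hd.
  generalize (eventually_and _ _ (tau_small nu M d hnu hd)
    (eventually_and _ _ hD (range_between s T t t' hs ht ht' htt))).
  apply filter_imp; intros N [h1 [[hN h2] [_ h3]]].
  unfold samp.
  generalize (discrete_time_lip (fun l => F N l (zidx N z)) (tau nu N) M (kidx nu N t)
    (kidx nu N t' - kidx nu N t)).
  assert (hk := kidx_mono nu N t t' hnu hN (proj1 (proj2 ht)) htt).
  replace (kidx nu N t + (kidx nu N t' - kidx nu N t))%nat with (kidx nu N t') by lia.
  intros hl; specialize (hl (fun l hl => h2 l _ (proj1 (h3 l hl)) (proj2 (h3 l hl)))).
  generalize (kidx_shift N t t' hN (proj1 (proj2 ht)) htt); intros hsf.
  rewrite (Rabs_pos_eq (t' - t)) by lra.
  apply Rabs_le_between in hsf.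
  match goal with |- Rabs ?e <= _ =>
    replace e with (F N (kidx nu N t') (zidx N z) - F N (kidx nu N t) (zidx N z)) by ring end.
  eapply Rle_trans; [exact hl|].
  assert (M * (INR (kidx nu N t' - kidx nu N t) * tau nu N) <= M * (t' - t + tau nu N))
    by (apply Rmult_le_compat_l; lra).
  lra. }
intros z t t' ht ht'; destruct (Rle_dec t t') as [h|h]; [apply main; auto|].
rewrite (Rabs_minus_sym (L F z t')), (Rabs_minus_sym t'); apply main; auto; lra.
Qed.

Lemma L_taylor_t (F G : nat -> nat -> Z -> R) (s T : R) : 0 < s -> bddR nu s T F ->
  bddR nu s T G -> lipR nu s T G ->
  eventually (fun N => forall k i, F N (S k) i = F N k i + tau nu N * G N k i) ->
  exists M, 0 <= M /\ forall z t t', in_range s T t -> in_range s T t' ->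
    Rabs (L F z t' - L F z t - (t' - t) * L G z t) <= M * (t' - t) ^ 2.
Proof.
intros hs hF hG [M [hM hD]] hstep.
assert (hG' := hG); destruct hG' as [M1 [hM1 hG1]].
exists (2 * M); split; [lra|]; intros z t t' ht ht'.
set (a := t' - t).
replace (L F z t' - L F z t - a * L G z t) with
  (1 * (1 * L F z t' + (-1) * L F z t) + (- a) * L G z t) by ring.
apply lim_abs_le with (1 := cv_lin _ _ 1 (- a) _ _
  (cv_lin _ _ 1 (-1) _ _ (L_cv F s T z t' hF ht') (L_cv F s T z t hF ht)) (L_cv _ s T z t hG ht)).
intros d hd.
(* [y] is the displacement in lattice time. It is negative for [t' < t], where the backward
   expansion is used, since the recursion runs forward only. *)
assert (hb : eventually (fun N => (0 < N)%nat /\ exists y, Rabs (y - a) <= tau nu N /\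
  Rabs (F N (kidx nu N t') (zidx N z) - F N (kidx nu N t) (zidx N z)
     - y * G N (kidx nu N t) (zidx N z)) <= 2 * M * Rabs y ^ 2)).
{ destruct (Rle_dec t t') as [htt|htt].
  - generalize (eventually_and _ _ hstep
      (eventually_and _ _ hD (range_between s T t t' hs ht ht' htt))).
    apply filter_imp; intros N [h1 [[hN h2] [_ h3]]]; split; [exact hN|].
    assert (hp := tau_pos nu N hN hnu).
    exists (INR (kidx nu N t' - kidx nu N t) * tau nu N); split; [apply kidx_shift; auto; apply ht|].
    assert (hk := kidx_mono nu N t t' hnu hN (proj1 (proj2 ht)) htt).
    generalize (discrete_time_taylor (fun l => F N l (zidx N z)) (fun l => G N l (zidx N z))
      (tau nu N) M (kidx nu N t) (kidx nu N t' - kidx nu N t) (Rlt_le _ _ hp) hM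
      (fun l _ => h1 l _) (fun l hl => h2 l _ (proj1 (h3 l ltac:(lia))) (proj2 (h3 l ltac:(lia))))).
    replace (kidx nu N t + (kidx nu N t' - kidx nu N t))%nat with (kidx nu N t') by lia.
    rewrite pow2_abs; intros hl; eapply Rle_trans; [exact hl|].
    generalize (Rmult_le_pos _ _ hM (pow2_ge_0 (INR (kidx nu N t' - kidx nu N t) * tau nu N))); lra.
  - assert (htt' : t' <= t) by lra.
    generalize (eventually_and _ _ hstep
      (eventually_and _ _ hD (range_between s T t' t hs ht' ht htt'))).
    apply filter_imp; intros N [h1 [[hN h2] [_ h3]]]; split; [exact hN|].
    assert (hp := tau_pos nu N hN hnu).
    exists (- (INR (kidx nu N t - kidx nu N t') * tau nu N)); split.
    { generalize (kidx_shift N t' t hN (proj1 (proj2 ht')) htt'); unfold a; intros hsf.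
      rewrite <- Rabs_Ropp.
      match goal with |- Rabs ?e <= _ => replace e with
        (INR (kidx nu N t - kidx nu N t') * tau nu N - (t - t')) by ring end; exact hsf. }
    assert (hk := kidx_mono nu N t' t hnu hN (proj1 (proj2 ht')) htt').
    generalize (discrete_time_taylor_back (fun l => F N l (zidx N z)) (fun l => G N l (zidx N z))
      (tau nu N) M (kidx nu N t') (kidx nu N t - kidx nu N t') (Rlt_le _ _ hp) hM
      (fun l _ => h1 l _) (fun l hl => h2 l _ (proj1 (h3 l ltac:(lia))) (proj2 (h3 l ltac:(lia))))).
    replace (kidx nu N t' + (kidx nu N t - kidx nu N t'))%nat with (kidx nu N t) by lia.
    rewrite pow2_abs; intros hl.
    match goal with |- Rabs ?e <= ?f =>
      match type of hl with Rabs ?e' <= ?f' =>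
        replace e with e' by ring; replace f with f' by ring end end.
    exact hl. }
generalize (eventually_and _ _ hb (eventually_and _ _ (eventually_and _ _ (tau_small nu 1 1 hnu Rlt_0_1)
  (tau_small nu (2 * M * (2 * Rabs a + 1) + M1) d hnu hd))
  (eventually_and _ _ hG1 (range_kidx s T t ht)))).
apply filter_imp; intros N [[hN [y [hy hl]]] [[ht1 htd] [[_ h2'] [_ h3]]]].
assert (hp := tau_pos nu N hN hnu).
unfold samp.
generalize (h2' _ (zidx N z) h3); intros hDz.
match goal with |- Rabs ?e <= _ =>
  replace e with ((F N (kidx nu N t') (zidx N z) - F N (kidx nu N t) (zidx N z)
     - y * G N (kidx nu N t) (zidx N z)) + (y - a) * G N (kidx nu N t) (zidx N z)) by ring end.
eapply Rle_trans; [apply Rabs_triang|]; rewrite (Rabs_mult (y - a)).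
assert (Rabs (y - a) * Rabs (G N (kidx nu N t) (zidx N z)) <= tau nu N * M1).
{ apply Rmult_le_compat; auto using Rabs_pos. }
assert (hya : Rabs y <= Rabs a + tau nu N).
{ replace y with (a + (y - a)) by ring; eapply Rle_trans; [apply Rabs_triang|lra]. }
assert (hya2 : Rabs y ^ 2 <= (Rabs a + tau nu N) ^ 2)
  by (apply pow_incr; split; [apply Rabs_pos|exact hya]).
assert (hexp : (Rabs a + tau nu N) ^ 2 <= a ^ 2 + (2 * Rabs a + 1) * tau nu N).
{ rewrite <- (pow2_abs a). generalize (Rabs_pos a); nra. }
assert (2 * M * Rabs y ^ 2 <= 2 * M * (a ^ 2 + (2 * Rabs a + 1) * tau nu N))
  by (apply Rmult_le_compat_l; lra).
lra.
Qed.

Lemma L_is_derive_t (F G : nat -> nat -> Z -> R) (s T z t : R) : 0 < s -> s < t < T ->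
  bddR nu s T F -> bddR nu s T G -> lipR nu s T G ->
  eventually (fun N => forall k i, F N (S k) i = F N k i + tau nu N * G N k i) ->
  is_derive (fun r => L F z r) t (L G z t).
Proof.
intros hs ht hF hG hl hstep.
destruct (L_taylor_t F G s T hs hF hG hl hstep) as [M [hM h]].
assert (hd : 0 < Rmin (t - s) (T - t)) by (apply Rmin_glb_lt; lra).
apply quadratic_is_derive with M (Rmin (t - s) (T - t)); [exact hM|exact hd|].
intros y hy; apply h.
- split; [right|]; lra.
- assert (Rabs (y - t) < t - s) by (eapply Rlt_le_trans; [exact hy|apply Rmin_l]).
  assert (Rabs (y - t) < T - t) by (eapply Rlt_le_trans; [exact hy|apply Rmin_r]).
  assert (h1 := Rabs_lt_between (y - t) (t - s)); assert (h2 := Rabs_lt_between (y - t) (T - t)).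
  split; [right|]; lra.
Qed.

End Limits.

(** * Joint continuity and the constant of integration *)

Definition jcont (f : R -> R -> R) (z t : R) : Prop :=
  continuous (fun p : R * R => f (fst p) (snd p)) (z, t).

Lemma jointly_continuous_on_jcont (f : R -> R -> R) :
  jointly_continuous_on (fun t => 0 < t) f -> forall z t, 0 < t -> jcont f z t.
Proof.
intros h z t ht P hP.
generalize (h (z, t) ht P hP); unfold within, filtermap; intros hw.
assert (ho : locally (z, t) (fun p : R * R => 0 < snd p)).
{ exists (mkposreal t ht); intros [z' t'] [_ h']; simpl in *.
  change (Rabs (t' - t) < t) in h'; apply Rabs_lt_between in h'; simpl; lra. }
generalize (filter_and _ _ hw ho); apply filter_imp; intros p [h1 h2]; auto.
Qed.

Lemma jcont_jointly_continuous_on (T : R -> Prop) (f : R -> R -> R) :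
  (forall z t, T t -> jcont f z t) -> jointly_continuous_on T f.
Proof.
intros h [z t] ht P hP; generalize (h z t ht P hP).
unfold filtermap, within; apply filter_imp; auto.
Qed.

Lemma jcont_z (f : R -> R -> R) (z t : R) : jcont f z t -> continuous (fun y => f y t) z.
Proof.
intros h; apply (continuous_comp (fun y : R => (y, t)) (fun p : R * R => f (fst p) (snd p))).
- intros P [d hP]; exists d; intros y hy; apply hP; split; [exact hy|apply ball_center].
- exact h.
Qed.

Lemma jcont_t (f : R -> R -> R) (z t : R) : jcont f z t -> continuous (fun s => f z s) t.
Proof.
intros h; apply (continuous_comp (fun s : R => (z, s)) (fun p : R * R => f (fst p) (snd p))).
- intros P [d hP]; exists d; intros y hy; apply hP; split; [apply ball_center|exact hy].
- exact h.
Qed.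

Lemma jcont_continuity_2d (f : R -> R -> R) (z t : R) :
  jcont f z t -> continuity_2d_pt (fun s y => f y s) t z.
Proof.
intros h; apply continuity_2d_pt_filterlim.
intros P hP; destruct (h P hP) as [d hd]; exists d.
intros [s y] [h1 h2]; apply (hd (y, s)); split; assumption.
Qed.

Lemma d_z_periodic (f : R -> R -> R) (t : R) : periodic1 (fun z => f z t) ->
  periodic1 (fun z => d_z f z t).
Proof.
intros h z; unfold d_z, Derive; f_equal; apply Lim_ext; intros y.
replace (z + 1 + y) with (z + y + 1) by ring.
rewrite (h (z + y)), (h z); reflexivity.
Qed.

(** The equation for [v] is integrated over a period. The time derivative contributes zero because
    the mean vanishes at all positive times, diffusion contributes zero by periodicity, and
    integration by parts with [psi_z = - v] turns the transport term into twice the integral of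
    [v ^ 2]. With the [v ^ 2] of the equation this explains the factor 3. *)
Lemma constant_of_mean (nu c t : R) (u v psi : R -> R -> R) (ht : 0 < t) (hnu : 0 <= nu)
  (pv : forall s, 0 < s -> periodic1 (fun z => v z s))
  (ppsi : forall s, 0 < s -> periodic1 (fun z => psi z s))
  (hpsi : forall z s, 0 < s -> is_derive (fun y => psi y s) z (- v z s))
  (hu : forall z, continuous (fun y => u y t) z)
  (cv : forall z s, 0 < s -> continuous (fun y => v y s) z)
  (ht_ex : forall z s, 0 < s -> ex_derive (fun r => v z r) s)
  (ht_c : forall z s, 0 < s -> jcont (d_t v) z s)
  (hz_ex : forall z, ex_derive (fun y => v y t) z)
  (hz_c : forall z, continuous (fun y => d_z v y t) z)
  (hzz_ex : 0 < nu -> forall z, ex_derive (fun y => d_z v y t) z)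
  (hzz_c : 0 < nu -> forall z, continuous (fun y => d_zz v y t) z)
  (heq : forall z, d_t v z t + 2 * psi z t * d_z v z t
    = nu * d_zz v z t + u z t ^ 2 - v z t ^ 2 + c) :
  c = c_of u v t.
Proof.
assert (hmean : forall s, 0 < s -> RInt (fun z => v z s) 0 1 = 0).
{ intros s hs; apply is_RInt_unique.
  apply is_RInt_ext with (fun z => opp (- v z s)); [intros; apply Ropp_involutive|].
  replace 0 with (opp (minus (psi 1 s) (psi 0 s))) at 2.
  - apply (is_RInt_opp (V := R_NormedModule)), (is_RInt_derive (fun z => psi z s)).
    + intros x _; apply hpsi, hs.
    + intros x _; apply (continuous_opp (fun z => v z s)), cv, hs.
  - generalize (ppsi s hs 0); rewrite Rplus_0_l; intros e.
    rewrite e; unfold minus, plus, opp; simpl; ring. }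
assert (h1 : is_RInt (fun z => d_t v z t) 0 1 0).
{ assert (hloc : locally t (fun s => 0 < s)).
  { exists (mkposreal t ht); intros y hy; change (Rabs (y - t) < t) in hy.
    apply Rabs_lt_between in hy; lra. }
  assert (hd : is_derive (fun s => RInt (fun z => v z s) 0 1) t (RInt (fun z => d_t v z t) 0 1)).
  { apply (is_derive_RInt_param (fun s z => v z s) 0 1 t).
    - revert hloc; apply filter_imp; intros s hs z _; apply ht_ex, hs.
    - intros z _; apply (jcont_continuity_2d (d_t v)), ht_c, ht.
    - revert hloc; apply filter_imp; intros s hs.
      apply (ex_RInt_continuous (V := R_CompleteNormedModule)); intros z _; apply cv, hs. }
  assert (hd0 : is_derive (fun s => RInt (fun z => v z s) 0 1) t 0).
  { apply is_derive_ext_loc with (fun _ => 0); [|apply (is_derive_const 0)].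
    revert hloc; apply filter_imp; intros s hs; symmetry; apply hmean, hs. }
  replace 0 with (RInt (fun z => d_t v z t) 0 1) at 2.
  - apply (RInt_correct (V := R_CompleteNormedModule)).
    apply (ex_RInt_continuous (V := R_CompleteNormedModule)); intros z _; apply jcont_z, ht_c, ht.
  - rewrite <- (is_derive_unique _ _ _ hd); apply is_derive_unique, hd0. }
assert (hvv : forall z, continuous (fun z => v z t ^ 2) z).
{ intros z; apply (continuous_ext (fun z => v z t * v z t)); [intros; simpl; ring|].
  apply (continuous_mult (fun z => v z t) (fun z => v z t)); apply cv, ht. }
assert (huu : forall z, continuous (fun z => u z t ^ 2) z).
{ intros z; apply (continuous_ext (fun z => u z t * u z t)); [intros; simpl; ring|].
  apply (continuous_mult (fun z => u z t) (fun z => u z t)); apply hu. }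
assert (iv : is_RInt (fun z => v z t ^ 2) 0 1 (RInt (fun z => v z t ^ 2) 0 1)).
{ apply (RInt_correct (V := R_CompleteNormedModule)).
  apply (ex_RInt_continuous (V := R_CompleteNormedModule)); intros; apply hvv. }
assert (iu : is_RInt (fun z => u z t ^ 2) 0 1 (RInt (fun z => u z t ^ 2) 0 1)).
{ apply (RInt_correct (V := R_CompleteNormedModule)).
  apply (ex_RInt_continuous (V := R_CompleteNormedModule)); intros; apply huu. }
assert (h2 : is_RInt (fun z => - v z t * v z t + psi z t * d_z v z t) 0 1 0).
{ replace 0 with (minus (psi 1 t * v 1 t) (psi 0 t * v 0 t)) at 2.
  - apply (is_RInt_derive (fun z => psi z t * v z t)).
    + intros z _; apply (is_derive_mult (fun z => psi z t) (fun z => v z t) z).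
      * apply hpsi, ht.
      * apply Derive_correct, hz_ex.
      * intros; apply Rmult_comm.
    + intros z _; apply (continuous_plus (fun z => - v z t * v z t) (fun z => psi z t * d_z v z t)).
      * apply (continuous_mult (fun z => - v z t) (fun z => v z t));
          [apply (continuous_opp (fun z => v z t))|]; apply cv, ht.
      * apply (continuous_mult (fun z => psi z t) (fun z => d_z v z t)); [|apply hz_c].
        apply (ex_derive_continuous (fun z => psi z t)); eexists; apply hpsi, ht.
  - generalize (ppsi t ht 0) (pv t ht 0); rewrite Rplus_0_l; intros e1 e2; rewrite e1, e2.
    unfold minus, plus, opp; simpl; ring. }
(* For [nu = 0] the function [d_zz v] may be arbitrary, so its product with zero is integrated
   directly. *)
assert (h3 : is_RInt (fun z => nu * d_zz v z t) 0 1 0).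
{ destruct (Rle_lt_or_eq_dec 0 nu hnu) as [hn|hn].
  - replace 0 with (scal nu (minus (d_z v 1 t) (d_z v 0 t))) at 2.
    + apply (is_RInt_scal (V := R_NormedModule) (fun z => d_zz v z t)).
      apply (is_RInt_derive (fun z => d_z v z t)).
      * intros z _; apply Derive_correct, hzz_ex, hn.
      * intros z _; apply hzz_c, hn.
    + generalize (d_z_periodic v t (pv t ht) 0); rewrite Rplus_0_l; intros e; rewrite e.
      unfold minus, plus, opp, scal; simpl; unfold mult; simpl; ring.
  - rewrite <- hn; apply is_RInt_ext with (fun _ => 0); [intros z _; symmetry; apply Rmult_0_l|].
    replace 0 with (scal (1 - 0) 0) at 2 by (unfold scal; simpl; unfold mult; simpl; ring).
    apply (is_RInt_const 0 1 0). }
assert (hc : is_RInt (fun _ => c) 0 1 (scal (1 - 0) c)) by apply (is_RInt_const 0 1 c).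
set (IV := RInt (fun z => v z t ^ 2) 0 1) in *.
set (IU := RInt (fun z => u z t ^ 2) 0 1) in *.
assert (hc' : is_RInt (fun _ => c) 0 1 (plus (plus 0 (scal 2 0))
  (plus (plus (scal 3 IV) (opp IU)) (opp 0)))).
{ apply is_RInt_ext with (fun z => plus (plus (d_t v z t)
    (scal 2 (- v z t * v z t + psi z t * d_z v z t)))
    (plus (plus (scal 3 (v z t ^ 2)) (opp (u z t ^ 2))) (opp (nu * d_zz v z t)))).
  { intros z _; generalize (heq z); unfold plus, scal, opp; simpl; unfold mult; simpl; lra. }
  apply (is_RInt_plus (V := R_NormedModule)).
  - apply (is_RInt_plus (V := R_NormedModule)); [exact h1|].
    apply (is_RInt_scal (V := R_NormedModule)), h2.
  - apply (is_RInt_plus (V := R_NormedModule)).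
    + apply (is_RInt_plus (V := R_NormedModule)).
      * apply (is_RInt_scal (V := R_NormedModule)), iv.
      * apply (is_RInt_opp (V := R_NormedModule)), iu.
    + apply (is_RInt_opp (V := R_NormedModule)), h3. }
apply (is_RInt_unique (V := R_CompleteNormedModule)) in hc.
apply (is_RInt_unique (V := R_CompleteNormedModule)) in hc'.
unfold c_of; fold IV IU.
rewrite hc in hc'; revert hc'; unfold plus, scal, opp; simpl; unfold mult; simpl; lra.
Qed.

(** * The viscous equations in the limit *)

Lemma im_le_Cmod (z : C) : Rabs (snd z) <= Cmod z.
Proof. eapply Rle_trans; [apply Rmax_r|apply Rmax_Cmod]. Qed.

Definition reF (F : nat -> nat -> Z -> C) (N k : nat) (i : Z) : R := fst (F N k i).
Definition imF (F : nat -> nat -> Z -> C) (N k : nat) (i : Z) : R := snd (F N k i).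

Lemma bddR_re (nu s T : R) F : bddF nu s T F -> bddR nu s T (reF F).
Proof.
intros [M [hM h]]; exists M; split; [exact hM|]; revert h; apply filter_imp.
intros N [hN h]; split; [exact hN|]; intros k i hk.
eapply Rle_trans; [apply re_le_Cmod|apply h, hk].
Qed.

Lemma bddR_im (nu s T : R) F : bddF nu s T F -> bddR nu s T (imF F).
Proof.
intros [M [hM h]]; exists M; split; [exact hM|]; revert h; apply filter_imp.
intros N [hN h]; split; [exact hN|]; intros k i hk.
eapply Rle_trans; [apply im_le_Cmod|apply h, hk].
Qed.

Lemma lipR_re (nu s T : R) F : lipF nu s T F -> lipR nu s T (reF F).
Proof.
intros [M [hM h]]; exists M; split; [exact hM|]; revert h; apply filter_imp.
intros N [hN h]; split; [exact hN|]; intros k i hk hk'.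
eapply Rle_trans; [|apply (h k i hk hk')].
eapply Rle_trans; [|apply re_le_Cmod]; right; reflexivity.
Qed.

Lemma lipR_im (nu s T : R) F : lipF nu s T F -> lipR nu s T (imF F).
Proof.
intros [M [hM h]]; exists M; split; [exact hM|]; revert h; apply filter_imp.
intros N [hN h]; split; [exact hN|]; intros k i hk hk'.
eapply Rle_trans; [|apply (h k i hk hk')].
eapply Rle_trans; [|apply im_le_Cmod]; right; reflexivity.
Qed.

Lemma rdiff_re F : rdiff (reF F) = reF (fun N k => diffZ (INR N) (F N k)).
Proof.
do 3 (apply functional_extensionality; intro); unfold rdiff, reF, diffZ; simpl; ring.
Qed.

Lemma rdiff_im F : rdiff (imF F) = imF (fun N k => diffZ (INR N) (F N k)).
Proof.
do 3 (apply functional_extensionality; intro); unfold rdiff, imF, diffZ; simpl; ring.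
Qed.

Section Viscous.
Variables (nu : R) (UF : (nat -> Prop) -> Prop) (W : nat -> nat -> Z -> C) (K : R) (UT : R -> R).
Hypothesis hnu : 0 < nu.
Hypothesis hU : limit_filter UF.
Hypothesis hW : scheme_family nu W K UT.

Let hFU : ProperFilter UF := proj1 hU.
#[local] Existing Instance hFU.

(** Lattice counterparts of the quantities in the limit: [VF j] and [WF j] of the [j]-th space
    derivatives of [v] and [u], [BF] of [2 psi], [CF] of the constant of integration, [RVF] and
    [RWF] of [v_t] and [u_t]. *)
Definition VF (j : nat) := reF (fun N k => diffn (INR N) j (W N k)).
Definition WF (j : nat) := imF (fun N k => diffn (INR N) j (W N k)).
Definition BF := reF (fun N k => velZ N (W N k)).
Definition CF := reF (fun N k (_ : Z) => cstZ N (W N k)).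
Definition RVF := reF (fun N k => rateZ nu N (W N k)).
Definition RWF := imF (fun N k => rateZ nu N (W N k)).

Lemma range_pos (t : R) : 0 < t -> in_range (t / 2) (t + 1) t.
Proof. intros; split; [right|]; lra. Qed.

Lemma range_zero (t : R) : 0 <= t -> in_range 0 (t + 1) t.
Proof. intros; split; [left|]; lra. Qed.

Lemma VF_bdd (j : nat) (s T : R) : 0 < s -> 0 <= T -> bddR nu s T (VF j).
Proof. intros; apply bddR_re, (bddF_W nu W K UT hnu hW); auto. Qed.

Lemma WF_bdd (j : nat) (s T : R) : 0 < s -> 0 <= T -> bddR nu s T (WF j).
Proof. intros; apply bddR_im, (bddF_W nu W K UT hnu hW); auto. Qed.

Lemma VF_bdd0 (j : nat) (T : R) : (j <= 1)%nat -> 0 <= T -> bddR nu 0 T (VF j).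
Proof. intros; apply bddR_re, (bddF_W1 nu W K UT hnu hW); auto. Qed.

Lemma WF_bdd0 (j : nat) (T : R) : (j <= 1)%nat -> 0 <= T -> bddR nu 0 T (WF j).
Proof. intros; apply bddR_im, (bddF_W1 nu W K UT hnu hW); auto. Qed.

Lemma VF_diff (j : nat) : rdiff (VF j) = VF (S j).
Proof. apply rdiff_re. Qed.

Lemma WF_diff (j : nat) : rdiff (WF j) = WF (S j).
Proof. apply rdiff_im. Qed.

Lemma VF_lip (j : nat) (s T : R) : 0 < s -> 0 <= T -> lipR nu s T (VF j).
Proof. intros; apply lipR_re, (lipF_W nu W K UT hnu hW); auto. Qed.

Lemma WF_lip (j : nat) (s T : R) : 0 < s -> 0 <= T -> lipR nu s T (WF j).
Proof. intros; apply lipR_im, (lipF_W nu W K UT hnu hW); auto. Qed.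

Lemma RVF_bdd (s T : R) : 0 < s -> 0 <= T -> bddR nu s T RVF /\ bddR nu s T (rdiff RVF) /\ lipR nu s T RVF.
Proof.
intros hs hT; split; [|split].
- apply bddR_re, (bddF_diff_rate nu W K UT hnu hW 0); auto.
- unfold RVF; rewrite rdiff_re; apply bddR_re, (bddF_diff_rate nu W K UT hnu hW 1); auto.
- apply lipR_re, (lipF_rate nu W K UT hnu hW); auto.
Qed.

Lemma RWF_bdd (s T : R) : 0 < s -> 0 <= T -> bddR nu s T RWF /\ bddR nu s T (rdiff RWF) /\ lipR nu s T RWF.
Proof.
intros hs hT; split; [|split].
- apply bddR_im, (bddF_diff_rate nu W K UT hnu hW 0); auto.
- unfold RWF; rewrite rdiff_im; apply bddR_im, (bddF_diff_rate nu W K UT hnu hW 1); auto.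
- apply lipR_im, (lipF_rate nu W K UT hnu hW); auto.
Qed.

Lemma L_jcont (F : nat -> nat -> Z -> R) (z t : R) : 0 < t ->
  (forall s T, 0 < s -> 0 <= T -> bddR nu s T F /\ bddR nu s T (rdiff F) /\ lipR nu s T F) ->
  jcont (L nu UF F) z t.
Proof.
intros ht h; destruct (h (t / 2) (2 * t) ltac:(lra) ltac:(lra)) as [h1 [h2 h3]].
destruct (L_lip_z nu UF hnu hU F _ _ h1 h2) as [A [hA ha]].
destruct (L_lip_t nu UF hnu hU F (t / 2) (2 * t) ltac:(lra) h1 h3) as [B [hB hb]].
apply filterlim_locally; intros eps; simpl.
assert (he : 0 < eps / (A + B + 1)) by (apply Rdiv_lt_0_compat; [apply cond_pos|lra]).
assert (hd : 0 < Rmin (t / 2) (eps / (A + B + 1))) by (apply Rmin_glb_lt; lra).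
exists (mkposreal _ hd); intros [z' t'] [k1 k2].
change (Rabs (z' - z) < Rmin (t / 2) (eps / (A + B + 1))) in k1.
change (Rabs (t' - t) < Rmin (t / 2) (eps / (A + B + 1))) in k2.
change (Rabs (L nu UF F z' t' - L nu UF F z t) < eps).
assert (k3 : Rabs (t' - t) < t / 2) by (eapply Rlt_le_trans; [exact k2|apply Rmin_l]).
assert (k4 : Rabs (t' - t) < eps / (A + B + 1)) by (eapply Rlt_le_trans; [exact k2|apply Rmin_r]).
assert (k5 : Rabs (z' - z) < eps / (A + B + 1)) by (eapply Rlt_le_trans; [exact k1|apply Rmin_r]).
apply Rabs_lt_between in k3.
assert (r1 : in_range (t / 2) (2 * t) t) by (split; [right|]; lra).
assert (r2 : in_range (t / 2) (2 * t) t') by (split; [right|]; lra).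
replace (L nu UF F z' t' - L nu UF F z t) with
  ((L nu UF F z' t' - L nu UF F z t') + (L nu UF F z t' - L nu UF F z t)) by ring.
eapply Rle_lt_trans; [apply Rabs_triang|].
generalize (ha z z' t' r2) (hb z t t' r1 r2); intros k6 k7.
assert (A * Rabs (z' - z) <= A * (eps / (A + B + 1))) by (apply Rmult_le_compat_l; lra).
assert (B * Rabs (t' - t) <= B * (eps / (A + B + 1))) by (apply Rmult_le_compat_l; lra).
assert ((A + B + 1) * (eps / (A + B + 1)) = eps) by (field; lra).
lra.
Qed.

Lemma VF_jcont (j : nat) (z t : R) : 0 < t -> jcont (L nu UF (VF j)) z t.
Proof.
intros ht; apply L_jcont; [exact ht|]; intros s T hs hT; split; [|split].
- apply VF_bdd; auto.
- rewrite VF_diff; apply VF_bdd; auto.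
- apply VF_lip; auto.
Qed.

Lemma WF_jcont (j : nat) (z t : R) : 0 < t -> jcont (L nu UF (WF j)) z t.
Proof.
intros ht; apply L_jcont; [exact ht|]; intros s T hs hT; split; [|split].
- apply WF_bdd; auto.
- rewrite WF_diff; apply WF_bdd; auto.
- apply WF_lip; auto.
Qed.

Lemma VF_is_derive (j : nat) (z t : R) : 0 < t ->
  is_derive (fun y => L nu UF (VF j) y t) z (L nu UF (VF (S j)) z t).
Proof.
intros ht; rewrite <- VF_diff.
apply (L_is_derive_z nu UF hnu hU (VF j) (t / 2) (t + 1));
  [| | |apply range_pos, ht]; rewrite ?VF_diff; apply VF_bdd; lra.
Qed.

Lemma WF_is_derive (j : nat) (z t : R) : 0 < t ->
  is_derive (fun y => L nu UF (WF j) y t) z (L nu UF (WF (S j)) z t).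
Proof.
intros ht; rewrite <- WF_diff.
apply (L_is_derive_z nu UF hnu hU (WF j) (t / 2) (t + 1));
  [| | |apply range_pos, ht]; rewrite ?WF_diff; apply WF_bdd; lra.
Qed.

Lemma VF_is_derive_t (z t : R) : 0 < t ->
  is_derive (fun r => L nu UF (VF 0) z r) t (L nu UF RVF z t).
Proof.
intros ht; destruct (RVF_bdd (t / 2) (t + 1) ltac:(lra) ltac:(lra)) as [h1 [_ h3]].
apply (L_is_derive_t nu UF hnu hU (VF 0) RVF (t / 2) (t + 1)); auto; try lra.
- apply VF_bdd; lra.
- generalize (tau_INR_small nu 1 hnu Rlt_0_1); apply filter_imp; intros N [hN _] k i.
  unfold VF, RVF, reF; simpl; rewrite (proj1 hW), stepZ_rateZ by auto; simpl; ring.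
Qed.

Lemma WF_is_derive_t (z t : R) : 0 < t ->
  is_derive (fun r => L nu UF (WF 0) z r) t (L nu UF RWF z t).
Proof.
intros ht; destruct (RWF_bdd (t / 2) (t + 1) ltac:(lra) ltac:(lra)) as [h1 [_ h3]].
apply (L_is_derive_t nu UF hnu hU (WF 0) RWF (t / 2) (t + 1)); auto; try lra.
- apply WF_bdd; lra.
- generalize (tau_INR_small nu 1 hnu Rlt_0_1); apply filter_imp; intros N [hN _] k i.
  unfold WF, RWF, imF; simpl; rewrite (proj1 hW), stepZ_rateZ by auto; simpl; ring.
Qed.

Lemma BF_bdd (T : R) : 0 <= T -> bddR nu 0 T BF.
Proof. intros; apply bddR_re, (bddF_vel nu W K UT hnu hW); auto. Qed.

Lemma BF_diff (T : R) : 0 <= T -> eventually (fun N => (0 < N)%nat /\ forall k i,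
  INR k * tau nu N <= T -> rdiff BF N k i = - (VF 0 N k i + VF 0 N k (i + 1)%Z)).
Proof.
intros hT; generalize (eventually_and _ _ (tau_INR_small nu 1 hnu Rlt_0_1)
  (vel_diff nu W K UT hnu hW T hT)); apply filter_imp; intros N [[hN _] h].
split; [exact hN|]; intros k i hk; unfold BF; rewrite rdiff_re; unfold reF; rewrite h by exact hk.
unfold VF, reF; simpl; ring.
Qed.

Lemma BF_diff_bdd (T : R) : 0 <= T -> bddR nu 0 T (rdiff BF).
Proof.
intros hT; destruct (VF_bdd0 0 T (Nat.le_0_l _) hT) as [M [hM h]].
exists (2 * M); split; [lra|].
generalize (eventually_and _ _ h (BF_diff T hT)); apply filter_imp.
intros N [[hN h1] [_ h2]]; split; [exact hN|]; intros k i hk.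
rewrite h2, Rabs_Ropp by lra; eapply Rle_trans; [apply Rabs_triang|].
generalize (h1 k i hk) (h1 k (i + 1)%Z hk); lra.
Qed.

Lemma BF_diff2_bdd (T : R) : 0 <= T -> bddR nu 0 T (rdiff (rdiff BF)).
Proof.
intros hT; destruct (VF_bdd0 1 T (le_n _) hT) as [M [hM h]].
exists (2 * M); split; [lra|].
generalize (eventually_and _ _ h (BF_diff T hT)); apply filter_imp.
intros N [[hN h1] [_ h2]]; split; [exact hN|]; intros k i hk.
unfold rdiff at 1; rewrite !h2 by lra.
replace (INR N * (- (VF 0 N k (i + 1)%Z + VF 0 N k (i + 1 + 1)%Z) - - (VF 0 N k i + VF 0 N k (i + 1)%Z)))
  with (- (rdiff (VF 0) N k i + rdiff (VF 0) N k (i + 1)%Z)) by (unfold rdiff; ring).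
rewrite VF_diff, Rabs_Ropp; eapply Rle_trans; [apply Rabs_triang|].
generalize (h1 k i hk) (h1 k (i + 1)%Z hk); lra.
Qed.

(** Neighbouring lattice points may be identified in the limit. This is how the asymmetries of the
    scheme disappear. *)
Lemma samp_step_small (F : nat -> nat -> Z -> R) (s T z t C d : R) (m : Z) : 0 < d ->
  in_range s T t -> bddR nu s T (rdiff F) -> m = 1%Z \/ m = (-1)%Z -> 0 <= C ->
  eventually (fun N => C * Rabs (F N (kidx nu N t) (zidx N z + m)%Z - F N (kidx nu N t) (zidx N z)) <= d).
Proof.
intros hd ht [M [hM h]] hm hC.
generalize (eventually_and _ _ (eventually_and _ _ h (range_kidx nu hnu s T t ht))
  (inv_INR_small (C * M) d hd)); apply filter_imp.
intros N [[[hN h1] [_ h2]] h3].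
assert (hq : 0 < INR N) by (apply lt_0_INR, hN).
eapply Rle_trans; [|exact h3]; rewrite Rmult_assoc; apply Rmult_le_compat_l; [exact hC|].
eapply Rle_trans; [apply (lattice_lip (F N (kidx nu N t)) (INR N) M hq (fun i => h1 _ i h2))|].
apply Rmult_le_compat_l; [exact hM|]; right.
unfold Rdiv; rewrite Rabs_mult, (Rabs_pos_eq (/ INR N)) by (left; apply Rinv_0_lt_compat, hq).
destruct hm as [->| ->].
- rewrite Rabs_R1; ring.
- rewrite Rabs_left by lra; ring.
Qed.

(** Valid up to [t = 0], unlike the derivatives of [u] and [v]: two differences of the velocity cost
    only one of [w], and first differences are bounded from the initial time on. The relation for
    [BF] involves [v] at two neighbouring points, which merge in the limit and give the factor 2. *)
Lemma BF_is_derive (z t : R) : 0 <= t ->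
  is_derive (fun y => L nu UF BF y t / 2) z (- L nu UF (VF 0) z t).
Proof.
intros ht; assert (hT : 0 <= t + 1) by lra.
assert (hd := L_is_derive_z nu UF hnu hU BF 0 (t + 1) z t (BF_bdd _ hT) (BF_diff_bdd _ hT)
  (BF_diff2_bdd _ hT) (range_zero t ht)).
assert (e : L nu UF (rdiff BF) z t = -2 * L nu UF (VF 0) z t).
{ apply (ulim_unique UF hU (samp nu (rdiff BF) z t)).
  - apply (L_cv nu UF hnu hU _ 0 (t + 1)); [apply BF_diff_bdd, hT|apply range_zero, ht].
  - apply (cv_close UF hU (fun N => -2 * samp nu (VF 0) z t N + 0 * samp nu (VF 0) z t N)).
    + replace (-2 * L nu UF (VF 0) z t) with (-2 * L nu UF (VF 0) z t + 0 * L nu UF (VF 0) z t) by ring.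
      apply (cv_lin UF hU); apply (L_cv nu UF hnu hU _ 0 (t + 1)); try apply range_zero, ht;
        apply VF_bdd0; auto.
    + intros d hd0.
      assert (hb1 : bddR nu 0 (t + 1) (rdiff (VF 0))) by (rewrite VF_diff; apply VF_bdd0; auto).
      generalize (eventually_and _ _ (eventually_and _ _ (BF_diff (t + 1) hT)
         (range_kidx nu hnu 0 (t + 1) t (range_zero t ht)))
         (samp_step_small (VF 0) 0 (t + 1) z t 1 d 1 hd0 (range_zero t ht) hb1
            (or_introl eq_refl) Rle_0_1)).
      apply filter_imp; intros N [[[hN h1] [_ h2]] h3].
      unfold samp; rewrite h1 by apply h2; rewrite <- Rabs_Ropp; rewrite Rmult_1_l in h3.
      match goal with |- Rabs ?e <= _ => match type of h3 with Rabs ?e' <= _ =>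
        replace e with e' by ring end end; exact h3. }
rewrite e in hd.
replace (- L nu UF (VF 0) z t) with (/ 2 * (-2 * L nu UF (VF 0) z t)) by field.
apply is_derive_ext with (fun y => / 2 * L nu UF BF y t).
- intros y; apply Rmult_comm.
- apply (is_derive_scal (fun y => L nu UF BF y t) z (/ 2)); exact hd.
Qed.

(** The identity defining the rate holds exactly on the lattice, and its terms converge separately,
    products included. [L nu UF CF 0 t] remains an unidentified function of time at this stage. *)
Lemma VF_equation (z t : R) : 0 < t ->
  L nu UF RVF z t = nu * L nu UF (VF 2) z t + L nu UF CF 0 t - L nu UF BF z t * L nu UF (VF 1) z t
    - L nu UF (VF 0) z t * L nu UF (VF 0) z t + L nu UF (WF 0) z t * L nu UF (WF 0) z t.
Proof.
intros ht; assert (hs : 0 < t / 2) by lra; assert (hT : 0 <= t + 1) by lra.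
assert (hr := range_pos t ht); assert (hr0 := range_zero t (Rlt_le _ _ ht)).
assert (cvV : forall j, filterlim (samp nu (VF j) z t) UF (locally (L nu UF (VF j) z t)))
  by (intros j; apply (L_cv nu UF hnu hU _ (t / 2) (t + 1)); [apply VF_bdd; auto|exact hr]).
assert (cvW : forall j, filterlim (samp nu (WF j) z t) UF (locally (L nu UF (WF j) z t)))
  by (intros j; apply (L_cv nu UF hnu hU _ (t / 2) (t + 1)); [apply WF_bdd; auto|exact hr]).
assert (cvB : filterlim (samp nu BF z t) UF (locally (L nu UF BF z t)))
  by (apply (L_cv nu UF hnu hU _ 0 (t + 1)); [apply BF_bdd; auto|exact hr0]).
assert (cvC : filterlim (samp nu CF 0 t) UF (locally (L nu UF CF 0 t))).
{ apply (L_cv nu UF hnu hU _ 0 (t + 1)); [|exact hr0].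
  apply bddR_re, (bddF_cst nu W K UT hnu hW); auto. }
apply (ulim_unique UF hU (samp nu RVF z t)).
{ apply (L_cv nu UF hnu hU _ (t / 2) (t + 1)); [apply RVF_bdd; auto|exact hr]. }
apply (cv_close UF hU (fun N => 1 * (nu * samp nu (VF 2) z t N + 1 * samp nu CF 0 t N) +
  (-1) * (1 * (samp nu BF z t N * samp nu (VF 1) z t N) +
    1 * (1 * (samp nu (VF 0) z t N * samp nu (VF 0) z t N) +
         (-1) * (samp nu (WF 0) z t N * samp nu (WF 0) z t N))))).
{ replace (nu * L nu UF (VF 2) z t + L nu UF CF 0 t - L nu UF BF z t * L nu UF (VF 1) z t
    - L nu UF (VF 0) z t * L nu UF (VF 0) z t + L nu UF (WF 0) z t * L nu UF (WF 0) z t) with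
   (1 * (nu * L nu UF (VF 2) z t + 1 * L nu UF CF 0 t) + (-1) * (1 * (L nu UF BF z t * L nu UF (VF 1) z t) +
    1 * (1 * (L nu UF (VF 0) z t * L nu UF (VF 0) z t) + (-1) * (L nu UF (WF 0) z t * L nu UF (WF 0) z t)))) by ring.
  apply (cv_lin UF hU); [apply (cv_lin UF hU); auto|].
  apply (cv_lin UF hU (fun N => samp nu BF z t N * samp nu (VF 1) z t N)); [apply (cv_mult UF hU); auto|].
  apply (cv_lin UF hU (fun N => samp nu (VF 0) z t N * samp nu (VF 0) z t N)
    (fun N => samp nu (WF 0) z t N * samp nu (WF 0) z t N)); apply (cv_mult UF hU); auto. }
intros d hd.
destruct (BF_bdd (t + 1) hT) as [B [hB hb]].
assert (hb3 : bddR nu (t / 2) (t + 1) (rdiff (VF 2))) by (rewrite VF_diff; apply VF_bdd; auto).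
assert (hb2 : bddR nu (t / 2) (t + 1) (rdiff (VF 1))) by (rewrite VF_diff; apply VF_bdd; auto).
generalize (eventually_and _ _ (eventually_and _ _ hb (range_kidx nu hnu 0 (t + 1) t hr0))
  (eventually_and _ _
  (samp_step_small (VF 2) _ _ z t nu (d / 2) (-1) ltac:(lra) hr hb3 (or_intror eq_refl) (Rlt_le _ _ hnu))
  (samp_step_small (VF 1) _ _ z t B (d / 2) (-1) ltac:(lra) hr hb2 (or_intror eq_refl) hB))).
apply filter_imp; intros N [[[hN h1] [_ h2]] [h3 h4]].
specialize (h1 (kidx nu N t) (zidx N z) h2).
unfold samp, RVF, CF, reF, rateZ, resZ, cdiffZ.
unfold VF, WF, BF, reF, imF in *; cbn [diffn] in h3, h4 |- *.
match goal with |- Rabs ?e <= _ => set (lhs := e) end.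
set (k := kidx nu N t) in *; set (i := zidx N z) in *.
change (fst (velZ N (W N k) i)) with (fst (velZ N (W N k) i)) in h1.
(* Only two terms are out of place, the second difference taken at [i - 1] and the backward half of
   the centred difference; everything else cancels. *)
replace lhs with
  (nu * (fst (diffZ (INR N) (diffZ (INR N) (W N k)) (i + -1)%Z)
     - fst (diffZ (INR N) (diffZ (INR N) (W N k)) i))
   + - (fst (velZ N (W N k) i) * ((fst (diffZ (INR N) (W N k) (i + -1)%Z)
     - fst (diffZ (INR N) (W N k) i)) / 2))).
2:{ unfold lhs; unfold Z.sub; simpl (- (1))%Z.
    rewrite (velZ_real N (W N k) i).
    generalize (diffZ (INR N) (diffZ (INR N) (W N k)) (i + -1)%Z)
      (diffZ (INR N) (diffZ (INR N) (W N k)) i) (diffZ (INR N) (W N k) (i + -1)%Z)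
      (diffZ (INR N) (W N k) i) (W N k i) (fst (velZ N (W N k) i)) (cstZ N (W N k)).
    intros [a a'] [b b'] [c c'] [e e'] [f f'] g [l l']; simpl; field. }
eapply Rle_trans; [apply Rabs_triang|]; rewrite Rabs_Ropp, !Rabs_mult, (Rabs_pos_eq nu) by lra.
unfold Rdiv at 1; rewrite Rabs_mult, (Rabs_pos_eq (/ 2)) by lra.
match type of h4 with _ * ?x <= _ => assert (0 <= x) by apply Rabs_pos;
  assert (Rabs (fst (velZ N (W N k) i)) * (x * / 2) <= B * (x * / 2))
   by (apply Rmult_le_compat_r; [lra|exact h1]); assert (B * (x * / 2) <= B * x) by nra end.
lra.
Qed.

Lemma WF_equation (z t : R) : 0 < t ->
  L nu UF RWF z t = nu * L nu UF (WF 2) z t - L nu UF BF z t * L nu UF (WF 1) z t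
    - 2 * (L nu UF (VF 0) z t * L nu UF (WF 0) z t).
Proof.
intros ht; assert (hs : 0 < t / 2) by lra; assert (hT : 0 <= t + 1) by lra.
assert (hr := range_pos t ht); assert (hr0 := range_zero t (Rlt_le _ _ ht)).
assert (cvV : forall j, filterlim (samp nu (VF j) z t) UF (locally (L nu UF (VF j) z t)))
  by (intros j; apply (L_cv nu UF hnu hU _ (t / 2) (t + 1)); [apply VF_bdd; auto|exact hr]).
assert (cvW : forall j, filterlim (samp nu (WF j) z t) UF (locally (L nu UF (WF j) z t)))
  by (intros j; apply (L_cv nu UF hnu hU _ (t / 2) (t + 1)); [apply WF_bdd; auto|exact hr]).
assert (cvB : filterlim (samp nu BF z t) UF (locally (L nu UF BF z t)))
  by (apply (L_cv nu UF hnu hU _ 0 (t + 1)); [apply BF_bdd; auto|exact hr0]).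
apply (ulim_unique UF hU (samp nu RWF z t)).
{ apply (L_cv nu UF hnu hU _ (t / 2) (t + 1)); [apply RWF_bdd; auto|exact hr]. }
apply (cv_close UF hU (fun N => nu * samp nu (WF 2) z t N +
  (-1) * (1 * (samp nu BF z t N * samp nu (WF 1) z t N) +
     2 * (samp nu (VF 0) z t N * samp nu (WF 0) z t N)))).
{ replace (nu * L nu UF (WF 2) z t - L nu UF BF z t * L nu UF (WF 1) z t - 2 * (L nu UF (VF 0) z t * L nu UF (WF 0) z t)) with
   (nu * L nu UF (WF 2) z t + (-1) * (1 * (L nu UF BF z t * L nu UF (WF 1) z t) +
     2 * (L nu UF (VF 0) z t * L nu UF (WF 0) z t))) by ring.
  apply (cv_lin UF hU); [auto|].
  apply (cv_lin UF hU (fun N => samp nu BF z t N * samp nu (WF 1) z t N)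
    (fun N => samp nu (VF 0) z t N * samp nu (WF 0) z t N)); apply (cv_mult UF hU); auto. }
intros d hd.
destruct (BF_bdd (t + 1) hT) as [B [hB hb]].
assert (hb3 : bddR nu (t / 2) (t + 1) (rdiff (WF 2))) by (rewrite WF_diff; apply WF_bdd; auto).
assert (hb2 : bddR nu (t / 2) (t + 1) (rdiff (WF 1))) by (rewrite WF_diff; apply WF_bdd; auto).
generalize (eventually_and _ _ (eventually_and _ _ hb (range_kidx nu hnu 0 (t + 1) t hr0))
  (eventually_and _ _
  (samp_step_small (WF 2) _ _ z t nu (d / 2) (-1) ltac:(lra) hr hb3 (or_intror eq_refl) (Rlt_le _ _ hnu))
  (samp_step_small (WF 1) _ _ z t B (d / 2) (-1) ltac:(lra) hr hb2 (or_intror eq_refl) hB))).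
apply filter_imp; intros N [[[hN h1] [_ h2]] [h3 h4]].
specialize (h1 (kidx nu N t) (zidx N z) h2).
unfold samp, RWF, imF, rateZ, resZ, cdiffZ.
unfold VF, WF, BF, reF, imF in *; cbn [diffn] in h3, h4 |- *.
match goal with |- Rabs ?e <= _ => set (lhs := e) end.
set (k := kidx nu N t) in *; set (i := zidx N z) in *.
replace lhs with
  (nu * (snd (diffZ (INR N) (diffZ (INR N) (W N k)) (i + -1)%Z)
     - snd (diffZ (INR N) (diffZ (INR N) (W N k)) i))
   + - (fst (velZ N (W N k) i) * ((snd (diffZ (INR N) (W N k) (i + -1)%Z)
     - snd (diffZ (INR N) (W N k) i)) / 2))).
2:{ unfold lhs, cstZ; unfold Z.sub; simpl (- (1))%Z.
    rewrite (velZ_real N (W N k) i).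
    generalize (diffZ (INR N) (diffZ (INR N) (W N k)) (i + -1)%Z)
      (diffZ (INR N) (diffZ (INR N) (W N k)) i) (diffZ (INR N) (W N k) (i + -1)%Z)
      (diffZ (INR N) (W N k) i) (W N k i) (fst (velZ N (W N k) i)).
    intros [a a'] [b b'] [c c'] [e e'] [f f'] g; simpl; field. }
eapply Rle_trans; [apply Rabs_triang|]; rewrite Rabs_Ropp, !Rabs_mult, (Rabs_pos_eq nu) by lra.
unfold Rdiv at 1; rewrite Rabs_mult, (Rabs_pos_eq (/ 2)) by lra.
match type of h4 with _ * ?x <= _ => assert (0 <= x) by apply Rabs_pos;
  assert (Rabs (fst (velZ N (W N k) i)) * (x * / 2) <= B * (x * / 2))
   by (apply Rmult_le_compat_r; [lra|exact h1]); assert (B * (x * / 2) <= B * x) by nra end.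
lra.
Qed.

End Viscous.

(** * Initial data and the viscous solution *)

Lemma periodic1_IZR (f : R -> R) : periodic1 f -> forall n z, f (z + IZR n) = f z.
Proof.
intros hf.
assert (h : forall (m : nat) z, f (z + INR m) = f z).
{ induction m as [|m IH]; intros z; [f_equal; simpl; ring|].
  rewrite S_INR, <- Rplus_assoc, hf; apply IH. }
intros n z; destruct (Z_le_dec 0 n) as [hn|hn].
- rewrite <- (h (Z.to_nat n) z), INR_IZR_INZ, Z2Nat.id by lia; reflexivity.
- rewrite <- (h (Z.to_nat (- n)) (z + IZR n)), INR_IZR_INZ, Z2Nat.id by lia.
  f_equal; rewrite opp_IZR; ring.
Qed.

Lemma periodic1_bounded (f : R -> R) : periodic1 f -> (forall z, continuous f z) ->
  exists M, 0 <= M /\ forall z, Rabs (f z) <= M.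
Proof.
intros hf hc.
destruct (bounded_continuity (V := R_NormedModule) f 0 1 (fun x _ => hc x)) as [M hM].
assert (h : forall z, Rabs (f z) <= M).
{ intros z; destruct (base_Int_part z) as [h1 h2].
  replace (f z) with (f (z - IZR (Int_part z))).
  - left; apply (hM (z - IZR (Int_part z))); lra.
  - rewrite <- (periodic1_IZR f hf (Int_part z)); f_equal; ring. }
exists M; split; [eapply Rle_trans; [apply Rabs_pos|apply (h 0)]|exact h].
Qed.

Lemma Lipschitz_of_derive (f df : R -> R) (M : R) : (forall x, is_derive f x (df x)) ->
  (forall x, Rabs (df x) <= M) -> forall x y, Rabs (f y - f x) <= M * Rabs (y - x).
Proof.
intros hf hM x y.
destruct (MVT_gen f x y df) as [c [_ hc]].
- intros; apply hf.
- intros z _; apply continuity_pt_filterlim, (ex_derive_continuous f); eexists; apply hf.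
- rewrite hc, Rabs_mult; apply Rmult_le_compat_r; [apply Rabs_pos|apply hM].
Qed.

Lemma Derive_periodic1 (f : R -> R) : periodic1 f -> periodic1 (Derive f).
Proof. intros h; exact (d_z_periodic (fun z _ => f z) 0 h). Qed.

Lemma C1_periodic_Lipschitz (f : R -> R) : periodic1 f -> (forall z, ex_derive f z) ->
  (forall z, continuous (Derive f) z) ->
  exists M, 0 <= M /\ forall x y, Rabs (f y - f x) <= M * Rabs (y - x).
Proof.
intros hf hd hc; destruct (periodic1_bounded (Derive f) (Derive_periodic1 f hf) hc) as [M [hM h]].
exists M; split; [exact hM|]; apply (Lipschitz_of_derive f (Derive f)); auto.
intros; now apply Derive_correct.
Qed.

Lemma Cm_of_chain (m : nat) (g : nat -> R -> R) :
  (forall j z, is_derive (g j) z (g (S j) z)) -> Cm m (g O).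
Proof.
intros h.
assert (hn : forall k z, Derive_n (g O) k z = g k z).
{ induction k as [|k IH]; intros z; [reflexivity|].
  simpl; rewrite (Derive_ext _ (g k)) by apply IH; apply is_derive_unique, h. }
intros k _ z; split.
- destruct k as [|k]; [exact I|]; simpl.
  apply ex_derive_ext with (g k); [intros; symmetry; apply hn|eexists; apply h].
- apply continuous_ext with (g k); [intros; symmetry; apply hn|].
  apply (ex_derive_continuous (g k)); eexists; apply h.
Qed.

(* Sampling destroys the zero mean of [v0] by [O(1/N)], so the discrete mean is subtracted. *)
Definition init_mean (v0 : R -> R) (N : nat) : R :=
  / INR N * rsumZ N (fun i => v0 (IZR i / INR N)).

Definition init_data (u0 v0 : R -> R) (N : nat) (i : Z) : C :=
  (v0 (IZR i / INR N) - init_mean v0 N, u0 (IZR i / INR N)).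

(** The error of a Riemann sum: in each cell the increment of the primitive differs from the
    left-endpoint term by at most [K / N ^ 2], and the increments telescope to the integral, which
    is zero. *)
Lemma init_mean_le (v0 : R -> R) (K : R) (N : nat) (hN : (0 < N)%nat)
  (hc : forall z, continuous v0 z) (hK : forall x y, Rabs (v0 y - v0 x) <= K * Rabs (y - x))
  (hm : RInt v0 0 1 = 0) (hK0 : 0 <= K) : Rabs (init_mean v0 N) <= K * / INR N.
Proof.
assert (hq : 0 < INR N) by (apply lt_0_INR, hN).
assert (hi : 0 < / INR N) by (apply Rinv_0_lt_compat, hq).
set (P := fun x => RInt v0 0 x).
assert (hP : forall x, is_derive P x (v0 x)).
{ intros x; apply (is_derive_RInt v0 P 0 x); [|apply hc].
  exists (mkposreal 1 Rlt_0_1); intros y _; apply (RInt_correct (V := R_CompleteNormedModule)).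
  apply (ex_RInt_continuous (V := R_CompleteNormedModule)); auto. }
assert (hstep : forall i : nat, Rabs (P (INR (S i) / INR N) - P (INR i / INR N)
    - / INR N * v0 (INR i / INR N)) <= K * / INR N * / INR N).
{ intros i.
  assert (e : INR (S i) / INR N = INR i / INR N + / INR N) by (rewrite S_INR; field; lra).
  destruct (MVT_gen P (INR i / INR N) (INR (S i) / INR N) v0) as [c [hc1 hc2]].
  - intros; apply hP.
  - intros z _; apply continuity_pt_filterlim, (ex_derive_continuous P); eexists; apply hP.
  - rewrite e, Rmin_left, Rmax_right in hc1 by lra.
    rewrite hc2, e.
    replace (v0 c * (INR i / INR N + / INR N - INR i / INR N) - / INR N * v0 (INR i / INR N))
      with (/ INR N * (v0 c - v0 (INR i / INR N))) by ring.
    rewrite Rabs_mult, (Rabs_pos_eq (/ INR N)), (Rmult_comm _ (/ INR N)) by lra.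
    apply Rmult_le_compat_l; [lra|].
    eapply Rle_trans; [apply hK|]; apply Rmult_le_compat_l; [exact hK0|].
    rewrite Rabs_pos_eq; lra. }
assert (htel : rsum (fun i => P (INR (S i) / INR N) - P (INR i / INR N)) N = 0).
{ rewrite (rsum_telescope (fun i => P (INR i / INR N))); unfold P.
  replace (INR N / INR N) with 1 by (field; lra).
  replace (INR 0 / INR N) with 0 by (simpl; field; lra).
  rewrite hm, RInt_point; unfold zero; simpl; ring. }
assert (hs := rsum_abs_le _ _ N (fun i _ => hstep i)).
rewrite (rsum_ext _ (fun i => 1 * (P (INR (S i) / INR N) - P (INR i / INR N))
  + (- / INR N) * v0 (INR i / INR N))) in hs by (intros; ring).
rewrite (rsum_lin 1 (- / INR N) (fun i => P (INR (S i) / INR N) - P (INR i / INR N))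
   (fun i => v0 (INR i / INR N))), htel in hs.
unfold init_mean, rsumZ.
rewrite (rsum_ext _ (fun i => v0 (INR i / INR N))) by (intros k _; now rewrite (INR_IZR_INZ k)).
rewrite <- Rabs_Ropp.
replace (- (/ INR N * rsum (fun i => v0 (INR i / INR N)) N)) with
  (1 * 0 + - / INR N * rsum (fun i => v0 (INR i / INR N)) N) by ring.
eapply Rle_trans; [exact hs|]; right; field; lra.
Qed.

Section Initial.
Variables (u0 v0 : R -> R) (K : R) (N : nat).
Hypothesis hN : (0 < N)%nat.
Hypothesis pu : periodic1 u0.
Hypothesis pv : periodic1 v0.

Let hq : 0 < INR N.
Proof. apply lt_0_INR, hN. Qed.

Lemma init_periodic : periodicZ N (init_data u0 v0 N).
Proof.
intros i; unfold init_data; rewrite plus_IZR, <- INR_IZR_INZ.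
replace ((IZR i + INR N) / INR N) with (IZR i / INR N + 1) by (field; lra).
now rewrite pu, pv.
Qed.

Lemma init_zero_mean : rsumZ N (fun i => fst (init_data u0 v0 N i)) = 0.
Proof.
unfold init_data; simpl.
transitivity (rsumZ N (fun i => 1 * v0 (IZR i / INR N) + (- init_mean v0 N) * 1)).
- apply rsum_ext; intros; ring.
- rewrite (rsumZ_lin N 1 _ (fun i => v0 (IZR i / INR N)) (fun _ => 1)).
  unfold rsumZ at 2; rewrite rsum_const; unfold init_mean; field; lra.
Qed.

Lemma init_Lipschitz (hK : 0 <= K) (hu : forall x y, Rabs (u0 y - u0 x) <= K * Rabs (y - x))
  (hv : forall x y, Rabs (v0 y - v0 x) <= K * Rabs (y - x)) (i : Z) :
  Cmod (diffZ (INR N) (init_data u0 v0 N) i) <= 2 * K.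
Proof.
eapply Rle_trans; [apply Cmod_le_sum|].
assert (h : forall f : R -> R, (forall x y, Rabs (f y - f x) <= K * Rabs (y - x)) ->
  Rabs (INR N * (f (IZR (i + 1) / INR N) - f (IZR i / INR N))) <= K).
{ intros f hf; rewrite Rabs_mult, (Rabs_pos_eq (INR N)) by lra.
  generalize (hf (IZR i / INR N) (IZR (i + 1) / INR N)); rewrite plus_IZR.
  replace ((IZR i + 1) / INR N - IZR i / INR N) with (/ INR N) by (field; lra).
  rewrite (Rabs_pos_eq (/ INR N)) by (left; apply Rinv_0_lt_compat, hq); intros h1.
  apply Rle_trans with (INR N * (K * / INR N)); [apply Rmult_le_compat_l; lra|].
  right; field; lra. }
generalize (h v0 hv) (h u0 hu); intros h1 h2.
replace (fst (diffZ (INR N) (init_data u0 v0 N) i)) with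
  (INR N * (v0 (IZR (i + 1) / INR N) - v0 (IZR i / INR N)))
  by (unfold diffZ, init_data; simpl; ring).
replace (snd (diffZ (INR N) (init_data u0 v0 N) i)) with
  (INR N * (u0 (IZR (i + 1) / INR N) - u0 (IZR i / INR N)))
  by (unfold diffZ, init_data; simpl; ring).
lra.
Qed.

End Initial.

(** * Continuity of the limit at the initial time *)

Section InitialTime.
Variables (nu : R) (UF : (nat -> Prop) -> Prop) (W : nat -> nat -> Z -> C) (K : R) (UT : R -> R).
Hypothesis hnu : 0 < nu.
Hypothesis hU : limit_filter UF.
Hypothesis hW : scheme_family nu W K UT.

Lemma limit_initial_modulus (F : nat -> nat -> Z -> R) (T : R) (hT : 0 <= T) :
  F = VF W 0 \/ F = WF W 0 ->
  exists A, 0 <= A /\ forall z t rho, 0 < rho -> 0 <= t <= T ->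
    Rabs (L nu UF F z t - L nu UF F z 0) <= 2 * K * rho + t * (2 * nu * K * / rho + A).
Proof.
intros hF.
assert (hK := scheme_family_K_pos nu W K UT hW).
assert (hb : bddR nu 0 T F).
{ destruct hF as [->| ->];
    [apply (VF_bdd0 nu W K UT hnu hW)|apply (WF_bdd0 nu W K UT hnu hW)]; auto. }
destruct (initial_modulus nu W K UT hnu hW T hT) as [A [hA h]].
exists A; split; [exact hA|]; intros z t rho hrho ht.
assert (r1 : in_range 0 T t) by (split; [now left|lra]).
assert (r0 : in_range 0 T 0) by (split; [now left|lra]).
replace (L nu UF F z t - L nu UF F z 0) with
  (1 * L nu UF F z t + (-1) * L nu UF F z 0) by ring.
apply (lim_abs_le UF hU) with
  (1 := cv_lin UF hU _ _ 1 (-1) _ _ (L_cv nu UF hnu hU F 0 T z t hb r1)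
                                (L_cv nu UF hnu hU F 0 T z 0 hb r0)).
intros d hd.
generalize (eventually_and _ _ (inv_INR_small (2 * K) d hd)
  (eventually_and _ _ h (range_kidx nu hnu 0 T t r1))).
apply filter_imp; intros N [h1 [[hN h2] [_ h3]]].
assert (hq : 0 < INR N) by (apply lt_0_INR, hN).
assert (hp := tau_pos nu N hN hnu).
(* The window has [S n] points, so that its width lies between [rho] and [rho + 1 / N]. *)
destruct (nfloor_ex (rho * INR N)) as [n [hn1 hn2]]; [nra|].
assert (hr1 : rho <= INR (S n) / INR N).
{ apply Rmult_le_reg_r with (INR N); [exact hq|].
  replace (INR (S n) / INR N * INR N) with (INR (S n)) by (field; lra).
  rewrite S_INR; lra. }
assert (hr2 : INR (S n) / INR N <= rho + / INR N).
{ apply Rmult_le_reg_r with (INR N); [exact hq|].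
  replace (INR (S n) / INR N * INR N) with (INR (S n)) by (field; lra).
  replace ((rho + / INR N) * INR N) with (rho * INR N + 1) by (field; lra).
  rewrite S_INR; lra. }
destruct (h2 (kidx nu N t) (zidx N z) (S n) (Nat.lt_0_succ _) (proj2 h3)) as [g1 g2].
assert (hfin : 2 * K * (INR (S n) / INR N) + INR (kidx nu N t) * tau nu N *
   (2 * nu * K * / (INR (S n) / INR N) + A) <= 2 * K * rho + t * (2 * nu * K * / rho + A) + d).
{ assert (/ (INR (S n) / INR N) <= / rho) by (apply Rinv_le_contravar; auto).
  assert (2 * nu * K * / (INR (S n) / INR N) <= 2 * nu * K * / rho)
    by (apply Rmult_le_compat_l; [nra|auto]).
  assert (2 * K * (INR (S n) / INR N) <= 2 * K * (rho + / INR N))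
    by (apply Rmult_le_compat_l; lra).
  assert (hi : 0 < / (INR (S n) / INR N)) by (apply Rinv_0_lt_compat; lra).
  assert (0 <= nu * K) by nra.
  assert (INR (kidx nu N t) * tau nu N * (2 * nu * K * / (INR (S n) / INR N) + A)
     <= t * (2 * nu * K * / rho + A)).
  { destruct (kidx_spec nu N t hnu hN (proj1 ht)) as [k1 k2].
    apply Rmult_le_compat; [lra| |exact k1|lra].
    assert (0 <= 2 * nu * K * / (INR (S n) / INR N)) by (apply Rmult_le_pos; lra); lra. }
  lra. }
unfold samp; rewrite (kidx_0 nu N hnu hN).
match goal with |- Rabs ?e <= _ =>
  replace e with (F N (kidx nu N t) (zidx N z) - F N O (zidx N z)) by ring end.
eapply Rle_trans; [|exact hfin]; destruct hF as [->| ->]; assumption.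
Qed.

Lemma limit_jointly_continuous (F : nat -> nat -> Z -> R) : F = VF W 0 \/ F = WF W 0 ->
  jointly_continuous_on (fun t => 0 <= t) (L nu UF F).
Proof.
intros hF [z0 t0] ht0; simpl in ht0.
destruct (Rle_lt_or_eq_dec 0 t0 ht0) as [hp|hz].
{ assert (hj : jcont (L nu UF F) z0 t0).
  { destruct hF as [->| ->]; [apply (VF_jcont nu UF W K UT hnu hU hW)|
      apply (WF_jcont nu UF W K UT hnu hU hW)]; exact hp. }
  intros P hP; generalize (hj P hP); unfold filtermap, within; apply filter_imp; auto. }
subst t0.
assert (hK := scheme_family_K_pos nu W K UT hW).
destruct (limit_initial_modulus F 1 Rle_0_1 hF) as [A [hA hmod]].
assert (hb : bddR nu 0 1 F /\ bddR nu 0 1 (rdiff F)).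
{ destruct hF as [->| ->]; split; rewrite ?VF_diff, ?WF_diff;
    first [apply (VF_bdd0 nu W K UT hnu hW)|apply (WF_bdd0 nu W K UT hnu hW)];
    first [lia|lra]. }
destruct (L_lip_z nu UF hnu hU F 0 1 (proj1 hb) (proj2 hb)) as [M [hM hlip]].
apply filterlim_locally; intros eps.
assert (he := cond_pos eps).
(* The width is fixed first, making [2 * K * rho] less than [eps / 4]. The factor [B] that
   multiplies [t] grows as [rho] shrinks but is a constant from here on. *)
set (rho := eps / (8 * (K + 1))).
assert (hrho : 0 < rho) by (apply Rdiv_lt_0_compat; lra).
set (B := 2 * nu * K * / rho + A).
assert (hB : 0 <= B).
{ unfold B; assert (0 < / rho) by (apply Rinv_0_lt_compat, hrho).
  assert (0 <= nu * K) by nra.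
  assert (0 <= 2 * nu * K * / rho) by (apply Rmult_le_pos; lra); lra. }
assert (hd : 0 < Rmin 1 (eps / (4 * (B + M + 1)))).
{ apply Rmin_glb_lt; [lra|apply Rdiv_lt_0_compat; lra]. }
exists (mkposreal _ hd); intros [z t] [k1 k2] ht; simpl in ht.
change (Rabs (z - z0) < Rmin 1 (eps / (4 * (B + M + 1)))) in k1.
change (Rabs (t - 0) < Rmin 1 (eps / (4 * (B + M + 1)))) in k2.
change (Rabs (L nu UF F z t - L nu UF F z0 0) < eps).
rewrite Rminus_0_r, Rabs_pos_eq in k2 by exact ht.
assert (k3 : t < 1) by (eapply Rlt_le_trans; [exact k2|apply Rmin_l]).
assert (k4 : t < eps / (4 * (B + M + 1))) by (eapply Rlt_le_trans; [exact k2|apply Rmin_r]).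
assert (k5 : Rabs (z - z0) < eps / (4 * (B + M + 1))) by (eapply Rlt_le_trans; [exact k1|apply Rmin_r]).
generalize (hmod z t rho hrho ltac:(lra)); fold B; intros g1.
assert (r0 : in_range 0 1 0) by (split; [now left|lra]).
generalize (hlip z0 z 0 r0); intros g2.
replace (L nu UF F z t - L nu UF F z0 0) with
  ((L nu UF F z t - L nu UF F z 0) + (L nu UF F z 0 - L nu UF F z0 0)) by ring.
eapply Rle_lt_trans; [apply Rabs_triang|].
assert (e1 : (B + M + 1) * (eps / (4 * (B + M + 1))) = eps / 4) by (field; lra).
set (q := eps / (4 * (B + M + 1))) in *.
assert (t * B <= q * B) by (apply Rmult_le_compat_r; lra).
assert (M * Rabs (z - z0) <= M * q) by (apply Rmult_le_compat_l; lra).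
assert (0 < q) by (unfold q; apply Rdiv_lt_0_compat; lra).
assert (e2 : rho * (8 * (K + 1)) = eps) by (unfold rho; field; lra).
lra.
Qed.

End InitialTime.

Lemma L_periodic (nu : R) (UF : (nat -> Prop) -> Prop) (hU : limit_filter UF) (hnu : 0 < nu)
  (F : nat -> nat -> Z -> R) (s T z t : R) : bddR nu s T F -> in_range s T t ->
  eventually (fun N => forall k i, INR k * tau nu N <= T ->
     F N k (i + Z.of_nat N)%Z = F N k i) ->
  L nu UF F (z + 1) t = L nu UF F z t.
Proof.
intros hb ht hp; apply (ulim_unique UF hU (samp nu F (z + 1) t)).
- apply (L_cv nu UF hnu hU F s T); auto.
- apply (cv_close UF hU (samp nu F z t)); [apply (L_cv nu UF hnu hU F s T); auto|].
  intros d hd; generalize (eventually_and _ _ hp (range_kidx nu hnu s T t ht)).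
  apply filter_imp; intros N [h1 [_ h2]]; unfold samp.
  rewrite zidx_period, h1 by apply h2.
  unfold Rminus; rewrite Rplus_opp_r, Rabs_R0; lra.
Qed.

Theorem viscous_solution (UF : (nat -> Prop) -> Prop) (hU : limit_filter UF)
  (nu : R) (u0 v0 : R -> R) (hnu : 0 < nu) (hu0 : Cm 1 u0) (hv0 : Cm 1 v0)
  (pu0 : periodic1 u0) (pv0 : periodic1 v0) (hm : RInt v0 0 1 = 0) :
  exists u v psi : R -> R -> R,
    model_solution nu (fun _ => 0) u0 v0 u v psi /\
    (forall m t, 0 < t -> Cm m (fun z => u z t) /\ Cm m (fun z => v z t)).
Proof.
assert (hcu : forall z, continuous u0 z) by (intros z; apply (hu0 0%nat (Nat.le_0_l _) z)).
assert (hcv : forall z, continuous v0 z) by (intros z; apply (hv0 0%nat (Nat.le_0_l _) z)).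
destruct (C1_periodic_Lipschitz u0 pu0 (fun z => proj1 (hu0 1%nat (le_n _) z))
  (fun z => proj2 (hu0 1%nat (le_n _) z))) as [K1 [hK1 hLu]].
destruct (C1_periodic_Lipschitz v0 pv0 (fun z => proj1 (hv0 1%nat (le_n _) z))
  (fun z => proj2 (hv0 1%nat (le_n _) z))) as [K2 [hK2 hLv]].
destruct (periodic1_bounded u0 pu0 hcu) as [U0 [hU0 hbu]].
set (K0 := K1 + K2).
assert (hK0 : 0 <= K0) by (unfold K0; lra).
assert (hLu' : forall x y, Rabs (u0 y - u0 x) <= K0 * Rabs (y - x)).
{ intros x y; eapply Rle_trans; [apply hLu|].
  apply Rmult_le_compat_r; [apply Rabs_pos|unfold K0; lra]. }
assert (hLv' : forall x y, Rabs (v0 y - v0 x) <= K0 * Rabs (y - x)).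
{ intros x y; eapply Rle_trans; [apply hLv|].
  apply Rmult_le_compat_r; [apply Rabs_pos|unfold K0; lra]. }
set (W := fun N k => schemeZ nu N (init_data u0 v0 N) k).
(* The inner 2 comes from adding the Lipschitz bounds of the two components, the outer one from the
   growth allowed by [scheme_invariants]. *)
set (K := 2 * (2 * K0)).
set (UT := fun T => U0 * exp (4 * (2 * K0) * T)).
assert (hW : scheme_family nu W K UT).
{ split; [reflexivity|]; intros T hT.
  generalize (eventually_and _ _ (tau_INR_small nu 1 hnu Rlt_0_1)
    (scheme_invariants nu (2 * K0) U0 T hnu ltac:(lra) hU0 hT)); apply filter_imp.
  intros N [[hN _] h]; apply h.
  - apply init_periodic; auto.
  - apply init_zero_mean; auto.
  - apply init_Lipschitz; auto.
  - intros i; apply hbu. }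
clearbody UT K.
set (v := L nu UF (VF W 0)). set (u := L nu UF (WF W 0)).
set (psi := fun z t => L nu UF (BF W) z t / 2).
assert (hvz : forall z t, 0 < t -> d_z v z t = L nu UF (VF W 1) z t).
{ intros z t ht; apply is_derive_unique, (VF_is_derive nu UF W K UT hnu hU hW 0), ht. }
assert (huz : forall z t, 0 < t -> d_z u z t = L nu UF (WF W 1) z t).
{ intros z t ht; apply is_derive_unique, (WF_is_derive nu UF W K UT hnu hU hW 0), ht. }
assert (hvzz' : forall z t, 0 < t -> is_derive (fun y => d_z v y t) z (L nu UF (VF W 2) z t)).
{ intros z t ht; apply is_derive_ext with (fun y => L nu UF (VF W 1) y t).
  - intros y; symmetry; apply hvz, ht.
  - apply (VF_is_derive nu UF W K UT hnu hU hW 1), ht. }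
assert (huzz' : forall z t, 0 < t -> is_derive (fun y => d_z u y t) z (L nu UF (WF W 2) z t)).
{ intros z t ht; apply is_derive_ext with (fun y => L nu UF (WF W 1) y t).
  - intros y; symmetry; apply huz, ht.
  - apply (WF_is_derive nu UF W K UT hnu hU hW 1), ht. }
assert (hvzz : forall z t, 0 < t -> d_zz v z t = L nu UF (VF W 2) z t)
  by (intros; now apply is_derive_unique, hvzz').
assert (huzz : forall z t, 0 < t -> d_zz u z t = L nu UF (WF W 2) z t)
  by (intros; now apply is_derive_unique, huzz').
assert (hvt : forall z t, 0 < t -> d_t v z t = L nu UF (RVF nu W) z t).
{ intros z t ht; apply is_derive_unique, (VF_is_derive_t nu UF W K UT hnu hU hW), ht. }
assert (hut : forall z t, 0 < t -> d_t u z t = L nu UF (RWF nu W) z t).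
{ intros z t ht; apply is_derive_unique, (WF_is_derive_t nu UF W K UT hnu hU hW), ht. }
assert (jext : forall f g, (forall z t, 0 < t -> f z t = g z t) ->
   (forall z t, 0 < t -> jcont g z t) -> forall z t, 0 < t -> jcont f z t).
{ intros f g hfg hg z t ht; apply continuous_ext_loc with (2 := hg z t ht).
  exists (mkposreal t ht); intros [z' t'] [_ h']; simpl in *.
  change (Rabs (t' - t) < t) in h'; apply Rabs_lt_between in h'; symmetry; apply hfg; lra. }
assert (jV : forall j z t, 0 < t -> jcont (L nu UF (VF W j)) z t)
  by (intros; now apply (VF_jcont nu UF W K UT hnu hU hW)).
assert (jW : forall j z t, 0 < t -> jcont (L nu UF (WF W j)) z t)
  by (intros; now apply (WF_jcont nu UF W K UT hnu hU hW)).
assert (jRV : forall z t, 0 < t -> jcont (L nu UF (RVF nu W)) z t).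
{ intros; apply (L_jcont nu UF hnu hU); auto; apply (RVF_bdd nu W K UT hnu hW). }
assert (jRW : forall z t, 0 < t -> jcont (L nu UF (RWF nu W)) z t).
{ intros; apply (L_jcont nu UF hnu hU); auto; apply (RWF_bdd nu W K UT hnu hW). }
assert (hper : forall T, 0 <= T -> eventually (fun N => (0 < N)%nat /\ forall k,
   INR k * tau nu N <= T -> periodicZ N (W N k))).
{ intros T hT; generalize (eventually_and _ _ (tau_INR_small nu 1 hnu Rlt_0_1) (proj2 hW T hT)).
  apply filter_imp; intros N [[hN _] h]; split; [exact hN|]; intros k hk; apply h, hk. }
assert (pv : forall t, 0 <= t -> periodic1 (fun z => v z t)).
{ intros t ht z; apply (L_periodic nu UF hU hnu (VF W 0) 0 (t + 1)).
  - apply (VF_bdd0 nu W K UT hnu hW); [lia|lra].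
  - apply range_zero, ht.
  - generalize (hper (t + 1) ltac:(lra)); apply filter_imp; intros N [hN h] k i hk.
    unfold VF, reF; simpl; now rewrite (h k hk). }
assert (pu : forall t, 0 <= t -> periodic1 (fun z => u z t)).
{ intros t ht z; apply (L_periodic nu UF hU hnu (WF W 0) 0 (t + 1)).
  - apply (WF_bdd0 nu W K UT hnu hW); [lia|lra].
  - apply range_zero, ht.
  - generalize (hper (t + 1) ltac:(lra)); apply filter_imp; intros N [hN h] k i hk.
    unfold WF, imF; simpl; now rewrite (h k hk). }
assert (ppsi : forall t, 0 <= t -> periodic1 (fun z => psi z t)).
{ intros t ht z; unfold psi; f_equal; apply (L_periodic nu UF hU hnu (BF W) 0 (t + 1)).
  - apply (BF_bdd nu W K UT hnu hW); lra.
  - apply range_zero, ht.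
  - generalize (hper (t + 1) ltac:(lra)); apply filter_imp; intros N [hN h] k i hk.
    unfold BF, reF; now rewrite velZ_periodic. }
assert (hpsi : forall z t, 0 <= t -> is_derive (fun y => psi y t) z (- v z t)).
{ intros z t ht; apply (BF_is_derive nu UF W K UT hnu hU hW), ht. }
(* One statement for both data: [e] is the subtracted discrete mean for [v0] and zero for [u0].
   Rounding the point and subtracting the mean each cost [K0 / N]. *)
assert (init : forall (f : R -> R) (F : nat -> nat -> Z -> R) (e : nat -> R) z,
  (forall x y, Rabs (f y - f x) <= K0 * Rabs (y - x)) -> bddR nu 0 1 F ->
  (forall N i, F N O i = f (IZR i / INR N) - e N) ->
  (forall N, (0 < N)%nat -> Rabs (e N) <= K0 * / INR N) -> L nu UF F z 0 = f z).
{ intros f F e z hf hb he hee; assert (r0 : in_range 0 1 0) by (split; [now left|lra]).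
  apply (ulim_unique UF hU (samp nu F z 0)); [now apply (L_cv nu UF hnu hU F 0 1)|].
  apply (cv_close UF hU (fun _ => f z)); [apply (cv_const UF hU)|]; intros d hd.
  generalize (eventually_and _ _ (tau_INR_small nu 1 hnu Rlt_0_1) (inv_INR_small (2 * K0) d hd)).
  apply filter_imp; intros N [[hN _] h]; unfold samp; rewrite (kidx_0 nu N hnu hN), he.
  assert (hq : 0 < INR N) by (apply lt_0_INR, hN).
  replace (f (IZR (zidx N z) / INR N) - e N - f z) with
    ((f (IZR (zidx N z) / INR N) - f z) + - e N) by ring.
  eapply Rle_trans; [apply Rabs_triang|]; rewrite Rabs_Ropp.
  generalize (hf z (IZR (zidx N z) / INR N)) (hee N hN).
  assert (hz : Rabs (IZR (zidx N z) / INR N - z) <= / INR N).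
  { destruct (zidx_spec N z) as [h1 h2].
    replace (IZR (zidx N z) / INR N - z) with ((IZR (zidx N z) - z * INR N) * / INR N)
      by (field; lra).
    rewrite Rabs_mult, (Rabs_pos_eq (/ INR N)) by (left; apply Rinv_0_lt_compat, hq).
    rewrite <- (Rmult_1_l (/ INR N)) at 2.
    apply Rmult_le_compat_r; [left; apply Rinv_0_lt_compat, hq|apply Rabs_le_between; lra]. }
  assert (K0 * Rabs (IZR (zidx N z) / INR N - z) <= K0 * / INR N)
    by (apply Rmult_le_compat_l; auto).
  lra. }
exists u, v, psi; split; [constructor|].
- exact pu.
- exact pv.
- exact ppsi.
- constructor.
  + apply (limit_jointly_continuous nu UF W K UT hnu hU hW); now right.
  + intros z t ht; eexists; apply (WF_is_derive_t nu UF W K UT hnu hU hW), ht.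
  + intros z t ht; eexists; apply (WF_is_derive nu UF W K UT hnu hU hW 0), ht.
  + apply jcont_jointly_continuous_on, (jext _ _ hut jRW).
  + apply jcont_jointly_continuous_on, (jext _ _ huz (jW 1%nat)).
  + intros _ z t ht; eexists; apply huzz', ht.
  + intros _; apply jcont_jointly_continuous_on, (jext _ _ huzz (jW 2%nat)).
- constructor.
  + apply (limit_jointly_continuous nu UF W K UT hnu hU hW); now left.
  + intros z t ht; eexists; apply (VF_is_derive_t nu UF W K UT hnu hU hW), ht.
  + intros z t ht; eexists; apply (VF_is_derive nu UF W K UT hnu hU hW 0), ht.
  + apply jcont_jointly_continuous_on, (jext _ _ hvt jRV).
  + apply jcont_jointly_continuous_on, (jext _ _ hvz (jV 1%nat)).
  + intros _ z t ht; eexists; apply hvzz', ht.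
  + intros _; apply jcont_jointly_continuous_on, (jext _ _ hvzz (jV 2%nat)).
- exact hpsi.
- intros t ht; unfold psi.
  replace (L nu UF (BF W) 0 t) with 0; [field|].
  apply (ulim_unique UF hU (samp nu (BF W) 0 t)).
  + apply (cv_close UF hU (fun _ => 0)); [apply (cv_const UF hU)|]; intros d hd.
    generalize (hper (t + 1) ltac:(lra)); apply filter_imp; intros N [hN _].
    unfold samp, BF, reF; rewrite zidx_0, velZ_0 by exact hN; simpl.
    unfold Rminus; rewrite Rplus_opp_r, Rabs_R0; lra.
  + apply (L_cv nu UF hnu hU _ 0 (t + 1)); [apply (BF_bdd nu W K UT hnu hW); lra|apply range_zero, ht].
- intros z; apply (init u0 _ (fun _ => 0)); auto.
  + apply (WF_bdd0 nu W K UT hnu hW); [lia|lra].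
  + intros N i; unfold WF, imF; simpl; ring.
  + intros N hN; rewrite Rabs_R0; apply Rmult_le_pos; [exact hK0|].
    left; apply Rinv_0_lt_compat, lt_0_INR, hN.
- intros z; apply (init v0 _ (init_mean v0)); auto.
  + apply (VF_bdd0 nu W K UT hnu hW); [lia|lra].
  + intros N hN; apply init_mean_le; auto.
- intros z t ht; rewrite hut, huz, huzz by exact ht.
  rewrite (WF_equation nu UF W K UT hnu hU hW z t ht); unfold psi, u, v; field.
- intros z t ht.
  (* The equation first holds with the limit of [cstZ]; [constant_of_mean] then identifies that
     limit with [c_of]. *)
  assert (heq : forall z, d_t v z t + 2 * psi z t * d_z v z t =
     nu * d_zz v z t + u z t ^ 2 - v z t ^ 2 + L nu UF (CF W) 0 t).
  { intros y; rewrite hvt, hvz, hvzz by exact ht.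
    rewrite (VF_equation nu UF W K UT hnu hU hW y t ht); unfold psi, u, v; field. }
  rewrite <- (constant_of_mean nu (L nu UF (CF W) 0 t) t u v psi); auto; try lra.
  + intros; apply pv; lra.
  + intros; apply ppsi; lra.
  + intros; apply hpsi; lra.
  + intros y; apply jcont_z, jW, ht.
  + intros y s hs; apply jcont_z, jV, hs.
  + intros y s hs; eexists; apply (VF_is_derive_t nu UF W K UT hnu hU hW), hs.
  + apply (jext _ _ hvt jRV).
  + intros y; eexists; apply (VF_is_derive nu UF W K UT hnu hU hW 0), ht.
  + intros y; apply jcont_z, (jext _ _ hvz (jV 1%nat)), ht.
  + intros _ y; eexists; apply hvzz', ht.
  + intros _ y; apply jcont_z, (jext _ _ hvzz (jV 2%nat)), ht.
- intros m t ht; split.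
  + apply (Cm_of_chain m (fun j z => L nu UF (WF W j) z t)); intros j z.
    apply (WF_is_derive nu UF W K UT hnu hU hW j), ht.
  + apply (Cm_of_chain m (fun j z => L nu UF (VF W j) z t)); intros j z.
    apply (VF_is_derive nu UF W K UT hnu hU hW j), ht.
Qed.

(** * Global Picard theorem *)

(** Because of [Rmax 0 t] every iterate is constant for [t <= 0], so continuity can be stated on the
    whole line and the point [0] needs no one-sided version. *)
Fixpoint picard (f : R -> R -> R) (x0 : R) (n : nat) (t : R) : R :=
  match n with
  | O => x0
  | S n => x0 + RInt (fun s => f s (picard f x0 n s)) 0 (Rmax 0 t)
  end.

Lemma continuous_Rmax0 (t : R) : continuous (Rmax 0) t.
Proof.
apply filterlim_locally; intros eps; exists eps; intros y hy.
change (Rabs (y - t) < eps) in hy; change (Rabs (Rmax 0 y - Rmax 0 t) < eps).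
eapply Rle_lt_trans; [|exact hy].
unfold Rmax, Rabs; repeat destruct Rle_dec; repeat destruct Rcase_abs; lra.
Qed.

Section Picard.
Variables (f : R -> R -> R) (x0 : R).
Hypothesis hfc : forall x t, continuous (fun s => f s x) t.
Hypothesis hfl : forall T, exists L, 0 <= L /\ forall t x y, Rabs t <= T ->
  Rabs (f t x - f t y) <= L * Rabs (x - y).

Lemma continuous_along (x : R -> R) (t : R) : continuous x t -> continuous (fun s => f s (x s)) t.
Proof.
intros hx; destruct (hfl (Rabs t + 1)) as [L [hL hl]].
apply filterlim_locally; intros eps.
assert (he := cond_pos eps).
assert (he1 : 0 < eps / (2 * (L + 1))) by (apply Rdiv_lt_0_compat; lra).
assert (he2 : 0 < eps / 2) by lra.
generalize (proj1 (filterlim_locally _ _) hx (mkposreal _ he1)).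
generalize (proj1 (filterlim_locally _ _) (hfc (x t) t) (mkposreal _ he2)).
assert (h1 : locally t (fun s => Rabs (s - t) < 1)) by (exists (mkposreal 1 Rlt_0_1); auto).
intros h2 h3; generalize (filter_and _ _ h1 (filter_and _ _ h2 h3)); apply filter_imp.
intros s [a1 [a2 a3]].
change (Rabs (f s (x t) - f t (x t)) < eps / 2) in a2.
change (Rabs (x s - x t) < eps / (2 * (L + 1))) in a3.
change (Rabs (f s (x s) - f t (x t)) < eps).
replace (f s (x s) - f t (x t)) with
  ((f s (x s) - f s (x t)) + (f s (x t) - f t (x t))) by ring.
eapply Rle_lt_trans; [apply Rabs_triang|].
assert (hs : Rabs s <= Rabs t + 1).
{ replace s with (t + (s - t)) by ring; eapply Rle_trans; [apply Rabs_triang|lra]. }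
generalize (hl s (x s) (x t) hs); intros h.
assert (L * Rabs (x s - x t) <= L * (eps / (2 * (L + 1)))) by (apply Rmult_le_compat_l; lra).
assert ((L + 1) * (eps / (2 * (L + 1))) = eps / 2) by (field; lra).
lra.
Qed.

Lemma RInt_max0_derive (g : R -> R) (hg : forall s, continuous g s) (t : R) : 0 < t ->
  is_derive (fun t => RInt g 0 (Rmax 0 t)) t (g t).
Proof.
intros ht; apply is_derive_ext_loc with (fun t => RInt g 0 t).
- exists (mkposreal t ht); intros y hy; change (Rabs (y - t) < t) in hy.
  apply Rabs_lt_between in hy; rewrite Rmax_right; [reflexivity|lra].
- apply (is_derive_RInt g (fun t => RInt g 0 t) 0 t); [|apply hg].
  exists (mkposreal 1 Rlt_0_1); intros y _; apply (RInt_correct (V := R_CompleteNormedModule)).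
  apply (ex_RInt_continuous (V := R_CompleteNormedModule)); auto.
Qed.

Lemma RInt_max0_continuous (g : R -> R) (hg : forall s, continuous g s) (t : R) :
  continuous (fun t => RInt g 0 (Rmax 0 t)) t.
Proof.
apply (continuous_comp (Rmax 0) (fun t => RInt g 0 t)); [apply continuous_Rmax0|].
apply (ex_derive_continuous (fun t => RInt g 0 t)); exists (g (Rmax 0 t)).
apply (is_derive_RInt g (fun t => RInt g 0 t) 0); [|apply hg].
exists (mkposreal 1 Rlt_0_1); intros y _; apply (RInt_correct (V := R_CompleteNormedModule)).
apply (ex_RInt_continuous (V := R_CompleteNormedModule)); auto.
Qed.

Lemma picard_continuous (n : nat) (t : R) : continuous (picard f x0 n) t.
Proof.
revert t; induction n as [|n IH]; intros t; [apply continuous_const|].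
simpl; apply (continuous_plus (fun _ => x0)
  (fun t => RInt (fun s => f s (picard f x0 n s)) 0 (Rmax 0 t))); [apply continuous_const|].
apply RInt_max0_continuous; intros s; apply continuous_along, IH.
Qed.

(* The weight [exp (2 L t)] makes the Picard map a contraction of ratio [1/2]. *)
Lemma picard_geometric (T : R) : 0 <= T -> exists C, 0 <= C /\ forall n t, 0 <= t <= T ->
  Rabs (picard f x0 (S n) t - picard f x0 n t) <= C * (1/2) ^ n.
Proof.
intros hT; destruct (hfl T) as [L0 [hL0 hl0]].
set (L := L0 + 1).
assert (hl : forall t x y, Rabs t <= T -> Rabs (f t x - f t y) <= L * Rabs (x - y)).
{ intros t x y ht; eapply Rle_trans; [apply hl0, ht|].
  apply Rmult_le_compat_r; [apply Rabs_pos|unfold L; lra]. }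
assert (hL : 0 < L) by (unfold L; lra).
destruct (bounded_continuity (V := R_NormedModule) (fun s => f s x0) 0 T (fun s _ => hfc x0 s))
  as [B hB].
assert (hB' : forall s, 0 <= s <= T -> Rabs (f s x0) <= B) by (intros s hs; left; apply (hB s hs)).
assert (hB0 : 0 <= B) by (eapply Rle_trans; [apply Rabs_pos|apply (hB' 0); lra]).
set (C := B * T).
assert (hC : 0 <= C) by (unfold C; nra).
assert (hcf : forall n s, continuous (fun s => f s (picard f x0 n s)) s)
  by (intros; apply continuous_along, picard_continuous).
assert (hex : forall n a b, ex_RInt (fun s => f s (picard f x0 n s)) a b)
  by (intros; apply (ex_RInt_continuous (V := R_CompleteNormedModule)); auto).
assert (main : forall n t, 0 <= t <= T ->
  Rabs (picard f x0 (S n) t - picard f x0 n t) <= C * (1/2) ^ n * exp (2 * L * t)).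
{ induction n as [|n IH]; intros t ht.
  - simpl picard; rewrite Rmax_right by lra.
    assert (e : forall r : R, x0 + r - x0 = r) by (intros; ring); rewrite e; clear e.
    eapply Rle_trans; [apply (abs_RInt_le_const (fun s => f s x0) 0 t B); [lra|apply (hex 0%nat)|]|].
    + intros s hs; apply hB'; lra.
    + unfold C; simpl; rewrite Rmult_1_r.
      assert (1 <= exp (2 * L * t)).
      { rewrite <- exp_0; destruct (Rle_lt_or_eq_dec 0 (2 * L * t)) as [h|h]; [nra| |].
        - left; apply exp_increasing, h.
        - rewrite h; lra. }
      assert (B * t <= B * T) by (apply Rmult_le_compat_l; lra).
      assert (0 <= B * T) by nra. nra.
  - change (picard f x0 (S (S n)) t) with
      (x0 + RInt (fun s => f s (picard f x0 (S n) s)) 0 (Rmax 0 t)).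
    change (picard f x0 (S n) t) with
      (x0 + RInt (fun s => f s (picard f x0 n s)) 0 (Rmax 0 t)).
    rewrite Rmax_right by lra.
    (* The antiderivative of [L] times the bound at stage [n]: integrating [exp (2 * L * s)] divides
       by [2 * L], which leaves the ratio [1/2]. *)
    set (E := fun s => C * (1/2) ^ n / 2 * exp (2 * L * s)).
    assert (hE : is_RInt (fun s => L * (C * (1/2) ^ n * exp (2 * L * s))) 0 t (minus (E t) (E 0))).
    { apply (is_RInt_derive E).
      - intros x _; unfold E; auto_derive; [exact I|]; field.
      - intros x _; apply (ex_derive_continuous (fun s => L * (C * (1/2) ^ n * exp (2 * L * s)))).
        auto_derive; exact I. }
    match goal with |- Rabs (x0 + ?a - (x0 + ?b)) <= _ =>
      replace (x0 + a - (x0 + b)) with (a - b) by (generalize (a : R) (b : R); intros; ring); change (a - b) with (minus a b) end.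
    rewrite <- (RInt_minus (V := R_CompleteNormedModule)) by apply hex.
    eapply Rle_trans; [apply abs_RInt_le; [lra|]|].
    { apply (ex_RInt_minus (V := R_NormedModule)); apply hex. }
    eapply Rle_trans.
    { apply (RInt_le _ (fun s => L * (C * (1/2) ^ n * exp (2 * L * s))) 0 t); [lra| | |].
      - apply (ex_RInt_continuous (V := R_CompleteNormedModule)); intros s _.
        apply (continuous_comp (fun s => minus (f s (picard f x0 (S n) s)) (f s (picard f x0 n s))) Rabs).
        + apply (continuous_minus (fun s => f s (picard f x0 (S n) s))); apply hcf.
        + apply continuous_Rabs.
      - eexists; exact hE.
      - intros s hs; unfold minus, plus, opp; simpl.
        eapply Rle_trans; [apply hl; rewrite Rabs_pos_eq; lra|].
        apply Rmult_le_compat_l; [lra|]; apply IH; lra. }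
    rewrite (is_RInt_unique _ _ _ _ hE); unfold E, minus, plus, opp; simpl.
    rewrite Rmult_0_r, exp_0.
    assert (0 <= C * (1/2) ^ n) by (apply Rmult_le_pos; [exact hC|apply pow_le; lra]).
    lra. }
exists (C * exp (2 * L * T)); split; [generalize (exp_pos (2 * L * T)); nra|].
intros n t ht; eapply Rle_trans; [apply main, ht|].
replace (C * exp (2 * L * T) * (1/2) ^ n) with (C * (1/2) ^ n * exp (2 * L * T)) by ring.
apply Rmult_le_compat_l; [apply Rmult_le_pos; [exact hC|apply pow_le; lra]|].
destruct (Rle_lt_or_eq_dec _ _ (proj2 ht)) as [h|h]; [left; apply exp_increasing; nra|rewrite h; lra].
Qed.

Lemma picard_neg (n : nat) (t : R) : t <= 0 -> picard f x0 n t = x0.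
Proof.
intros ht; destruct n as [|n]; [reflexivity|]; simpl.
rewrite Rmax_left, RInt_point by lra; unfold zero; simpl; ring.
Qed.

Lemma picard_cauchy (T : R) : 0 <= T -> exists C, 0 <= C /\ forall n p t, t <= T ->
  Rabs (picard f x0 (n + p) t - picard f x0 n t) <= C * (1/2) ^ n.
Proof.
intros hT; destruct (picard_geometric T hT) as [C [hC h]].
exists (2 * C); split; [lra|].
intros n p t ht.
assert (hpn : forall n, 0 <= C * (1/2) ^ n)
  by (intros; apply Rmult_le_pos; [exact hC|apply pow_le; lra]).
destruct (Rle_dec t 0) as [h0|h0].
{ rewrite !picard_neg by lra; unfold Rminus; rewrite Rplus_opp_r, Rabs_R0.
  generalize (hpn n); lra. }
assert (main : Rabs (picard f x0 (n + p) t - picard f x0 n t) <=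
   2 * C * (1/2) ^ n - 2 * C * (1/2) ^ (n + p)).
{ induction p as [|p IH].
  - rewrite Nat.add_0_r; unfold Rminus; rewrite Rplus_opp_r, Rabs_R0; lra.
  - rewrite Nat.add_succ_r.
    replace (picard f x0 (S (n + p)) t - picard f x0 n t) with
      ((picard f x0 (S (n + p)) t - picard f x0 (n + p) t)
        + (picard f x0 (n + p) t - picard f x0 n t)) by ring.
    eapply Rle_trans; [apply Rabs_triang|].
    generalize (h (n + p)%nat t ltac:(lra)); simpl; lra. }
generalize (hpn (n + p)%nat); lra.
Qed.

Lemma picard_limit : exists x : R -> R, (forall t, t <= 0 -> x t = x0) /\
  forall T, 0 <= T -> exists C, 0 <= C /\ forall n t, t <= T ->
    Rabs (picard f x0 n t - x t) <= C * (1/2) ^ n.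
Proof.
assert (hlim : forall t, is_lim_seq (fun n => picard f x0 n t)
   (real (Lim_seq (fun n => picard f x0 n t)))).
{ intros t; destruct (picard_cauchy (Rmax 0 t) (Rmax_l _ _)) as [C [hC h]].
  apply Lim_seq_correct', ex_lim_seq_cauchy_corr; intros eps.
  destruct (is_lim_seq_spec (fun n => (2 * C) * (1/2) ^ n) 0) as [_ hs].
  assert (hg : is_lim_seq (fun n => (2 * C) * (1/2) ^ n) 0).
  { replace (Finite 0) with (Rbar_mult (2 * C) 0) by (simpl; f_equal; ring).
    apply is_lim_seq_scal_l, is_lim_seq_geom; rewrite Rabs_pos_eq; lra. }
  destruct (hs hg eps) as [N hN]; exists N; intros n m hn hm.
  specialize (hN N (le_n _)); rewrite Rminus_0_r in hN.
  apply Rle_lt_trans with ((2 * C) * (1/2) ^ N);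
    [|eapply Rle_lt_trans; [apply Rle_abs|exact hN]].
  replace (picard f x0 n t - picard f x0 m t) with
    ((picard f x0 (N + (n - N)) t - picard f x0 N t) +
      - (picard f x0 (N + (m - N)) t - picard f x0 N t)).
  - eapply Rle_trans; [apply Rabs_triang|]; rewrite Rabs_Ropp.
    generalize (h N (n - N)%nat t (Rmax_r _ _)) (h N (m - N)%nat t (Rmax_r _ _)); lra.
  - replace (N + (n - N))%nat with n by lia; replace (N + (m - N))%nat with m by lia; ring. }
exists (fun t => real (Lim_seq (fun n => picard f x0 n t))); split.
- intros t ht; rewrite (Lim_seq_ext _ (fun _ => x0)) by (intros; now apply picard_neg).
  now rewrite Lim_seq_const.
- intros T hT; destruct (picard_cauchy T hT) as [C [hC h]]; exists C; split; [exact hC|].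
  intros n t ht.
  assert (h1 : is_lim_seq (fun p => Rabs (picard f x0 n t - picard f x0 (p + n) t))
    (Rabs (picard f x0 n t - real (Lim_seq (fun n => picard f x0 n t))))).
  { apply (is_lim_seq_abs _ (Finite (picard f x0 n t - real (Lim_seq (fun n => picard f x0 n t))))).
    apply is_lim_seq_minus'; [apply is_lim_seq_const|].
    apply (is_lim_seq_incr_n (fun p => picard f x0 p t) n), hlim. }
  apply (is_lim_seq_le _ (fun _ => C * (1/2) ^ n) _ (C * (1/2) ^ n)) with (2 := h1);
    [|apply is_lim_seq_const].
  intros p; rewrite Rabs_minus_sym, Nat.add_comm; apply h, ht.
Qed.

Theorem ode_solution : exists x : R -> R, x 0 = x0 /\ (forall t, continuous x t) /\
  (forall t, 0 < t -> is_derive x t (f t (x t))).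
Proof.
destruct picard_limit as [x [hx0 hx]].
assert (hsmall : forall C eps, 0 < eps -> exists n, C * (1/2) ^ n < eps).
{ intros C eps heps; destruct (pow_lt_1_zero (1/2) ltac:(rewrite Rabs_pos_eq; lra)
    (eps / (Rabs C + 1))) as [N hN].
  - apply Rdiv_lt_0_compat; [exact heps|generalize (Rabs_pos C); lra].
  - exists N; specialize (hN N (le_n _)); rewrite Rabs_pos_eq in hN by (apply pow_le; lra).
    assert (hp : 0 <= (1/2) ^ N) by (apply pow_le; lra).
    assert (hc : 0 < Rabs C + 1) by (generalize (Rabs_pos C); lra).
    apply Rmult_lt_compat_r with (r := Rabs C + 1) in hN; [|exact hc].
    replace (eps / (Rabs C + 1) * (Rabs C + 1)) with eps in hN by (field; lra).
    generalize (Rle_abs C); nra. }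
assert (hc : forall t, continuous x t).
{ intros t; apply filterlim_locally; intros eps.
  assert (hT : 0 <= Rabs t + 1) by (generalize (Rabs_pos t); lra).
  destruct (hx (Rabs t + 1) hT) as [C [hC h]].
  assert (he := cond_pos eps).
  destruct (hsmall C (eps / 4) ltac:(lra)) as [n hn].
  assert (he2 : 0 < eps / 2) by lra.
  generalize (proj1 (filterlim_locally _ _) (picard_continuous n t) (mkposreal _ he2)).
  assert (h1 : locally t (fun s => Rabs (s - t) < 1)) by (exists (mkposreal 1 Rlt_0_1); auto).
  intros h2; generalize (filter_and _ _ h1 h2); apply filter_imp; intros s [a1 a2].
  change (Rabs (picard f x0 n s - picard f x0 n t) < eps / 2) in a2.
  change (Rabs (x s - x t) < eps).
  assert (hs : s <= Rabs t + 1).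
  { apply Rabs_lt_between in a1; generalize (Rle_abs t); lra. }
  assert (ht : t <= Rabs t + 1) by (generalize (Rle_abs t); lra).
  generalize (h n s hs) (h n t ht); intros b1 b2.
  replace (x s - x t) with (- (picard f x0 n s - x s) + ((picard f x0 n t - x t)
     + (picard f x0 n s - picard f x0 n t))) by ring.
  eapply Rle_lt_trans; [apply Rabs_triang|]; rewrite Rabs_Ropp.
  generalize (Rabs_triang (picard f x0 n t - x t) (picard f x0 n s - picard f x0 n t)); lra. }
assert (hcx : forall s, continuous (fun s => f s (x s)) s) by (intros; apply continuous_along, hc).
assert (hint : forall t, 0 <= t -> x t = x0 + RInt (fun s => f s (x s)) 0 (Rmax 0 t)).
{ intros t ht; apply cond_eq; intros eps heps; rewrite Rmax_right by exact ht.
  destruct (hx t ht) as [C [hC h]]; destruct (hfl t) as [L [hL hl]].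
  destruct (hsmall (C + C * L * t) eps heps) as [n hn].
  assert (h1 := h (S n) t (Rle_refl _)).
  simpl picard in h1; rewrite Rmax_right in h1 by exact ht.
  assert (hcf : forall s, continuous (fun s => f s (picard f x0 n s)) s)
    by (intros; apply continuous_along, picard_continuous).
  assert (h2 : Rabs (minus (RInt (fun s => f s (picard f x0 n s)) 0 t)
      (RInt (fun s => f s (x s)) 0 t)) <= (t - 0) * (L * (C * (1/2) ^ n))).
  { rewrite <- (RInt_minus (V := R_CompleteNormedModule)) by
      (apply (ex_RInt_continuous (V := R_CompleteNormedModule)); auto).
    apply abs_RInt_le_const; [exact ht| |].
    - apply (ex_RInt_continuous (V := R_CompleteNormedModule)); intros s _.
      apply (continuous_minus (fun s => f s (picard f x0 n s))); auto.
    - intros s hs; unfold minus, plus, opp; simpl.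
      eapply Rle_trans; [apply hl; rewrite Rabs_pos_eq; lra|].
      apply Rmult_le_compat_l; [exact hL|]; apply h; lra. }
  unfold minus, plus, opp in h2; simpl in h2.
  set (A := RInt (fun s => f s (picard f x0 n s)) 0 t) in *.
  set (B := RInt (fun s => f s (x s)) 0 t) in *.
  replace (x t - (x0 + B)) with (- (x0 + A - x t) + (A + - B)) by ring.
  eapply Rle_lt_trans; [apply Rabs_triang|]; rewrite Rabs_Ropp.
  eapply Rle_lt_trans; [|exact hn].
  assert (C * (1/2) ^ S n <= C * (1/2) ^ n).
  { simpl; assert (0 <= (1/2) ^ n) by (apply pow_le; lra). nra. }
  lra. }
exists x; split; [apply hx0; lra|split; [exact hc|]].
intros t ht; apply is_derive_ext_loc with
  (fun t => x0 + RInt (fun s => f s (x s)) 0 (Rmax 0 t)).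
- exists (mkposreal t ht); intros y hy; change (Rabs (y - t) < t) in hy.
  apply Rabs_lt_between in hy; symmetry; apply hint; lra.
- replace (f t (x t)) with (plus 0 (f t (x t))) by (unfold plus; simpl; ring).
  apply (is_derive_plus (fun _ => x0)); [apply (is_derive_const x0)|].
  apply (RInt_max0_derive (fun s => f s (x s))); auto.
Qed.

End Picard.

(** * Moving the origin *)

Lemma continuous_pair {T U V : UniformSpace} (f : T -> U) (g : T -> V) (x : T) :
  continuous f x -> continuous g x -> continuous (fun y => (f y, g y) : U * V) x.
Proof.
intros hf hg P [d hd].
assert (h1 : locally x (fun y => ball (f x) d (f y))) by exact (hf _ (locally_ball (f x) d)).
assert (h2 : locally x (fun y => ball (g x) d (g y))) by exact (hg _ (locally_ball (g x) d)).
unfold filtermap; generalize (filter_and _ _ h1 h2); apply filter_imp; intros y [b1 b2]; apply hd; split; assumption.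
Qed.

Lemma jcont_comp (f : R -> R -> R) (g h : R * R -> R) (p : R * R) :
  jcont f (g p) (h p) -> continuous g p -> continuous h p ->
  continuous (fun q => f (g q) (h q)) p.
Proof.
intros hf hg hh.
apply (continuous_comp (fun q => (g q, h q)) (fun q => f (fst q) (snd q))); [|exact hf].
now apply continuous_pair.
Qed.

Lemma jcont_ext_pos (f g : R -> R -> R) (z t : R) : 0 < t ->
  (forall z t, 0 < t -> f z t = g z t) -> jcont g z t -> jcont f z t.
Proof.
intros ht hfg; apply continuous_ext_loc.
exists (mkposreal t ht); intros [z' t'] [_ h']; simpl in *.
change (Rabs (t' - t) < t) in h'; apply Rabs_lt_between in h'; symmetry; apply hfg; lra.
Qed.

(** Freezing a function before time zero turns continuity relative to the half plane into continuity
    at every point of the plane, to which composition and compactness theorems apply. *)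
Lemma jcont_max0 (f : R -> R -> R) : jointly_continuous_on (fun t => 0 <= t) f ->
  forall z t, jcont (fun z t => f z (Rmax 0 t)) z t.
Proof.
intros h z t P hP.
assert (h1 := h (z, Rmax 0 t) (Rmax_l 0 t) P hP); unfold filtermap, within in h1; simpl in h1.
assert (hc : continuous (fun p : R * R => (fst p, Rmax 0 (snd p))) (z, t)).
{ apply continuous_pair; [apply continuous_fst|].
  apply (continuous_comp snd (Rmax 0)); [apply continuous_snd|apply continuous_Rmax0]. }
generalize (hc _ h1); unfold filtermap; apply filter_imp; intros p hp; apply hp, Rmax_l.
Qed.

Lemma is_derive_along (f fz : R -> R -> R) (g : R -> R) (t dg ft : R) :
  locally (g t, t) (fun p : R * R => is_derive (fun y => f y (snd p)) (fst p) (fz (fst p) (snd p))) ->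
  jcont fz (g t) t -> is_derive (fun s => f (g t) s) t ft -> is_derive g t dg ->
  is_derive (fun s => f (g s) s) t (dg * fz (g t) t + ft).
Proof.
intros h1 h2 h3 h4.
assert (hd := filterdiff_comp'_2 g (fun s => s) f t (fun y => scal y dg) (fun y => y)
   (fun y y' => plus (scal y (fz (g t) t)) (scal y' ft)) h4 (filterdiff_id _)
   (is_derive_filterdiff f (g t) t fz ft h1 h3 h2)).
simpl in hd; unfold is_derive.
apply filterdiff_ext_lin with (1 := hd); intros y; unfold scal, plus; simpl; unfold mult; simpl; ring.
Qed.

Lemma Derive_shift (f : R -> R) (c z : R) : Derive (fun y => f (y + c)) z = Derive f (z + c).
Proof.
unfold Derive; f_equal; apply Lim_ext; intros y; do 2 f_equal; f_equal; ring.
Qed.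

Lemma ex_derive_shift (f : R -> R) (c z : R) : ex_derive f (z + c) ->
  ex_derive (fun y => f (y + c)) z.
Proof.
intros h; apply (ex_derive_comp f (fun y => y + c)); [exact h|].
auto_derive; exact I.
Qed.

Lemma continuous_shift (f : R -> R) (c z : R) : continuous f (z + c) ->
  continuous (fun y => f (y + c)) z.
Proof.
intros h; apply (continuous_comp (fun y => y + c) f); [|exact h].
apply (continuous_plus (fun y => y) (fun _ => c)); [apply continuous_id|apply continuous_const].
Qed.

Lemma Cm_shift (m : nat) (f : R -> R) (c : R) : Cm m f -> Cm m (fun z => f (z + c)).
Proof.
intros h.
assert (hn : forall k z, Derive_n (fun z => f (z + c)) k z = Derive_n f k (z + c)).
{ induction k as [|k IH]; intros z; [reflexivity|].
  simpl; rewrite (Derive_ext _ (fun y => Derive_n f k (y + c))) by apply IH; apply Derive_shift. }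
intros k hk z; destruct (h k hk (z + c)) as [h1 h2]; split.
- destruct k as [|k]; [exact I|]; simpl in *.
  apply ex_derive_ext with (fun y => Derive_n f k (y + c)); [intros; symmetry; apply hn|].
  now apply ex_derive_shift.
- apply continuous_ext with (fun y => Derive_n f k (y + c)); [intros; symmetry; apply hn|].
  now apply continuous_shift.
Qed.

Lemma RInt_shift (f : R -> R) (c a b : R) : (forall z, continuous f z) ->
  RInt (fun z => f (z + c)) a b = RInt f (a + c) (b + c).
Proof.
intros hc.
generalize (RInt_comp_lin (V := R_CompleteNormedModule) f 1 c a b).
rewrite !Rmult_1_l; intros h; rewrite <- h.
- apply RInt_ext; intros z _; unfold scal; simpl; unfold mult; simpl.
  now rewrite !Rmult_1_l.
- apply (ex_RInt_continuous (V := R_CompleteNormedModule)); auto.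
Qed.

Lemma RInt_periodic_shift (f : R -> R) (c : R) : periodic1 f -> (forall z, continuous f z) ->
  RInt (fun z => f (z + c)) 0 1 = RInt f 0 1.
Proof.
intros hp hc.
assert (hex : forall a b, ex_RInt f a b)
  by (intros; apply (ex_RInt_continuous (V := R_CompleteNormedModule)); auto).
rewrite (RInt_shift f c 0 1 hc).
rewrite Rplus_0_l.
assert (e1 := RInt_Chasles (V := R_CompleteNormedModule) f c 0 1 (hex _ _) (hex _ _)).
assert (e2 := RInt_Chasles (V := R_CompleteNormedModule) f c 1 (1 + c) (hex _ _) (hex _ _)).
assert (e3 : RInt f 1 (1 + c) = RInt f 0 c).
{ transitivity (RInt (fun z => f (z + 1)) 0 c); [|apply RInt_ext; intros; apply hp].
  rewrite (RInt_shift f 1 0 c hc); f_equal; ring. }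
assert (e4 := opp_RInt_swap (V := R_CompleteNormedModule) f 0 c (hex _ _)).
unfold plus, opp in *; simpl in *.
rewrite <- e2, e3, <- e1, <- e4.
generalize (RInt f 0 c) (RInt f 0 1); simpl; intros; ring.
Qed.

Section Shift.
Variables (nu : R) (a u0 v0 : R -> R) (u v psi : R -> R -> R).
Hypothesis ha : continuous_on (fun t => 0 <= t) a.
Hypothesis hs : model_solution nu (fun _ => 0) u0 v0 u v psi.

(** Periodicity reduces all [z] to a compact interval, so the modulus of continuity in time is
    uniform on the whole line. *)
Lemma velocity_uniform (T : R) (eps : posreal) : exists d : posreal,
  forall z s t, 0 <= s <= T -> 0 <= t <= T -> Rabs (t - s) < d -> Rabs (v z t - v z s) < eps.
Proof.
assert (hj := jcont_max0 v (cr_continuous _ _ (ms_regular_v _ _ _ _ _ _ _ hs))).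
destruct (uniform_continuity_2d (fun t z => v z (Rmax 0 t)) 0 T 0 1) with (eps := eps) as [d hd].
- intros t z _ _; apply (jcont_continuity_2d (fun z t => v z (Rmax 0 t))), hj.
- exists d; intros z s t h1 h2 h3.
  destruct (base_Int_part z) as [b1 b2].
  assert (e : forall r, 0 <= r -> v z r = v (z - IZR (Int_part z)) r).
  { intros r hr; rewrite <- (periodic1_IZR (fun z => v z r)
      (ms_periodic_v _ _ _ _ _ _ _ hs r hr) (Int_part z) (z - IZR (Int_part z))).
    f_equal; ring. }
  rewrite !e by lra.
  generalize (hd s (z - IZR (Int_part z)) t (z - IZR (Int_part z))).
  rewrite !Rmax_right by lra; intros h; apply h; try lra.
  unfold Rminus at 1; rewrite Rplus_opp_r, Rabs_R0; apply cond_pos.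
Qed.

(** By uniform continuity [v] changes by less than 1 over time steps of length [d / 2], and [T] is
    reached in finitely many of them. *)
Lemma velocity_bounded (T : R) : 0 <= T -> exists M, 0 <= M /\
  forall z t, 0 <= t <= T -> Rabs (v z t) <= M.
Proof.
intros hT; destruct (velocity_uniform T (mkposreal 1 Rlt_0_1)) as [d hd]; simpl in hd.
assert (hdp := cond_pos d).
assert (hj := jcont_max0 v (cr_continuous _ _ (ms_regular_v _ _ _ _ _ _ _ hs))).
destruct (periodic1_bounded (fun z => v z 0) (ms_periodic_v _ _ _ _ _ _ _ hs 0 (Rle_refl _)))
  as [M0 [hM0 hM]].
{ intros z; generalize (jcont_z _ _ _ (hj z 0)); rewrite Rmax_left by lra; auto. }
assert (hn : forall n z t, 0 <= t <= T -> t <= INR n * (d / 2) -> Rabs (v z t) <= M0 + INR n).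
{ induction n as [|n IH]; intros z t ht htn.
  - simpl in *; replace t with 0 by lra; generalize (hM z); lra.
  - rewrite S_INR in *; destruct (Rle_dec t (d / 2)) as [h|h].
    + replace (v z t) with (v z 0 + (v z t - v z 0)) by ring.
      eapply Rle_trans; [apply Rabs_triang|].
      assert (Rabs (v z t - v z 0) < 1) by (apply hd; try lra; rewrite Rabs_pos_eq; lra).
      generalize (hM z) (pos_INR n); lra.
    + replace (v z t) with (v z (t - d / 2) + (v z t - v z (t - d / 2))) by ring.
      eapply Rle_trans; [apply Rabs_triang|].
      assert (Rabs (v z t - v z (t - d / 2)) < 1)
        by (apply hd; try lra; rewrite Rabs_pos_eq; lra).
      generalize (IH z (t - d / 2) ltac:(lra) ltac:(lra)); lra. }
destruct (nfloor_ex (T / (d / 2))) as [n [_ h2]]; [apply Rdiv_le_0_compat; lra|].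
exists (M0 + INR (S n)); split; [generalize (pos_INR (S n)); lra|].
intros z t ht; apply hn; [exact ht|].
rewrite S_INR; apply Rle_trans with (T / (d / 2) * (d / 2)); [|apply Rmult_le_compat_r; lra].
replace (T / (d / 2) * (d / 2)) with T by (field; lra); lra.
Qed.

Let drift (t x : R) : R := 2 * (psi x (Rmax 0 t) - a (Rmax 0 t)).

Lemma a_max0_continuous (t : R) : continuous (fun s => a (Rmax 0 s)) t.
Proof.
intros P hP; assert (h := ha (Rmax 0 t) (Rmax_l 0 t) P hP).
generalize (continuous_Rmax0 t _ h); unfold filtermap, within.
apply filter_imp; intros s hs'; apply hs', Rmax_l.
Qed.

(** Continuity of [psi] in time is not part of [model_solution]. It follows from [psi_z = - v] and
    the normalisation at [z = 0]: the increment of [psi] in time is [|x|] times at most the uniform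
    increment of [v]. *)
Lemma psi_max0_continuous (x t : R) : continuous (fun s => psi x (Rmax 0 s)) t.
Proof.
apply filterlim_locally; intros eps.
assert (he := cond_pos eps).
assert (he1 : 0 < eps / (Rabs x + 1)).
{ apply Rdiv_lt_0_compat; [lra|generalize (Rabs_pos x); lra]. }
destruct (velocity_uniform (Rabs t + 1) (mkposreal _ he1)) as [d hd]; simpl in hd.
assert (hd1 : 0 < Rmin 1 d) by (apply Rmin_glb_lt; [lra|apply cond_pos]).
exists (mkposreal _ hd1); intros s hs'; change (Rabs (s - t) < Rmin 1 d) in hs'.
change (Rabs (psi x (Rmax 0 s) - psi x (Rmax 0 t)) < eps).
assert (h1 : Rabs (s - t) < 1) by (eapply Rlt_le_trans; [exact hs'|apply Rmin_l]).
assert (h2 : Rabs (s - t) < d) by (eapply Rlt_le_trans; [exact hs'|apply Rmin_r]).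
assert (h3 : Rabs (Rmax 0 s - Rmax 0 t) < d).
{ eapply Rle_lt_trans; [|exact h2].
  unfold Rmax, Rabs; repeat destruct Rle_dec; repeat destruct Rcase_abs; lra. }
assert (ht : 0 <= Rmax 0 t <= Rabs t + 1).
{ split; [apply Rmax_l|apply Rmax_lub; generalize (Rabs_pos t) (Rle_abs t); lra]. }
assert (hs0 : 0 <= Rmax 0 s <= Rabs t + 1).
{ apply Rabs_lt_between in h1.
  split; [apply Rmax_l|apply Rmax_lub; generalize (Rabs_pos t) (Rle_abs t); lra]. }
generalize (Lipschitz_of_derive (fun y => psi y (Rmax 0 s) - psi y (Rmax 0 t))
  (fun y => - v y (Rmax 0 s) - - v y (Rmax 0 t)) (eps / (Rabs x + 1))); intros hl.
specialize (hl ltac:(intros y; apply (is_derive_minus (fun y => psi y (Rmax 0 s)));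
  apply (ms_psi_z _ _ _ _ _ _ _ hs), Rmax_l)).
assert (hl' : forall y, Rabs (- v y (Rmax 0 s) - - v y (Rmax 0 t)) <= eps / (Rabs x + 1)).
{ intros y; left; replace (- v y (Rmax 0 s) - - v y (Rmax 0 t)) with
    (- (v y (Rmax 0 s) - v y (Rmax 0 t))) by ring; rewrite Rabs_Ropp; apply hd; auto. }
specialize (hl hl' 0 x).
rewrite !(ms_psi_0 _ _ _ _ _ _ _ hs) in hl by apply Rmax_l.
rewrite Rminus_0_r, Rminus_0_r, Rminus_0_r in hl.
eapply Rle_lt_trans; [exact hl|].
apply Rmult_lt_reg_r with ((Rabs x + 1) / eps).
{ apply Rdiv_lt_0_compat; [generalize (Rabs_pos x)|]; lra. }
generalize (Rabs_pos x); intros hx.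
replace (eps / (Rabs x + 1) * Rabs x * ((Rabs x + 1) / eps)) with (Rabs x) by (field; lra).
replace (eps * ((Rabs x + 1) / eps)) with (Rabs x + 1) by (field; lra); lra.
Qed.

Lemma drift_continuous (x t : R) : continuous (fun s => drift s x) t.
Proof.
apply (continuous_scal_r 2 (fun s => psi x (Rmax 0 s) - a (Rmax 0 s))).
apply (continuous_minus (fun s => psi x (Rmax 0 s))); [apply psi_max0_continuous|].
apply a_max0_continuous.
Qed.

Lemma drift_Lipschitz (T : R) : exists L, 0 <= L /\ forall t x y, Rabs t <= T ->
  Rabs (drift t x - drift t y) <= L * Rabs (x - y).
Proof.
destruct (velocity_bounded (Rmax 0 T) (Rmax_l _ _)) as [M [hM h]].
exists (2 * M); split; [lra|]; intros t x y ht.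
assert (ht' : 0 <= Rmax 0 t <= Rmax 0 T).
{ split; [apply Rmax_l|]; apply Rmax_lub; [apply Rmax_l|].
  eapply Rle_trans; [apply Rle_abs|eapply Rle_trans; [exact ht|apply Rmax_r]]. }
unfold drift.
replace (2 * (psi x (Rmax 0 t) - a (Rmax 0 t)) - 2 * (psi y (Rmax 0 t) - a (Rmax 0 t))) with
  (2 * (psi x (Rmax 0 t) - psi y (Rmax 0 t))) by ring.
rewrite Rabs_mult, (Rabs_pos_eq 2) by lra.
generalize (Lipschitz_of_derive (fun y => psi y (Rmax 0 t)) (fun y => - v y (Rmax 0 t)) M
  (fun z => ms_psi_z _ _ _ _ _ _ _ hs z _ (Rmax_l 0 t))
  (fun z => eq_ind_r (fun r => r <= M) (h z _ ht') (Rabs_Ropp (v z (Rmax 0 t)))) y x).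
lra.
Qed.

Lemma regularity_shift (f : R -> R -> R) (xi : R -> R) (hf : classical_regularity nu f)
  (hc : forall t, continuous xi t)
  (hd : forall t, 0 < t -> is_derive xi t (drift t (xi t))) :
  classical_regularity nu (fun z t => f (z + xi t) t) /\
  (forall z t, 0 < t -> d_t (fun z t => f (z + xi t) t) z t =
     drift t (xi t) * d_z f (z + xi t) t + d_t f (z + xi t) t).
Proof.
assert (cdrift : forall t, continuous (fun s => drift s (xi s)) t).
{ intros t; apply (continuous_along drift); auto; [apply drift_continuous|apply drift_Lipschitz]. }
assert (jz : forall z t, 0 < t -> jcont (d_z f) z t).
{ apply jointly_continuous_on_jcont, (cr_d_z _ _ hf). }
assert (jt : forall z t, 0 < t -> jcont (d_t f) z t).
{ apply jointly_continuous_on_jcont, (cr_d_t _ _ hf). }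
assert (csh : forall p : R * R, continuous (fun q : R * R => fst q + xi (snd q)) p).
{ intros p; apply (continuous_plus (fun q : R * R => fst q) (fun q => xi (snd q)));
    [apply continuous_fst|].
  apply (continuous_comp snd xi); [apply continuous_snd|apply hc]. }
assert (hder : forall z t, 0 < t -> is_derive (fun s => f (z + xi s) s) t
   (drift t (xi t) * d_z f (z + xi t) t + d_t f (z + xi t) t)).
{ intros z t ht; apply (is_derive_along f (d_z f) (fun s => z + xi s)).
  - exists (mkposreal t ht); intros [z' t'] [_ h']; simpl in *.
    change (Rabs (t' - t) < t) in h'; apply Rabs_lt_between in h'.
    apply Derive_correct, (cr_ex_d_z _ _ hf); lra.
  - apply jz, ht.
  - apply Derive_correct, (cr_ex_d_t _ _ hf), ht.
  - replace (drift t (xi t)) with (0 + drift t (xi t)) by ring.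
    apply (is_derive_plus (fun _ => z) xi); [apply (is_derive_const z)|apply hd, ht]. }
assert (hdt : forall z t, 0 < t -> d_t (fun z t => f (z + xi t) t) z t =
     drift t (xi t) * d_z f (z + xi t) t + d_t f (z + xi t) t)
  by (intros; now apply is_derive_unique, hder).
split; [|exact hdt].
assert (hz : forall z t, d_z (fun z t => f (z + xi t) t) z t = d_z f (z + xi t) t)
  by (intros z t; apply (Derive_shift (fun y => f y t))).
assert (hzz : forall z t, d_zz (fun z t => f (z + xi t) t) z t = d_zz f (z + xi t) t).
{ intros z t; unfold d_zz; unfold d_z at 1.
  rewrite (Derive_ext _ (fun y => d_z f (y + xi t) t)) by (intros; apply hz).
  apply (Derive_shift (fun y => d_z f y t)). }
constructor.
- intros [z t] ht; simpl in ht.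
  assert (hj : continuous (fun p : R * R => f (fst p + xi (snd p)) (Rmax 0 (snd p))) (z, t)).
  { apply (jcont_comp (fun z t => f z (Rmax 0 t)) (fun p => fst p + xi (snd p)) snd).
    - apply jcont_max0, (cr_continuous _ _ hf).
    - apply csh.
    - apply continuous_snd. }
  intros P hP; simpl in hP; rewrite <- (Rmax_right 0 t ht) in hP at 2.
  generalize (hj P hP); unfold filtermap, within; apply filter_imp.
  intros p hp hp0; rewrite Rmax_right in hp by exact hp0; exact hp.
- intros z t ht; eexists; apply hder, ht.
- intros z t ht; apply (ex_derive_shift (fun y => f y t)), (cr_ex_d_z _ _ hf), ht.
- apply jcont_jointly_continuous_on; intros z t ht.
  apply (jcont_ext_pos _ (fun z t => drift t (xi t) * d_z f (z + xi t) t + d_t f (z + xi t) t)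
    z t ht hdt).
  apply (continuous_plus (fun p : R * R => drift (snd p) (xi (snd p)) * d_z f (fst p + xi (snd p)) (snd p))
    (fun p => d_t f (fst p + xi (snd p)) (snd p))).
  + apply (continuous_mult (fun p : R * R => drift (snd p) (xi (snd p)))
      (fun p => d_z f (fst p + xi (snd p)) (snd p))).
    * apply (continuous_comp snd (fun s => drift s (xi s))); [apply continuous_snd|apply cdrift].
    * apply (jcont_comp (d_z f) (fun p => fst p + xi (snd p)) snd);
        [apply jz, ht|apply csh|apply continuous_snd].
  + apply (jcont_comp (d_t f) (fun p => fst p + xi (snd p)) snd);
      [apply jt, ht|apply csh|apply continuous_snd].
- apply jcont_jointly_continuous_on; intros z t ht.
  apply (jcont_ext_pos _ (fun z t => d_z f (z + xi t) t) z t ht (fun z t _ => hz z t)).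
  apply (jcont_comp (d_z f) (fun p => fst p + xi (snd p)) snd);
      [apply jz, ht|apply csh|apply continuous_snd].
- intros hn z t ht.
  apply ex_derive_ext with (fun y => d_z f (y + xi t) t); [intros; symmetry; apply hz|].
  apply (ex_derive_shift (fun y => d_z f y t)), (cr_ex_d_zz _ _ hf hn), ht.
- intros hn; apply jcont_jointly_continuous_on; intros z t ht.
  apply (jcont_ext_pos _ (fun z t => d_zz f (z + xi t) t) z t ht (fun z t _ => hzz z t)).
  apply (jcont_comp (d_zz f) (fun p => fst p + xi (snd p)) snd);
    [|apply csh|apply continuous_snd].
  apply (jointly_continuous_on_jcont _ (cr_d_zz _ _ hf hn)), ht.
Qed.

(** In the moving frame the time derivative gains [xi' f_z]. With the chosen [xi'] this compensates
    exactly the change of [psi] by a function of time, and [c_of] stays the same because integrals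
    of periodic functions over a period are invariant under translation. *)
Theorem shift_solution : exists xi : R -> R,
  model_solution nu a u0 v0 (fun z t => u (z + xi t) t) (fun z t => v (z + xi t) t)
    (fun z t => psi (z + xi t) t - psi (xi t) t + a t).
Proof.
destruct (ode_solution drift 0 drift_continuous drift_Lipschitz) as [xi [h0 [hc hd]]].
exists xi.
destruct (regularity_shift u xi (ms_regular_u _ _ _ _ _ _ _ hs) hc hd) as [ru du].
destruct (regularity_shift v xi (ms_regular_v _ _ _ _ _ _ _ hs) hc hd) as [rv dv].
assert (cf : forall f z t, classical_regularity nu f -> 0 <= t -> continuous (fun y => f y t) z).
{ intros f z t hf ht.
  generalize (jcont_z _ _ _ (jcont_max0 f (cr_continuous _ _ hf) z t)).
  rewrite Rmax_right by exact ht; auto. }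
assert (hz : forall f z t, d_z (fun z t => f (z + xi t) t) z t = d_z f (z + xi t) t)
  by (intros f z t; apply (Derive_shift (fun y => f y t))).
assert (hzz : forall f z t, d_zz (fun z t => f (z + xi t) t) z t = d_zz f (z + xi t) t).
{ intros f z t; unfold d_zz; unfold d_z at 1.
  rewrite (Derive_ext _ (fun y => d_z f (y + xi t) t)) by (intros; apply hz).
  apply (Derive_shift (fun y => d_z f y t)). }
assert (hper : forall f t, periodic1 (fun z => f z t) -> periodic1 (fun z => f (z + xi t) t)).
{ intros f t hf z; simpl; replace (z + 1 + xi t) with (z + xi t + 1) by ring; apply hf. }
assert (hdr : forall t, 0 < t -> drift t (xi t) = 2 * (psi (xi t) t - a t)).
{ intros t ht; unfold drift; rewrite !Rmax_right by lra; reflexivity. }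
constructor.
- intros t ht; apply (hper u), (ms_periodic_u _ _ _ _ _ _ _ hs), ht.
- intros t ht; apply (hper v), (ms_periodic_v _ _ _ _ _ _ _ hs), ht.
- intros t ht z; do 2 f_equal; apply (hper psi), (ms_periodic_psi _ _ _ _ _ _ _ hs), ht.
- exact ru.
- exact rv.
- intros z t ht.
  replace (- v (z + xi t) t) with (1 * - v (z + xi t) t - 0 + 0) by ring.
  apply (is_derive_plus (fun y => psi (y + xi t) t - psi (xi t) t) (fun _ => a t));
    [|apply (is_derive_const (a t))].
  apply (is_derive_minus (fun y => psi (y + xi t) t) (fun _ => psi (xi t) t));
    [|apply (is_derive_const (psi (xi t) t))].
  apply (is_derive_comp (fun y => psi y t) (fun y => y + xi t)).
  + apply (ms_psi_z _ _ _ _ _ _ _ hs), ht.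
  + auto_derive; [exact I|ring].
- intros t ht; rewrite Rplus_0_l; ring.
- intros z; rewrite h0, Rplus_0_r; apply (ms_init_u _ _ _ _ _ _ _ hs).
- intros z; rewrite h0, Rplus_0_r; apply (ms_init_v _ _ _ _ _ _ _ hs).
- intros z t ht; rewrite du, (hz u), (hzz u), hdr by exact ht.
  generalize (ms_eq_u _ _ _ _ _ _ _ hs (z + xi t) t ht); lra.
- intros z t ht; rewrite dv, (hz v), (hzz v), hdr by exact ht.
  assert (ec : c_of (fun z t => u (z + xi t) t) (fun z t => v (z + xi t) t) t = c_of u v t).
  { assert (hi : forall f, classical_regularity nu f -> periodic1 (fun z => f z t) ->
      RInt (fun z => f (z + xi t) t ^ 2) 0 1 = RInt (fun z => f z t ^ 2) 0 1).
    { intros f hf hp; apply (RInt_periodic_shift (fun z => f z t ^ 2)).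
      - intros y; simpl; now rewrite (hp y).
      - intros y; apply (continuous_ext (fun z => f z t * f z t)); [intros; simpl; ring|].
        apply (continuous_mult (fun z => f z t) (fun z => f z t)); apply cf; auto; lra. }
    unfold c_of; rewrite !hi; auto;
      [apply (ms_regular_u _ _ _ _ _ _ _ hs)|apply (ms_periodic_u _ _ _ _ _ _ _ hs)|
       apply (ms_regular_v _ _ _ _ _ _ _ hs)|apply (ms_periodic_v _ _ _ _ _ _ _ hs)]; lra. }
  rewrite ec.
  generalize (ms_eq_v _ _ _ _ _ _ _ hs (z + xi t) t ht); lra.
Qed.

End Shift.

(** * Functions of class [C^k] and inverses of flows *)

(** Equivalent to [Cm] by [Ck_of_Cm] and [Cm_of_Ck], but recursive in the derivative, so that
    products, compositions and inverses are treated by a direct induction. *)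
Fixpoint Ck (k : nat) (f : R -> R) : Prop :=
  match k with
  | O => forall z, continuous f z
  | S k => exists f', (forall z, is_derive f z (f' z)) /\ Ck k f'
  end.

Lemma Ck_continuous (k : nat) (f : R -> R) : Ck k f -> forall z, continuous f z.
Proof.
destruct k as [|k]; [auto|]; intros [f' [h _]] z.
apply (ex_derive_continuous f); eexists; apply h.
Qed.

Lemma Ck_S (k : nat) (f : R -> R) : Ck (S k) f -> Ck k f.
Proof.
revert f; induction k as [|k IH]; intros f h; [exact (Ck_continuous 1 f h)|].
destruct h as [f' [h1 h2]]; exists f'; auto.
Qed.

Lemma Ck_le (n k : nat) (f : R -> R) : (k <= n)%nat -> Ck n f -> Ck k f.
Proof. intros h; induction h; [auto|intros hf; apply IHh, Ck_S, hf]. Qed.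

Lemma Ck_const (k : nat) (c : R) : Ck k (fun _ => c).
Proof.
revert c; induction k as [|k IH]; intros c; [intros z; apply continuous_const|].
exists (fun _ => 0); split; [intros z; apply (is_derive_const c)|apply IH].
Qed.

Lemma Ck_plus (k : nat) (f g : R -> R) : Ck k f -> Ck k g -> Ck k (fun z => f z + g z).
Proof.
revert f g; induction k as [|k IH]; intros f g.
- intros hf hg z; apply (continuous_plus f g); auto.
- intros [f' [h1 h2]] [g' [h3 h4]]; exists (fun z => f' z + g' z); split; [|auto].
  intros z; apply (is_derive_plus f g); auto.
Qed.

Lemma Ck_mult (k : nat) (f g : R -> R) : Ck k f -> Ck k g -> Ck k (fun z => f z * g z).
Proof.
revert f g; induction k as [|k IH]; intros f g.
- intros hf hg z; apply (continuous_mult f g); auto.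
- intros hf hg; assert (kf := Ck_S _ _ hf); assert (kg := Ck_S _ _ hg).
  destruct hf as [f' [h1 h2]], hg as [g' [h3 h4]].
  exists (fun z => f' z * g z + f z * g' z); split.
  + intros z; apply (is_derive_mult f g z); auto; intros; apply Rmult_comm.
  + apply Ck_plus; auto.
Qed.

Lemma Ck_comp (k : nat) (f g : R -> R) : Ck k f -> Ck k g -> Ck k (fun z => f (g z)).
Proof.
revert f g; induction k as [|k IH]; intros f g.
- intros hf hg z; apply (continuous_comp g f); auto.
- intros hf hg; assert (kg := Ck_S _ _ hg).
  destruct hf as [f' [h1 h2]], hg as [g' [h3 h4]].
  exists (fun z => g' z * f' (g z)); split.
  + intros z; apply (is_derive_comp f g); auto.
  + apply Ck_mult; auto.
Qed.

Lemma Ck_inv (k : nat) (f : R -> R) : (forall z, f z <> 0) -> Ck k f -> Ck k (fun z => / f z).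
Proof.
intros h0; revert f h0; induction k as [|k IH]; intros f h0.
- intros hf z; apply (continuous_comp f Rinv); [apply hf|apply continuous_Rinv, h0].
- intros hf; assert (kf := Ck_S _ _ hf); destruct hf as [f' [h1 h2]].
  exists (fun z => - 1 * f' z * (/ f z * / f z)); split.
  + intros z; replace (- 1 * f' z * (/ f z * / f z)) with (- f' z / f z ^ 2)
      by (field; apply h0).
    apply is_derive_inv; auto.
  + apply Ck_mult; [apply Ck_mult; [apply Ck_const|exact h2]|apply Ck_mult; auto].
Qed.

Lemma Ck_of_Cm (m : nat) (f : R -> R) : Cm m f -> Ck m f.
Proof.
revert f; induction m as [|m IH]; intros f h.
- intros z; apply (h O (le_n _) z).
- exists (Derive f); split.
  + intros z; apply Derive_correct, (proj1 (h 1%nat ltac:(lia) z)).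
  + apply IH; intros k hk z; destruct (h (S k) ltac:(lia) z) as [h1 h2].
    assert (e : forall j y, Derive_n (Derive f) j y = Derive_n f (S j) y)
      by (intros j y; exact (Derive_n_comp f j 1 y)  || (rewrite <- Nat.add_1_r; apply (Derive_n_comp f j 1))).
    split.
    * destruct k as [|k]; [exact I|]; simpl.
      apply ex_derive_ext with (Derive_n f (S k)); [intros; symmetry; apply e|exact h1].
    * apply continuous_ext with (Derive_n f (S k)); [intros; symmetry; apply e|exact h2].
Qed.

Lemma Cm_of_Ck (m : nat) (f : R -> R) : Ck m f -> Cm m f.
Proof.
revert f; induction m as [|m IH]; intros f h.
- intros k hk z; replace k with O by lia; split; [exact I|apply h].
- assert (hc := Ck_continuous _ _ h); destruct h as [f' [h1 h2]].
  assert (hD : Derive f = f') by (apply functional_extensionality; intros; apply is_derive_unique, h1).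
  intros [|k] hk z; [split; [exact I|apply hc]|].
  destruct (IH f' h2 k ltac:(lia) z) as [a1 a2].
  assert (e : forall j y, Derive_n f' j y = Derive_n f (S j) y)
    by (rewrite <- hD; intros j y; rewrite <- Nat.add_1_r; apply (Derive_n_comp f j 1)).
  split.
  + destruct k as [|k]; [eexists; apply h1|]; simpl in a1.
    apply ex_derive_ext with (Derive_n f' k); [intros; apply e|exact a1].
  + apply continuous_ext with (Derive_n f' k); [intros; apply e|exact a2].
Qed.

(** Differentiation in the manner of Caratheodory: the increment of [g] is that of [h] times a slope
    function, of which only continuity at [x] is used. It makes inverses differentiable without
    dividing by increments that may vanish. *)
Lemma is_derive_factor (g h k : R -> R) (x l : R) : continuous k x -> is_derive h x l ->
  (forall y, g y - g x = k y * (h y - h x)) -> is_derive g x (k x * l).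
Proof.
intros hk hh hg; apply is_derive_Reals; apply is_derive_Reals in hh; intros eps heps.
assert (e1 : 0 < Rmin 1 (eps / (2 * (Rabs l + 1)))).
{ apply Rmin_glb_lt; [lra|apply Rdiv_lt_0_compat; [lra|generalize (Rabs_pos l); lra]]. }
assert (e2 : 0 < eps / (2 * (Rabs (k x) + 1))).
{ apply Rdiv_lt_0_compat; [lra|generalize (Rabs_pos (k x)); lra]. }
destruct (proj1 (filterlim_locally _ _) hk (mkposreal _ e1)) as [d1 h1].
destruct (hh _ e2) as [d2 h2].
exists (mkposreal (Rmin d1 d2) (Rmin_stable_in_posreal d1 d2)); intros r hr0 hr; simpl in hr.
assert (r1 : Rabs r < d1) by (eapply Rlt_le_trans; [exact hr|apply Rmin_l]).
assert (r2 : Rabs r < d2) by (eapply Rlt_le_trans; [exact hr|apply Rmin_r]).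
specialize (h2 r hr0 r2).
assert (h1' : Rabs (k (x + r) - k x) < Rmin 1 (eps / (2 * (Rabs l + 1)))).
{ apply (h1 (x + r)); change (Rabs (x + r - x) < d1); replace (x + r - x) with r by ring; exact r1. }
assert (h3 : Rabs (k (x + r) - k x) < 1) by (eapply Rlt_le_trans; [exact h1'|apply Rmin_l]).
assert (h4 : Rabs (k (x + r) - k x) < eps / (2 * (Rabs l + 1)))
  by (eapply Rlt_le_trans; [exact h1'|apply Rmin_r]).
rewrite hg.
set (q := (h (x + r) - h x) / r) in *.
replace (k (x + r) * (h (x + r) - h x) / r - k x * l) with
  (k (x + r) * (q - l) + (k (x + r) - k x) * l) by (unfold q; field; exact hr0).
eapply Rle_lt_trans; [apply Rabs_triang|]; rewrite !Rabs_mult.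
assert (hkb : Rabs (k (x + r)) <= Rabs (k x) + 1).
{ replace (k (x + r)) with (k x + (k (x + r) - k x)) by ring.
  eapply Rle_trans; [apply Rabs_triang|lra]. }
assert (a1 : Rabs (k (x + r)) * Rabs (q - l) <= (Rabs (k x) + 1) * Rabs (q - l))
  by (apply Rmult_le_compat_r; [apply Rabs_pos|exact hkb]).
assert (a2 : (Rabs (k x) + 1) * Rabs (q - l) < (Rabs (k x) + 1) * (eps / (2 * (Rabs (k x) + 1))))
  by (apply Rmult_lt_compat_l; [generalize (Rabs_pos (k x)); lra|exact h2]).
replace ((Rabs (k x) + 1) * (eps / (2 * (Rabs (k x) + 1)))) with (eps / 2) in a2
  by (field; generalize (Rabs_pos (k x)); lra).
assert (a3 : Rabs (k (x + r) - k x) * Rabs l <= eps / (2 * (Rabs l + 1)) * (Rabs l + 1)).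
{ apply Rmult_le_compat; try apply Rabs_pos; lra. }
replace (eps / (2 * (Rabs l + 1)) * (Rabs l + 1)) with (eps / 2) in a3
  by (field; generalize (Rabs_pos l); lra).
lra.
Qed.

(** * The inverse of a monotone flow *)

Section Inverse.
Variables (X J a : R -> R -> R).
Hypothesis hX : forall x t, is_derive (fun y => X y t) x (J x t).
Hypothesis hJ : forall x t, 0 < J x t.
Hypothesis hJc : forall x t, jcont J x t.
Hypothesis hXt : forall x t, continuous (fun s => X x s) t.
Hypothesis ha : forall z t, X (a z t) t = z.

Lemma flow_mvt (x y t : R) : exists c, Rmin x y <= c <= Rmax x y /\
  X y t - X x t = J c t * (y - x).
Proof.
destruct (MVT_gen (fun y => X y t) x y (fun y => J y t)) as [c [h1 h2]].
- intros; apply hX.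
- intros z _; apply continuity_pt_filterlim, (ex_derive_continuous (fun y => X y t)).
  eexists; apply hX.
- exists c; auto.
Qed.

Lemma flow_increasing (x y t : R) : x < y -> X x t < X y t.
Proof.
intros h; destruct (flow_mvt x y t) as [c [_ e]]; generalize (hJ c t); nra.
Qed.

Lemma flow_reflect (x y t : R) : X x t < X y t -> x < y.
Proof.
intros h; destruct (Rlt_le_dec x y) as [l|l]; [exact l|exfalso].
destruct (Rle_lt_or_eq_dec _ _ l) as [l'|e]; [|subst; lra].
generalize (flow_increasing y x t l'); lra.
Qed.

(** By monotonicity it is enough to trap [z'] between the images of [x - eps / 2] and [x + eps / 2]
    at time [t'], and these two images depend continuously on time. *)
Lemma inverse_jcont (z t : R) : jcont a z t.
Proof.
apply filterlim_locally; intros eps; simpl.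
set (x := a z t).
assert (he := cond_pos eps).
assert (h1 : X (x - eps / 2) t < z) by (rewrite <- (ha z t) at 1; apply flow_increasing; unfold x; lra).
assert (h2 : z < X (x + eps / 2) t) by (rewrite <- (ha z t) at 1; apply flow_increasing; unfold x; lra).
assert (e1 : 0 < (z - X (x - eps / 2) t) / 2) by lra.
assert (e2 : 0 < (X (x + eps / 2) t - z) / 2) by lra.
destruct (proj1 (filterlim_locally _ _) (hXt (x - eps / 2) t) (mkposreal _ e1)) as [d1 k1].
destruct (proj1 (filterlim_locally _ _) (hXt (x + eps / 2) t) (mkposreal _ e2)) as [d2 k2].
assert (hd : 0 < Rmin (Rmin d1 d2) (Rmin ((z - X (x - eps / 2) t) / 2) ((X (x + eps / 2) t - z) / 2))).
{ repeat apply Rmin_glb_lt; auto; apply cond_pos. }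
exists (mkposreal _ hd); intros [z' t'] [b1 b2].
change (Rabs (z' - z) < Rmin (Rmin d1 d2) (Rmin ((z - X (x - eps / 2) t) / 2) ((X (x + eps / 2) t - z) / 2))) in b1.
change (Rabs (t' - t) < Rmin (Rmin d1 d2) (Rmin ((z - X (x - eps / 2) t) / 2) ((X (x + eps / 2) t - z) / 2))) in b2.
change (Rabs (a z' t' - x) < eps).
assert (c1 : Rabs (t' - t) < d1)
  by (eapply Rlt_le_trans; [exact b2|]; eapply Rle_trans; [apply Rmin_l|apply Rmin_l]).
assert (c2 : Rabs (t' - t) < d2)
  by (eapply Rlt_le_trans; [exact b2|]; eapply Rle_trans; [apply Rmin_l|apply Rmin_r]).
assert (c3 : Rabs (z' - z) < (z - X (x - eps / 2) t) / 2)
  by (eapply Rlt_le_trans; [exact b1|]; eapply Rle_trans; [apply Rmin_r|apply Rmin_l]).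
assert (c4 : Rabs (z' - z) < (X (x + eps / 2) t - z) / 2)
  by (eapply Rlt_le_trans; [exact b1|]; eapply Rle_trans; [apply Rmin_r|apply Rmin_r]).
specialize (k1 t' c1); specialize (k2 t' c2).
change (Rabs (X (x - eps / 2) t' - X (x - eps / 2) t) < (z - X (x - eps / 2) t) / 2) in k1.
change (Rabs (X (x + eps / 2) t' - X (x + eps / 2) t) < (X (x + eps / 2) t - z) / 2) in k2.
apply Rabs_lt_between in k1; apply Rabs_lt_between in k2.
apply Rabs_lt_between in c3; apply Rabs_lt_between in c4.
assert (x - eps / 2 < a z' t') by (apply (flow_reflect _ _ t'); rewrite ha; lra).
assert (a z' t' < x + eps / 2) by (apply (flow_reflect _ _ t'); rewrite ha; lra).
apply Rabs_lt_between; lra.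
Qed.

(* Slope of the inverse of [X . s] between [x0] and [g s]; by the mean value theorem it is
   [1 / J] at an intermediate point, hence continuous at [s = t]. *)
Lemma inverse_slope (g : R -> R) (b : R -> R) (t x0 : R) (hg0 : g t = x0) (hgc : continuous g t)
  (hbc : continuous b t) :
  exists k : R -> R, continuous k t /\ k t = / J x0 (b t) /\
    forall s, g s - x0 = k s * (X (g s) (b s) - X x0 (b s)).
Proof.
exists (fun s => if Req_EM_T (g s) x0 then / J x0 (b t)
                 else (g s - x0) / (X (g s) (b s) - X x0 (b s))).
assert (hk : forall s, g s <> x0 -> exists c, Rabs (c - x0) <= Rabs (g s - x0) /\
   (g s - x0) / (X (g s) (b s) - X x0 (b s)) = / J c (b s) /\ X (g s) (b s) - X x0 (b s) <> 0).
{ intros s hs; destruct (flow_mvt x0 (g s) (b s)) as [c [h1 h2]]; exists c.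
  assert (hj := hJ c (b s)).
  split; [|split].
  - revert h1; unfold Rmin, Rmax, Rabs; repeat destruct Rle_dec; repeat destruct Rcase_abs; lra.
  - rewrite h2; field; split; lra.
  - rewrite h2; apply Rmult_integral_contrapositive; split; lra. }
split; [|split].
- assert (hc : continuous (fun p : R * R => / J (fst p) (snd p)) (x0, b t)).
  { apply (continuous_comp (fun p : R * R => J (fst p) (snd p)) Rinv); [apply hJc|].
    apply continuous_Rinv; simpl; generalize (hJ x0 (b t)); lra. }
  apply filterlim_locally; intros eps.
  destruct (proj1 (filterlim_locally _ _) hc eps) as [d hd].
  assert (n1 := proj1 (filterlim_locally _ _) hgc d); assert (n2 := proj1 (filterlim_locally _ _) hbc d).
  generalize (filter_and _ _ n1 n2); apply filter_imp; intros s [b1 b2].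
  change (Rabs (g s - g t) < d) in b1; rewrite hg0 in b1.
  destruct (Req_EM_T (g t) x0) as [_|n]; [|contradiction].
  destruct (Req_EM_T (g s) x0) as [e|n].
  + apply ball_center.
  + destruct (hk s n) as [c [h1 [h2 _]]]; rewrite h2.
    apply (hd (c, b s)); split; [|exact b2].
    change (Rabs (c - x0) < d); lra.
- destruct (Req_EM_T (g t) x0) as [_|n]; [reflexivity|contradiction].
- intros s; destruct (Req_EM_T (g s) x0) as [e|n]; [rewrite e; ring|].
  destruct (hk s n) as [c [_ [_ h3]]]; field; exact h3.
Qed.

Lemma inverse_is_derive_z (z t : R) : is_derive (fun y => a y t) z (/ J (a z t) t).
Proof.
destruct (inverse_slope (fun y => a y t) (fun _ => t) z (a z t) eq_refl) as [k [h1 [h2 h3]]].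
- apply jcont_z, inverse_jcont.
- apply continuous_const.
- rewrite <- h2, <- (Rmult_1_r (k z)).
  apply (is_derive_factor _ (fun y => y)); [exact h1|apply (is_derive_id z)|].
  intros y; rewrite h3, !ha; reflexivity.
Qed.

(** The images of [a z s] and [a z t] are compared at the same time [s]. There [X (a z s) s = z] is
    constant, so the whole variation is that of [X (a z t) s], which has the opposite sign. *)
Lemma inverse_is_derive_t (z t Xt : R) : is_derive (fun s => X (a z t) s) t Xt ->
  is_derive (fun s => a z s) t (- Xt / J (a z t) t).
Proof.
intros hd.
destruct (inverse_slope (fun s => a z s) (fun s => s) t (a z t) eq_refl) as [k [h1 [h2 h3]]].
- apply jcont_t, inverse_jcont.
- apply continuous_id.
- replace (- Xt / J (a z t) t) with (k t * - Xt)
    by (rewrite h2; field; generalize (hJ (a z t) t); lra).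
  apply (is_derive_factor _ (fun s => - X (a z t) s)); [exact h1| |].
  + apply (is_derive_opp (fun s => X (a z t) s)), hd.
  + intros y; rewrite h3, !ha; ring.
Qed.

End Inverse.

Lemma RInt_param_continuous (h : R -> R -> R) (a b s : R) :
  locally s (fun s => forall y, continuous (h s) y) ->
  (forall y, continuity_2d_pt h s y) ->
  continuous (fun s => RInt (h s) a b) s.
Proof.
intros hex hc.
assert (key : forall a b, a <= b -> continuous (fun s => RInt (h s) a b) s).
{ clear a b; intros a b hab; apply filterlim_locally; intros eps.
  assert (he : 0 < eps / (b - a + 1)) by (apply Rdiv_lt_0_compat; [apply cond_pos|lra]).
  destruct (uniform_continuity_2d_1d' h a b s (fun y _ => hc y) (mkposreal _ he)) as [d hd].
  simpl in hd.
  assert (h0 : forall y, continuous (h s) y) by exact (locally_singleton _ _ hex).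
  assert (hl : locally s (fun r => Rabs (r - s) < d)) by (exists d; auto).
  generalize (filter_and _ _ hex hl); apply filter_imp; intros r [h1 h2].
  change (Rabs (minus (RInt (h r) a b) (RInt (h s) a b)) < eps).
  assert (e1 : forall (g : R -> R), (forall y, continuous g y) -> ex_RInt g a b)
    by (intros; apply (ex_RInt_continuous (V := R_CompleteNormedModule)); auto).
  rewrite <- (RInt_minus (V := R_CompleteNormedModule)) by auto.
  apply Rle_lt_trans with ((b - a) * (eps / (b - a + 1))).
  - apply abs_RInt_le_const; [exact hab| |].
    + apply (ex_RInt_minus (V := R_NormedModule)); auto.
    + intros y hy; left; apply (hd y s y r); try lra.
      * generalize (cond_pos d); lra.
      * apply Rabs_lt_between in h2; lra.
      * unfold Rminus; rewrite Rplus_opp_r, Rabs_R0; apply cond_pos.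
  - apply Rmult_lt_reg_r with (b - a + 1); [lra|].
    replace ((b - a) * (eps / (b - a + 1)) * (b - a + 1)) with ((b - a) * eps) by (field; lra).
    generalize (cond_pos eps); nra. }
destruct (Rle_dec a b) as [hab|hab]; [now apply key|].
apply (continuous_ext_loc _ (fun s => opp (RInt (h s) b a))).
- revert hex; apply filter_imp; intros r hr.
  apply (opp_RInt_swap (V := R_CompleteNormedModule) (h r) b a).
  apply (ex_RInt_continuous (V := R_CompleteNormedModule)); auto.
- apply (continuous_opp (fun s => RInt (h s) b a)), key; lra.
Qed.

(** Meant for integrals with a variable upper limit: the integrand is the [z]-derivative, and
    continuity in the parameter is known for each fixed limit. *)
Lemma jcont_of_derive_z (f fz : R -> R -> R) (z t : R) :
  (forall z t, is_derive (fun y => f y t) z (fz z t)) -> jcont fz z t ->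
  continuous (fun s => f z s) t -> jcont f z t.
Proof.
intros hd hc ht; apply filterlim_locally; intros eps; simpl.
assert (he := cond_pos eps).
destruct (proj1 (filterlim_locally _ _) hc (mkposreal 1 Rlt_0_1)) as [d1 h1].
assert (e2 : 0 < eps / 2) by lra.
destruct (proj1 (filterlim_locally _ _) ht (mkposreal _ e2)) as [d2 h2].
set (M := Rabs (fz z t) + 1).
assert (hM : 0 < M) by (unfold M; generalize (Rabs_pos (fz z t)); lra).
assert (hdp : 0 < Rmin (Rmin d1 d2) (eps / (2 * M))).
{ apply Rmin_glb_lt; [apply Rmin_glb_lt; apply cond_pos|apply Rdiv_lt_0_compat; lra]. }
exists (mkposreal _ hdp); intros [z' t'] [b1 b2].
change (Rabs (z' - z) < Rmin (Rmin d1 d2) (eps / (2 * M))) in b1.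
change (Rabs (t' - t) < Rmin (Rmin d1 d2) (eps / (2 * M))) in b2.
change (Rabs (f z' t' - f z t) < eps).
assert (c1 : Rabs (z' - z) < d1)
  by (eapply Rlt_le_trans; [exact b1|]; eapply Rle_trans; [apply Rmin_l|apply Rmin_l]).
assert (c2 : Rabs (t' - t) < d1)
  by (eapply Rlt_le_trans; [exact b2|]; eapply Rle_trans; [apply Rmin_l|apply Rmin_l]).
assert (c3 : Rabs (t' - t) < d2)
  by (eapply Rlt_le_trans; [exact b2|]; eapply Rle_trans; [apply Rmin_l|apply Rmin_r]).
assert (c4 : Rabs (z' - z) < eps / (2 * M)) by (eapply Rlt_le_trans; [exact b1|apply Rmin_r]).
specialize (h2 t' c3); change (Rabs (f z t' - f z t) < eps / 2) in h2.
destruct (MVT_gen (fun y => f y t') z z' (fun y => fz y t')) as [c [k1 k2]].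
- intros; apply hd.
- intros y _; apply continuity_pt_filterlim, (ex_derive_continuous (fun y => f y t')).
  eexists; apply hd.
- assert (hcz : Rabs (c - z) <= Rabs (z' - z)).
  { revert k1; unfold Rmin, Rmax, Rabs; repeat destruct Rle_dec; repeat destruct Rcase_abs; lra. }
  assert (hb : Rabs (fz c t' - fz z t) < 1).
  { apply (h1 (c, t')); split; [change (Rabs (c - z) < d1); lra|exact c2]. }
  assert (hb' : Rabs (fz c t') <= M).
  { unfold M; replace (fz c t') with (fz z t + (fz c t' - fz z t)) by ring.
    eapply Rle_trans; [apply Rabs_triang|lra]. }
  replace (f z' t' - f z t) with ((f z' t' - f z t') + (f z t' - f z t)) by ring.
  eapply Rle_lt_trans; [apply Rabs_triang|]; rewrite k2, Rabs_mult.
  assert (Rabs (fz c t') * Rabs (z' - z) <= M * (eps / (2 * M))).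
  { apply Rmult_le_compat; try apply Rabs_pos; lra. }
  replace (M * (eps / (2 * M))) with (eps / 2) in * by (field; lra).
  lra.
Qed.

(** * The inviscid flow *)

Lemma continuous_Rplus {T : UniformSpace} (f g : T -> R) (x : T) :
  continuous f x -> continuous g x -> continuous (fun p => f p + g p) x.
Proof. apply (continuous_plus f g). Qed.

Lemma continuous_Rminus {T : UniformSpace} (f g : T -> R) (x : T) :
  continuous f x -> continuous g x -> continuous (fun p => f p - g p) x.
Proof. apply (continuous_minus f g). Qed.

Lemma continuous_Ropp {T : UniformSpace} (f : T -> R) (x : T) :
  continuous f x -> continuous (fun p => - f p) x.
Proof. apply (continuous_opp f). Qed.

Lemma continuous_Rmult {T : UniformSpace} (f g : T -> R) (x : T) :
  continuous f x -> continuous g x -> continuous (fun p => f p * g p) x.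
Proof. apply (continuous_mult f g). Qed.

Lemma continuous_Rcomp {T : UniformSpace} (f : R -> R) (g : T -> R) (x : T) :
  continuous f (g x) -> continuous g x -> continuous (fun p => f (g p)) x.
Proof. intros hf hg; now apply (continuous_comp g f). Qed.

Lemma continuous_Rinv_fun {T : UniformSpace} (f : T -> R) (x : T) :
  f x <> 0 -> continuous f x -> continuous (fun p => / f p) x.
Proof. intros h0 hf; apply continuous_Rcomp; [now apply continuous_Rinv|exact hf]. Qed.

Lemma continuous_Rdiv {T : UniformSpace} (f g : T -> R) (x : T) :
  g x <> 0 -> continuous f x -> continuous g x -> continuous (fun p => f p / g p) x.
Proof. intros h0 hf hg; apply continuous_Rmult; [exact hf|now apply continuous_Rinv_fun]. Qed.

Ltac cont_tac := repeat match goal with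
  | h : ?G |- ?G => exact h
  | |- continuous (fun _ => ?c) _ => apply continuous_const
  | |- continuous (fun _ => _ + _) _ => apply continuous_Rplus
  | |- continuous (fun _ => _ - _) _ => apply continuous_Rminus
  | |- continuous (fun _ => _ * _) _ => apply continuous_Rmult
  | |- continuous (fun _ => - _) _ => apply continuous_Ropp
  | |- continuous (fun p => fst p) _ => apply (@continuous_fst R_UniformSpace R_UniformSpace)
  | |- continuous (fun p => snd p) _ => apply (@continuous_snd R_UniformSpace R_UniformSpace)
  end.

Section Labels.
Variables (u0 v0 du0 dv0 : R -> R) (B K : R).
Hypothesis hdu : forall x, is_derive u0 x (du0 x).
Hypothesis hdv : forall x, is_derive v0 x (dv0 x).
Hypothesis hcdu : forall x, continuous du0 x.
Hypothesis hcdv : forall x, continuous dv0 x.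
Hypothesis pu0 : periodic1 u0.
Hypothesis pv0 : periodic1 v0.
Hypothesis hB : 0 <= B.
Hypothesis hK : 0 < K.
Hypothesis hBb : forall x, Rabs (u0 x) + Rabs (v0 x) <= B.
Hypothesis hKl : forall x y, Rabs (u0 y - u0 x) + Rabs (v0 y - v0 x) <= K * Rabs (y - x).

(* [Y = |y|^2] for [y = cos th + w0 sin th], the angular part of the solution [p + w0 q] of the
   linearized Riccati equation [y'' = c y]. *)
Definition Y (th x : R) : R :=
  (cos th + v0 x * sin th) * (cos th + v0 x * sin th) + (u0 x * sin th) * (u0 x * sin th).
Definition Y1 (th x : R) : R :=
  2 * ((cos th + v0 x * sin th) * (- sin th + v0 x * cos th) + u0 x * u0 x * (sin th * cos th)).
Definition Y2 (th x : R) : R :=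
  2 * ((- sin th + v0 x * cos th) * (- sin th + v0 x * cos th)
       - (cos th + v0 x * sin th) * (cos th + v0 x * sin th)
       + u0 x * u0 x * (cos th * cos th - sin th * sin th)).
Definition Yx (th x : R) : R :=
  2 * ((cos th + v0 x * sin th) * (dv0 x * sin th) + u0 x * du0 x * (sin th * sin th)).
Definition Y1x (th x : R) : R :=
  2 * (dv0 x * sin th * (- sin th + v0 x * cos th)
       + (cos th + v0 x * sin th) * (dv0 x * cos th) + 2 * (u0 x * du0 x) * (sin th * cos th)).

(** The Ermakov identity for the product [Y] of [y] and its conjugate: both solve [y'' = - y] in the
    angle, and their Wronskian is [- 2 i u0]. It is what makes [w] satisfy the Riccati equation. *)
Lemma Y_identity (th x : R) : 2 * Y th x * Y2 th x - Y1 th x ^ 2 + 4 * Y th x ^ 2 = 4 * u0 x ^ 2.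
Proof.
assert (h : sin th * sin th + cos th * cos th = 1) by apply (sin2_cos2 th).
replace (4 * u0 x ^ 2) with (4 * u0 x ^ 2 * (sin th * sin th + cos th * cos th) ^ 2)
  by (rewrite h; ring).
unfold Y, Y1, Y2; ring.
Qed.

Lemma Y_derive_th (th x : R) : is_derive (fun th => Y th x) th (Y1 th x).
Proof. unfold Y, Y1; auto_derive; [exact I|ring]. Qed.

Lemma Y1_derive_th (th x : R) : is_derive (fun th => Y1 th x) th (Y2 th x).
Proof. unfold Y1, Y2; auto_derive; [exact I|ring]. Qed.

Lemma Y_derive_x (th x : R) : is_derive (fun x => Y th x) x (Yx th x).
Proof.
unfold Y, Yx; auto_derive.
- repeat split; match goal with
    | |- ex_derive (fun _ => u0 _) _ => eexists; apply hdu
    | |- ex_derive (fun _ => v0 _) _ => eexists; apply hdv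
    | _ => idtac end.
- replace (Derive (fun x => u0 x) x) with (du0 x) by (symmetry; apply is_derive_unique, hdu).
  replace (Derive (fun x => v0 x) x) with (dv0 x) by (symmetry; apply is_derive_unique, hdv).
  ring.
Qed.

Lemma Y1_derive_x (th x : R) : is_derive (fun x => Y1 th x) x (Y1x th x).
Proof.
unfold Y1, Y1x; auto_derive.
- repeat split; match goal with
    | |- ex_derive (fun _ => u0 _) _ => eexists; apply hdu
    | |- ex_derive (fun _ => v0 _) _ => eexists; apply hdv
    | _ => idtac end.
- replace (Derive (fun x => u0 x) x) with (du0 x) by (symmetry; apply is_derive_unique, hdu).
  replace (Derive (fun x => v0 x) x) with (dv0 x) by (symmetry; apply is_derive_unique, hdv).
  ring.
Qed.

Lemma u0_cont (x : R) : continuous u0 x.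
Proof. apply (ex_derive_continuous u0); eexists; apply hdu. Qed.

Lemma v0_cont (x : R) : continuous v0 x.
Proof. apply (ex_derive_continuous v0); eexists; apply hdv. Qed.

Lemma Y_all_continuous {T : UniformSpace} (th x : T -> R) (p : T) :
  continuous th p -> continuous x p ->
  continuous (fun p => Y (th p) (x p)) p /\ continuous (fun p => Y1 (th p) (x p)) p /\
  continuous (fun p => Y2 (th p) (x p)) p /\ continuous (fun p => Yx (th p) (x p)) p /\
  continuous (fun p => Y1x (th p) (x p)) p.
Proof.
intros hth hx.
assert (c1 : continuous (fun p => cos (th p)) p) by (apply continuous_Rcomp; [apply continuous_cos|exact hth]).
assert (c2 : continuous (fun p => sin (th p)) p) by (apply continuous_Rcomp; [apply continuous_sin|exact hth]).
assert (c3 : continuous (fun p => u0 (x p)) p) by (apply continuous_Rcomp; [apply u0_cont|exact hx]).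
assert (c4 : continuous (fun p => v0 (x p)) p) by (apply continuous_Rcomp; [apply v0_cont|exact hx]).
assert (c5 : continuous (fun p => du0 (x p)) p) by (apply continuous_Rcomp; [apply hcdu|exact hx]).
assert (c6 : continuous (fun p => dv0 (x p)) p) by (apply continuous_Rcomp; [apply hcdv|exact hx]).
unfold Y, Y1, Y2, Yx, Y1x; repeat split; cont_tac.
Qed.

Lemma Y_nonneg (th x : R) : 0 <= Y th x.
Proof. apply Rplus_le_le_0_compat; apply Rle_0_sqr. Qed.

Lemma Y_periodic (th : R) : periodic1 (Y th).
Proof. intros x; unfold Y; now rewrite pu0, pv0. Qed.

Lemma Y1_periodic (th : R) : periodic1 (Y1 th).
Proof. intros x; unfold Y1; now rewrite pu0, pv0. Qed.

(** The modulus of [y]. It is Lipschitz in the angle and in the label, and the bound on the angular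
    speed is linear in it, as a Lipschitz estimate at its zeros requires. *)
Definition rootY (th x : R) : R := Cmod (cos th + v0 x * sin th, u0 x * sin th).

Lemma rootY_sqr (th x : R) : rootY th x * rootY th x = Y th x.
Proof.
unfold rootY, Cmod; rewrite sqrt_sqrt; [unfold Y; simpl; ring|apply Rplus_le_le_0_compat; apply pow2_ge_0].
Qed.

Lemma Cmod_sub_le (a b : C) : Rabs (Cmod a - Cmod b) <= Rabs (fst a - fst b) + Rabs (snd a - snd b).
Proof.
assert (h1 : Cmod a <= Cmod (a - b)%C + Cmod b).
{ replace a with ((a - b) + b)%C at 1 by ring; apply Cmod_triangle. }
assert (h2 : Cmod b <= Cmod (a - b)%C + Cmod a).
{ replace b with (- (a - b) + a)%C at 1 by ring.
  eapply Rle_trans; [apply Cmod_triangle|]; rewrite Cmod_opp; lra. }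
apply Rle_trans with (Cmod (a - b)%C); [apply Rabs_le_between; lra|].
apply (Cmod_le_sum (a - b)%C).
Qed.

Lemma sin_Lipschitz (a b : R) : Rabs (sin a - sin b) <= Rabs (a - b).
Proof.
rewrite <- (Rmult_1_l (Rabs (a - b))).
apply (Lipschitz_of_derive sin cos); [apply is_derive_sin|].
intros x; apply Rabs_le_between; generalize (COS_bound x); lra.
Qed.

Lemma cos_Lipschitz (a b : R) : Rabs (cos a - cos b) <= Rabs (a - b).
Proof.
rewrite <- (Rmult_1_l (Rabs (a - b))).
apply (Lipschitz_of_derive cos (fun x => - sin x)); [apply is_derive_cos|].
intros x; rewrite Rabs_Ropp; apply Rabs_le_between; generalize (SIN_bound x); lra.
Qed.

Lemma rootY_Lipschitz_th (th th' x : R) :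
  Rabs (rootY th x - rootY th' x) <= (1 + B) * Rabs (th - th').
Proof.
unfold rootY; eapply Rle_trans; [apply Cmod_sub_le|]; simpl.
replace (cos th + v0 x * sin th - (cos th' + v0 x * sin th')) with
  ((cos th - cos th') + v0 x * (sin th - sin th')) by ring.
rewrite <- Rmult_minus_distr_l, Rabs_mult.
generalize (Rabs_triang (cos th - cos th') (v0 x * (sin th - sin th'))).
rewrite Rabs_mult.
generalize (sin_Lipschitz th th') (cos_Lipschitz th th') (hBb x) (Rabs_pos (u0 x)) (Rabs_pos (v0 x))
  (Rabs_pos (th - th')).
intros h1 h2 h3 h4 h5 h6 h7.
assert (Rabs (u0 x) * Rabs (sin th - sin th') <= Rabs (u0 x) * Rabs (th - th'))
  by (apply Rmult_le_compat_l; auto).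
assert (Rabs (v0 x) * Rabs (sin th - sin th') <= Rabs (v0 x) * Rabs (th - th'))
  by (apply Rmult_le_compat_l; auto).
assert ((Rabs (u0 x) + Rabs (v0 x)) * Rabs (th - th') <= B * Rabs (th - th'))
  by (apply Rmult_le_compat_r; auto).
lra.
Qed.

Lemma rootY_Lipschitz_x (th x y : R) : Rabs (rootY th x - rootY th y) <= K * Rabs (x - y).
Proof.
unfold rootY; eapply Rle_trans; [apply Cmod_sub_le|]; simpl.
replace (cos th + v0 x * sin th - (cos th + v0 y * sin th)) with ((v0 x - v0 y) * sin th) by ring.
replace (u0 x * sin th - u0 y * sin th) with ((u0 x - u0 y) * sin th) by ring.
rewrite !Rabs_mult.
assert (hs : Rabs (sin th) <= 1) by (apply Rabs_le_between; generalize (SIN_bound th); lra).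
generalize (hKl y x) (Rabs_pos (v0 x - v0 y)) (Rabs_pos (u0 x - u0 y)) (Rabs_pos (sin th)); nra.
Qed.

Lemma rootY_le (th x : R) : rootY th x <= 1 + B.
Proof.
unfold rootY; eapply Rle_trans; [apply Cmod_le_sum|]; simpl.
assert (hs : Rabs (sin th) <= 1) by (apply Rabs_le_between; generalize (SIN_bound th); lra).
assert (hc : Rabs (cos th) <= 1) by (apply Rabs_le_between; generalize (COS_bound th); lra).
generalize (Rabs_triang (cos th) (v0 x * sin th)); rewrite !Rabs_mult.
generalize (hBb x) (Rabs_pos (u0 x)) (Rabs_pos (v0 x)) (Rabs_pos (sin th)); nra.
Qed.

Lemma rootY_nonneg (th x : R) : 0 <= rootY th x.
Proof. apply Cmod_ge_0. Qed.

(** * Regular angles and the integral of [1 / Y] *)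

Definition regular (th : R) : Prop := forall x, Y th x <> 0.

Lemma Y_pos (th x : R) : regular th -> 0 < Y th x.
Proof. intros h; generalize (Y_nonneg th x) (h x); lra. Qed.

Lemma rootY_pos (th x : R) : regular th -> 0 < rootY th x.
Proof.
intros h; generalize (Y_pos th x h) (rootY_nonneg th x); rewrite <- rootY_sqr; nra.
Qed.

Lemma Y_cont_x (th x : R) : continuous (Y th) x.
Proof.
exact (proj1 (Y_all_continuous (fun _ => th) (fun x => x) x (continuous_const th x) (continuous_id x))).
Qed.

Lemma invY_cont_x (th x : R) : regular th -> continuous (fun x => / Y th x) x.
Proof. intros h; apply continuous_Rinv_fun; [apply h|apply Y_cont_x]. Qed.

(** By periodicity [1 / Y] is bounded at a regular angle, so [rootY] has a positive lower bound; it
    changes by at most [(1 + B) * |th' - th|] and cannot vanish nearby. *)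
Lemma regular_open (th : R) : regular th -> locally th regular.
Proof.
intros h.
destruct (periodic1_bounded (fun x => / Y th x)) as [M [hM hb]].
- intros x; now rewrite (Y_periodic th x).
- intros x; apply invY_cont_x, h.
- set (m := / (M + 1)).
  assert (hm : 0 < m) by (apply Rinv_0_lt_compat; lra).
  assert (hr : forall x, m <= rootY th x * (1 + B)).
  { intros x; apply Rle_trans with (Y th x).
    - generalize (hb x) (Y_pos th x h); intros h1 h2.
      assert (h3 : 0 < / Y th x) by (apply Rinv_0_lt_compat, h2).
      rewrite Rabs_pos_eq in h1 by lra.
      unfold m; rewrite <- (Rinv_inv (Y th x)); apply Rinv_le_contravar; lra.
    - rewrite <- rootY_sqr; apply Rmult_le_compat_l; [apply rootY_nonneg|apply rootY_le]. }
  assert (hd : 0 < m / ((1 + B) * (1 + B))) by (apply Rdiv_lt_0_compat; nra).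
  exists (mkposreal _ hd); intros th' hth x hx; change (Rabs (th' - th) < m / ((1 + B) * (1 + B))) in hth.
  generalize (rootY_Lipschitz_th th' th x) (hr x).
  assert (h0 : rootY th' x = 0) by (generalize (rootY_sqr th' x) (rootY_nonneg th' x); rewrite hx; nra).
  rewrite h0; unfold Rminus at 1; rewrite Rplus_0_l, Rabs_Ropp, Rabs_pos_eq by apply rootY_nonneg.
  intros h1 h2.
  assert ((1 + B) * Rabs (th' - th) < (1 + B) * (m / ((1 + B) * (1 + B))))
    by (apply Rmult_lt_compat_l; lra).
  assert (e : (1 + B) * ((1 + B) * (m / ((1 + B) * (1 + B)))) = m) by (field; lra).
  nra.
Qed.

(** [A th 1] is the period integral [I (th)]. Below, [dA] and [ddA] are the first two derivatives of
    [1 / Y] in the angle, so that [A1] and [A2] are those of [A]. *)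
Definition A (th x : R) : R := RInt (fun y => / Y th y) 0 x.
Definition dA (th y : R) : R := - Y1 th y / (Y th y * Y th y).
Definition ddA (th y : R) : R :=
  2 * (Y1 th y * Y1 th y) / (Y th y * Y th y * Y th y) - Y2 th y / (Y th y * Y th y).
Definition A1 (th x : R) : R := RInt (dA th) 0 x.
Definition A2 (th x : R) : R := RInt (ddA th) 0 x.

Lemma dA_continuous {T : UniformSpace} (th x : T -> R) (p : T) : regular (th p) ->
  continuous th p -> continuous x p ->
  continuous (fun p => / Y (th p) (x p)) p /\ continuous (fun p => dA (th p) (x p)) p /\
  continuous (fun p => ddA (th p) (x p)) p.
Proof.
intros hr hth hx; destruct (Y_all_continuous th x p hth hx) as [c0 [c1 [c2 _]]].
assert (h0 := hr (x p)).
unfold dA, ddA; split; [|split].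
- now apply continuous_Rinv_fun.
- apply continuous_Rdiv; [nra|cont_tac|cont_tac].
- apply continuous_Rminus; apply continuous_Rdiv; cont_tac; try nra.
  apply Rmult_integral_contrapositive; split; [nra|exact h0].
Qed.

Lemma A_is_derive_th (th x : R) : regular th ->
  is_derive (fun th => A th x) th (A1 th x) /\ is_derive (fun th => A1 th x) th (A2 th x).
Proof.
intros hr; assert (ho := regular_open th hr).
(* Differentiation under the integral sign involves the integrand at all nearby angles, which are
   regular by [regular_open]. *)
assert (gen : forall (h dh : R -> R -> R),
  (forall th y, regular th -> is_derive (fun th => h th y) th (dh th y)) ->
  (forall th y, regular th -> continuous (h th) y) ->
  (forall th y, regular th -> continuous (fun p : R * R => dh (fst p) (snd p)) (th, y)) ->
  is_derive (fun th => RInt (h th) 0 x) th (RInt (dh th) 0 x)).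
{ intros h dh h1 h2 h3.
  replace (RInt (dh th) 0 x) with (RInt (fun y => Derive (fun z => h z y) th) 0 x)
    by (apply RInt_ext; intros y _; now apply is_derive_unique, h1).
  apply (is_derive_RInt_param h 0 x th).
  - revert ho; apply filter_imp; intros s hs y _; eexists; apply h1, hs.
  - intros y _; apply continuity_2d_pt_filterlim.
    assert (hc : continuous (fun p : R * R => Derive (fun z => h z (snd p)) (fst p)) (th, y)).
    { apply continuous_ext_loc with (2 := h3 th y hr).
      destruct ho as [d hd]; exists d; intros [s y'] [hs _]; simpl.
      symmetry; apply is_derive_unique, h1, hd, hs. }
    exact hc.
  - revert ho; apply filter_imp; intros s hs.
    apply (ex_RInt_continuous (V := R_CompleteNormedModule)); intros y _; apply h2, hs. }
split.
- apply (gen (fun th y => / Y th y) dA).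
  + intros s y hs; replace (dA s y) with (- Y1 s y / Y s y ^ 2) by (unfold dA; field; apply hs).
    apply (is_derive_inv (fun th => Y th y)); [apply Y_derive_th|exact (hs y)].
  + intros s y hs; apply invY_cont_x, hs.
  + intros s y hs; apply (dA_continuous fst snd (s, y)); [exact hs|apply continuous_fst|apply continuous_snd].
- apply (gen dA ddA).
  + intros s y hs; unfold dA, ddA.
    assert (a0 := is_derive_unique _ _ _ (Y_derive_th s y)).
    assert (a1 := is_derive_unique _ _ _ (Y1_derive_th s y)).
    auto_derive.
    * repeat split; first [exact I | exact (ex_intro _ _ (Y1_derive_th s y)) |
        exact (ex_intro _ _ (Y_derive_th s y)) | apply Rmult_integral_contrapositive; split; apply hs].
    * replace (Derive (fun x => Y x y) s) with (Y1 s y) by (symmetry; exact a0).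
      replace (Derive (fun x => Y1 x y) s) with (Y2 s y) by (symmetry; exact a1).
      field; apply hs.
  + intros s y hs; apply (dA_continuous (fun _ => s) (fun y => y) y);
      [exact hs|apply continuous_const|apply continuous_id].
  + intros s y hs; apply (dA_continuous fst snd (s, y)); [exact hs|apply continuous_fst|apply continuous_snd].
Qed.

Lemma A2_continuous (th x : R) : regular th -> continuous (fun th => A2 th x) th.
Proof.
intros hr; apply (RInt_param_continuous ddA 0 x th).
- generalize (regular_open th hr); apply filter_imp; intros s hs y.
  apply (dA_continuous (fun _ => s) (fun y => y) y);
      [exact hs|apply continuous_const|apply continuous_id].
- intros y; apply continuity_2d_pt_filterlim.
  apply (dA_continuous fst snd (th, y)); [exact hr|apply continuous_fst|apply continuous_snd].
Qed.

Lemma RInt_0_is_derive (h : R -> R) (x : R) : (forall y, continuous h y) ->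
  is_derive (fun x => RInt h 0 x) x (h x).
Proof.
intros hc; apply (is_derive_RInt h (fun x => RInt h 0 x) 0 x); [|apply hc].
exists (mkposreal 1 Rlt_0_1); intros y _; apply (RInt_correct (V := R_CompleteNormedModule)).
apply (ex_RInt_continuous (V := R_CompleteNormedModule)); auto.
Qed.

Lemma A_is_derive_x (th x : R) : regular th ->
  is_derive (A th) x (/ Y th x) /\ is_derive (A1 th) x (dA th x).
Proof.
intros hr; split.
- apply (RInt_0_is_derive (fun y => / Y th y)); intros; apply invY_cont_x, hr.
- apply (RInt_0_is_derive (dA th)); intros y; apply (dA_continuous (fun _ => th) (fun y => y) y);
      [exact hr|apply continuous_const|apply continuous_id].
Qed.

Lemma RInt_0_periodic (h : R -> R) (x : R) : (forall y, continuous h y) -> periodic1 h ->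
  RInt h 0 (x + 1) = RInt h 0 x + RInt h 0 1.
Proof.
intros hc hp.
assert (hex : forall a b, ex_RInt h a b)
  by (intros; apply (ex_RInt_continuous (V := R_CompleteNormedModule)); auto).
rewrite <- (RInt_Chasles (V := R_CompleteNormedModule) h 0 x (x + 1)) by apply hex.
unfold plus; simpl; f_equal.
rewrite <- (RInt_periodic_shift h x hp hc), (RInt_shift h x 0 1 hc).
f_equal; ring.
Qed.

Lemma A_periodic (th x : R) : regular th ->
  A th (x + 1) = A th x + A th 1 /\ A1 th (x + 1) = A1 th x + A1 th 1.
Proof.
intros hr; split; apply RInt_0_periodic.
- intros; apply invY_cont_x, hr.
- intros y; now rewrite (Y_periodic th y).
- intros y; apply (dA_continuous (fun _ => th) (fun y => y) y);
      [exact hr|apply continuous_const|apply continuous_id].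
- intros y; unfold dA; now rewrite (Y_periodic th y), (Y1_periodic th y).
Qed.

Definition c0 : R := / (1 + B + K).

(* [sqrt Y] is [K]-Lipschitz in the label, so [1 / Y] is large on a whole neighbourhood of a point
   where it is large; this is what keeps [I] from staying bounded as [Y] approaches zero. *)
Lemma rootY_A_lower (th x : R) : regular th -> c0 <= rootY th x * A th 1.
Proof.
intros hr.
set (s := rootY th x).
assert (hs : 0 < s) by apply (rootY_pos th x hr).
(* A primitive of [1 / (s + K y)^2], the lower bound for [1 / Y] at distance [y]. Its increment over
   a period times [s] is [1 / (s + K)], and [s <= 1 + B] gives [c0]. *)
set (E := fun y : R => / K * (/ s - / (s + K * y))).
assert (hsy : forall y, 0 <= y -> 0 < s + K * y) by (intros; nra).
assert (hE : is_RInt (fun y => / ((s + K * y) * (s + K * y))) 0 1 (minus (E 1) (E 0))).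
{ apply (is_RInt_derive E).
  - intros y hy; rewrite Rmin_left in hy by lra; assert (h1 := hsy y ltac:(lra)).
    unfold E; auto_derive; [lra|field; lra].
  - intros y hy; rewrite Rmin_left in hy by lra; assert (h1 := hsy y ltac:(lra)).
    apply (ex_derive_continuous (fun y => / ((s + K * y) * (s + K * y)))).
    auto_derive; nra. }
assert (hle : minus (E 1) (E 0) <= A th 1).
{ rewrite <- (is_RInt_unique _ _ _ _ hE); unfold A.
  rewrite <- (RInt_periodic_shift (fun y => / Y th y) x).
  2:{ intros y; now rewrite (Y_periodic th y). }
  2:{ intros y; apply invY_cont_x, hr. }
  apply RInt_le; [lra|eexists; exact hE| |].
  - apply (ex_RInt_continuous (V := R_CompleteNormedModule)); intros y _.
    apply (continuous_shift (fun y => / Y th y)), invY_cont_x, hr.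
  - intros y hy; rewrite <- rootY_sqr.
    assert (h1 : 0 < rootY th (y + x)) by apply (rootY_pos th _ hr).
    assert (h2 : rootY th (y + x) <= s + K * y).
    { generalize (rootY_Lipschitz_x th (y + x) x); replace (y + x - x) with y by ring.
      rewrite (Rabs_pos_eq y) by lra; fold s; intros h.
      generalize (Rle_abs (rootY th (y + x) - s)); lra. }
    apply Rinv_le_contravar; [apply Rmult_lt_0_compat; exact h1|].
    apply Rmult_le_compat; lra. }
apply Rle_trans with (s * minus (E 1) (E 0)); [|apply Rmult_le_compat_l; lra].
unfold minus, plus, opp, E, c0; simpl.
assert (e : s * (/ K * (/ s - / (s + K * 1)) + - (/ K * (/ s - / (s + K * 0)))) = / (s + K))
  by (field; lra).
rewrite e; apply Rinv_le_contravar; [lra|].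
generalize (rootY_le th x); fold s; lra.
Qed.

Lemma c0_pos : 0 < c0.
Proof. apply Rinv_0_lt_compat; lra. Qed.

Lemma A_1_pos (th : R) : regular th -> 0 < A th 1.
Proof.
intros hr; generalize (rootY_A_lower th 0 hr) c0_pos (rootY_pos th 0 hr); nra.
Qed.

(** * The angular speed and its Lipschitz continuity *)

Definition speed (th : R) : R :=
  if excluded_middle_informative (regular th) then / A th 1 else 0.

Lemma speed_regular (th : R) : regular th -> speed th = / A th 1.
Proof. intros h; unfold speed; destruct excluded_middle_informative; [reflexivity|contradiction]. Qed.

Lemma speed_singular (th : R) : ~ regular th -> speed th = 0.
Proof. intros h; unfold speed; destruct excluded_middle_informative; [contradiction|reflexivity]. Qed.

Lemma invA_le_rootY (th x : R) : regular th -> / A th 1 <= rootY th x / c0.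
Proof.
intros hr; assert (h1 := A_1_pos th hr); assert (h2 := c0_pos).
assert (h3 := rootY_A_lower th x hr).
apply Rmult_le_reg_l with (A th 1 * c0); [nra|].
replace (A th 1 * c0 * / A th 1) with c0 by (field; lra).
replace (A th 1 * c0 * (rootY th x / c0)) with (rootY th x * A th 1) by (field; lra); exact h3.
Qed.

(** At a singular angle [rootY] vanishes for some label [x]. At the regular angle the speed is at
    most [rootY th x / c0], and [rootY] at the same label has grown from zero at rate at most
    [1 + B]. *)
Lemma speed_Lipschitz_singular (th th' : R) : regular th -> ~ regular th' ->
  Rabs (speed th - speed th') <= (1 + B) / c0 * Rabs (th - th').
Proof.
intros h1 h2; rewrite speed_regular, speed_singular by auto.
apply not_all_not_ex in h2; destruct h2 as [x hx].
assert (h0 : rootY th' x = 0) by (generalize (rootY_sqr th' x) (rootY_nonneg th' x); rewrite hx; nra).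
rewrite Rminus_0_r, Rabs_pos_eq by (left; apply Rinv_0_lt_compat, A_1_pos, h1).
eapply Rle_trans; [apply (invA_le_rootY th x h1)|].
generalize (rootY_Lipschitz_th th th' x); rewrite h0, Rminus_0_r, Rabs_pos_eq by apply rootY_nonneg.
intros h3; unfold Rdiv; rewrite (Rmult_comm (1 + B)), Rmult_assoc, Rmult_comm.
apply Rmult_le_compat_l; [left; apply Rinv_0_lt_compat, c0_pos|exact h3].
Qed.

(** The derivative of [I] is unbounded near singular angles, but that of [1 / I] is not. With [s],
    [r] the two moduli, [1 / s^2 - 1 / r^2] is at most [D * (1 / (s r^2) + 1 / (s^2 r))]; replacing
    the single factors [1 / s] and [1 / r] by [I / c0] and integrating gives [2 D / c0] times the
    product of the two integrals, which division by that product removes. *)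
Lemma speed_Lipschitz_regular (th th' : R) : regular th -> regular th' ->
  Rabs (speed th - speed th') <= 2 * ((1 + B) / c0) * Rabs (th - th').
Proof.
intros h1 h2; rewrite !speed_regular by auto.
assert (p1 := A_1_pos th h1); assert (p2 := A_1_pos th' h2); assert (hc := c0_pos).
set (D := (1 + B) * Rabs (th - th')).
assert (hD : 0 <= D) by (unfold D; generalize (Rabs_pos (th - th')); nra).
assert (hex : forall th, regular th -> ex_RInt (fun y => / Y th y) 0 1)
  by (intros s hs; apply (ex_RInt_continuous (V := R_CompleteNormedModule)); intros; apply invY_cont_x, hs).
assert (hpt : forall x, Rabs (/ Y th x - / Y th' x) <=
  D / c0 * A th 1 * / Y th' x + D / c0 * A th' 1 * / Y th x).
{ intros x; assert (s1 := rootY_pos th x h1); assert (s2 := rootY_pos th' x h2).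
  rewrite <- !rootY_sqr.
  generalize (rootY_Lipschitz_th th th' x) (rootY_A_lower th x h1) (rootY_A_lower th' x h2); fold D.
  generalize dependent (rootY th x); generalize dependent (rootY th' x); intros r hr s hs hl k1 k2.
  replace (/ (s * s) - / (r * r)) with (- ((s - r) * (s + r)) * / (s * s * (r * r))) by (field; lra).
  assert (hp : 0 < s * s * (r * r)) by (repeat apply Rmult_lt_0_compat; lra).
  rewrite Rabs_mult, Rabs_Ropp, Rabs_mult, (Rabs_pos_eq (s + r)), (Rabs_pos_eq (/ (s * s * (r * r))))
    by (try (left; apply Rinv_0_lt_compat); lra).
  apply Rmult_le_reg_r with (s * s * (r * r)); [exact hp|].
  rewrite Rmult_assoc, Rinv_l, Rmult_1_r by lra.
  replace ((D / c0 * A th 1 * / (r * r) + D / c0 * A th' 1 * / (s * s)) * (s * s * (r * r))) with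
    (D * (s * (s * A th 1 / c0)) + D * (r * (r * A th' 1 / c0))) by (field; lra).
  apply Rle_trans with (D * (s + r)); [apply Rmult_le_compat_r; lra|].
  assert (q1 : 1 <= s * A th 1 / c0).
  { apply Rmult_le_reg_r with c0; [lra|]; replace (s * A th 1 / c0 * c0) with (s * A th 1) by (field; lra); lra. }
  assert (q2 : 1 <= r * A th' 1 / c0).
  { apply Rmult_le_reg_r with c0; [lra|]; replace (r * A th' 1 / c0 * c0) with (r * A th' 1) by (field; lra); lra. }
  assert (s <= s * (s * A th 1 / c0)) by nra.
  assert (r <= r * (r * A th' 1 / c0)) by nra.
  assert (D * s <= D * (s * (s * A th 1 / c0))) by (apply Rmult_le_compat_l; lra).
  assert (D * r <= D * (r * (r * A th' 1 / c0))) by (apply Rmult_le_compat_l; lra).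
  lra. }
assert (hint : Rabs (A th 1 - A th' 1) <= 2 * (D / c0) * (A th 1 * A th' 1)).
{ assert (hr : is_RInt (fun x => D / c0 * A th 1 * / Y th' x + D / c0 * A th' 1 * / Y th x) 0 1
    (plus (scal (D / c0 * A th 1) (A th' 1)) (scal (D / c0 * A th' 1) (A th 1)))).
  { apply (is_RInt_plus (V := R_NormedModule));
      apply (is_RInt_scal (V := R_NormedModule)); apply (RInt_correct (V := R_CompleteNormedModule)); auto. }
  change (Rabs (minus (A th 1) (A th' 1)) <= 2 * (D / c0) * (A th 1 * A th' 1)); unfold A at 1 2.
  rewrite <- (RInt_minus (V := R_CompleteNormedModule)) by auto.
  eapply Rle_trans; [apply abs_RInt_le; [lra|]; apply (ex_RInt_minus (V := R_NormedModule)); auto|].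
  eapply Rle_trans; [apply (RInt_le _ _ 0 1 ltac:(lra)) with (2 := ex_intro _ _ hr)|].
  - apply (ex_RInt_continuous (V := R_CompleteNormedModule)); intros x _.
    apply (continuous_Rcomp Rabs); [apply continuous_Rabs|].
    apply (continuous_minus (fun x => / Y th x) (fun x => / Y th' x)); apply invY_cont_x; auto.
  - intros x _; apply hpt.
  - rewrite (is_RInt_unique _ _ _ _ hr); unfold plus, scal; simpl; unfold mult; simpl; lra. }
replace (/ A th 1 - / A th' 1) with (- (A th 1 - A th' 1) * / (A th 1 * A th' 1)) by (field; lra).
assert (hp : 0 < A th 1 * A th' 1) by (apply Rmult_lt_0_compat; lra).
rewrite Rabs_mult, Rabs_Ropp, (Rabs_pos_eq (/ (A th 1 * A th' 1)))
  by (left; apply Rinv_0_lt_compat, hp).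
apply Rmult_le_reg_r with (A th 1 * A th' 1); [exact hp|].
rewrite Rmult_assoc, Rinv_l, Rmult_1_r by lra.
eapply Rle_trans; [exact hint|]; right; unfold D; field; lra.
Qed.

Lemma speed_Lipschitz (th th' : R) :
  Rabs (speed th - speed th') <= 2 * ((1 + B) / c0) * Rabs (th - th').
Proof.
assert (hp : 0 <= (1 + B) / c0) by (apply Rdiv_le_0_compat; [lra|apply c0_pos]).
assert (hm := Rabs_pos (th - th')).
destruct (classic (regular th)) as [h|h], (classic (regular th')) as [h'|h'].
- now apply speed_Lipschitz_regular.
- eapply Rle_trans; [now apply speed_Lipschitz_singular|]; nra.
- rewrite Rabs_minus_sym, (Rabs_minus_sym th).
  eapply Rle_trans; [now apply speed_Lipschitz_singular|]; rewrite Rabs_minus_sym; nra.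
- rewrite !speed_singular by auto; unfold Rminus at 1; rewrite Rplus_opp_r, Rabs_R0; nra.
Qed.

Lemma Y_0 (x : R) : Y 0 x = 1.
Proof. unfold Y; rewrite cos_0, sin_0; ring. Qed.

Lemma regular_0 : regular 0.
Proof. intros x; rewrite Y_0; lra. Qed.

Lemma angle_exists : exists th : R -> R, th 0 = 0 /\ (forall t, continuous th t) /\
  (forall t, 0 <= t -> regular (th t)) /\ (forall t, 0 < t -> is_derive th t (/ A (th t) 1)).
Proof.
set (L := 2 * ((1 + B) / c0)).
assert (hL : 0 <= L).
{ unfold L; assert (0 <= (1 + B) / c0) by (apply Rdiv_le_0_compat; [lra|apply c0_pos]); lra. }
destruct (ode_solution (fun _ x => speed x) 0) as [th [h0 [hc hd]]].
- intros x t; apply continuous_const.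
- intros T; exists L; split; [exact hL|]; intros; apply speed_Lipschitz.
- assert (hreg : forall t, 0 <= t -> regular (th t)).
  { intros t ht; apply NNPP; intros hn.
    destruct (Rle_lt_or_eq_dec 0 t ht) as [htp|<-]; [|apply hn; rewrite h0; apply regular_0].
    set (b := th t) in *.
    (* Gronwall's inequality backwards in time. As the speed vanishes at [b], it is at most
       [L * |th - b|], so [E] does not decrease; its value at [t] is zero, hence so is its value
       [b ^ 2] at time zero. Then [b = 0], which is a regular angle. *)
    set (E := fun s => (th s - b) * (th s - b) * exp (2 * L * s)).
    assert (hE : forall s, 0 < s -> is_derive E s
      ((2 * (th s - b) * speed (th s) + 2 * L * ((th s - b) * (th s - b))) * exp (2 * L * s))).
    { intros s hs; unfold E; assert (a0 := is_derive_unique _ _ _ (hd s hs)).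
      auto_derive; [repeat split; exact (ex_intro _ _ (hd s hs))|].
      replace (Derive (fun x => th x) s) with (speed (th s)) by (symmetry; exact a0); ring. }
    destruct (MVT_gen E 0 t (fun s =>
      (2 * (th s - b) * speed (th s) + 2 * L * ((th s - b) * (th s - b))) * exp (2 * L * s)))
      as [s [hs e]].
    - intros s hs; apply hE; rewrite Rmin_left in hs; lra.
    - intros s _; apply continuity_pt_filterlim; unfold E.
      assert (c1 : continuous (fun s => exp (2 * L * s)) s).
      { apply (continuous_Rcomp exp (fun s => 2 * L * s)); [apply continuous_exp|].
        apply (continuous_Rmult (fun _ => 2 * L) (fun s => s)); [apply continuous_const|apply continuous_id]. }
      assert (c2 : continuous (fun s => th s) s) by apply hc.
      change (continuous (fun s => (th s - b) * (th s - b) * exp (2 * L * s)) s); cont_tac.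
    - assert (hpos : 0 <= (2 * (th s - b) * speed (th s) + 2 * L * ((th s - b) * (th s - b)))).
      { generalize (speed_Lipschitz (th s) b); rewrite (speed_singular b hn), Rminus_0_r; fold L.
        intros hl.
        assert (Rabs ((th s - b) * speed (th s)) <= L * ((th s - b) * (th s - b))).
        { rewrite Rabs_mult; apply Rle_trans with (Rabs (th s - b) * (L * Rabs (th s - b))).
          - apply Rmult_le_compat_l; [apply Rabs_pos|exact hl].
          - replace (Rabs (th s - b) * (L * Rabs (th s - b))) with (L * (Rabs (th s - b) ^ 2)) by ring.
            rewrite pow2_abs; right; ring. }
        generalize (Rle_abs (- ((th s - b) * speed (th s)))); rewrite Rabs_Ropp; lra. }
      assert (h1 : E 0 <= E t).
      { cbv beta in e; rewrite Rminus_0_r in e.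
        generalize (Rmult_le_pos _ _ (Rmult_le_pos _ _ hpos (Rlt_le _ _ (exp_pos (2 * L * s)))) ht); lra. }
      unfold E in h1; fold b in h1; rewrite h0, Rmult_0_r, exp_0 in h1.
      assert (hb0 : b = 0) by (generalize (exp_pos (2 * L * t)); nra).
      apply hn; rewrite hb0; apply regular_0. }
  exists th; split; [exact h0|split; [exact hc|split; [exact hreg|]]].
  intros t ht; rewrite <- speed_regular by (apply hreg; lra); apply hd, ht.
Qed.

(** * Explicit formulas in Lagrangian variables *)

Section Flow.
Variable th : R -> R.
Hypothesis th_0 : th 0 = 0.
Hypothesis th_cont : forall t, continuous th t.
Hypothesis th_regular : forall t, 0 <= t -> regular (th t).
Hypothesis th_derive : forall t, 0 < t -> is_derive th t (/ A (th t) 1).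

(* In terms of [r] and [y] of the header: [It = r^2], [Jt = X_x = 1 / |y|^2], [Xt] is the flow,
   [2 Pt] its velocity, [Vt + i Ut] is [w = y_t / y], and [ct = c = (r'' - r th'^2) / r].
   [I1t] and [I2t] are derivatives of [I] in the angle; [thb] freezes the angle before time [0]. *)
Definition thb (t : R) : R := th (Rmax 0 t).
Definition It (t : R) : R := A (thb t) 1.
Definition I1t (t : R) : R := A1 (thb t) 1.
Definition I2t (t : R) : R := A2 (thb t) 1.
Definition Jt (x t : R) : R := / (It t * Y (thb t) x).
Definition Xt (x t : R) : R := A (thb t) x / It t.
Definition Pt (x t : R) : R :=
  (A1 (thb t) x / It t - A (thb t) x * I1t t / (It t * It t)) / (2 * It t).
Definition Ut (x t : R) : R := u0 x / (It t * Y (thb t) x).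
Definition Vt (x t : R) : R := (I1t t / It t + Y1 (thb t) x / Y (thb t) x) / (2 * It t).
Definition Ux (x t : R) : R :=
  (du0 x - u0 x * Yx (thb t) x / Y (thb t) x) / (It t * Y (thb t) x).
Definition Vx (x t : R) : R :=
  (Y1x (thb t) x - Y1 (thb t) x * Yx (thb t) x / Y (thb t) x) / (2 * It t * Y (thb t) x).
Definition ct (t : R) : R :=
  I2t t / (2 * (It t * It t * It t))
  - 3 / 4 * (I1t t * I1t t) / (It t * It t * It t * It t) - 1 / (It t * It t).
Definition Utt (x t : R) : R := - 2 * Vt x t * Ut x t.
Definition Vtt (x t : R) : R := Ut x t * Ut x t - Vt x t * Vt x t + ct t.

Lemma thb_cont (t : R) : continuous thb t.
Proof. apply (continuous_Rcomp th); [apply th_cont|apply continuous_Rmax0]. Qed.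

Lemma thb_regular (t : R) : regular (thb t).
Proof. apply th_regular, Rmax_l. Qed.

Lemma thb_derive (t : R) : 0 < t -> is_derive thb t (/ It t).
Proof.
intros ht; unfold It, thb; rewrite Rmax_right by lra.
apply is_derive_ext_loc with th; [|apply th_derive, ht].
exists (mkposreal t ht); intros y hy; change (Rabs (y - t) < t) in hy.
apply Rabs_lt_between in hy; rewrite Rmax_right by lra; reflexivity.
Qed.

Lemma It_pos (t : R) : 0 < It t.
Proof. apply A_1_pos, thb_regular. Qed.

Lemma Yt_pos (x t : R) : 0 < Y (thb t) x.
Proof. apply Y_pos, thb_regular. Qed.

Lemma A_thb_cont (x t : R) : continuous (fun t => A (thb t) x) t /\
  continuous (fun t => A1 (thb t) x) t /\ continuous (fun t => A2 (thb t) x) t.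
Proof.
destruct (A_is_derive_th (thb t) x (thb_regular t)) as [h1 h2].
split; [|split].
- apply (continuous_Rcomp (fun s => A s x)); [|apply thb_cont].
  apply (ex_derive_continuous (fun s => A s x)); eexists; exact h1.
- apply (continuous_Rcomp (fun s => A1 s x)); [|apply thb_cont].
  apply (ex_derive_continuous (fun s => A1 s x)); eexists; exact h2.
- apply (continuous_Rcomp (fun s => A2 s x)); [apply A2_continuous, thb_regular|apply thb_cont].
Qed.

Lemma A_thb_derive (x t : R) : 0 < t ->
  is_derive (fun t => A (thb t) x) t (A1 (thb t) x / It t) /\
  is_derive (fun t => A1 (thb t) x) t (A2 (thb t) x / It t).
Proof.
intros ht; destruct (A_is_derive_th (thb t) x (thb_regular t)) as [h1 h2].
split; unfold Rdiv; rewrite Rmult_comm.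
- apply (is_derive_comp (fun s => A s x) thb); [exact h1|apply thb_derive, ht].
- apply (is_derive_comp (fun s => A1 s x) thb); [exact h2|apply thb_derive, ht].
Qed.

Lemma Y_thb_derive (x t : R) : 0 < t ->
  is_derive (fun t => Y (thb t) x) t (Y1 (thb t) x / It t) /\
  is_derive (fun t => Y1 (thb t) x) t (Y2 (thb t) x / It t).
Proof.
intros ht; split; unfold Rdiv; rewrite Rmult_comm.
- apply (is_derive_comp (fun s => Y s x) thb); [apply Y_derive_th|apply thb_derive, ht].
- apply (is_derive_comp (fun s => Y1 s x) thb); [apply Y1_derive_th|apply thb_derive, ht].
Qed.

Lemma base_jcont (p : R * R) :
  (continuous (fun p : R * R => It (snd p)) p /\ continuous (fun p : R * R => I1t (snd p)) p /\
   continuous (fun p : R * R => I2t (snd p)) p) /\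
  (continuous (fun p : R * R => Y (thb (snd p)) (fst p)) p /\
   continuous (fun p : R * R => Y1 (thb (snd p)) (fst p)) p /\
   continuous (fun p : R * R => Yx (thb (snd p)) (fst p)) p /\
   continuous (fun p : R * R => Y1x (thb (snd p)) (fst p)) p) /\
  (continuous (fun p : R * R => A (thb (snd p)) (fst p)) p /\
   continuous (fun p : R * R => A1 (thb (snd p)) (fst p)) p) /\
  (continuous (fun p : R * R => u0 (fst p)) p /\ continuous (fun p : R * R => du0 (fst p)) p).
Proof.
assert (cth : forall q : R * R, continuous (fun p : R * R => thb (snd p)) q)
  by (intros q; apply (continuous_Rcomp thb); [apply thb_cont|apply continuous_snd]).
split; [|split; [|split]].
- destruct p as [z t]; destruct (A_thb_cont 1 t) as [h1 [h2 h3]].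
  split; [|split].
  + apply (continuous_Rcomp It); [exact h1|apply continuous_snd].
  + apply (continuous_Rcomp I1t); [exact h2|apply continuous_snd].
  + apply (continuous_Rcomp I2t); [exact h3|apply continuous_snd].
- destruct p as [z t].
  destruct (Y_all_continuous (fun p : R * R => thb (snd p)) fst (z, t) (cth (z, t)) (continuous_fst z t))
    as [h1 [h2 [_ [h3 h4]]]]; auto.
- destruct p as [z t]; split.
  + apply (jcont_of_derive_z (fun x t => A (thb t) x) (fun x t => / Y (thb t) x)).
    * intros x s; exact (proj1 (A_is_derive_x (thb s) x (thb_regular s))).
    * exact (proj1 (dA_continuous (fun p : R * R => thb (snd p)) fst (z, t)
        (thb_regular t) (cth (z, t)) (continuous_fst z t))).
    * exact (proj1 (A_thb_cont z t)).
  + apply (jcont_of_derive_z (fun x t => A1 (thb t) x) (fun x t => dA (thb t) x)).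
    * intros x s; exact (proj2 (A_is_derive_x (thb s) x (thb_regular s))).
    * exact (proj1 (proj2 (dA_continuous (fun p : R * R => thb (snd p)) fst (z, t)
        (thb_regular t) (cth (z, t)) (continuous_fst z t)))).
    * exact (proj1 (proj2 (A_thb_cont z t))).
- split; [apply (continuous_Rcomp u0); [apply u0_cont|apply continuous_fst]|].
  apply (continuous_Rcomp du0); [apply hcdu|apply continuous_fst].
Qed.

Lemma flow_jcont (x t : R) : (jcont Jt x t /\ jcont Pt x t /\ jcont Ut x t /\ jcont Vt x t) /\
  (jcont Ux x t /\ jcont Vx x t /\ jcont Utt x t /\ jcont Vtt x t).
Proof.
destruct (base_jcont (x, t)) as [[h1 [h2 h3]] [[h4 [h5 [h6 h7]]] [[h8 h9] [h10 h11]]]].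
assert (pI := It_pos t); assert (pY := Yt_pos x t).
assert (pIY : 0 < It t * Y (thb t) x) by nra.
assert (pII : 0 < It t * It t) by nra.
assert (pIII : 0 < It t * It t * It t) by nra.
assert (pIIII : 0 < It t * It t * It t * It t) by nra.
assert (jU : jcont Ut x t) by (apply continuous_Rdiv; simpl; [lra|cont_tac|cont_tac]).
assert (jV : jcont Vt x t).
{ apply continuous_Rdiv; simpl; [lra| |cont_tac].
  apply continuous_Rplus; (apply continuous_Rdiv; simpl; [lra|cont_tac|cont_tac]). }
assert (jc : continuous (fun p : R * R => ct (snd p)) (x, t)).
{ unfold ct; apply continuous_Rminus; [apply continuous_Rminus|]; (apply continuous_Rdiv; simpl; [nra|cont_tac|cont_tac]). }
unfold jcont in *.
split; [split; [|split; [|split]]|split; [|split; [|split]]]; try assumption.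
- apply continuous_Rinv_fun; simpl; [lra|cont_tac].
- apply continuous_Rdiv; simpl; [lra| |cont_tac].
  apply continuous_Rminus; (apply continuous_Rdiv; simpl; [lra|cont_tac|cont_tac]).
- apply continuous_Rdiv; simpl; [lra| |cont_tac].
  apply continuous_Rminus; [cont_tac|]; apply continuous_Rdiv; simpl; [lra|cont_tac|cont_tac].
- apply continuous_Rdiv; simpl; [nra| |cont_tac].
  apply continuous_Rminus; [cont_tac|]; apply continuous_Rdiv; simpl; [lra|cont_tac|cont_tac].
- unfold Utt; cont_tac.
- unfold Vtt; cont_tac.
Qed.

Lemma quotient_is_derive (f g : R -> R) (x df dg : R) : g x <> 0 ->
  is_derive f x df -> is_derive g x dg ->
  is_derive (fun x => f x / g x) x ((df * g x - f x * dg) / (g x * g x)).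
Proof.
intros h0 hf hg.
replace ((df * g x - f x * dg) / (g x * g x)) with ((df * g x - f x * dg) / g x ^ 2) by (field; exact h0).
apply (is_derive_div f g); auto.
Qed.

Lemma Rmult_is_derive (f g : R -> R) (x df dg : R) :
  is_derive f x df -> is_derive g x dg ->
  is_derive (fun x => f x * g x) x (df * g x + f x * dg).
Proof. intros hf hg; apply (is_derive_mult f g x); auto; intros; apply Rmult_comm. Qed.

Lemma Rminus_is_derive (f g : R -> R) (x df dg : R) :
  is_derive f x df -> is_derive g x dg -> is_derive (fun x => f x - g x) x (df - dg).
Proof. intros hf hg; apply (is_derive_minus f g); auto. Qed.

Lemma Rplus_is_derive (f g : R -> R) (x df dg : R) :
  is_derive f x df -> is_derive g x dg -> is_derive (fun x => f x + g x) x (df + dg).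
Proof. intros hf hg; apply (is_derive_plus f g); auto. Qed.

Lemma flow_derive_x (x t : R) : is_derive (fun x => Xt x t) x (Jt x t) /\
  is_derive (fun x => Pt x t) x (- Vt x t * Jt x t) /\
  is_derive (fun x => Ut x t) x (Ux x t) /\ is_derive (fun x => Vt x t) x (Vx x t).
Proof.
assert (pI := It_pos t); assert (pY := Yt_pos x t).
destruct (A_is_derive_x (thb t) x (thb_regular t)) as [h1 h2].
assert (c : forall k : R, is_derive (fun _ : R => k) x 0) by (intros; apply (is_derive_const k)).
assert (hY := Y_derive_x (thb t) x); assert (hY1 := Y1_derive_x (thb t) x).
assert (sc : forall (f : R -> R) df k, is_derive f x df -> is_derive (fun x => f x / k) x (df / k)).
{ intros f df k hf; replace (df / k) with (df * / k + f x * 0) by (unfold Rdiv; ring).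
  apply (Rmult_is_derive f (fun _ => / k)); auto. }
split; [|split; [|split]].
- replace (Jt x t) with (/ Y (thb t) x / It t) by (unfold Jt; field; lra).
  apply (sc (A (thb t))), h1.
- replace (- Vt x t * Jt x t) with
   ((dA (thb t) x / It t - (/ Y (thb t) x * I1t t + A (thb t) x * 0) / (It t * It t)) / (2 * It t))
   by (unfold Vt, Jt, dA; field; lra).
  apply sc, Rminus_is_derive; apply sc; [exact h2|].
  apply (Rmult_is_derive (A (thb t)) (fun _ => I1t t)); auto.
- replace (Ux x t) with
   ((du0 x * (It t * Y (thb t) x) - u0 x * (0 * Y (thb t) x + It t * Yx (thb t) x))
     / ((It t * Y (thb t) x) * (It t * Y (thb t) x))) by (unfold Ux; field; lra).
  apply (quotient_is_derive u0 (fun x => It t * Y (thb t) x)); [nra|apply hdu|].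
  apply (Rmult_is_derive (fun _ => It t) (Y (thb t))); auto.
- replace (Vx x t) with
   ((0 + (Y1x (thb t) x * Y (thb t) x - Y1 (thb t) x * Yx (thb t) x) / (Y (thb t) x * Y (thb t) x))
     / (2 * It t)) by (unfold Vx; field; lra).
  apply sc, Rplus_is_derive; [apply c|].
  apply (quotient_is_derive (Y1 (thb t)) (Y (thb t))); auto; lra.
Qed.

Lemma flow_derive_t (x t : R) : 0 < t -> is_derive (fun t => Xt x t) t (2 * Pt x t) /\
  is_derive (fun t => Ut x t) t (Utt x t) /\ is_derive (fun t => Vt x t) t (Vtt x t).
Proof.
intros ht.
assert (pI := It_pos t); assert (pY := Yt_pos x t).
destruct (A_thb_derive x t ht) as [a1 a2], (A_thb_derive 1 t ht) as [i1 i2].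
destruct (Y_thb_derive x t ht) as [y1 y2].
change (A1 (thb t) 1) with (I1t t) in i1; change (A2 (thb t) 1) with (I2t t) in i2.
change (is_derive It t (I1t t / It t)) in i1; change (is_derive I1t t (I2t t / It t)) in i2.
assert (c : forall k : R, is_derive (fun _ : R => k) t 0) by (intros; apply (is_derive_const k)).
split; [|split].
- replace (2 * Pt x t) with
   ((A1 (thb t) x / It t * It t - A (thb t) x * (I1t t / It t)) / (It t * It t))
   by (unfold Pt; field; lra).
  apply (quotient_is_derive (fun t => A (thb t) x) It); auto; lra.
- replace (Utt x t) with
   ((0 * (It t * Y (thb t) x) - u0 x * (I1t t / It t * Y (thb t) x + It t * (Y1 (thb t) x / It t)))
     / ((It t * Y (thb t) x) * (It t * Y (thb t) x))) by (unfold Utt, Ut, Vt; field; lra).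
  apply (quotient_is_derive (fun _ => u0 x) (fun t => It t * Y (thb t) x)); [nra|apply c|].
  apply (Rmult_is_derive It (fun t => Y (thb t) x)); auto.
- replace (Vtt x t) with
   ((((I2t t / It t * It t - I1t t * (I1t t / It t)) / (It t * It t) +
      (Y2 (thb t) x / It t * Y (thb t) x - Y1 (thb t) x * (Y1 (thb t) x / It t))
        / (Y (thb t) x * Y (thb t) x)) * (2 * It t)
     - (I1t t / It t + Y1 (thb t) x / Y (thb t) x) * (0 * It t + 2 * (I1t t / It t)))
     / ((2 * It t) * (2 * It t))).
  + apply (quotient_is_derive (fun t => I1t t / It t + Y1 (thb t) x / Y (thb t) x) (fun t => 2 * It t));
      [lra| |apply (Rmult_is_derive (fun _ => 2) It); auto].
    apply Rplus_is_derive.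
    * apply (quotient_is_derive I1t It); auto; lra.
    * apply (quotient_is_derive (fun t => Y1 (thb t) x) (fun t => Y (thb t) x)); auto; lra.
  (* [Y_identity] eliminates the second derivative of [Y]. What is left of [V_t] besides [U^2 - V^2]
     no longer depends on the label, and it is [ct]. *)
  + assert (e : Y2 (thb t) x =
      (4 * u0 x ^ 2 + Y1 (thb t) x ^ 2 - 4 * Y (thb t) x ^ 2) / (2 * Y (thb t) x)).
    { rewrite <- (Y_identity (thb t) x); field; lra. }
    rewrite e; unfold Vtt, Ut, Vt, ct; field; lra.
Qed.

Lemma Xt_period (x t : R) : Xt (x + 1) t = Xt x t + 1.
Proof.
unfold Xt; rewrite (proj1 (A_periodic (thb t) x (thb_regular t))).
fold (It t); generalize (It_pos t); intros; field; lra.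
Qed.

Lemma Pt_period (x t : R) : Pt (x + 1) t = Pt x t.
Proof.
unfold Pt; destruct (A_periodic (thb t) x (thb_regular t)) as [e1 e2]; rewrite e1, e2.
fold (It t) (I1t t); generalize (It_pos t); intros; field; lra.
Qed.

Lemma A_0 (s : R) : A s 0 = 0 /\ A1 s 0 = 0.
Proof. unfold A, A1; rewrite !RInt_point; split; reflexivity. Qed.

Lemma Xt_0 (t : R) : Xt 0 t = 0.
Proof. unfold Xt; rewrite (proj1 (A_0 _)); unfold Rdiv; ring. Qed.

Lemma Pt_0 (t : R) : Pt 0 t = 0.
Proof. unfold Pt; destruct (A_0 (thb t)) as [e1 e2]; rewrite e1, e2; unfold Rdiv; ring. Qed.

(** The inverse of the flow map at time [t]: the label of the particle found at [z]. *)
Definition label (z t : R) : R := iota (fun x => Xt x t = z).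

(** The flow fixes every integer, since it fixes [0] and commutes with unit translations; the
    intermediate value theorem then applies between two integers enclosing [z]. *)
Lemma Xt_surjective (z t : R) : exists x, Xt x t = z.
Proof.
assert (hn : forall (n : nat) x, Xt (x + INR n) t = Xt x t + INR n).
{ induction n as [|n IH]; intros x; [simpl; rewrite !Rplus_0_r; reflexivity|].
  rewrite S_INR, <- Rplus_assoc, Xt_period, IH; ring. }
destruct (nfloor_ex (Rabs z) (Rabs_pos z)) as [n [_ hn2]].
assert (hz := Rabs_le_between z (INR (S n))); rewrite S_INR in hz.
assert (hz' : - (INR n + 1) <= z <= INR n + 1) by (apply hz; lra).
assert (e1 : Xt (INR (S n)) t = INR (S n)).
{ generalize (hn (S n) 0); rewrite Xt_0, !Rplus_0_l; auto. }
assert (e2 : Xt (- INR (S n)) t = - INR (S n)).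
{ generalize (hn (S n) (- INR (S n))); rewrite Rplus_opp_l, Xt_0; lra. }
destruct (IVT_gen (fun x => Xt x t) (- INR (S n)) (INR (S n)) z) as [x [_ hx]].
- intros x; apply continuity_pt_filterlim, (ex_derive_continuous (fun x => Xt x t)).
  exists (Jt x t); exact (proj1 (flow_derive_x x t)).
- rewrite e1, e2, S_INR; generalize (pos_INR n); intros.
  rewrite Rmin_left, Rmax_right; lra.
- exists x; exact hx.
Qed.

Lemma Jt_pos (x t : R) : 0 < Jt x t.
Proof. apply Rinv_0_lt_compat, Rmult_lt_0_compat; [apply It_pos|apply Yt_pos]. Qed.

Lemma Xt_injective (x y t : R) : Xt x t = Xt y t -> x = y.
Proof.
intros e.
assert (mono := flow_increasing Xt Jt (fun x t => proj1 (flow_derive_x x t)) Jt_pos).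
destruct (Rtotal_order x y) as [h|[h|h]]; [|exact h|].
- generalize (mono x y t h); lra.
- generalize (mono y x t h); lra.
Qed.

Lemma Xt_label (z t : R) : Xt (label z t) t = z.
Proof.
apply (iota_correct (fun x => Xt x t = z)).
destruct (Xt_surjective z t) as [x hx]; exists x; split; [exact hx|].
intros y hy; apply (Xt_injective x y t); congruence.
Qed.

Lemma Jt_jcont (x t : R) : jcont Jt x t.
Proof. exact (proj1 (proj1 (flow_jcont x t))). Qed.

Lemma Xt_cont_t (x t : R) : continuous (fun s => Xt x s) t.
Proof.
destruct (A_thb_cont x t) as [h _], (A_thb_cont 1 t) as [h' _].
apply (continuous_Rdiv (fun t => A (thb t) x) It); [generalize (It_pos t); lra|exact h|exact h'].
Qed.

Lemma Xt_derive_x (x t : R) : is_derive (fun y => Xt y t) x (Jt x t).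
Proof. exact (proj1 (flow_derive_x x t)). Qed.

Lemma label_jcont (z t : R) : jcont label z t.
Proof. exact (inverse_jcont Xt Jt label Xt_derive_x Jt_pos Xt_cont_t Xt_label z t). Qed.

Lemma label_derive_z (z t : R) : is_derive (fun y => label y t) z (/ Jt (label z t) t).
Proof. exact (inverse_is_derive_z Xt Jt label Xt_derive_x Jt_pos Jt_jcont Xt_cont_t Xt_label z t). Qed.

Lemma label_derive_t (z t : R) : 0 < t ->
  is_derive (fun s => label z s) t (- (2 * Pt (label z t) t) / Jt (label z t) t).
Proof.
intros ht.
exact (inverse_is_derive_t Xt Jt label Xt_derive_x Jt_pos Jt_jcont Xt_cont_t Xt_label z t _
  (proj1 (flow_derive_t (label z t) t ht))).
Qed.

Lemma label_period (z t : R) : label (z + 1) t = label z t + 1.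
Proof. apply (Xt_injective _ _ t); rewrite Xt_period, !Xt_label; reflexivity. Qed.

Lemma label_0 (t : R) : label 0 t = 0.
Proof. apply (Xt_injective _ _ t); rewrite Xt_label, Xt_0; reflexivity. Qed.

(** * Return to Eulerian variables *)

Definition euler (F : R -> R -> R) (z t : R) : R := F (label z t) t.

Lemma euler_jcont (F : R -> R -> R) (z t : R) : jcont F (label z t) t -> jcont (euler F) z t.
Proof.
intros hF; apply (jcont_comp F (fun p => label (fst p) (snd p)) snd (z, t));
  [exact hF|apply label_jcont|apply continuous_snd].
Qed.

Lemma euler_derive_z (F Fx : R -> R -> R) (z t : R) :
  (forall x t, is_derive (fun x => F x t) x (Fx x t)) ->
  is_derive (fun y => euler F y t) z (euler (fun x t => Fx x t / Jt x t) z t).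
Proof.
intros hF; unfold euler, Rdiv; rewrite Rmult_comm.
apply (is_derive_comp (fun x => F x t) (fun y => label y t)); [apply hF|apply label_derive_z].
Qed.

Lemma euler_derive_t (F Fx Ft : R -> R -> R) (z t : R) : 0 < t ->
  (forall x t, is_derive (fun x => F x t) x (Fx x t)) -> (forall x t, jcont Fx x t) ->
  (forall x, is_derive (fun t => F x t) t (Ft x t)) ->
  is_derive (fun s => euler F z s) t
    (euler (fun x t => - (2 * Pt x t) / Jt x t * Fx x t + Ft x t) z t).
Proof.
intros ht hF hc hFt; unfold euler.
apply (is_derive_along F Fx (fun s => label z s)).
- apply filter_forall; intros p; apply hF.
- apply hc.
- apply hFt.
- apply label_derive_t, ht.
Qed.

Lemma euler_regularity (F Fx Ft : R -> R -> R) :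
  (forall x t, jcont F x t /\ jcont Fx x t /\ jcont Ft x t) ->
  (forall x t, is_derive (fun x => F x t) x (Fx x t)) ->
  (forall x t, 0 < t -> is_derive (fun t => F x t) t (Ft x t)) ->
  classical_regularity 0 (euler F) /\
  (forall z t, d_z (euler F) z t = euler (fun x t => Fx x t / Jt x t) z t) /\
  (forall z t, 0 < t -> d_t (euler F) z t =
     euler (fun x t => - (2 * Pt x t) / Jt x t * Fx x t + Ft x t) z t).
Proof.
intros hc hx ht.
assert (dz : forall z t, d_z (euler F) z t = euler (fun x t => Fx x t / Jt x t) z t)
  by (intros; apply is_derive_unique, euler_derive_z, hx).
assert (dt : forall z t, 0 < t -> d_t (euler F) z t =
     euler (fun x t => - (2 * Pt x t) / Jt x t * Fx x t + Ft x t) z t).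
{ intros z t h; apply is_derive_unique, euler_derive_t; auto; intros; apply hc. }
split; [|split; [exact dz|exact dt]].
constructor.
- apply jcont_jointly_continuous_on; intros; apply euler_jcont, hc.
- intros z t h; eexists; apply (euler_derive_t F Fx Ft); auto; intros; apply hc.
- intros z t h; eexists; apply (euler_derive_z F Fx); auto.
- apply jcont_jointly_continuous_on; intros z t h.
  apply (jcont_ext_pos _ _ z t h dt), euler_jcont.
  destruct (flow_jcont (label z t) t) as [[j1 [j2 _]] _], (hc (label z t) t) as [_ [c1 c2]].
  unfold jcont in *; apply continuous_Rplus; [|exact c2]; apply continuous_Rmult; [|exact c1].
  apply continuous_Rdiv; [generalize (Jt_pos (label z t) t); simpl; lra| |exact j1].
  apply continuous_Ropp, continuous_Rmult; [apply continuous_const|exact j2].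
- apply jcont_jointly_continuous_on; intros z t h.
  apply (jcont_ext_pos _ _ z t h (fun z t _ => dz z t)), euler_jcont.
  destruct (flow_jcont (label z t) t) as [[j1 _] _], (hc (label z t) t) as [_ [c1 _]].
  unfold jcont in *; apply continuous_Rdiv; [generalize (Jt_pos (label z t) t); simpl; lra|exact c1|exact j1].
- intros h; lra.
- intros h; lra.
Qed.

(** A bootstrap: the derivative of the label in [z] is [It * Y] evaluated at the label, so
    regularity of order [k] of the label gives order [k + 1], as long as [Y] is regular enough. [Y]
    contains the data undifferentiated, so no order is lost. *)
Lemma label_Ck (m : nat) (t : R) : Ck m u0 -> Ck m v0 -> Ck m (fun z => label z t).
Proof.
intros hu hv.
assert (hY : Ck m (Y (thb t))).
{ unfold Y; repeat first [apply Ck_plus|apply Ck_mult|apply Ck_const|assumption]. }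
assert (h : forall k, (k <= m)%nat -> Ck k (fun z => label z t)).
{ induction k as [|k IH]; intros hk.
  - intros z; apply jcont_z, label_jcont.
  - exists (fun z => It t * Y (thb t) (label z t)); split.
    + intros z; generalize (label_derive_z z t); unfold Jt; rewrite Rinv_inv; auto.
    + apply Ck_mult; [apply Ck_const|].
      apply (Ck_comp k (Y (thb t)) (fun z => label z t)); [apply (Ck_le m); [lia|exact hY]|apply IH; lia]. }
apply h; lia.
Qed.

Lemma euler_Ck (m : nat) (t : R) : Ck m u0 -> Ck m v0 ->
  Ck m (fun z => euler Ut z t) /\ Ck m (fun z => euler Vt z t).
Proof.
intros hu hv; assert (hl := label_Ck m t hu hv).
assert (hY : Ck m (Y (thb t))).
{ unfold Y; repeat first [apply Ck_plus|apply Ck_mult|apply Ck_const|assumption]. }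
assert (hY1 : Ck m (Y1 (thb t))).
{ unfold Y1; repeat first [apply Ck_plus|apply Ck_mult|apply Ck_const|assumption]. }
assert (hiY : Ck m (fun x => / Y (thb t) x)).
{ apply Ck_inv; [intros x; generalize (Yt_pos x t); lra|exact hY]. }
split.
- apply (Ck_comp m (fun x => Ut x t) (fun z => label z t)); [|exact hl].
  apply (Ck_mult m u0); [exact hu|]; apply Ck_inv.
  + intros x; generalize (Jt_pos x t); unfold Jt; intros h h0; rewrite h0, Rinv_0 in h; lra.
  + apply Ck_mult; [apply Ck_const|exact hY].
- apply (Ck_comp m (fun x => Vt x t) (fun z => label z t)); [|exact hl].
  unfold Vt, Rdiv; repeat first [apply Ck_plus|apply Ck_mult|apply Ck_const|assumption].
Qed.

Hypothesis hmean : RInt v0 0 1 = 0.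

Lemma initial_values (x : R) : Xt x 0 = x /\ Ut x 0 = u0 x /\ Vt x 0 = v0 x.
Proof.
assert (e0 : thb 0 = 0) by (unfold thb; rewrite Rmax_left by lra; exact th_0).
assert (eA : forall y, A 0 y = y).
{ intros y; unfold A; rewrite (RInt_ext _ (fun _ => 1)) by (intros; rewrite Y_0; exact Rinv_1).
  rewrite RInt_const; unfold scal; simpl; unfold mult; simpl; ring. }
assert (eI : It 0 = 1) by (unfold It; rewrite e0; apply eA).
assert (eY1 : forall y, Y1 0 y = 2 * v0 y) by (intros; unfold Y1; rewrite cos_0, sin_0; ring).
(* The zero mean of [v0] enters here: the derivative of [I] at angle zero is [- 2] times that mean,
   and otherwise [Vt] would start from [v0] shifted by a constant. *)
assert (eI1 : I1t 0 = 0).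
{ unfold I1t, A1; rewrite e0.
  rewrite (RInt_ext _ (fun y => scal (-2) (v0 y))).
  - rewrite (RInt_scal (V := R_CompleteNormedModule)).
    + rewrite hmean; unfold scal; simpl; unfold mult; simpl; ring.
    + apply (ex_RInt_continuous (V := R_CompleteNormedModule)); intros; apply v0_cont.
  - intros y _; unfold dA; rewrite Y_0, eY1.
    change (- (2 * v0 y) / (1 * 1) = -2 * v0 y); field. }
unfold Xt, Ut, Vt; rewrite eI, eI1, e0, eA, Y_0, eY1.
repeat split; field.
Qed.

Theorem inviscid_flow_solution :
  model_solution 0 (fun _ => 0) u0 v0 (euler Ut) (euler Vt) (euler Pt).
Proof.
destruct (euler_regularity Ut Ux Utt) as [ru [uz ut]].
{ intros x t; destruct (flow_jcont x t) as [[_ [_ [h1 _]]] [h2 [_ [h3 _]]]]; auto. }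
{ intros x t; apply flow_derive_x. }
{ intros x t ht; apply flow_derive_t, ht. }
destruct (euler_regularity Vt Vx Vtt) as [rv [vz vt]].
{ intros x t; destruct (flow_jcont x t) as [[_ [_ [_ h1]]] [_ [h2 [_ h3]]]]; auto. }
{ intros x t; apply flow_derive_x. }
{ intros x t ht; apply flow_derive_t, ht. }
assert (pUV : forall t x, Ut (x + 1) t = Ut x t /\ Vt (x + 1) t = Vt x t).
{ intros t x; unfold Ut, Vt.
  now rewrite (Y_periodic (thb t) x), (Y1_periodic (thb t) x), (pu0 x). }
assert (pv : forall t, periodic1 (fun z => euler Vt z t))
  by (intros t z; unfold euler; rewrite label_period; apply pUV).
assert (ppsi : forall t, periodic1 (fun z => euler Pt z t))
  by (intros t z; unfold euler; rewrite label_period; apply Pt_period).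
assert (hpsi : forall z t, is_derive (fun y => euler Pt y t) z (- euler Vt z t)).
{ intros z t; generalize (euler_derive_z Pt (fun x t => - Vt x t * Jt x t) z t
    (fun x t => proj1 (proj2 (flow_derive_x x t)))); unfold euler.
  generalize (Jt_pos (label z t) t); intros hj.
  replace (- Vt (label z t) t * Jt (label z t) t / Jt (label z t) t) with (- Vt (label z t) t)
    by (field; lra); auto. }
constructor.
- intros t _ z; unfold euler; rewrite label_period; apply pUV.
- intros t _; apply pv.
- intros t _; apply ppsi.
- exact ru.
- exact rv.
- intros z t _; apply hpsi.
- intros t _; unfold euler; rewrite label_0; apply Pt_0.
- intros z; unfold euler; destruct (initial_values (label z 0)) as [e1 [e2 _]].
  rewrite e2; rewrite Xt_label in e1; now rewrite <- e1.
- intros z; unfold euler; destruct (initial_values (label z 0)) as [e1 [_ e2]].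
  rewrite e2; rewrite Xt_label in e1; now rewrite <- e1.
(* The motion of the label contributes [- 2 P / J] times [F_x], and [2 psi d_z] contributes the
   opposite, so only the time derivative at fixed label remains. *)
- intros z t ht; rewrite ut, uz by exact ht; unfold euler, Utt.
  generalize (Jt_pos (label z t) t); intros; field; lra.
- intros z t ht.
  assert (heq : forall z, d_t (euler Vt) z t + 2 * euler Pt z t * d_z (euler Vt) z t =
     0 * d_zz (euler Vt) z t + euler Ut z t ^ 2 - euler Vt z t ^ 2 + ct t).
  { intros y; rewrite vt, vz by exact ht; unfold euler, Vtt.
    generalize (Jt_pos (label y t) t); intros; field; lra. }
  rewrite <- (constant_of_mean 0 (ct t) t (euler Ut) (euler Vt) (euler Pt)); auto; try lra.
  + intros y; apply jcont_z, euler_jcont; exact (proj1 (proj2 (proj2 (proj1 (flow_jcont _ _))))).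
  + intros y s _; apply jcont_z, euler_jcont; exact (proj2 (proj2 (proj2 (proj1 (flow_jcont _ _))))).
  + intros y s hs; apply (cr_ex_d_t _ _ rv), hs.
  + apply jointly_continuous_on_jcont, (cr_d_t _ _ rv).
  + intros y; apply (cr_ex_d_z _ _ rv), ht.
  + intros y; apply jcont_z, (jointly_continuous_on_jcont _ (cr_d_z _ _ rv)), ht.
Qed.

End Flow.

End Labels.

(** * Global solutions *)

Lemma limit_filter_exists : exists U, limit_filter U.
Proof.
destruct ultrafilter_nat_exists as [U [FU [hU he]]]; exists U; split; [exact FU|split; [exact he|]].
intros x M; now apply ultrafilter_bounded_cv.
Qed.

Lemma inviscid_solution (u0 v0 : R -> R) : Cm 1 u0 -> Cm 1 v0 -> periodic1 u0 -> periodic1 v0 ->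
  RInt v0 0 1 = 0 ->
  exists u v psi, model_solution 0 (fun _ => 0) u0 v0 u v psi /\
    (forall m t, Cm m u0 -> Cm m v0 -> Cm m (fun z => u z t) /\ Cm m (fun z => v z t)).
Proof.
intros cu cv pu pv hm.
assert (C1 : forall f, Cm 1 f -> (forall z, continuous f z) /\ (forall z, ex_derive f z) /\
  (forall z, continuous (Derive f) z)).
{ intros f hf; split; [|split]; intros z;
    [apply (hf 0%nat)|apply (hf 1%nat)|apply (hf 1%nat)]; lia. }
destruct (C1 u0 cu) as [u1 [u2 u3]], (C1 v0 cv) as [v1 [v2 v3]].
destruct (periodic1_bounded u0 pu u1) as [Bu [hBu bu]], (periodic1_bounded v0 pv v1) as [Bv [hBv bv]].
destruct (C1_periodic_Lipschitz u0 pu u2 u3) as [Ku [hKu ku]],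
  (C1_periodic_Lipschitz v0 pv v2 v3) as [Kv [hKv kv]].
assert (hB : 0 <= Bu + Bv) by lra.
(* The added 1 makes the Lipschitz constant positive also for constant data; the primitive in
   [rootY_A_lower] divides by it. *)
assert (hK : 0 < Ku + Kv + 1) by lra.
assert (hbb : forall x, Rabs (u0 x) + Rabs (v0 x) <= Bu + Bv)
  by (intros x; generalize (bu x) (bv x); lra).
assert (hkk : forall x y, Rabs (u0 y - u0 x) + Rabs (v0 y - v0 x) <= (Ku + Kv + 1) * Rabs (y - x))
  by (intros x y; generalize (ku x y) (kv x y) (Rabs_pos (y - x)); lra).
assert (du : forall x, is_derive u0 x (Derive u0 x)) by (intros; apply Derive_correct, u2).
assert (dv : forall x, is_derive v0 x (Derive v0 x)) by (intros; apply Derive_correct, v2).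
destruct (angle_exists u0 v0 (Derive u0) (Derive v0) _ _ du dv u3 v3 pu pv hB hK hbb hkk)
  as [th [h0 [hc [hr hd]]]].
exists (euler u0 v0 th (Ut u0 v0 th)), (euler u0 v0 th (Vt u0 v0 th)), (euler u0 v0 th (Pt u0 v0 th)).
split.
- exact (inviscid_flow_solution u0 v0 (Derive u0) (Derive v0) _ _ du dv u3 v3 pu pv hB hK hbb hkk
    th h0 hc hr hd hm).
- intros m t mu mv.
  destruct (euler_Ck u0 v0 (Derive u0) (Derive v0) _ _ du dv u3 v3 pu pv hB hK hbb hkk
    th hc hr m t (Ck_of_Cm m u0 mu) (Ck_of_Cm m v0 mv)) as [k1 k2].
  split; apply Cm_of_Ck; assumption.
Qed.

Theorem theorem4 (nu : R) (m : nat) (a u0 v0 : R -> R)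
  (hnu : 0 <= nu) (hm : (1 <= m)%nat)
  (ha : continuous_on (fun t => 0 <= t) a)
  (hu0 : Cm m u0) (hv0 : Cm m v0)
  (pu0 : periodic1 u0) (pv0 : periodic1 v0)
  (hv0_mean : RInt v0 0 1 = 0) :
  exists u v psi : R -> R -> R,
    model_solution nu a u0 v0 u v psi /\
    (forall t, 0 <= t -> Cm m (fun z => u z t) /\ Cm m (fun z => v z t)).
Proof.
assert (cu : Cm 1 u0) by (intros k hk; apply hu0; lia).
assert (cv : Cm 1 v0) by (intros k hk; apply hv0; lia).
assert (hs : exists u v psi, model_solution nu (fun _ => 0) u0 v0 u v psi /\
  (forall t, 0 <= t -> Cm m (fun z => u z t) /\ Cm m (fun z => v z t))).
{ destruct (Rle_lt_or_eq_dec 0 nu hnu) as [hp|<-].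
  - destruct limit_filter_exists as [UF hU].
    destruct (viscous_solution UF hU nu u0 v0 hp cu cv pu0 pv0 hv0_mean) as [u [v [psi [hs hr]]]].
    exists u, v, psi; split; [exact hs|]; intros t ht.
    (* For [t > 0] the solution is smooth of every order. At [t = 0] it is the datum itself, and
       only there does [C^m] come from the hypothesis. *)
    destruct (Rle_lt_or_eq_dec 0 t ht) as [htp|<-]; [apply hr, htp|].
    replace (fun z => u z 0) with u0
      by (apply functional_extensionality; intros z; symmetry; apply (ms_init_u _ _ _ _ _ _ _ hs)).
    replace (fun z => v z 0) with v0
      by (apply functional_extensionality; intros z; symmetry; apply (ms_init_v _ _ _ _ _ _ _ hs)).
    auto.
  - destruct (inviscid_solution u0 v0 cu cv pu0 pv0 hv0_mean) as [u [v [psi [hs hr]]]].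
    exists u, v, psi; split; [exact hs|auto]. }
destruct hs as [u [v [psi [hs hr]]]].
destruct (shift_solution nu a u0 v0 u v psi ha hs) as [xi hx].
do 3 eexists; split; [exact hx|].
intros t ht; destruct (hr t ht) as [r1 r2]; split.
- exact (Cm_shift m (fun z => u z t) (xi t) r1).
- exact (Cm_shift m (fun z => v z t) (xi t) r2).
Qed.
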